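(* Let $(\mathbf u,p,C)$ be the solution of $(V_a)$, $(\mathbf u_h,p_h,C_h)$ the solution of $(V_{ah})$, and $(\mathbf u_h^{i},p_h^{i},C_h^{i})$ the iterates defined by $(V_{ahi})$ with parameter $\gamma>0$ and initial guess $(\mathbf u_h^0,C_h^0)\in X_h\times Y_h$. (1) Assume that $\mathbf f_0\in L^2(\Omega)^d$, $C\in H^2(\Omega)$, $\mathbf u\in W^{1,3}(\Omega)^d$, $p\in H^2(\Omega)$, $$S_6^0|C|_{W^{1,3}(\Omega)}+\|C\|_{L^\infty(\Omega)}\le\frac{\alpha\mu K_m}{2\sqrt2\,\rho\,c_{\mathbf f_1}S_2^0},$$ that $\|\mathbf u_h^0\|_{L^2(\Omega)^d}\le L_1(\mathbf f,g)$, that $\gamma>\max\{\gamma_*,\gamma_{**}\}$, and that $$h\le\Big(\frac1{2c_Ic_1}\Big(|C|_{W^{1,3}(\Omega)}+\frac{\|C\|_{L^\infty(\Omega)}}{S_6^0}\Big)\Big)^{6/(6-d)}.$$ Then there is an integer $i_1$ depending on $h$ such that for all $i\ge i_1$ and all $\kappa\in\mathcal T_h$, $$\eta_{\kappa,i}^{(D_1)}\le c\Big(\|\mathbf u_h^{i+1}-\mathbf u\|_{L^2(w_\kappa)}+\|C-C_h^{i+1}\|_{H^1(w_\kappa)}+\sum_{\kappa'\subset w_\kappa}h_{\kappa'}\|g-g_h\|_{L^2(\kappa')}\Big),$$ where the sum is over elements $\kappa'$ of $\mathcal T_h$ contained in $w_\kappa$, and $c$ is a positive constant depending on the exact solution but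 independent of $h$ and $w_\kappa$. (2) Without any of the assumptions in (1), for all $\kappa\in\mathcal T_h$, $$\eta_{\kappa,i}^{(L_2)}\le\|C-C_h^{i+1}\|_{H^1(\kappa)}+\|C-C_h^i\|_{H^1(\kappa)}.$$
   Context: Setting. $d\in\{2,3\}$ and $\Omega\subset\mathbb R^d$ is a bounded, simply connected open polygon ($d=2$) or polyhedron ($d=3$) with Lipschitz boundary and outer unit normal $\mathbf n$. $|\cdot|$ is the Euclidean norm. $\mu,\rho,\beta,\alpha,r_0$ are strictly positive constants. $K$ is a uniformly positive definite, bounded tensor field with $0<K_m\le\|K^{-1}\|_{L^\infty(\Omega)^{d\times d}}\le K_M$, where $K_m$ is not larger than the smallest eigenvalue of $K^{-1}$ over $\Omega$. The data satisfy $\mathbf f(\mathbf x,C)=\mathbf f_0(\mathbf x)+\mathbf f_1(C)$ with $\mathbf f_0\in L^{3/2}(\Omega)^d$, $\mathbf f_1:\mathbb R\to\mathbb R^d$ Lipschitz with constant $c_{\mathbf f_1}>0$ and $\mathbf f_1(0)=0$, and $g\in L^2(\Omega)$. For a function $C$, $\mathbf f(\cdot,C)$ denotes $\mathbf x\mapsto\mathbf f(\mathbf x,C(\mathbf x))$. $|\cdot|_{W^{1,p}(\Omega)}$ is the seminorm $\|\nabla\cdot\|_{L^p}$. $S_p^0$ is a constant such that $\|v\|_{L^p(\Omega)}\le S_p^0|v|_{H^1(\Omega)}$ for all $v\in H^1_0(\Omega)$. Spaces: $X=L^3(\Omega)^d$, $M=W^{1,3/2}(\Omega)\cap L^2_0(\Omega)$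 ($L^2_0$: zero-mean functions of $L^2$), $Y=H^1_0(\Omega)$. Problem $(V_a)$: find $(\mathbf u,p,C)\in X\times M\times Y$ such that for all $\mathbf v\in X$, $q\in M$, $S\in Y$: $\frac\mu\rho\int_\Omega K^{-1}\mathbf u\cdot\mathbf v+\frac\beta\rho\int_\Omega|\mathbf u|\mathbf u\cdot\mathbf v+\int_\Omega\nabla p\cdot\mathbf v=\int_\Omega\mathbf f(\cdot,C)\cdot\mathbf v$; $\int_\Omega\nabla q\cdot\mathbf u=0$; $\alpha\int_\Omega\nabla C\cdot\nabla S+\int_\Omega(\mathbf u\cdot\nabla C)S+r_0\int_\Omega CS=\int_\Omega gS$. Meshes: $(\mathcal T_h)_h$ is a family of conforming triangulations of $\overline\Omega$ by closed nondegenerate triangles/tetrahedra $\kappa$, of maximal diameter $h$; $h_\kappa$ is the diameter of $\kappa$, $\rho_\kappa$ that of its inscribed ball, $h_e$ the diameter of an edge ($d=2$) or face ($d=3$) $e$. It is regular ($\max_\kappa h_\kappa/\rho_\kappa\le\sigma$, $\sigma$ independent of $h$) and uniformly regular ($h_\kappa\ge\beta_0h$, $\beta_0>0$ independent of $h$). $w_\kappa$ is the union of the elements of $\mathcal T_h$ whose intersection with $\kappa$ is nonempty. Discrete spaces: with $b_\kappa=\lambda_1\cdots\lambda_{d+1}$ the product of the barycentric coordinates of $\kappa$ and $\mathcal P(\kappa)=\mathbb P_1(\kappa)\oplus\mathrm{Vect}\{b_\kappa\}$, $X_h=\{\mathbf v_h\in C^0(\overline\Omega)^d:\mathbf v_h|_\kappa\in\mathcal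 P(\kappa)^d\ \forall\kappa\}$, $M_h=\{q_h\in C^0(\overline\Omega):q_h|_\kappa\in\mathbb P_1(\kappa)\ \forall\kappa\}\cap L_0^2(\Omega)$, $Y_h=\{q_h\in C^0(\overline\Omega):q_h|_\kappa\in\mathbb P_1(\kappa)\ \forall\kappa\}\cap H_0^1(\Omega)$. Problem $(V_{ah})$: find $(\mathbf u_h,p_h,C_h)\in X_h\times M_h\times Y_h$ such that for all $\mathbf v_h\in X_h$, $q_h\in M_h$, $S_h\in Y_h$: $\frac\mu\rho\int_\Omega K^{-1}\mathbf u_h\cdot\mathbf v_h+\frac\beta\rho\int_\Omega|\mathbf u_h|\mathbf u_h\cdot\mathbf v_h+\int_\Omega\nabla p_h\cdot\mathbf v_h=\int_\Omega\mathbf f(\cdot,C_h)\cdot\mathbf v_h$; $\int_\Omega\nabla q_h\cdot\mathbf u_h=0$; $\alpha\int_\Omega\nabla C_h\cdot\nabla S_h+\int_\Omega(\mathbf u_h\cdot\nabla C_h)S_h+\frac12\int_\Omega\operatorname{div}(\mathbf u_h)C_hS_h+r_0\int_\Omega C_hS_h=\int_\Omega gS_h$. Iterative problem $(V_{ahi})$: given $(\mathbf u_h^i,C_h^i)\in X_h\times Y_h$, find $(\mathbf u_h^{i+1},p_h^{i+1},C_h^{i+1})\in X_h\times M_h\times Y_h$ such that for all $\mathbf v_h\in X_h$, $q_h\in M_h$, $S_h\in Y_h$: $\gamma\int_\Omega(\mathbf u_h^{i+1}-\mathbf u_h^i)\cdot\mathbf v_h+\frac\mu\rho\int_\Omega K^{-1}\mathbf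 u_h^{i+1}\cdot\mathbf v_h+\frac\beta\rho\int_\Omega|\mathbf u_h^i|\mathbf u_h^{i+1}\cdot\mathbf v_h+\int_\Omega\nabla p_h^{i+1}\cdot\mathbf v_h=\int_\Omega\mathbf f(\cdot,C_h^i)\cdot\mathbf v_h$; $\int_\Omega\nabla q_h\cdot\mathbf u_h^{i+1}=0$; $\alpha\int_\Omega\nabla C_h^{i+1}\cdot\nabla S_h+\int_\Omega(\mathbf u_h^{i+1}\cdot\nabla C_h^{i+1})S_h+\frac12\int_\Omega\operatorname{div}(\mathbf u_h^{i+1})C_h^{i+1}S_h+r_0\int_\Omega C_h^{i+1}S_h=\int_\Omega gS_h$. Constants. $c_I>0$ is the constant (independent of $h$) of the inverse inequality $\|v_h\|_{L^p}\le c_Ih^{d/p-d/2}\|v_h\|_{L^2}$ for discrete functions, $p\in\{3,6\}$. $c_1>0$ is the constant, independent of $h$, of the known a priori error estimate $|C-C_h|_{H^1(\Omega)}+\|\mathbf u-\mathbf u_h\|_{L^2(\Omega)^d}+\|\nabla(p-p_h)\|_{L^{3/2}(\Omega)^d}\le c_1h$. With $F=\|\mathbf f_0\|_{L^2(\Omega)^d}+c_{\mathbf f_1}\frac{(S_2^0)^2}{\alpha}\|g\|_{L^2(\Omega)}$: $L_1(\mathbf f,g)=\frac{\rho}{\mu K_m}F$, $\gamma_*=\frac{32\beta}{27\rho}c_I^3h^{-d/2}\big(\frac{\rho}{\mu K_m}+\frac{\rho K_M}{\mu K_m^2}\big)F+\frac{32\beta^2\rho}{27\mu^3K_m^3}c_I^6h^{-d}F^2$,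 $\gamma_{**}=2c_I^4h^{-2d/3}\frac{\rho^{1/3}\beta^{4/3}}{\mu^{5/3}K_m^{5/3}}F^{4/3}$. $g_h$ is an approximation of $g$ that is constant on each $\kappa$. $\Gamma_h^i$ is the set of edges/faces not contained in $\partial\Omega$; $[\cdot]_e$ is the jump across $e$. Indicators for $\kappa\in\mathcal T_h$: $\eta_{\kappa,i}^{(L_2)}=\|C_h^i-C_h^{i+1}\|_{H^1(\kappa)}$; $\eta_{\kappa,i}^{(D_1)}=h_\kappa\|\alpha\Delta C_h^{i+1}-\mathbf u_h^{i+1}\cdot\nabla C_h^{i+1}-\frac12\operatorname{div}(\mathbf u_h^{i+1})C_h^{i+1}-r_0C_h^{i+1}+g_h\|_{L^2(\kappa)}+\frac12\sum_{e\in\partial\kappa\cap\Gamma_h^i}h_e^{1/2}\|\alpha[\nabla C_h^{i+1}\cdot\mathbf n]_e\|_{L^2(e)}$. *)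

(* Defs.v *)
From HB Require Import structures.
From mathcomp Require Import all_boot all_order all_algebra.
From mathcomp Require Import all_classical all_reals all_analysis.
Set Implicit Arguments.
Unset Strict Implicit.
Unset Printing Implicit Defensive.
Import Order.TTheory GRing.Theory Num.Theory.
Import numFieldNormedType.Exports.
Local Open Scope classical_set_scope.
Local Open Scope ring_scope.

(* The coordinates generate the Borel sigma-algebra of R^n. *)
Section measurable_row.
Context {R : realType} (n : nat).

Let coord (i : 'I_n) (v : 'rV[R]_n) : measurableTypeR R := v 0 i.

Let row_set0 : g_sigma_preimage coord set0.
Proof. exact: sigma_algebra0. Qed.

Let row_setC A : g_sigma_preimage coord A -> g_sigma_preimage coord (~` A).
Proof. exact: sigma_algebraC. Qed.

Let row_bigcup (F : (set 'rV[R]_n)^nat) :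
  (forall i, g_sigma_preimage coord (F i)) ->
  g_sigma_preimage coord (\bigcup_i F i).
Proof. exact: sigma_algebra_bigcup. Qed.

HB.instance Definition _ := @isMeasurable.Build
  (measure_tuple_display default_measure_display)
  'rV[R]_n (g_sigma_preimage coord) row_set0 row_setC row_bigcup.

Lemma measurable_coord (i : 'I_n) :
  measurable_fun [set: 'rV[R]_n] (fun v => v 0 i : measurableTypeR R).
Proof.
move=> _ Y mY; rewrite setTI; apply: sub_sigma_algebra => /=.
rewrite -bigcup_seq/=; exists i => /=; first by rewrite mem_index_enum.
by exists Y => //; rewrite setTI.
Qed.

Lemma measurable_rowP d (T : measurableType d) (f : T -> 'rV[R]_n) :
  (forall i, measurable_fun [set: T] (fun x => f x 0 i : measurableTypeR R)) ->
  measurable_fun [set: T] f.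
Proof.
move=> mf.
apply: (@measurability _ _ _ _ setT f
  (\big[setU/set0]_(i < n) preimage_set_system setT (coord i) measurable)) => //.
move=> _ [B + <-].
rewrite -bigcup_seq => -[i _ [A mA <-]].
by have := mf i measurableT A mA; rewrite !setTI.
Qed.

End measurable_row.

Section lebesgue_row.
Context {R : realType}.

Definition row_cons n (z : measurableTypeR R * 'rV[R]_n) : 'rV[R]_n.+1 :=
  row_mx (z.1%:M : 'M[R]_1) z.2.

Definition row_uncons n (v : 'rV[R]_n.+1) : measurableTypeR R * 'rV[R]_n :=
  (v 0 0, rsubmx (v : 'rV[R]_(1 + n))).

Lemma row_consK n : cancel (@row_cons n) (@row_uncons n).
Proof.
case=> a v; rewrite /row_uncons /row_cons row_mxKr; congr pair.
have -> : (0 : 'I_n.+1) = lshift n (0 : 'I_1) by apply: val_inj.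
by rewrite (row_mxEl (a%:M : 'M[R]_1)) mxE eqxx.
Qed.

Lemma row_unconsK n : cancel (@row_uncons n) (@row_cons n).
Proof.
move=> v; rewrite /row_cons /row_uncons; apply/rowP => i.
rewrite -(splitK (i : 'I_(1 + n))); case: fintype.split => j /=.
  rewrite (row_mxEl ((v 0 0)%:M : 'M[R]_1)) ord1 mxE eqxx mulr1n.
  by congr (v _ _); apply: val_inj.
by rewrite (row_mxEr ((v 0 0)%:M : 'M[R]_1)) mxE.
Qed.

Lemma measurable_row_cons n : measurable_fun setT (@row_cons n).
Proof.
apply: measurable_rowP => i.
rewrite -(splitK (i : 'I_(1 + n))); case: fintype.split => j /=.
- rewrite (_ : (fun x => _) = fst); first exact: measurable_fst.
  by apply/funext => x; rewrite (row_mxEl (x.1%:M : 'M[R]_1)) ord1 mxE eqxx.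
- rewrite (_ : (fun x => _) = (fun v : 'rV[R]_n => v 0 j : measurableTypeR R) \o snd).
    exact: (measurableT_comp (measurable_coord j) measurable_snd).
  by apply/funext => x; rewrite (row_mxEr (x.1%:M : 'M[R]_1)).
Qed.

Lemma measurable_row_uncons n : measurable_fun setT (@row_uncons n).
Proof.
apply/measurable_fun_pairP; split; first exact: measurable_coord.
apply: measurable_rowP => i.
rewrite (_ : (fun x => _) = (fun v : 'rV[R]_n.+1 => v 0 (rshift 1 i) : measurableTypeR R)).
  exact: measurable_coord.
by apply/funext => v; rewrite /= mxE.
Qed.

Section step.
Variables (n : nat) (m : {sigma_finite_measure set 'rV[R]_n -> \bar R}).

Definition lebesgue_row_step : set 'rV[R]_n.+1 -> \bar R :=
  pushforward (lebesgue_measure \x m)%E (@row_cons n).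

Let lebesgue_row_step0 : lebesgue_row_step set0 = 0%E.
Proof. by rewrite /lebesgue_row_step /pushforward preimage_set0 measure0. Qed.

Let lebesgue_row_step_ge0 A : (0 <= lebesgue_row_step A)%E.
Proof. by rewrite /lebesgue_row_step /pushforward; exact: measure_ge0. Qed.

Let lebesgue_row_step_sigma_additive : semi_sigma_additive lebesgue_row_step.
Proof.
move=> F mF tF mUF; rewrite /lebesgue_row_step /pushforward preimage_bigcup.
apply: measure_semi_sigma_additive.
- by move=> i; rewrite -[X in measurable X]setTI; exact: measurable_row_cons.
- apply/trivIsetP => /= i j _ _ ij; rewrite -preimage_setI.
  by move/trivIsetP : tF => /(_ _ _ _ _ ij) ->//; rewrite preimage_set0.
- rewrite -preimage_bigcup -[X in measurable X]setTI.
  exact: measurable_row_cons.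
Qed.

HB.instance Definition _ := isMeasure.Build _ _ _ lebesgue_row_step
  lebesgue_row_step0 lebesgue_row_step_ge0 lebesgue_row_step_sigma_additive.

Let lebesgue_row_step_sigma_finite : sigma_finite setT lebesgue_row_step.
Proof.
have /sigma_finiteP[F [TF ndF Foo]] := sigma_finiteT (@lebesgue_measure R).
have /sigma_finiteP[G [TG ndG Goo]] := sigma_finiteT m.
have FGT : setT = \bigcup_i (F i `*` G i).
  rewrite -setXTT TF TG predeqE => -[x y]; split.
    move=> [/= [i _ Fix] [j _ Gjy]]; exists (maxn i j) => //; split.
    - by move: x Fix; exact/subsetPset/ndF/leq_maxl.
    - by move: y Gjy; exact/subsetPset/ndG/leq_maxr.
  by move=> [i _ []/= ? ?]; split; exists i.
exists (fun i => @row_uncons n @^-1` (F i `*` G i)).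
  by rewrite -preimage_bigcup -FGT preimage_setT.
move=> i; have [mFi Fioo] := Foo i; have [mGi Gioo] := Goo i.
have mFG : measurable (F i `*` G i) by exact: measurableX.
split; first by rewrite -[X in measurable X]setTI; exact: measurable_row_uncons.
rewrite /lebesgue_row_step /pushforward -comp_preimage.
rewrite (_ : _ \o _ = id); last by apply/funext => z /=; rewrite row_consK.
rewrite preimage_id product_measure1E//.
by rewrite lte_mul_pinfty// ge0_fin_numE.
Qed.

HB.instance Definition _ :=
  Measure_isSigmaFinite.Build _ _ _ lebesgue_row_step
    lebesgue_row_step_sigma_finite.

End step.

Fixpoint lebesgue_row (n : nat) : {sigma_finite_measure set 'rV[R]_n -> \bar R} :=
  match n with
  | 0%N => \d_(0 : 'rV[R]_0)
  | n'.+1 => lebesgue_row_step (lebesgue_row n')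
  end.

Lemma row_cons0 n z : @row_cons n z 0 ord0 = z.1.
Proof. by rewrite -{2}(row_consK z). Qed.

Lemma row_cons_lift n z (i : 'I_n) : @row_cons n z 0 (lift ord0 i) = z.2 0 i.
Proof.
have -> : lift ord0 i = rshift 1 i :> 'I_(1 + n) by apply: val_inj.
by rewrite /row_cons (row_mxEr (z.1%:M : 'M[R]_1)).
Qed.

Lemma lebesgue_row_box (n : nat) (A : 'I_n -> set (measurableTypeR R)) :
  (forall i, measurable (A i)) ->
  lebesgue_row n [set v | forall i, A i (v 0 i)] =
  (\prod_(i < n) lebesgue_measure (A i))%E.
Proof.
elim: n A => [|n IHn] A mA.
  rewrite big_ord0 /= diracE (_ : _ \in _ = true)//.
  by apply/mem_set => -[].
rewrite big_ord_recl -IHn//= /lebesgue_row_step /pushforward.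
rewrite -product_measure1E//.
  congr ((_ \x _)%E _); apply/seteqP; split=> -[x v] /=.
    move=> Av; split; first by have := Av ord0; rewrite row_cons0.
    by move=> i; have := Av (lift ord0 i); rewrite row_cons_lift.
  move=> [A0 Av] i; case: (unliftP ord0 i) => [j|] ->.
    by rewrite row_cons_lift.
  by rewrite row_cons0.
rewrite [X in measurable X](_ : _ = \bigcap_(i in [set: 'I_n])
   ((fun v : 'rV[R]_n => v 0 i : measurableTypeR R) @^-1` A (lift ord0 i))).
  apply: fin_bigcap_measurable => // i _; rewrite -[X in measurable X]setTI.
  exact: measurable_coord.
by apply/seteqP; split => [v Av i _|v Av i] /=; [exact: Av|exact: (Av i)].
Qed.

End lebesgue_row.

Section domain.
Context {R : realType}.

Definition dot n (v w : 'rV[R]_n) : R := \sum_i v 0 i * w 0 i.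

(* The library norm of 'rV is the maximum norm (same topology). *)
Definition enorm n (v : 'rV[R]_n) : R := Num.sqrt (dot v v).

Definition opnorm n (A : 'M[R]_n) : R :=
  sup [set enorm (v *m A) | v in [set v : 'rV[R]_n | enorm v <= 1]].

Definition diam n (A : set 'rV[R]_n) : R :=
  sup [set enorm (z.1 - z.2) | z in A `*` A].

Definition inscribed_diam n (A : set 'rV[R]_n) : R :=
  sup [set 2 * r | r in
    [set r | 0 <= r /\ exists c, [set x | enorm (x - c) <= r] `<=` A]].

Definition hull m n (a : 'M[R]_(m, n)) : set 'rV[R]_n :=
  [set x | exists l : 'rV[R]_m,
     [/\ forall i, 0 <= l 0 i, \sum_i l 0 i = 1 & x = l *m a]].

Definition subhull m n (P : pred 'I_m) (a : 'M[R]_(m, n)) : set 'rV[R]_n :=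
  [set x | exists l : 'rV[R]_m,
     [/\ forall i, 0 <= l 0 i, \sum_i l 0 i = 1,
         forall i, ~~ P i -> l 0 i = 0 & x = l *m a]].

Definition boundary n (A : set 'rV[R]_n) : set 'rV[R]_n := closure A `\` A°.

Definition simply_connected n (A : set 'rV[R]_n) : Prop :=
  connected A /\
  forall c : R -> 'rV[R]_n,
    {within `[0, 1]%classic, continuous c} ->
    (forall t, `[0, 1]%classic t -> A (c t)) -> c 0 = c 1 ->
    exists H : R * R -> 'rV[R]_n,
      {within `[0, 1]%classic `*` `[0, 1]%classic, continuous H} /\
      forall s t, `[0, 1]%classic s -> `[0, 1]%classic t ->
        [/\ A (H (s, t)), H (s, 0) = c s, H (s, 1) = c 0,
            H (0, t) = c 0 & H (1, t) = c 0].

(* Up to an orthogonal change Q of Cartesian coordinates, A is locally the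
   strict epigraph, in the direction of the first axis, of a Lipschitz
   function. *)
Definition lipschitz_boundary k (A : set 'rV[R]_k.+1) : Prop :=
  forall x0, boundary A x0 ->
  exists (Q : 'M[R]_k.+1) (phi : 'rV[R]_k -> R) (L r : R),
    [/\ Q *m Q^T = 1%:M, 0 < r,
        forall s t, `|phi s - phi t| <= L * enorm (s - t) &
        forall y, enorm (y - x0) < r ->
          (A y <-> phi (col' ord0 (y *m Q)) < (y *m Q) 0 ord0)].

End domain.

(* A simplex of R^(k+1) is the matrix whose rows are its k+2 vertices. *)
Notation simplex R k := ('M[R]_(k.+2, k.+1)).

Section meshes.
Context {R : realType} {k : nat}.
Local Notation d := k.+1.
Implicit Types (Om : set 'rV[R]_d) (a b : simplex R k) (T : seq (simplex R k)).

(* If l is the row of barycentric coordinates of x, then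
   l *m bary_mx a = row_mx 1 x. *)
Definition bary_mx a : 'M[R]_d.+1 := row_mx (const_mx 1 : 'M[R]_(d.+1, 1)) a.

Definition nondegenerate a : Prop := bary_mx a \in unitmx.

Definition bary a (x : 'rV[R]_d) : 'rV[R]_d.+1 :=
  (row_mx (const_mx 1 : 'M[R]_(1, 1)) x : 'M[R]_(1, d.+1)) *m invmx (bary_mx a).

Definition bubble a (x : 'rV[R]_d) : R := \prod_i bary a x 0 i.

Definition polyhedral_domain Om : Prop :=
  [/\ open Om, Om !=set0, bounded_set Om, simply_connected Om &
      lipschitz_boundary Om] /\
  exists s : seq (simplex R k),
    (forall a, a \in s -> nondegenerate a) /\
    closure Om = \bigcup_(a in [set` s]) hull a.

Definition triangulation Om T : Prop :=
  [/\ uniq T,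
      forall a, a \in T -> nondegenerate a,
      closure Om = \bigcup_(a in [set` T]) hull a &
      forall a b, a \in T -> b \in T -> a != b ->
        hull a <> hull b /\
        hull a `&` hull b =
          subhull [pred i | [exists j, row i a == row j b]] a].

Definition mesh_size T : R := \big[Num.max/0]_(a <- T) diam (hull a).

Definition regular_family Om (J : Type) (Th : J -> seq (simplex R k))
    (sigma beta0 : R) : Prop :=
  0 < beta0 /\
  forall j, triangulation Om (Th j) /\
    forall a, a \in Th j ->
      diam (hull a) / inscribed_diam (hull a) <= sigma /\
      beta0 * mesh_size (Th j) <= diam (hull a).

Definition elem_patch T a : set 'rV[R]_d :=
  \bigcup_(b in [set b | b \in T /\ hull b `&` hull a !=set0]) hull b.

(* The edge (d = 2) or face (d = 3) opposite to the vertex i. *)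
Definition face a (i : 'I_k.+2) : 'M[R]_(k.+1, k.+1) := row' i a.

Definition interior_face Om a (i : 'I_k.+2) : Prop :=
  ~ (hull (face a i) `<=` boundary Om).

(* The other element of T containing an interior face. *)
Definition neighbour T a (i : 'I_k.+2) : simplex R k :=
  head a [seq b <- T | (b != a) && `[< hull (face a i) `<=` hull b >]].

(* Unique up to the sign, which does not influence the size of a jump. *)
Definition unit_normal (e : 'M[R]_(k.+1, k.+1)) : 'rV[R]_d :=
  xget 0 [set n | enorm n = 1 /\ forall i j, dot (row i e - row j e) n = 0].

Definition edge_mx (e : 'M[R]_(k.+1, k.+1)) : 'M[R]_(k, d) :=
  \matrix_(i, j) (e (lift ord0 i) j - e ord0 j).

Definition ref_simplex : set 'rV[R]_k :=
  [set t | (forall i, 0 <= t 0 i) /\ \sum_i t 0 i <= 1].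

(* Surface integral over the simplex with vertices the rows of e, through its
   affine parametrisation by the reference simplex of R^(d-1). *)
Definition face_integral (e : 'M[R]_(k.+1, k.+1)) (phi : 'rV[R]_d -> R) : R :=
  Num.sqrt (\det (edge_mx e *m (edge_mx e)^T)) *
  \int[lebesgue_row k]_(t in ref_simplex) phi (row ord0 e + t *m edge_mx e).

Definition L2_face (e : 'M[R]_(k.+1, k.+1)) (phi : 'rV[R]_d -> R) : R :=
  Num.sqrt (face_integral e (fun x => phi x ^+ 2)).

End meshes.

Section spaces.
Context {R : realType} {k : nat}.
Local Notation d := k.+1.
Local Notation pt := 'rV[R]_k.+1.
Implicit Types (D Om : set pt) (v : pt -> R) (w G : pt -> pt).
Implicit Types (p : \bar R) (T : seq (simplex R k)).

Definition integ D v : R := \int[lebesgue_row d]_(x in D) v x.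

Definition eLp p D v : \bar R :=
  Lnorm (lebesgue_row d) p (fun x => (v x * \1_D x)%:E).
Definition Lp p D v : R := fine (eLp p D v).

(* L^p norm of a vector field: L^p norm of its Euclidean length. *)
Definition LpV p D w : R := Lp p D (fun x => enorm (w x)).

Definition in_Lp p D v : Prop := measurable_fun D v /\ (eLp p D v < +oo)%E.

Definition in_LpV p D w : Prop :=
  (forall i, measurable_fun D (fun x => w x 0 i)) /\
  (eLp p D (fun x => enorm (w x)) < +oo)%E.

Definition pderiv (i : 'I_d) v : pt -> R := fun x => 'D_(delta_mx 0 i) v x.

Definition smooth v : Prop :=
  forall (s : seq 'I_d) x, differentiable (foldr pderiv v s) x.

Definition test_function Om (phi : pt -> R) : Prop :=
  smooth phi /\
  exists S : set pt,
    [/\ compact S, S `<=` Om & forall x, ~ S x -> phi x = 0].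

Definition locally_integrable_on Om v : Prop :=
  measurable_fun Om v /\
  forall S, compact S -> S `<=` Om ->
    (lebesgue_row d).-integrable S (EFin \o v).

Definition is_weak_gradient Om v G : Prop :=
  [/\ locally_integrable_on Om v,
      forall i, locally_integrable_on Om (fun x => G x 0 i) &
      forall phi, test_function Om phi -> forall i,
        integ Om (fun x => v x * pderiv i phi x) =
        - integ Om (fun x => G x 0 i * phi x)].

(* A representative of the weak gradient (unique almost everywhere on Om);
   zero if v has no weak gradient. *)
Definition wgrad Om v : pt -> pt := xget (fun=> 0) [set G | is_weak_gradient Om v G].

Definition wdiv Om w : pt -> R :=
  fun x => \sum_i wgrad Om (fun y => w y 0 i) x 0 i.

Definition W1 p Om v : Prop :=
  in_Lp p Om v /\ exists2 G, is_weak_gradient Om v G & in_LpV p Om G.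

Definition W1seminorm p Om v : R := LpV p Om (wgrad Om v).

(* Norm of H^1(D) for an open subset D of Om *)
Definition H1norm Om D v : R :=
  Num.sqrt (Lp 2%:E D v ^+ 2 + LpV 2%:E D (wgrad Om v) ^+ 2).

Definition H2 Om v : Prop :=
  W1 2%:E Om v /\ forall i, W1 2%:E Om (fun x => wgrad Om v x 0 i).

Definition W1V p Om w : Prop := forall i, W1 p Om (fun x => w x 0 i).

Definition H10 Om v : Prop :=
  W1 2%:E Om v /\
  forall eps : R, 0 < eps -> exists2 phi, test_function Om phi &
    H1norm Om Om (fun x => v x - phi x) < eps.

Definition L20 Om v : Prop := in_Lp 2%:E Om v /\ integ Om v = 0.

Definition spaceX Om w : Prop := in_LpV 3%:E Om w.
Definition spaceM Om v : Prop := W1 (3 / 2)%:E Om v /\ L20 Om v.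
Definition spaceY Om v : Prop := H10 Om v.

Definition poincare_sobolev_constant Om (p S : R) : Prop :=
  0 < S /\ forall v, H10 Om v -> Lp p%:E Om v <= S * W1seminorm 2%:E Om v.

Definition is_P1 (a : simplex R k) v : Prop :=
  exists (q : pt) (s : R), forall x, hull a x -> v x = dot q x + s.

Definition is_P1_bubble (a : simplex R k) v : Prop :=
  exists (q : pt) (s t : R),
    forall x, hull a x -> v x = dot q x + s + t * bubble a x.

Definition spaceXh Om T w : Prop :=
  {within closure Om, continuous w} /\
  forall a, a \in T -> forall i, is_P1_bubble a (fun x => w x 0 i).

Definition spaceP1h Om T v : Prop :=
  {within closure Om, continuous v} /\ forall a, a \in T -> is_P1 a v.

Definition spaceMh Om T v : Prop := spaceP1h Om T v /\ L20 Om v.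
Definition spaceYh Om T v : Prop := spaceP1h Om T v /\ H10 Om v.

Definition inverse_constant Om (J : Type) (Th : J -> seq (simplex R k)) (cI : R)
    : Prop :=
  0 < cI /\
  forall (p : R), p = 3 \/ p = 6 -> forall j w, spaceXh Om (Th j) w ->
    LpV p%:E Om w <=
      cI * mesh_size (Th j) `^ (d%:R / p - d%:R / 2) * LpV 2%:E Om w.

End spaces.

Section problems.
Context {R : realType} {k : nat}.
Local Notation d := k.+1.
Local Notation pt := 'rV[R]_k.+1.

Record pde_data := PdeData {
  mu : R; rho : R; beta : R; alpha : R; r0 : R;
  Kt : pt -> 'M[R]_k.+1; Km : R; KM : R;
  f0 : pt -> pt; f1 : R -> pt; cf1 : R;
  g : pt -> R }.

Definition admissible (Om : set pt) (P : pde_data) : Prop :=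
  [/\ [/\ 0 < mu P, 0 < rho P, 0 < beta P, 0 < alpha P & 0 < r0 P],
      [/\ forall i j, measurable_fun Om (fun x => Kt P x i j),
          exists2 k0 : R, 0 < k0 &
            {ae lebesgue_row d, forall x, Om x -> (Kt P x)^T = Kt P x /\
               forall v : pt, k0 * dot v v <= dot (v *m Kt P x) v} &
          (eLp +oo Om (fun x => opnorm (Kt P x)) < +oo)%E],
      [/\ 0 < Km P,
          ((Km P)%:E <= eLp +oo Om (fun x => opnorm (invmx (Kt P x))))%E,
          (eLp +oo Om (fun x => opnorm (invmx (Kt P x))) <= (KM P)%:E)%E &
          {ae lebesgue_row d, forall x, Om x ->
             forall l, eigenvalue (invmx (Kt P x)) l -> Km P <= l}],
      [/\ in_LpV (3 / 2)%:E Om (f0 P), 0 < cf1 P, f1 P 0 = 0 &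
          forall s t, enorm (f1 P s - f1 P t) <= cf1 P * `|s - t|] &
      in_Lp 2%:E Om (g P)].

Variables (Om : set pt) (P : pde_data).

(* K^-1 v, for a row vector v *)
Definition Kinv (v : pt -> pt) : pt -> pt := fun x => v x *m (invmx (Kt P x))^T.

Definition source (C : pt -> R) : pt -> pt := fun x => f0 P x + f1 P (C x).

Definition problem_Va (u : pt -> pt) (p C : pt -> R) : Prop :=
  [/\ spaceX Om u, spaceM Om p & spaceY Om C] /\
  [/\ forall v, spaceX Om v ->
        mu P / rho P * integ Om (fun x => dot (Kinv u x) (v x))
        + beta P / rho P * integ Om (fun x => enorm (u x) * dot (u x) (v x))
        + integ Om (fun x => dot (wgrad Om p x) (v x))
        = integ Om (fun x => dot (source C x) (v x)),
      forall q, spaceM Om q ->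
        integ Om (fun x => dot (wgrad Om q x) (u x)) = 0 &
      forall S, spaceY Om S ->
        alpha P * integ Om (fun x => dot (wgrad Om C x) (wgrad Om S x))
        + integ Om (fun x => dot (u x) (wgrad Om C x) * S x)
        + r0 P * integ Om (fun x => C x * S x)
        = integ Om (fun x => g P x * S x)].

Section discrete.
Variable T : seq (simplex R k).

Definition transport_eq (u : pt -> pt) (C : pt -> R) : Prop :=
  forall S, spaceYh Om T S ->
    alpha P * integ Om (fun x => dot (wgrad Om C x) (wgrad Om S x))
    + integ Om (fun x => dot (u x) (wgrad Om C x) * S x)
    + 2^-1 * integ Om (fun x => wdiv Om u x * C x * S x)
    + r0 P * integ Om (fun x => C x * S x)
    = integ Om (fun x => g P x * S x).

Definition problem_Vah (uh : pt -> pt) (ph Ch : pt -> R) : Prop :=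
  [/\ spaceXh Om T uh, spaceMh Om T ph & spaceYh Om T Ch] /\
  [/\ forall v, spaceXh Om T v ->
        mu P / rho P * integ Om (fun x => dot (Kinv uh x) (v x))
        + beta P / rho P * integ Om (fun x => enorm (uh x) * dot (uh x) (v x))
        + integ Om (fun x => dot (wgrad Om ph x) (v x))
        = integ Om (fun x => dot (source Ch x) (v x)),
      forall q, spaceMh Om T q ->
        integ Om (fun x => dot (wgrad Om q x) (uh x)) = 0 &
      transport_eq uh Ch].

Definition problem_Vahi (gamma : R) (u : pt -> pt) (C : pt -> R)
    (u' : pt -> pt) (p' C' : pt -> R) : Prop :=
  [/\ spaceXh Om T u', spaceMh Om T p' & spaceYh Om T C'] /\
  [/\ forall v, spaceXh Om T v ->
        gamma * integ Om (fun x => dot (u' x - u x) (v x))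
        + mu P / rho P * integ Om (fun x => dot (Kinv u' x) (v x))
        + beta P / rho P * integ Om (fun x => enorm (u x) * dot (u' x) (v x))
        + integ Om (fun x => dot (wgrad Om p' x) (v x))
        = integ Om (fun x => dot (source C x) (v x)),
      forall q, spaceMh Om T q ->
        integ Om (fun x => dot (wgrad Om q x) (u' x)) = 0 &
      transport_eq u' C'].

(* p 0 plays no role. *)
Definition iterates (gamma : R) (u : nat -> pt -> pt) (p C : nat -> pt -> R)
    : Prop :=
  [/\ spaceXh Om T (u 0%N), spaceYh Om T (C 0%N) &
      forall i, problem_Vahi gamma (u i) (C i) (u i.+1) (p i.+1) (C i.+1)].

(* Elements are integrated over their interiors: weak derivatives only make
   sense in Om, and the boundary of an element has measure zero. *)
Definition eta_L2 (a : simplex R k) (C C' : pt -> R) : R :=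
  H1norm Om (hull a)° (fun x => C x - C' x).

Definition laplacian (v : pt -> R) : pt -> R :=
  fun x => \sum_i pderiv i (pderiv i v) x.

(* Trace from inside a, at a point x of its boundary, of the derivative of v
   in the direction n. *)
Definition normal_trace (a : simplex R k) (n : pt) (v : pt -> R) (x : pt) : R :=
  lim ((fun y => 'D_n v y) @ within (hull a)° (nbhs x)).

Definition jump (a : simplex R k) (i : 'I_k.+2) (v : pt -> R) (x : pt) : R :=
  let n := unit_normal (face a i) in
  normal_trace a n v x - normal_trace (neighbour T a i) n v x.

(* gh gives the (constant) value of the approximation of g on each element. *)
Definition eta_D1 (gh : simplex R k -> R) (a : simplex R k)
    (u : pt -> pt) (C : pt -> R) : R :=
  diam (hull a) *
    Lp 2%:E (hull a)° (fun x =>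
      alpha P * laplacian C x - dot (u x) (wgrad Om C x)
      - 2^-1 * wdiv Om u x * C x - r0 P * C x + gh a)
  + 2^-1 * \sum_(i | `[< interior_face Om a i >])
      diam (hull (face a i)) `^ 2^-1 *
      L2_face (face a i) (fun x => alpha P * jump a i C x).

End discrete.

Definition apriori_constant (J : Type) (Th : J -> seq (simplex R k))
    (u : pt -> pt) (p C : pt -> R) (c1 : R) : Prop :=
  0 < c1 /\
  forall j uh ph Ch, problem_Vah (Th j) uh ph Ch ->
    W1seminorm 2%:E Om (fun x => C x - Ch x)
    + LpV 2%:E Om (fun x => u x - uh x)
    + LpV (3 / 2)%:E Om (wgrad Om (fun x => p x - ph x))
    <= c1 * mesh_size (Th j).

Definition data_norm (S2 : R) : R :=
  LpV 2%:E Om (f0 P) + cf1 P * (S2 ^+ 2 / alpha P) * Lp 2%:E Om (g P).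

Definition L1_bound (S2 : R) : R := rho P / (mu P * Km P) * data_norm S2.

Definition gamma_star (S2 cI h : R) : R :=
  32 * beta P / (27 * rho P) * cI ^+ 3 * h `^ (- (d%:R / 2))
    * (rho P / (mu P * Km P) + rho P * KM P / (mu P * Km P ^+ 2))
    * data_norm S2
  + 32 * beta P ^+ 2 * rho P / (27 * mu P ^+ 3 * Km P ^+ 3)
    * cI ^+ 6 * h `^ (- d%:R) * data_norm S2 ^+ 2.

Definition gamma_starstar (S2 cI h : R) : R :=
  2 * cI ^+ 4 * h `^ (- (2 * d%:R / 3))
    * (rho P `^ (1 / 3) * beta P `^ (4 / 3)
       / (mu P `^ (5 / 3) * Km P `^ (5 / 3)))
    * data_norm S2 `^ (4 / 3).

End problems.
Arguments pde_data : clear implicits.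

(* Main.v *)
Require Import Defs.
From HB Require Import structures.
From mathcomp Require Import all_boot all_order all_algebra.
From mathcomp Require Import all_classical all_reals all_analysis.
From mathcomp Require Import perm measurable_realfun ess_sup_inf.
From mathcomp Require Import ring lra.
Set Implicit Arguments.
Unset Strict Implicit.
Unset Printing Implicit Defensive.
Import Order.TTheory GRing.Theory Num.Theory.
Import numFieldNormedType.Exports.
Local Open Scope classical_set_scope.
Local Open Scope ring_scope.

(* The iterates converge to (u_h, C_h). Testing the difference of the momentum
   equations with the error and using the monotonicity of v |-> |v| v, the
   lagged factor |u^i| is absorbed by gamma |u^{i+1} - u^i|^2, because gamma
   exceeds gamma_star; the coupling through f_1 is absorbed by the smallness of
   C and of h. The error is then a contraction up to a vanishing term, and hence
   |C - C^{i+1}|_{H^1} <= (c1 + 1) h for i large. An affine function which is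
   large on an element is large on a ball of radius comparable to h, so the
   Sobolev inequality in L^6 bounds C^{i+1} uniformly in h.

   The lower bound for the error does not use element and face bubbles. The
   exact concentration equation is tested with smooth radial bumps psi, of radius
   comparable to h. Since u is solenoidal, the residual against psi is, up to the
   term in grad psi, a sum of integrals of u' - u and C - C' against psi, grad psi
   and C', all controlled by the local error. Inside an element the gradient term
   vanishes and psi is centred where the polynomial residual is largest. Across
   a face, psi is centred on the face, and the gradient term is the jump of
   grad C' times an integral of constant sign. *)

(** * Lebesgue measure on row vectors *)

(** The usual bubble argument integrates the residual by parts on each element and needs Green's
    formula with traces on the faces. Test functions with compact support in Om avoid this: all
    integrations by parts reduce to the definition of the weak gradient. The fact behind it is that
    a function which agrees on each closed element with a smooth one has its elementwise gradient as
    weak gradient, a consequence of the translation invariance of the measure. The same fact makes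
    the discrete convection form skew.

    The uniform bound on C^{i+1} is what makes c independent of h. It multiplies u' - u in the term
    with grad psi and, by an inverse estimate for affine functions, it bounds h |grad C'|. It is the
    only point where the convergence of the iterates is used, so i_1 may depend on h and gamma
    although c may not.

    The powers of h balance as follows. A bump on a ball of radius comparable to h has L^2 norm of
    order h^{d/2} and a gradient of size 1/h. The exact velocity enters through its L^3 norm, so its
    convection term puts psi in L^6, and h^{d/6} has to be at most a multiple of h^{d/2 - 1}: this
    is where d <= 3 enters. *)

Section row_measure.
Context {R : realType} (n : nat).
Local Notation pt := 'rV[R]_n.
Local Notation mu := (@lebesgue_row R n).

Definition open_box (a b : pt) : set pt :=
  [set x | forall i, a 0 i < x 0 i < b 0 i].

Definition open_boxes : set (set pt) := [set A | exists a b, A = open_box a b].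

Lemma open_box_prod a b :
  open_box a b = [set v | forall i, [set` `]a 0 i, b 0 i[%R] (v 0 i)].
Proof. by apply/seteqP; split=> x /= xab i; have := xab i; rewrite /= in_itv. Qed.

Lemma measurable_open_box a b : measurable (open_box a b).
Proof.
rewrite open_box_prod [X in measurable X](_ : _ = \bigcap_(i in [set: 'I_n])
   ((fun v : pt => v 0 i : measurableTypeR R) @^-1` [set` `]a 0 i, b 0 i[%R])).
  apply: fin_bigcap_measurable => // i _; rewrite -[X in measurable X]setTI.
  exact: measurable_coord.
by apply/seteqP; split => [v Av i _|v Av i] /=; [exact: Av|exact: (Av i)].
Qed.

Lemma open_boxesI : setI_closed open_boxes.
Proof.
move=> _ _ [a [b ->]] [c [e ->]].
exists (\row_i Num.max (a 0 i) (c 0 i)), (\row_i Num.min (b 0 i) (e 0 i)).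
apply/seteqP; split => x /=.
  by move=> [xab xce] i; rewrite !mxE gt_max lt_min; case/andP: (xab i) (xce i) => -> -> /andP[-> ->].
by move=> h; split => i; have := h i; rewrite !mxE gt_max lt_min => /andP[/andP[? ?] /andP[? ?]]; apply/andP.
Qed.

(** Boxes are a pi-system that generates the sigma-algebra; uniqueness of measures and Dynkin
    induction can then be checked on boxes, whose volume is explicit. *)
Lemma row_measurableE : @measurable _ 'rV[R]_n = <<s open_boxes >>.
Proof.
apply/seteqP; split; last first.
  apply: smallest_sub; first exact: sigma_algebra_measurable.
  by move=> _ [a [b ->]]; exact: measurable_open_box.
apply: smallest_sub.
  exact: smallest_sigma_algebra.
move=> A; rewrite -bigcup_seq/= => -[i _ [B mB <-]]; rewrite setTI.
suff : measurable_fun [set: g_sigma_algebraType open_boxes]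
    (fun v : g_sigma_algebraType open_boxes => (v : pt) 0 i : measurableTypeR R).
  by move=> /(_ measurableT B mB); rewrite setTI.
apply: (measurability _ (RGenOInfty.measurableE R)) => //.
move=> _ [_ [x ->] <-]; rewrite setTI.
rewrite [X in measurable X](_ : _ = \bigcup_m
   (open_box (\row_j (if j == i then x else - m%:R)) (const_mx m%:R))).
  by apply: bigcup_measurable => m _; apply: sub_sigma_algebra; do 2 eexists.
apply/seteqP; split => [v|v [m _ vm]] /=; last first.
  by have := vm i; rewrite !mxE eqxx in_itv/= andbT => /andP[].
rewrite in_itv/= andbT => xv.
pose M := \sum_j `|v 0 j|.
have [m Mm] : exists m : nat, M < m%:R.
  by exists (Num.truncn M).+1; rewrite truncnS_gt.
have vM j : `|v 0 j| <= M.
  by rewrite /M (bigD1 j)//= lerDl sumr_ge0.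
exists m => // j; rewrite !mxE.
have := le_lt_trans (vM j) Mm; rewrite ltr_norml => /andP[v1 v2].
by rewrite v2 andbT; case: ifPn => [/eqP ->|].
Qed.

Lemma row_ballP (x y : pt) e :
  ball x e y <-> 0 < e /\ forall i, `|x 0 i - y 0 i| < e.
Proof.
split=> [[e0 xy]|[e0 xy]]; split=> // i; first exact: (xy 0 i).
by move=> j; rewrite !ord1; exact: xy.
Qed.

(** Rational end points make the family countable, and the closed box inside A is a compact
    neighbourhood. Both serve to pass from boxes to open sets and to almost everywhere
    statements. *)
Lemma rat_open_box (A : set pt) x : open A -> A x ->
  exists q : 'rV[rat]_n * 'rV[rat]_n,
    open_box (map_mx ratr q.1) (map_mx ratr q.2) x /\
    [set y : pt | forall i, ratr (q.1 0 i) <= y 0 i <= ratr (q.2 0 i)] `<=` A.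
Proof.
move=> oA Ax; have /nbhs_ballP[e /= e0 eA] := open_nbhs_nbhs (conj oA Ax).
have e2 : 0 < e / 2 by rewrite divr_gt0.
have ha i : exists q : rat, x 0 i - e / 2 < ratr q < x 0 i.
  have /rat_in_itvoo[q] : x 0 i - e / 2 < x 0 i by rewrite ltrBlDr ltrDl.
  by rewrite in_itv/=; exists q.
have hb i : exists q : rat, x 0 i < ratr q < x 0 i + e / 2.
  have /rat_in_itvoo[q] : x 0 i < x 0 i + e / 2 by rewrite ltrDl.
  by rewrite in_itv/=; exists q.
exists (\row_i xchoose (ha i), \row_i xchoose (hb i)); split => /=.
  move=> i; rewrite !mxE/=.
  by have /andP[_ ->] := xchooseP (ha i); have /andP[-> _] := xchooseP (hb i).
move=> y/= xy; apply: eA; apply/row_ballP; split=> // i.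
have := xy i; rewrite !mxE => /andP[h1 h2].
have /andP[h3 h4] := xchooseP (ha i); have /andP[h5 h6] := xchooseP (hb i).
by rewrite ltr_norml; apply/andP; split; lra.
Qed.

Lemma measurable_row_open (A : set pt) : open A -> measurable A.
Proof.
move=> oA.
rewrite (_ : A = \bigcup_(q : 'rV[rat]_n * 'rV[rat]_n)
   if `[< [set y : pt | forall i, ratr (q.1 0 i) <= y 0 i <= ratr (q.2 0 i)] `<=` A >]
   then open_box (map_mx ratr q.1) (map_mx ratr q.2) else set0).
  apply: countable_bigcupT_measurable => // q.
  by case: ifPn => // _; exact: measurable_open_box.
apply/seteqP; split => [x Ax|x [q _]].
  have [q [qx qA]] := rat_open_box oA Ax.
  by exists q => //; case: asboolP.
case: asboolP => // qA /= xq; apply: qA => i.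
by have := xq i; rewrite !mxE => /andP[/ltW -> /ltW ->].
Qed.

Lemma measurable_row_closed (A : set pt) : closed A -> measurable A.
Proof.
move=> cA; rewrite -(setCK A); apply: measurableC; apply: measurable_row_open.
exact: closed_openC.
Qed.

Lemma measurable_row_continuous (f : pt -> R) :
  continuous f -> measurable_fun [set: pt] f.
Proof.
move=> cf; apply: (measurability _ (RGenOInfty.measurableE R)) => //.
move=> _ [_ [x ->] <-]; rewrite setTI; apply: measurable_row_open.
by apply: open_comp => // ? _; exact: cf.
Qed.

Lemma lebesgue_open_box (a b : pt) : (forall i, a 0 i <= b 0 i) ->
  mu (open_box a b) = (\prod_i (b 0 i - a 0 i))%:E.
Proof.
move=> ab; rewrite open_box_prod
  (lebesgue_row_box (A := fun i => [set` `]a 0 i, b 0 i[%R]))//.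
rewrite -prodEFin; apply: eq_bigr => i _ /=.
rewrite lebesgue_measure_itv/= lte_fin; case: ifPn => //.
by rewrite -leNgt => ba; rewrite (_ : a 0 i = b 0 i) ?subrr//; apply/eqP; rewrite eq_le ab ba.
Qed.

Lemma open_box_empty (a b : pt) i : b 0 i <= a 0 i -> open_box a b = set0.
Proof.
move=> ba; apply/seteqP; split => // x /(_ i) /andP[h1 h2].
by have := lt_trans h1 h2; rewrite ltNge ba.
Qed.

Definition shift_row (c x : pt) : pt := x + c.

Lemma measurable_shift_row c : measurable_fun [set: pt] (shift_row c).
Proof.
apply: measurable_rowP => i; rewrite /shift_row.
under eq_fun do rewrite mxE.
by apply: measurable_funD => //; exact: measurable_coord.
Qed.

Lemma big_open_box (x : pt) :
  exists m : nat, open_box (const_mx (- m%:R)) (const_mx m%:R) x.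
Proof.
pose M := \sum_j `|x 0 j|; exists (Num.truncn M).+1 => j; rewrite !mxE.
have vM : `|x 0 j| <= M by rewrite /M (bigD1 j)//= lerDl sumr_ge0.
by rewrite -ltr_norml (le_lt_trans vM)// truncnS_gt.
Qed.

(** The translated measure and the original one agree on the pi-system of boxes, which contains an
    exhausting sequence of sets of finite measure. *)
Lemma lebesgue_shift_row c (A : set pt) : measurable A ->
  mu (shift_row c @^-1` A) = mu A.
Proof.
pose B m : set pt := open_box (const_mx (- m%:R)) (const_mx m%:R).
have mmu : measurable_fun [set: pt] (shift_row c) by exact: measurable_shift_row.
pose phi : {mfun pt >-> pt} := HB.pack (shift_row c) (isMeasurableFun.Build _ _ _ _ _ mmu).
apply: (measure_unique open_boxes B row_measurableE open_boxesI _ _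
  [the measure _ _ of pushforward mu phi] mu).
- by move=> m; do 2 eexists.
- by apply/seteqP; split => // x _; have [m xm] := big_open_box x; exists m.
- move=> _ [a [b ->]]; rewrite /= /pushforward.
  have -> : shift_row c @^-1` open_box a b = open_box (a - c) (b - c).
    apply/seteqP; split => x /= xab i; have := xab i; rewrite /shift_row !mxE.
      by move=> /andP[h1 h2]; apply/andP; split; lra.
    by move=> /andP[h1 h2]; apply/andP; split; lra.
  have [/forallP ab|] := boolP [forall i, a 0 i <= b 0 i].
    rewrite !lebesgue_open_box//.
      by congr EFin; apply: eq_bigr => i _; rewrite !mxE; lra.
    by move=> i; rewrite !mxE lerD2r.
  rewrite negb_forall => /existsP[i]; rewrite -ltNge => /ltW ba.
  by rewrite !(@open_box_empty _ _ i)// !mxE lerD2r.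
- move=> m; rewrite /= /pushforward /B.
  have -> : shift_row c @^-1` open_box (const_mx (- m%:R)) (const_mx m%:R) =
     open_box (const_mx (- m%:R) - c) (const_mx m%:R - c).
    apply/seteqP; split => x /= xab i; have := xab i; rewrite /shift_row !mxE.
      by move=> /andP[h1 h2]; apply/andP; split; lra.
    by move=> /andP[h1 h2]; apply/andP; split; lra.
  rewrite lebesgue_open_box ?ltry// => i; rewrite !mxE lerD2r.
  by rewrite ge0_cp.
Qed.

Lemma lebesgue_row_lty (A : set pt) M : measurable A ->
  (forall x, A x -> forall i, `|x 0 i| <= M) -> (mu A < +oo)%E.
Proof.
move=> mA AM; apply: (@le_lt_trans _ _ (mu (open_box (const_mx (- (`|M| + 1))) (const_mx (`|M| + 1))))).
  apply: le_measure; rewrite ?inE//; first exact: measurable_open_box.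
  move=> x Ax i; rewrite !mxE -ltr_norml (le_lt_trans (AM x Ax i))//.
  by rewrite ltr_pwDr// ler_norm.
rewrite lebesgue_open_box ?ltry// => i; rewrite !mxE.
by rewrite ge0_cp// addr_ge0.
Qed.

(** A line of direction v meets N at most once, so the translates of N by v / (m + 1) are pairwise
    disjoint. They have equal measure and lie in a common bounded set, which forces mu N = 0. The
    intended N are pieces of hyperplanes. *)
Lemma null_translates (N : set pt) (v : pt) (M : R) : measurable N ->
  (forall x, N x -> forall i, `|x 0 i| <= M) ->
  (forall x s, N x -> N (x + s *: v) -> s = 0) -> mu N = 0.
Proof.
move=> mN NM Nv.
pose F (m : nat) : set pt := shift_row (- (m.+1%:R^-1 *: v)) @^-1` N.
have mF m : measurable (F m).
  by rewrite -[X in measurable X]setTI; exact: measurable_shift_row.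
have tF : trivIset setT F.
  apply/trivIsetP => m l _ _ ml; apply/seteqP; split => // x [Nm Nl].
  have := Nv _ (m.+1%:R^-1 - l.+1%:R^-1) Nm.
  rewrite (_ : _ + _ = shift_row (- (l.+1%:R^-1 *: v)) x); last first.
    by rewrite /shift_row scalerBl addrA subrK.
  move=> /(_ Nl)/eqP; rewrite subr_eq0 => /eqP/invr_inj/eqP.
  by rewrite eqr_nat eqSS (negbTE ml).
pose V := \sum_i `|v 0 i|.
have vV i : `|v 0 i| <= V by rewrite /V (bigD1 i)//= lerDl sumr_ge0.
pose A := \bigcup_m F m.
have mA : measurable A by exact: bigcup_measurable.
have Afin : (mu A < +oo)%E.
  apply: (@lebesgue_row_lty A (M + V)) => // x [m _ Fx] i.
  rewrite -(subrK ((m.+1%:R^-1 *: v) 0 i) (x 0 i)).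
  rewrite (le_trans (ler_normD _ _))// lerD//.
    by have := NM _ Fx i; rewrite /shift_row !mxE.
  rewrite mxE normrM (le_trans _ (vV i))// ler_piMl//.
  by rewrite ger0_norm// invf_le1// ler1n.
have NA m : (m%:R%:E * mu N <= mu A)%E.
  rewrite (_ : (m%:R%:E * mu N)%E = mu (\big[setU/set0]_(i < m) F i)).
    apply: le_measure; rewrite ?inE//; first by apply: bigsetU_measurable.
    by rewrite -bigcup_mkord => x [i _ Fx]; exists i.
  rewrite measure_bigsetU//; elim: m => [|l IHl]; first by rewrite mul0e big_ord0.
  rewrite big_ord_recr/= -IHl -natr1 EFinD ge0_muleDl// mul1e.
  by congr (_ + _)%E; rewrite lebesgue_shift_row.
have /fineK NE : mu N \is a fin_num.
  rewrite ge0_fin_numE//; apply: le_lt_trans Afin.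
  by have := NA 1; rewrite mul1e.
have /fineK AE : mu A \is a fin_num by rewrite ge0_fin_numE.
apply/eqP; rewrite -NE eqe; apply/eqP/le_anti/andP; split; last exact: fine_ge0.
rewrite leNgt; apply/negP => N0.
have := NA (Num.truncn (fine (mu A) / fine (mu N))).+1.
rewrite -AE -NE -EFinM lee_fin leNgt => /negP; apply.
by rewrite -ltr_pdivrMr// truncnS_gt.
Qed.

Lemma lebesgue_shift_integral c (f : pt -> \bar R) :
  measurable_fun [set: pt] f -> mu.-integrable [set: pt] f ->
  mu.-integrable [set: pt] (f \o shift_row c) /\
  (\int[mu]_x f (shift_row c x) = \int[mu]_x f x)%E.
Proof.
move=> mf fi.
have mmu : measurable_fun [set: pt] (shift_row c) by exact: measurable_shift_row.
have fci : mu.-integrable [set: pt] (f \o shift_row c).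
  apply/integrableP; split; first exact: measurableT_comp.
  have /integrableP[_] := fi; apply: le_lt_trans.
  rewrite le_eqVlt; apply/orP; left; apply/eqP.
  transitivity (\int[pushforward mu (shift_row c)]_x `|f x|)%E.
    by rewrite ge0_integral_pushforward//; exact: measurableT_comp.
  by apply: eq_measure_integral => A mA _; exact: lebesgue_shift_row.
split=> //; transitivity (\int[pushforward mu (shift_row c)]_x f x)%E.
  by rewrite integral_pushforward// preimage_setT.
by apply: eq_measure_integral => A mA _; exact: lebesgue_shift_row.
Qed.

End row_measure.

(** * Smooth bumps *)

Section smooth_functions.
Context {R : realType} {k : nat}.
Local Notation d := k.+1.
Local Notation pt := 'rV[R]_k.+1.

(** [smooth] quantifies over lists of derivatives; recursion on the order of differentiability is
    the form in which the product and chain rules can be proved by induction. *)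
Fixpoint Cn (n : nat) (v : pt -> R) : Prop :=
  (forall x, differentiable v x) /\
  match n with 0%N => True | m.+1 => forall i, Cn m (pderiv i v) end.

Lemma CnP n v : Cn n.+1 v <->
  (forall x, differentiable v x) /\ forall i, Cn n (pderiv i v).
Proof. by []. Qed.

Lemma Cn_differentiable n v : Cn n v -> forall x, differentiable v x.
Proof. by case: n => [|n] []. Qed.

Lemma CnS n v : Cn n.+1 v -> Cn n v.
Proof.
elim: n v => [|n IHn] v /CnP[dv Dv]; first by split.
by apply/CnP; split => // i; apply: IHn.
Qed.

Lemma smoothP v : smooth v <-> forall n, Cn n v.
Proof.
split=> [sv n|Cv s].
  elim: n v sv => [|n IHn] v sv; first by split => // x; exact: (sv [::]).
  split; first by move=> x; exact: (sv [::]).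
  move=> i; apply: IHn => s x; have := sv (rcons s i) x.
  by rewrite -cats1 foldr_cat.
suff : forall n s, (size s <= n)%N -> forall v, Cn n v ->
    forall x, differentiable (foldr pderiv v s) x.
  by move=> /(_ _ _ (leqnn (size s))); exact.
elim=> [|n IHn] {}s; first by case: s => // _ w [].
elim/last_ind: s => [|s i _]; first by move=> _ w [].
rewrite size_rcons ltnS => sn w /CnP[_ Dw] x.
by rewrite -cats1 foldr_cat /=; apply: IHn.
Qed.

Lemma pderivD i (v w : pt -> R) x : differentiable v x -> differentiable w x ->
  pderiv i (fun x => v x + w x) x = pderiv i v x + pderiv i w x.
Proof.
by move=> dv dw; rewrite /pderiv -(deriveD (diff_derivable dv) (diff_derivable dw)).
Qed.

Lemma pderivM i (v w : pt -> R) x : differentiable v x -> differentiable w x ->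
  pderiv i (fun x => v x * w x) x = v x * pderiv i w x + w x * pderiv i v x.
Proof.
by move=> dv dw; rewrite /pderiv (deriveM (diff_derivable dv) (diff_derivable dw)).
Qed.

Lemma pderiv_cst i (c : R) (x : pt) : pderiv i (fun=> c) x = 0.
Proof. by rewrite /pderiv derive_cst. Qed.

Lemma CnD n v w : Cn n v -> Cn n w -> Cn n (fun x => v x + w x).
Proof.
elim: n v w => [|n IHn] v w.
  by move=> [dv _] [dw _]; split => // x; exact: differentiableD.
move=> /CnP[dv Dv] /CnP[dw Dw]; apply/CnP; split; first by move=> x; exact: differentiableD.
move=> i; have -> : pderiv i (fun x => v x + w x) =
    (fun x => pderiv i v x + pderiv i w x).
  by apply/funext => x; exact: pderivD.
by apply: IHn.
Qed.

Lemma CnM n v w : Cn n v -> Cn n w -> Cn n (fun x => v x * w x).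
Proof.
elim: n v w => [|n IHn] v w Cv Cw.
  by move: Cv Cw => [dv _] [dw _]; split => // x; exact: differentiableM.
have /CnP[dv Dv] := Cv; have /CnP[dw Dw] := Cw.
apply/CnP; split; first by move=> x; exact: differentiableM.
move=> i; have -> : pderiv i (fun x => v x * w x) =
    (fun x => v x * pderiv i w x + w x * pderiv i v x).
  by apply/funext => x; exact: pderivM.
by apply: CnD; apply: IHn => //; exact: CnS.
Qed.

Lemma Cn_cst n (c : R) : Cn n (fun=> c).
Proof.
elim: n c => [|n IHn] c; first by split => // x; exact: differentiable_cst.
apply/CnP; split; first by move=> x; exact: differentiable_cst.
move=> i; have -> : pderiv i (fun=> c) = (fun=> 0).
  by apply/funext => x; exact: pderiv_cst.
exact: IHn.
Qed.

Lemma differentiable_coord_row (i : 'I_d) (x : pt) :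
  differentiable (fun y : pt => y 0 i) x.
Proof. exact: differentiable_coord. Qed.

Lemma pderiv_coord i j (x : pt) : pderiv i (fun y : pt => y 0 j) x = (i == j)%:R.
Proof.
rewrite /pderiv deriveE; last exact: differentiable_coord_row.
have lin : linear (fun y : pt => y 0 j : R) by move=> a y z; rewrite !mxE.
pose f : {linear pt -> R} := HB.pack (fun y : pt => y 0 j : R)
  (GRing.isLinear.Build _ _ _ _ _ lin).
have cf : continuous f by move=> y; apply: differentiable_continuous; exact: differentiable_coord_row.
by rewrite (_ : (fun y : pt => y 0 j) = f)// diff_lin//= mxE eqxx/= eq_sym.
Qed.

Lemma Cn_coord n i : Cn n (fun y : pt => y 0 i).
Proof.
case: n => [|n]; first by split => // x; exact: differentiable_coord_row.
apply/CnP; split; first by move=> x; exact: differentiable_coord_row.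
move=> j; have -> : pderiv j (fun y : pt => y 0 i) = (fun=> (j == i)%:R).
  by apply/funext => x; exact: pderiv_coord.
exact: Cn_cst.
Qed.

Lemma smoothD (v w : pt -> R) : smooth v -> smooth w -> smooth (fun x => v x + w x).
Proof. by move=> /smoothP sv /smoothP sw; apply/smoothP => n; exact: CnD. Qed.

Lemma smoothM (v w : pt -> R) : smooth v -> smooth w -> smooth (fun x => v x * w x).
Proof. by move=> /smoothP sv /smoothP sw; apply/smoothP => n; exact: CnM. Qed.

Lemma smooth_cst (c : R) : smooth (fun _ : pt => c).
Proof. by apply/smoothP => n; exact: Cn_cst. Qed.

Lemma smooth_coord i : smooth (fun y : pt => y 0 i).
Proof. by apply/smoothP => n; exact: Cn_coord. Qed.

Lemma smooth_sum (I : Type) (s : seq I) (F : I -> pt -> R) :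
  (forall i, smooth (F i)) -> smooth (fun x => \sum_(i <- s) F i x).
Proof.
move=> sF; elim: s => [|a s IHs].
  by under eq_fun do rewrite big_nil; exact: smooth_cst.
by under eq_fun do rewrite big_cons; exact: smoothD.
Qed.

Lemma smooth_prod (I : Type) (s : seq I) (F : I -> pt -> R) :
  (forall i, smooth (F i)) -> smooth (fun x => \prod_(i <- s) F i x).
Proof.
move=> sF; elim: s => [|a s IHs].
  by under eq_fun do rewrite big_nil; exact: smooth_cst.
by under eq_fun do rewrite big_cons; exact: smoothM.
Qed.

Lemma smooth_differentiable (v : pt -> R) x : smooth v -> differentiable v x.
Proof. by move=> sv; exact: (sv [::]). Qed.

Lemma smooth_pderiv (v : pt -> R) i : smooth v -> smooth (pderiv i v).
Proof. by move=> sv s x; have := sv (rcons s i) x; rewrite -cats1 foldr_cat. Qed.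

Lemma smooth_continuous (v : pt -> R) : smooth v -> continuous v.
Proof. by move=> sv x; apply: differentiable_continuous; exact: smooth_differentiable. Qed.

(* All derivatives of exp(-1/t) have the form P(1/t) exp(-1/t) for t > 0. *)
Definition flat (P : {poly R}) (t : R) : R :=
  if 0 < t then P.[t^-1] * expR (- t^-1) else 0.

(** With s = 1/t, the derivative of P(s) exp(-s) in s is (P' - P)(s) exp(-s), and ds/dt = - s^2. *)
Definition flat_diff (P : {poly R}) : {poly R} := 'X^2 * (P - P^`()).

(** The inequality s^n <= n! e^s with s = 1/t makes every polynomial in 1/t times exp(-1/t) not only
    bounded but of order t; this rate yields the derivative at 0. *)
Lemma poly_expR_bound (P : {poly R}) :
  exists C : R, 0 <= C /\ forall t, 0 < t -> `|P.[t^-1]| * expR (- t^-1) <= C * t.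
Proof.
suff [C [C0 CP]] : exists C : R, 0 <= C /\ forall s, 0 < s -> `|P.[s]| * s <= C * expR s.
  exists C; split=> // t t0; have s0 : 0 < t^-1 by rewrite invr_gt0.
  have := CP _ s0; rewrite -ler_pdivlMr// => h.
  rewrite expRN ler_pdivrMr ?expR_gt0// (le_trans h)//.
  by rewrite invrK mulrAC.
have expX n s : 0 < s -> s ^+ n <= n`!%:R * expR s.
  case: n => [s0|n s0]; first by rewrite expr0 mul1r -expR0 ler_expR ltW.
  rewrite mulrC -ler_pdivrMr ?ltr0n ?fact_gt0//.
  by apply: le_trans (expR_ge1Dxn n (ltW s0)); rewrite lerDr.
exists (\sum_(i < size P) `|P`_i| * (i.+1)`!%:R); split.
  by apply: sumr_ge0 => i _; rewrite mulr_ge0.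
move=> s s0; rewrite horner_coef -{2}(gtr0_norm s0) -normrM mulr_suml.
rewrite (le_trans (ler_norm_sum _ _ _))// mulr_suml ler_sum// => i _.
rewrite -mulrA -exprSr normrM -mulrA ler_wpM2l// gtr0_norm ?exprn_gt0//.
exact: expX.
Qed.

Lemma flat_le0 P t : t <= 0 -> flat P t = 0.
Proof. by rewrite /flat leNgt; case: ltP. Qed.

Lemma is_derive_flat P (t : R) : is_derive t 1 (flat P) (flat (flat_diff P) t).
Proof.
have [t0|t0|->] := ltgtP t 0.
- rewrite flat_le0; last exact: ltW.
  apply: (near_eq_is_derive (f := cst 0)).
  near=> s; rewrite flat_le0// ltW//; near: s; exact: lt_nbhsl.
- pose f := ((fun s => P.[s^-1]) * (fun s => expR (- s^-1))) : R -> R.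
  apply: (near_eq_is_derive (f := f)).
    near=> s; rewrite /f /flat ifT//; near: s; exact: lt_nbhsr.
  have dV : is_derive t 1 (fun s : R => s^-1) (- t ^- 2).
    by have := is_deriveV (f := id) (lt0r_neq0 t0) (is_derive_id t 1); rewrite [_ *: _]mulr1.
  have dN : is_derive t 1 (fun s : R => - s^-1) (t ^- 2).
    by have := is_deriveN dV; rewrite opprK.
  have d1 : is_derive t 1 (fun s : R => P.[s^-1]) (P^`().[t^-1] * - t ^- 2).
    exact: (is_derive1_comp (is_derive_poly P t^-1) dV).
  have d2 : is_derive t 1 (fun s : R => expR (- s^-1)) (expR (- t^-1) * t ^- 2).
    exact: (@is_derive1_comp R expR (fun s : R => - s^-1) t _ _ (is_derive_expR (- t^-1)) dN).
  have := is_deriveM d1 d2; congr is_derive.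
  rewrite /flat t0 /flat_diff hornerM hornerXn hornerD hornerN /GRing.scale/=.
  by rewrite -exprVn; ring.
- rewrite flat_le0//.
  (* The additional factor 1/t improves the bound on [flat P h] to C h^2, so that the difference
     quotient at 0 tends to 0. *)
  have [C [C0 CP]] := poly_expR_bound ('X * P).
  have bnd h : `|flat P h| <= C * h ^+ 2.
    rewrite /flat; case: ifPn => h0; last by rewrite normr0 mulr_ge0// sqr_ge0.
    have := CP h h0; rewrite hornerM hornerX normrM gtr0_norm ?invr_gt0//.
    rewrite -mulrA mulrC -ler_pdivlMr ?invr_gt0// invrK normrM.
    by rewrite (gtr0_norm (expR_gt0 _)) expr2 mulrA.
  have lim0 : h^-1 *: (flat P (h + 0) - flat P 0) @[h --> 0^'] --> (0 : R).
    apply/cvgr0Pnorm_lt => e e0; near=> h.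
    have h0 : h != 0 by near: h; exact: nbhs_dnbhs_neq.
    rewrite addr0 (@flat_le0 P 0)// subr0 normrM normfV.
    rewrite -ltr_pdivlMl ?invr_gt0 ?normr_gt0// invrK.
    rewrite (le_lt_trans (bnd h))// -[h ^+ 2]real_normK ?num_real//.
    rewrite expr2 mulrA [X in _ < X]mulrC ltr_pM2r ?normr_gt0//.
    have : `|h| < e / (C + 1).
      near: h; apply: dnbhs0_lt; by rewrite divr_gt0// ltr_wpDl.
    rewrite ltr_pdivlMr ?ltr_wpDl// => h1.
    by rewrite (le_lt_trans _ h1)// mulrDr mulr1 mulrC lerDl.
  apply: DeriveDef.
    rewrite /derivable; apply/cvg_ex; exists 0 => /=.
    by under eq_fun do rewrite /GRing.scale/= mulr1.
  rewrite /derive; apply/cvg_lim => //.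
  by under eq_fun do rewrite /GRing.scale/= mulr1.
Unshelve. all: by end_near. Qed.

Lemma pderiv_flat P (q : pt -> R) i x : differentiable q x ->
  differentiable (fun y => flat P (q y)) x /\
  pderiv i (fun y => flat P (q y)) x = flat (flat_diff P) (q x) * pderiv i q x.
Proof.
move=> dq; have [dP DP] := is_derive_flat P (q x).
have dfP : differentiable (flat P) (q x) by exact/derivable1_diffP.
have dc : differentiable (flat P \o q) x by exact: differentiable_comp.
split=> //; rewrite /pderiv (deriveE _ dc) (deriveE _ dq).
rewrite diff_comp//= diff1E// derive1E DP.
by rewrite [LHS]mulrC.
Qed.

Lemma smooth_flat P (q : pt -> R) : smooth q -> smooth (fun y => flat P (q y)).
Proof.
move=> /smoothP sq; apply/smoothP => n; elim: n P => [|n IHn] P.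
  split=> // x; have [] := @pderiv_flat P q ord0 x _ => //.
  exact: Cn_differentiable (sq 0%N) x.
apply/CnP; split=> [x|i].
  have [] := @pderiv_flat P q ord0 x _ => //.
  exact: Cn_differentiable (sq 0%N) x.
have -> : pderiv i (fun y => flat P (q y)) =
    (fun x => flat (flat_diff P) (q x) * pderiv i q x).
  apply/funext => x; have [] := @pderiv_flat P q i x _ => //.
  exact: Cn_differentiable (sq 0%N) x.
by apply: CnM; [exact: IHn|have /CnP[] := sq n.+1].
Qed.

Lemma flat1_ge0 t : 0 <= flat 1 t.
Proof. by rewrite /flat; case: ifPn => // _; rewrite hornerC mul1r expR_ge0. Qed.

Lemma flat1_le1 t : flat 1 t <= 1.
Proof.
rewrite /flat; case: ifPn => // t0; rewrite hornerC mul1r -expR0 ler_expR.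
by rewrite oppr_le0 invr_ge0 ltW.
Qed.

Lemma flat1_cvg t : flat 1 (m%:R * t) @[m --> \oo] --> (((0 < t)%R : nat)%:R : R).
Proof.
have [t0|t0] := ltP 0 t; last first.
  rewrite (_ : (fun _ => _) = cst 0); first exact: cvg_cst.
  by apply/funext => m; rewrite flat_le0// mulr_ge0_le0.
rewrite -(cvg_shiftS (fun m => flat 1 (m%:R * t))) /=.
have -> : (fun n => flat 1 (n.+1%:R * t)) = (fun n => expR (- (t^-1 * n.+1%:R^-1))).
  apply/funext => n; rewrite /flat ifT ?mulr_gt0// hornerC mul1r.
  by rewrite invfM mulrC.
rewrite (_ : true%:R = expR (- (t^-1 * 0)) :> R); last by rewrite mulr0 oppr0 expR0.
apply: (cvg_comp _ expR); last exact: continuous_expR.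
apply: cvgN; apply: cvgMr; exact: cvg_harmonic.
Qed.

(** For t > 0, exp(-1/(m t)) increases to 1 as m grows, while the profile is 0 for t <= 0: these
    functions converge pointwise to the indicator of the open box and vanish outside it. *)
Definition box_bump (a b : pt) (m : nat) (x : pt) : R :=
  \prod_i (flat 1 (m%:R * (x 0 i - a 0 i)) * flat 1 (m%:R * (b 0 i - x 0 i))).

Lemma smooth_affine1 (c e : R) i : smooth (fun x : pt => c * x 0 i + e).
Proof.
by apply: smoothD; [apply: smoothM; [exact: smooth_cst|exact: smooth_coord]|exact: smooth_cst].
Qed.

Lemma smooth_box_bump a b m : smooth (box_bump a b m).
Proof.
apply: smooth_prod => i; apply: smoothM; apply: smooth_flat.
  by under eq_fun do rewrite mulrBr; exact: smooth_affine1.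
under eq_fun do rewrite mulrBr addrC -mulNr.
exact: smooth_affine1.
Qed.

Lemma box_bump_bnd a b m x : 0 <= box_bump a b m x <= 1.
Proof.
apply/andP; split; first by apply: prodr_ge0 => i _; rewrite mulr_ge0 ?flat1_ge0.
rewrite /box_bump [leRHS](_ : _ = \prod_(i < d) 1); last by rewrite big1.
by apply: ler_prod => i _; rewrite mulr_ge0 ?flat1_ge0//= mulr_ile1 ?flat1_ge0 ?flat1_le1.
Qed.

Lemma box_bump_out a b m x : ~ open_box a b x -> box_bump a b m x = 0.
Proof.
move=> nx; have [i nxi] : exists i, ~ (a 0 i < x 0 i < b 0 i).
  by apply/existsNP.
rewrite /box_bump (bigD1 i)//=.
have [ax|xa] := ltP (a 0 i) (x 0 i); last first.
  by rewrite flat_le0 ?mul0r// mulr_ge0_le0// subr_le0.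
have [xb|bx] := ltP (x 0 i) (b 0 i); first by move: nxi; rewrite ax xb.
by rewrite [flat _ (_ * (b 0 i - _))]flat_le0 ?mulr0 ?mul0r// mulr_ge0_le0// subr_le0.
Qed.

Lemma box_bump_cvg a b x :
  box_bump a b m x @[m --> \oo] --> (\1_(open_box a b) x : R).
Proof.
have [xab|nx] := pselect (open_box a b x); last first.
  rewrite indicE memNset//.
  rewrite (_ : (fun _ => _) = cst 0); first exact: cvg_cst.
  by apply/funext => m; exact: box_bump_out.
rewrite indicE mem_set//= mulr1n (_ : 1 = \prod_(i < d) (1 * 1) :> R); last first.
  by rewrite mulr1 big1.
rewrite /box_bump; elim: (index_enum _) => [|i s IHs].
  by rewrite big_nil; under eq_fun do rewrite big_nil; exact: cvg_cst.
rewrite big_cons; under eq_fun do rewrite big_cons.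
apply: cvgM => //; have /andP[h1 h2] := xab i; apply: cvgM.
  by have := @flat1_cvg (x 0 i - a 0 i); rewrite subr_gt0 h1.
by have := @flat1_cvg (b 0 i - x 0 i); rewrite subr_gt0 h2.
Qed.

End smooth_functions.

(** * Supports, almost everywhere equality and dominated convergence for real integrals *)

Section integral_tools.
Context d {T : measurableType d} {R : realType}.
Variable mu : {measure set T -> \bar R}.
Implicit Types (D S E : set T) (f g : T -> R).

Lemma integrable_cst_lty D (c : R) : measurable D -> (mu D < +oo)%E ->
  mu.-integrable D (cst c%:E).
Proof.
move=> mD Doo; apply/integrableP; split; first exact: measurable_cst.
by rewrite integral_cst// lte_mul_pinfty// lee_fin.
Qed.

Lemma integrable_bounded D f M : measurable D -> (mu D < +oo)%E ->
  measurable_fun D f -> (forall x, D x -> `|f x| <= M) ->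
  mu.-integrable D (EFin \o f).
Proof.
move=> mD Doo mf fM; apply: (le_integrable mD (g := cst `|M|%:E)).
- exact/measurable_EFinP.
- by move=> x Dx; rewrite /= lee_fin normr_id (le_trans (fM x Dx))// ler_norm.
- exact: integrable_cst_lty.
Qed.

Lemma Rintegral_supp D S f : S `<=` D -> (forall x, ~ S x -> f x = 0) ->
  \int[mu]_(x in D) f x = \int[mu]_(x in S) f x.
Proof.
move=> SD f0; rewrite [LHS]Rintegral_mkcond [RHS]Rintegral_mkcond.
congr Rintegral; apply/funext => x; rewrite !patchE.
case: ifPn => [/set_mem Dx|nDx]; case: ifPn => [/set_mem Sx//|nSx].
- by rewrite f0// => Sx; move: nSx; rewrite mem_set.
- by move: nDx; rewrite mem_set//; exact: SD.
- by [].
Qed.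

Lemma integrable_supp D S f : measurable S -> measurable D -> S `<=` D ->
  (forall x, ~ S x -> f x = 0) ->
  mu.-integrable S (EFin \o f) -> mu.-integrable D (EFin \o f).
Proof.
move=> mS mD SD f0 /(integrable_mkcond _ mS) fS; apply/integrable_mkcond => //.
rewrite (_ : (EFin \o f) \_ D = (EFin \o f) \_ S)//.
apply/funext => x; rewrite !patchE.
case: ifPn => [/set_mem Dx|nDx]; case: ifPn => [/set_mem Sx//|nSx].
- by rewrite /= f0// => Sx; move: nSx; rewrite mem_set.
- by move: nDx; rewrite mem_set//; exact: SD.
- by [].
Qed.

Lemma ae_Rintegral D f g : measurable D ->
  measurable_fun D f -> measurable_fun D g ->
  {ae mu, forall x, D x -> f x = g x} ->
  \int[mu]_(x in D) f x = \int[mu]_(x in D) g x.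
Proof.
move=> mD mf mg fg; rewrite /Rintegral; congr fine.
apply: ae_eq_integral => //; try exact/measurable_EFinP.
by apply: filterS fg => x /= h Dx; rewrite h.
Qed.

Lemma Rintegral_dct D (f_ : nat -> T -> R) f M : measurable D -> (mu D < +oo)%E ->
  (forall n, measurable_fun D (f_ n)) -> measurable_fun D f ->
  (forall n x, D x -> `|f_ n x| <= M) ->
  {ae mu, forall x, D x -> f_ n x @[n --> \oo] --> f x} ->
  \int[mu]_(x in D) f_ n x @[n --> \oo] --> \int[mu]_(x in D) f x.
Proof.
move=> mD Doo mf_ mf fM ff.
have iM : mu.-integrable D (cst `|M|%:E) by exact: integrable_cst_lty.
have [||||h1 h2 h3] := @dominated_convergence _ _ _ mu D mD
  (fun n => EFin \o f_ n) (EFin \o f) (cst `|M|%:E) _ _ _ iM.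
- by move=> n; exact/measurable_EFinP.
- exact/measurable_EFinP.
- apply: filterS ff => x /= h Dx; apply: cvg_EFin; first by apply: nearW.
  exact: h.
- by apply: aeW => x n Dx; rewrite /= lee_fin (le_trans (fM n x Dx))// ler_norm.
- apply: fine_cvg; rewrite fineK//; exact: integrable_fin_num.
Qed.

End integral_tools.

(** * Test functions *)

Section test_functions.
Context {R : realType} {k : nat}.
Local Notation d := k.+1.
Local Notation pt := 'rV[R]_k.+1.
Local Notation mu := (@lebesgue_row R k.+1).
Implicit Types (S Om : set pt) (phi v : pt -> R).

Lemma compact_row_bounded S : compact S ->
  exists M, forall x, S x -> forall i, `|x 0 i| <= M.
Proof.
move=> /compact_bounded [M [Mr h]]; exists (`|M| + 1) => x Sx i.
apply: le_trans (h (`|M| + 1) _ x Sx); last by rewrite ltr_pwDr// ler_norm.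
by rewrite [leRHS]mx_normrE; apply: (le_bigmax _ (fun ij => `|x ij.1 ij.2|) (0, i)).
Qed.

Lemma compact_row_measurable S : compact S -> measurable S.
Proof.
by move=> cS; apply: measurable_row_closed; apply: compact_closed => //; exact: norm_hausdorff.
Qed.

Lemma compact_row_lty S : compact S -> (mu S < +oo)%E.
Proof.
move=> cS; have [M SM] := compact_row_bounded cS.
exact: lebesgue_row_lty (compact_row_measurable cS) SM.
Qed.

Lemma continuous_compact_bnd S phi : compact S -> continuous phi ->
  exists M, forall x, S x -> `|phi x| <= M.
Proof.
move=> cS cphi; have : compact (phi @` S).
  by apply: continuous_compact => //; exact: continuous_subspaceT.
move=> /compact_bounded [M [Mr h]]; exists (`|M| + 1) => x Sx.
by apply: h; [rewrite ltr_pwDr// ler_norm|exists x].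
Qed.

Lemma supp_bnd S phi : compact S -> continuous phi -> (forall x, ~ S x -> phi x = 0) ->
  exists2 M, 0 <= M & forall x, `|phi x| <= M.
Proof.
move=> cS cphi p0; have [M hM] := continuous_compact_bnd cS cphi.
exists `|M| => // x; have [Sx|/p0 ->] := pselect (S x); last by rewrite normr0.
by rewrite (le_trans (hM x Sx))// ler_norm.
Qed.

Lemma pderiv_supp S phi i : closed S -> (forall x, ~ S x -> phi x = 0) ->
  forall x, ~ S x -> pderiv i phi x = 0.
Proof.
move=> cS p0 x Sx; rewrite /pderiv (near_eq_derive _ (g := cst 0)) ?derive_cst//.
near=> y; apply: p0; near: y.
have oS : open (~` S) by exact: closed_openC.
exact: open_nbhs_nbhs (conj oS Sx).
Unshelve. all: by end_near. Qed.

Lemma test_functionM Om phi v : smooth v -> test_function Om phi ->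
  test_function Om (fun x => v x * phi x).
Proof.
move=> sv [sp [S [cS SO p0]]]; split; first exact: smoothM.
by exists S; split => // x /p0 ->; rewrite mulr0.
Qed.

Lemma test_functionB Om phi v : test_function Om v -> test_function Om phi ->
  test_function Om (fun x => v x - phi x).
Proof.
move=> [sv [S' [cS' SO' v0]]] [sp [S [cS SO p0]]]; split.
  under eq_fun do rewrite -mulN1r.
  by apply: smoothD => //; apply: smoothM => //; exact: smooth_cst.
exists (S' `|` S); split; first exact: compactU.
  by move=> x [/SO'|/SO].
by move=> x /not_orP[/v0 -> /p0 ->]; rewrite subr0.
Qed.

Lemma smooth_measurable phi : smooth phi -> measurable_fun [set: pt] phi.
Proof. by move=> sp; apply: measurable_row_continuous; exact: smooth_continuous. Qed.

Lemma loc_int_mul Om v phi : open Om -> locally_integrable_on Om v ->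
  continuous phi -> (exists S, [/\ compact S, S `<=` Om & forall x, ~ S x -> phi x = 0]) ->
  mu.-integrable Om (EFin \o (fun x => v x * phi x)).
Proof.
move=> oOm [mv iv] cphi [S [cS SO p0]].
have mS := compact_row_measurable cS.
apply: (@integrable_supp _ _ _ _ Om S) => //.
- exact: measurable_row_open.
- by move=> x /p0 ->; rewrite mulr0.
have [M M0 pM] := supp_bnd cS cphi p0.
apply: (le_integrable mS (g := EFin \o (fun x => M * v x))).
- apply/measurable_EFinP; apply: measurable_funM.
    exact: measurable_funS (measurable_row_open oOm) SO mv.
  exact: measurable_funTS (measurable_row_continuous cphi).
- move=> x Sx; rewrite /= lee_fin !normrM mulrC ler_wpM2r// (le_trans (pM x))//.
  exact: ler_norm.
- exact: integrableZl (iv _ cS SO).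
Qed.

Lemma loc_int_mul_test Om v phi : open Om -> locally_integrable_on Om v ->
  test_function Om phi -> mu.-integrable Om (EFin \o (fun x => v x * phi x)).
Proof.
move=> oOm iv [sp Sp]; apply: loc_int_mul => //; exact: smooth_continuous.
Qed.

Lemma loc_int_mul_pderiv Om v phi i : open Om -> locally_integrable_on Om v ->
  test_function Om phi -> mu.-integrable Om (EFin \o (fun x => v x * pderiv i phi x)).
Proof.
move=> oOm iv [sp [S [cS SO p0]]]; apply: loc_int_mul => //.
  by apply: smooth_continuous; exact: smooth_pderiv.
exists S; split=> //; apply: pderiv_supp => //.
by apply: compact_closed => //; exact: norm_hausdorff.
Qed.

Definition closed_box (a b : pt) : set pt := [set x | forall i, a 0 i <= x 0 i <= b 0 i].

Lemma compact_closed_box a b : compact (closed_box a b).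
Proof.
have := @rV_compact R d (fun i => [set` `[a 0 i, b 0 i]%R]) (fun i => @segment_compact R _ _).
congr compact; apply/seteqP; split=> x /= h i; have := h i; by rewrite in_itv.
Qed.

Lemma open_closed_box a b : open_box a b `<=` closed_box a b.
Proof. by move=> x xab i; have /andP[/ltW -> /ltW ->] := xab i. Qed.

Lemma box_bump_test Om a b m : closed_box a b `<=` Om -> test_function Om (box_bump a b m).
Proof.
move=> abO; split; first exact: smooth_box_bump.
exists (closed_box a b); split => //; first exact: compact_closed_box.
by move=> x xab; apply: box_bump_out => /open_closed_box.
Qed.

(* du Bois-Reymond: the integrals over boxes vanish, hence, by Dynkin's
   lemma, those over all measurable subsets of a box. *)
Lemma weak_zero Om (G : pt -> R) : open Om -> locally_integrable_on Om G ->
  (forall phi, test_function Om phi -> integ Om (fun x => G x * phi x) = 0) ->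
  {ae mu, forall x, Om x -> G x = 0}.
Proof.
move=> oOm [mG iG] G0.
have mOm := measurable_row_open oOm.
have key (a b : pt) : closed_box a b `<=` Om -> {ae mu, forall x, open_box a b x -> G x = 0}.
  move=> KO; set K := closed_box a b; set Q := open_box a b.
  have cK : compact K by exact: compact_closed_box.
  have mK := compact_row_measurable cK.
  have mQ : measurable Q by exact: measurable_open_box.
  have iK := iG K cK KO.
  have QK : Q `<=` K by exact: open_closed_box.
  have iQ E : measurable E -> E `<=` Q -> mu.-integrable E (EFin \o G).
    by move=> mE EQ; apply: integrableS iK => //; exact: subset_trans QK.
  have box c e : (\int[mu]_(x in open_box c e `&` Q) (G x)%:E = 0)%E.
    pose c' : pt := \row_i Num.max (c 0 i) (a 0 i).
    pose e' : pt := \row_i Num.min (e 0 i) (b 0 i).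
    have -> : open_box c e `&` Q = open_box c' e'.
      apply/seteqP; split => x /=.
        by move=> [xab xce] i; rewrite !mxE gt_max lt_min; case/andP: (xab i) (xce i) => -> -> /andP[-> ->].
      by move=> h; split => i; have := h i; rewrite !mxE gt_max lt_min => /andP[/andP[? ?] /andP[? ?]]; apply/andP.
    have cK' : closed_box c' e' `<=` K.
      by move=> x h i; have := h i; rewrite !mxE ge_max le_min => /andP[/andP[_ ->] /andP[_ ->]].
    have mQ' : measurable (open_box c' e') by exact: measurable_open_box.
    have : \int[mu]_(x in K) (G x * box_bump c' e' m x) @[m --> \oo] -->
           \int[mu]_(x in K) (G x * \1_(open_box c' e') x).
      have mGK : measurable_fun K G by exact: measurable_funS mG.
      have [|||||h1 h2 h3] := @dominated_convergence _ _ _ mu K mK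
        (fun m => EFin \o (fun x => G x * box_bump c' e' m x))
        (EFin \o (fun x => G x * \1_(open_box c' e') x)) (abse \o (EFin \o G)).
      - move=> m; apply/measurable_EFinP; apply: measurable_funM => //.
        by apply: measurable_funTS; apply: smooth_measurable; exact: smooth_box_bump.
      - by apply/measurable_EFinP; apply: measurable_funM.
      - apply: aeW => x Kx; apply: cvg_EFin; first by apply: nearW.
        by apply: cvgMr; exact: box_bump_cvg.
      - exact: integrable_abse.
      - apply: aeW => x m Kx; rewrite /= lee_fin normrM ler_piMr//.
        by have /andP[h1 h2] := box_bump_bnd c' e' m x; rewrite ger0_norm.
      - apply: fine_cvg; rewrite fineK//; exact: integrable_fin_num.
    have -> : (fun m => \int[mu]_(x in K) (G x * box_bump c' e' m x)) = cst 0.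
      apply/funext => m; rewrite -(@Rintegral_supp _ _ _ mu Om)//.
        by apply: G0; apply: box_bump_test; exact: subset_trans KO.
      move=> x Kx; rewrite box_bump_out ?mulr0// => /open_closed_box/cK'//.
    move=> /(cvg_lim (@Rhausdorff R)); rewrite lim_cst// => I0.
    have : (\int[mu]_(x in open_box c' e') (G x)%:E)%E =
       (\int[mu]_(x in K) (G x * \1_(open_box c' e') x))%:E.
      rewrite fineK; last first.
        apply: integrable_fin_num => //.
        apply: (le_integrable mK (g := EFin \o G)) => //.
          apply/measurable_EFinP; apply: measurable_funM => //.
          exact: measurable_funS mG.
        move=> x Kx; rewrite /= lee_fin normrM ler_piMr//.
        by rewrite indicE; case: (_ \in _); rewrite ?normr1 ?normr0.
      rewrite [RHS]integral_mkcond [LHS]integral_mkcond; apply: eq_integral => x _.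
      rewrite !patchE indicE; case: ifPn => xQ; case: ifPn => xK //=.
      - by rewrite mulr1.
      - by move: xK; rewrite mem_set//; apply: cK'; apply: open_closed_box; exact: set_mem.
      - by rewrite mulr0.
    by rewrite -I0.
  have all E : measurable E -> (\int[mu]_(x in E `&` Q) (G x)%:E = 0)%E.
    rewrite row_measurableE => mE.
    pose PP : set_system pt := fun E => (\int[mu]_(x in E `&` Q) (G x)%:E = 0)%E.
    apply: (@dynkin_induction _ _ _ PP (@row_measurableE R d) (@open_boxesI R d)) => //.
    - by rewrite /PP setTI -[Q]setIid; exact: box.
    - by move=> _ [c [e ->]]; exact: box.
    - move=> S mS; rewrite /PP => PS.
      have : (\int[mu]_(x in (S `&` Q) `|` (~` S `&` Q)) (G x)%:E = 0)%E.
        by rewrite -setIUl setUv setTI -[Q]setIid; exact: box.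
      have mSQ : measurable (S `&` Q) by exact: measurableI.
      have mCSQ : measurable (~` S `&` Q) by apply: measurableI => //; exact: measurableC.
      rewrite integral_setU_EFin//; first by rewrite PS add0e.
        have -> : (S `&` Q) `|` (~` S `&` Q) = Q by rewrite -setIUl setUv setTI.
        by apply: (measurable_funS mOm _ mG) => x /QK /KO.
      by rewrite disj_set2E -setIIl setICr set0I.
    - move=> F mF tF PF; rewrite /PP setI_bigcupl integral_bigcup//.
      + by rewrite (eq_eseriesr (g := fun=> 0%E)) ?eseries0// => i _; exact: PF.
      + exact: trivIset_setIr.
      + by move=> n; exact: measurableI.
      + apply: iQ; last by move=> x [n _ []].
        by apply: bigcup_measurable => n _; exact: measurableI.
  have := @integral_ae_eq _ _ _ mu Q mQ (cst 0%E) (EFin \o G) (iQ Q mQ (@subset_refl _ Q)) (measurable_cst _).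
  move=> /(_ _)/wrap[E EQ mE|].
    rewrite integral0 -(all E mE); congr integral; apply/seteqP.
    by split => [x Ex|x []//]; split=> //; exact: EQ.
  by apply: filterS => x h Qx; have [] := h Qx.
(* Countably many rational boxes cover Om, so the union of their exceptional sets is still null. *)
pose Bq (q : 'rV[rat]_d * 'rV[rat]_d) (x : pt) :=
  closed_box (map_mx ratr q.1) (map_mx ratr q.2) `<=` Om ->
  open_box (map_mx ratr q.1) (map_mx ratr q.2) x -> G x = 0.
have : {ae mu, forall x n, if unpickle n is Some q then Bq q x else True}.
  apply: ae_foralln => n; case: (unpickle n) => [q|]; last by apply: aeW.
  have [KO|nKO] := pselect (closed_box (map_mx ratr q.1 : pt) (map_mx ratr q.2) `<=` Om).
    by apply: filterS (key _ _ KO) => x h _.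
  by apply: aeW => x /nKO.
apply: filterS => x h Omx.
have [q [qx qO]] := rat_open_box oOm Omx.
have := h (pickle q); rewrite pickleK; apply=> //.
by move=> y hy; apply: qO => i; have := hy i; rewrite !mxE.
Qed.

End test_functions.

(** * Weak gradients *)

Section weak_gradients.
Context {R : realType} {k : nat}.
Local Notation d := k.+1.
Local Notation pt := 'rV[R]_k.+1.
Local Notation mu := (@lebesgue_row R k.+1).
Local Notation e_ i := (delta_mx 0 i : 'rV[R]_k.+1).
Implicit Types (S Om : set pt) (phi v : pt -> R).

Lemma is_derive_line (f : pt -> R) (x w : pt) (s : R) : derivable f (x + s *: w) w ->
  is_derive s 1 (fun s => f (x + s *: w)) ('D_w f (x + s *: w)).
Proof.
move=> df; have E : (fun h : R => h^-1 *: (((fun s => f (x + s *: w)) \o shift s) (h *: 1) -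
    f (x + s *: w))) = (fun h : R => h^-1 *: ((f \o shift (x + s *: w)) (h *: w) - f (x + s *: w))).
  apply/funext => h; rewrite /= /shift; congr (_ *: (f _ - _)).
  by rewrite [h *: 1]mulr1 scalerDl addrCA.
by apply: DeriveDef; rewrite /derivable /derive E.
Qed.

Lemma MVT_line (f : pt -> R) (x w : pt) :
  (forall s : R, 0 <= s <= 1 -> derivable f (x + s *: w) w) ->
  exists2 s : R, 0 <= s <= 1 & f (x + w) - f x = 'D_w f (x + s *: w).
Proof.
move=> df; pose g (s : R) := f (x + s *: w).
have dg (s : R) : 0 <= s <= 1 -> is_derive s 1 g ('D_w f (x + s *: w)).
  by move=> s01; apply: is_derive_line; exact: df.
have [||c c01] := @MVT_segment R g (fun s => 'D_w f (x + s *: w)) 0 1 ler01.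
- by move=> s; rewrite in_itv/= => /andP[/ltW h1 /ltW h2]; apply: dg; rewrite h1.
- apply: derivable_within_continuous => s; rewrite in_itv/= => s01.
  by have [] := dg s s01.
- rewrite /g scale1r scale0r addr0 subr0 mulr1 => ->.
  by exists c => //; move: c01; rewrite in_itv.
Qed.

Lemma deriveZv (f : pt -> R) (x w : pt) (t : R) : differentiable f x ->
  'D_(t *: w) f x = t * 'D_w f x.
Proof. by move=> df; rewrite !deriveE// linearZ. Qed.

Lemma pderiv_lip (f : pt -> R) M i : (forall x, differentiable f x) ->
  (forall x, `|pderiv i f x| <= M) ->
  forall x (t : R), `|f (x + t *: e_ i) - f x| <= M * `|t|.
Proof.
move=> df fM x t; have [s _ ->] := @MVT_line f x (t *: e_ i) (fun s _ => diff_derivable (df _)).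
by rewrite deriveZv// normrM mulrC ler_wpM2r//; exact: fM.
Qed.

(** The sequential form of the derivative, because dominated convergence is applied along the steps
    t0 / (n + 1). *)
Lemma seq_derive (f : pt -> R) (x w : pt) (t : nat -> R) : derivable f x w ->
  t n @[n --> \oo] --> (0 : R) -> (forall n, t n != 0) ->
  (f (x + t n *: w) - f x) / t n @[n --> \oo] --> 'D_w f x.
Proof.
move=> df t0 tn0.
have td : t n @[n --> \oo] --> (0 : R)^'.
  move=> A /= dA; have h : \forall n \near \oo, (t n != 0 -> A (t n)) := t0 _ dA.
  suff : \forall n \near \oo, A (t n) by [].
  by apply: filterS h => n; apply; exact: tn0.
have := cvg_comp _ _ td df.
rewrite (_ : (_ \o _) = (fun n => (f (x + t n *: w) - f x) / t n))//.
by apply/funext => n /=; rewrite [LHS]mulrC /shift [x + _]addrC.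
Qed.

(** The continuous map (x, t) -> x + t w sends a neighbourhood of each point (x, 0) with x in S into
    Om; compactness of S makes the range of t uniform. *)
Lemma compact_shift_sub S Om (w : pt) : compact S -> open Om -> S `<=` Om ->
  exists2 t0 : R, 0 < t0 & forall x (t : R), S x -> `|t| <= t0 -> Om (x + t *: w).
Proof.
move=> /compact_near_coveringP cS oOm SO.
have [|e e0 he] := cS R (nbhs (0 : R)) (fun t x => Om (x + t *: w)) _ _.
  move=> x Sx.
  have cf : {for (x, 0 : R), continuous (fun z : pt * R => z.1 + z.2 *: w)}.
    apply: cvgD; first exact: cvg_fst.
    by apply: cvgZr_tmp; exact: cvg_snd.
  have Ox : nbhs (x + (0 : R) *: w) Om.
    by rewrite scale0r addr0; apply: open_nbhs_nbhs; split => //; exact: SO.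
  exact: cf Ox.
exists (e / 2); first by rewrite divr_gt0.
move=> x t Sx te; apply: he => //=; rewrite sub0r normrN.
by rewrite (le_lt_trans te)// ltr_pdivrMr// ltr_pMr// ltr1n.
Qed.

Lemma integrable_bs D (f : pt -> R) M : measurable D -> (mu D < +oo)%E ->
  measurable_fun [set: pt] f -> (forall x, `|f x| <= M) ->
  (forall x, ~ D x -> f x = 0) -> mu.-integrable [set: pt] (EFin \o f).
Proof.
move=> mD Doo mf fM f0; apply: (@integrable_supp _ _ _ _ setT D) => //.
by apply: (integrable_bounded (M := M)) => //; exact: measurable_funTS.
Qed.

(* The difference quotients of v and of the test function are exchanged by
   translation invariance. *)
Lemma lip_weak Om v (G : pt -> R) i L M : open Om ->
  measurable_fun Om v -> measurable_fun Om G ->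
  (forall x, Om x -> `|v x| <= M) ->
  (forall x (t : R), (forall s : R, 0 <= s <= 1 -> Om (x + (s * t) *: e_ i)) ->
     `|v (x + t *: e_ i) - v x| <= L * `|t|) ->
  {ae mu, forall x, Om x -> is_derive x (e_ i) v (G x)} ->
  forall phi, test_function Om phi ->
  integ Om (fun x => v x * pderiv i phi x) = - integ Om (fun x => G x * phi x).
Proof.
move=> oOm mv mG vM vL dv phi tphi.
have [sp [S [cS SO p0]]] := tphi.
have mOm := measurable_row_open oOm.
have mS := compact_row_measurable cS.
have clS : closed S by apply: compact_closed => //; exact: norm_hausdorff.
have cphi := smooth_continuous sp.
have mphi := smooth_measurable sp.
have spd := smooth_pderiv i sp.
have dphi0 := pderiv_supp i clS p0.
have [Mp Mp0 pM] := supp_bnd cS cphi p0.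
have [Md Md0 pdM] := supp_bnd cS (smooth_continuous spd) dphi0.
have philip := pderiv_lip (fun x => smooth_differentiable x sp) pdM.
have [t0 t00 tO] := compact_shift_sub (e_ i) cS oOm SO.
pose t n : R := t0 / n.+1%:R.
have tn n : 0 < t n by rewrite divr_gt0.
have tt0 n : t n <= t0 by rewrite ler_pdivrMr// ler_peMr// ?ler1n// ltW.
have tcvg : t n @[n --> \oo] --> (0 : R).
  by rewrite -(mulr0 t0); apply: cvgMr; exact: cvg_harmonic.
pose vO x : R := if x \in Om then v x else 0.
have mvO : measurable_fun [set: pt] vO.
  apply: (eq_measurable_fun _ _ ((measurable_restrictT v mOm).1 mv)) => x _.
  by rewrite /vO patchE.
have vOM x : `|vO x| <= `|M|.
  rewrite /vO; case: ifPn => [/set_mem Ox|_]; last by rewrite normr0.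
  by rewrite (le_trans (vM x Ox))// ler_norm.
have vOE x : Om x -> vO x = v x by move=> Ox; rewrite /vO mem_set.
have [B SB] := compact_row_bounded cS.
pose D : set pt := open_box (const_mx (- (`|B| + t0 + 1))) (const_mx (`|B| + t0 + 1)).
have mD : measurable D by exact: measurable_open_box.
have DE (x : pt) : (forall i, `|x 0 i| < `|B| + t0 + 1) -> D x.
  by move=> h j; rewrite !mxE -ltr_norml.
have Doo : (mu D < +oo)%E.
  apply: (@lebesgue_row_lty _ _ _ (`|B| + t0 + 1)) => // x Dx j.
  by have := Dx j; rewrite !mxE -ltr_norml => /ltW.
have SD : S `<=` D.
  move=> x Sx; apply: DE => j; rewrite (le_lt_trans (SB x Sx j))//.
  by rewrite (le_lt_trans (ler_norm _))// -addrA ltr_pwDr// addr_gt0.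
have StD n x : S (x + t n *: e_ i) -> D x.
  move=> Sx; apply: DE => j; have := SB _ Sx j; rewrite !mxE => h.
  rewrite -(addrK (t n * ((0 == 0 :> 'I_1) && (j == i))%:R) (x 0 j)).
  rewrite (le_lt_trans (ler_normB _ _))// -addrA ler_ltD//.
    by rewrite (le_trans h)// ler_norm.
  rewrite (@le_lt_trans _ _ t0)// ?ltrDl//.
  rewrite normrM (ger0_norm (ltW (tn n))) (le_trans _ (tt0 n))// ler_piMr//; first exact: ltW.
  by case: (_ && _); rewrite ?normr1 ?normr0.
have msh (f : pt -> R) c : measurable_fun [set: pt] f ->
    measurable_fun [set: pt] (fun x => f (x + c)).
  by move=> mf; apply: (measurableT_comp mf); exact: measurable_shift_row.
(* The integrals of [a n] tend to that of v d_i phi and those of [b n] to that of G phi. A change of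
   variables in the shifted term turns the first into minus the second for every n. *)
pose a n (x : pt) := vO x * ((phi (x + t n *: e_ i) - phi x) / t n).
pose b n (x : pt) := ((vO x - vO (x - t n *: e_ i)) / t n) * phi x.
have aD n x : ~ D x -> a n x = 0.
  move=> Dx; rewrite /a !p0 ?subr0 ?mul0r ?mulr0//; first by move/SD.
  by move/StD.
have ab n : \int[mu]_x a n x = - \int[mu]_x b n x.
  pose F1 (x : pt) := vO x * phi (x + t n *: e_ i).
  pose F2 (x : pt) := vO (x - t n *: e_ i) * phi x.
  pose F3 (x : pt) := vO x * phi x.
  have iF2 : mu.-integrable [set: pt] (EFin \o F2).
    apply: (@integrable_bs D _ (`|M| * Mp)) => //.
    - by apply: measurable_funM => //; exact: msh.
    - by move=> x; rewrite normrM ler_pM.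
    - by move=> x Dx; rewrite /F2 p0 ?mulr0// => /SD.
  have iF3 : mu.-integrable [set: pt] (EFin \o F3).
    apply: (@integrable_bs D _ (`|M| * Mp)) => //.
    - exact: measurable_funM.
    - by move=> x; rewrite normrM ler_pM.
    - by move=> x Dx; rewrite /F3 p0 ?mulr0// => /SD.
  have mF2 : measurable_fun [set: pt] (EFin \o F2) by have /integrableP[] := iF2.
  have [] := lebesgue_shift_integral (t n *: e_ i) mF2 iF2.
  rewrite (_ : (EFin \o F2) \o _ = EFin \o F1); last first.
    by apply/funext => x; rewrite /F2 /F1 /shift_row /= addrK.
  move=> iF1 EF.
  have EF' : \int[mu]_x F1 x = \int[mu]_x F2 x.
    rewrite /Rintegral -EF; congr fine; apply: eq_integral => x _.
    by rewrite /F2 /F1 /shift_row /= addrK.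
  have iB1 : mu.-integrable [set: pt] (EFin \o (fun x => F1 x - F3 x)).
    exact: (integrableB measurableT iF1 iF3).
  have iB2 : mu.-integrable [set: pt] (EFin \o (fun x => F3 x - F2 x)).
    exact: (integrableB measurableT iF3 iF2).
  transitivity ((t n)^-1 * (\int[mu]_x F1 x - \int[mu]_x F3 x)).
    rewrite -RintegralB// -RintegralZl//.
    by apply: eq_Rintegral => x _; rewrite /a /F1 /F3; ring.
  rewrite EF' -opprB mulrN -RintegralB// -RintegralZl//.
  by congr (- _); apply: eq_Rintegral => x _; rewrite /b /F2 /F3; ring.
have lima : \int[mu]_x a n x @[n --> \oo] --> integ Om (fun x => v x * pderiv i phi x).
  have -> : integ Om (fun x => v x * pderiv i phi x) =
      \int[mu]_(x in D) (vO x * pderiv i phi x).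
    rewrite /integ (Rintegral_supp _ SO); last by move=> x /dphi0 ->; rewrite mulr0.
    rewrite (Rintegral_supp _ SD); last by move=> x /dphi0 ->; rewrite mulr0.
    by apply: eq_Rintegral => x /set_mem Sx; rewrite vOE//; exact: SO.
  under eq_fun do rewrite (Rintegral_supp _ (@subsetT _ D) (aD _)).
  apply: (@Rintegral_dct _ _ _ _ _ _ _ (`|M| * Md)) => //.
  - move=> n; apply: measurable_funTS; apply: measurable_funM => //.
    apply: measurable_funM => //; apply: measurable_funB => //; exact: msh.
  - apply: measurable_funTS; apply: measurable_funM => //; exact: smooth_measurable.
  - move=> n x _; rewrite normrM ler_pM// normrM normfV (gtr0_norm (tn n)).
    by rewrite ler_pdivrMr// (le_trans (philip _ _))// gtr0_norm.
  - apply: aeW => x _; apply: cvgMr; apply: seq_derive => //.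
      by apply: diff_derivable; exact: smooth_differentiable.
    by move=> n; rewrite gt_eqF.
have bS n x : ~ S x -> b n x = 0 by move=> Sx; rewrite /b p0 ?mulr0.
have limb : \int[mu]_x b n x @[n --> \oo] --> integ Om (fun x => G x * phi x).
  rewrite /integ (Rintegral_supp _ SO); last by move=> x /p0 ->; rewrite mulr0.
  under eq_fun do rewrite (Rintegral_supp _ (@subsetT _ S) (bS _)).
  apply: (@Rintegral_dct _ _ _ _ _ _ _ (`|L| * Mp)) => //.
  - exact: compact_row_lty.
  - move=> n; apply: measurable_funTS; apply: measurable_funM => //.
    apply: measurable_funM => //; apply: measurable_funB => //; exact: msh.
  - apply: measurable_funM; first exact: measurable_funS mG.
    exact: measurable_funTS.
  - move=> n x Sx; rewrite normrM ler_pM// normrM normfV (gtr0_norm (tn n)).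
    have Ox : Om (x - t n *: e_ i).
      by rewrite -scaleNr; apply: tO => //; rewrite normrN gtr0_norm.
    rewrite ler_pdivrMr// !vOE//; last exact: SO.
    rewrite distrC -scaleNr (le_trans (vL _ _ _))//; last first.
      by rewrite normrN gtr0_norm// ler_wpM2r ?ler_norm// ltW.
    move=> s /andP[s0 s1].
    have tn0 := ltW (tn n).
    have stn0 : 0 <= s * t n := mulr_ge0 s0 tn0.
    apply: tO => //; rewrite mulrN normrN (ger0_norm stn0).
    by apply: le_trans (tt0 n); rewrite ler_piMl.
  - apply: filterS dv => x dv Sx; have Ox := SO _ Sx; have [dvx vx] := dv Ox.
    apply: cvgMl; rewrite -vx.
    have Ntn0 n : - t n != 0 by rewrite oppr_eq0 gt_eqF.
    have Ntcvg : - t n @[n --> \oo] --> (0 : R) by rewrite -oppr0; exact: cvgN.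
    have -> : (fun n => (vO x - vO (x - t n *: e_ i)) / t n) =
        (fun n => (v (x + - t n *: e_ i) - v x) / - t n).
      apply/funext => n; have Ox' : Om (x - t n *: e_ i).
        by rewrite -scaleNr; apply: tO => //; rewrite normrN gtr0_norm.
      by rewrite !vOE// scaleNr invrN mulrN -mulNr opprB.
    exact: seq_derive.
apply: (cvg_unique (@Rhausdorff R) lima).
have Eab : (fun n => \int[mu]_x a n x) = (fun n => - \int[mu]_x b n x).
  by apply/funext => n; exact: ab.
by rewrite /= Eab; exact: cvgN.
Qed.

Definition grad v : pt -> pt := fun x => \row_i pderiv i v x.

Lemma continuous_loc_int Om v : open Om -> continuous v -> locally_integrable_on Om v.
Proof.
move=> oOm cv; have mv := measurable_row_continuous cv.
split; first exact: measurable_funTS.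
move=> S cS SO; have [M vM] := continuous_compact_bnd cS cv.
apply: (integrable_bounded (M := M)) => //; first exact: compact_row_measurable.
  exact: compact_row_lty.
exact: measurable_funTS.
Qed.

Lemma test_is_weak_gradient Om v : open Om -> test_function Om v ->
  is_weak_gradient Om v (grad v).
Proof.
move=> oOm [sv [S [cS SO v0]]].
have cp i : continuous (pderiv i v) by apply: smooth_continuous; exact: smooth_pderiv.
split.
- by apply: continuous_loc_int => //; exact: smooth_continuous.
- by move=> i; under eq_fun do rewrite mxE; exact: continuous_loc_int.
- move=> phi tphi i.
  have [M M0 vM] := supp_bnd cS (smooth_continuous sv) v0.
  have clS : closed S by apply: compact_closed => //; exact: norm_hausdorff.
  have [L L0 vL] := supp_bnd cS (cp i) (pderiv_supp i clS v0).
  under [in RHS]eq_fun do rewrite mxE.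
  apply: (@lip_weak Om v (pderiv i v) i L M) => //.
  + by apply: measurable_funTS; exact: smooth_measurable.
  + by apply: measurable_funTS; exact: measurable_row_continuous.
  + by move=> x t _; apply: pderiv_lip => // y; exact: smooth_differentiable.
  + apply: aeW => x _; apply: DeriveDef => //.
    by apply: diff_derivable; exact: smooth_differentiable.
Qed.

Lemma loc_intD Om v w : open Om -> locally_integrable_on Om v ->
  locally_integrable_on Om w -> locally_integrable_on Om (fun x => v x + w x).
Proof.
move=> oOm [mv iv] [mw iw]; split; first exact: measurable_funD.
move=> S cS SO; apply: (integrableD _ (iv _ cS SO) (iw _ cS SO)).
exact: compact_row_measurable.
Qed.

Lemma loc_intZ Om v (c : R) : open Om -> locally_integrable_on Om v ->
  locally_integrable_on Om (fun x => c * v x).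
Proof.
move=> oOm [mv iv]; split; first exact: measurable_funM.
move=> S cS SO; have mS := compact_row_measurable cS.
exact: integrableZl (iv _ cS SO).
Qed.

Lemma is_weak_gradientD Om v w G H : open Om -> is_weak_gradient Om v G ->
  is_weak_gradient Om w H ->
  is_weak_gradient Om (fun x => v x + w x) (fun x => G x + H x).
Proof.
move=> oOm [iv iG vG] [iw iH wH]; split.
- exact: loc_intD.
- by move=> i; under eq_fun do rewrite mxE; exact: loc_intD.
- move=> phi tphi i; have mOm := measurable_row_open oOm.
  transitivity (integ Om (fun x => v x * pderiv i phi x) + integ Om (fun x => w x * pderiv i phi x)).
    rewrite /integ -RintegralD//; try exact: loc_int_mul_pderiv.
    by apply: eq_Rintegral => x _; rewrite mulrDl.
  rewrite vG// wH// -opprD; congr (- _); rewrite /integ -RintegralD//; try exact: loc_int_mul_test.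
  by apply: eq_Rintegral => x _; rewrite mxE mulrDl.
Qed.

Lemma is_weak_gradientZ Om v G (c : R) : open Om -> is_weak_gradient Om v G ->
  is_weak_gradient Om (fun x => c * v x) (fun x => c *: G x).
Proof.
move=> oOm [iv iG vG]; split.
- exact: loc_intZ.
- by move=> i; under eq_fun do rewrite mxE; exact: loc_intZ.
- move=> phi tphi i; have mOm := measurable_row_open oOm.
  transitivity (c * integ Om (fun x => v x * pderiv i phi x)).
    rewrite /integ -RintegralZl//; last exact: loc_int_mul_pderiv.
    by apply: eq_Rintegral => x _; rewrite mulrA.
  rewrite vG// mulrN; congr (- _); rewrite /integ -RintegralZl//; last exact: loc_int_mul_test.
  by apply: eq_Rintegral => x _; rewrite mxE mulrA.
Qed.

Lemma is_weak_gradientB Om v w G H : open Om -> is_weak_gradient Om v G ->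
  is_weak_gradient Om w H ->
  is_weak_gradient Om (fun x => v x - w x) (fun x => G x - H x).
Proof.
move=> oOm vG wH; have := is_weak_gradientD oOm vG (is_weak_gradientZ (-1) oOm wH).
congr (is_weak_gradient Om _ _); apply/funext => x; first by rewrite mulN1r.
by rewrite scaleN1r.
Qed.

(** The zero function v - v has G - H as weak gradient, so each coordinate of G - H is orthogonal to
    all test functions. *)
Lemma weak_gradient_unique Om v G H : open Om -> is_weak_gradient Om v G ->
  is_weak_gradient Om v H -> {ae mu, forall x, Om x -> G x = H x}.
Proof.
move=> oOm vG vH; have [_ iGH GH] := is_weak_gradientB oOm vG vH.
have ae0 i : {ae mu, forall x, Om x -> (G x - H x) 0 i = 0}.
  apply: weak_zero => // phi tphi.
  apply: oppr_inj; rewrite -GH// oppr0 /integ.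
  rewrite (@eq_Rintegral _ _ _ mu Om (fun=> 0)); last by move=> x _; rewrite subrr mul0r.
  by rewrite Rintegral_cst ?mul0r//; exact: measurable_row_open.
have : {ae mu, forall x i, Om x -> (G x - H x) 0 i = 0}.
  have := @ae_foralln _ _ _ mu (fun n x => forall i : 'I_d, i = n :> nat -> Om x -> (G x - H x) 0 i = 0).
  move=> /(_ _)/wrap[n|].
    have [nd|nd] := ltnP n d; last first.
      by apply: aeW => x i iE; move: nd; rewrite -iE leqNgt ltn_ord.
    apply: filterS (ae0 (Ordinal nd)) => x h i iE.
    by rewrite (_ : i = Ordinal nd)//; apply: val_inj.
  by apply: filterS => x h i; exact: h.
apply: filterS => x h Ox; apply/rowP => i; apply/eqP; rewrite -subr_eq0; apply/eqP.
by have := h i Ox; rewrite !mxE.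
Qed.

Lemma wgradP Om v G : is_weak_gradient Om v G -> is_weak_gradient Om v (wgrad Om v).
Proof. by move=> vG; rewrite /wgrad; case: xgetP => // /(_ G). Qed.

Lemma wgradE Om v G : open Om -> is_weak_gradient Om v G ->
  {ae mu, forall x, Om x -> wgrad Om v x = G x}.
Proof. by move=> oOm vG; apply: weak_gradient_unique oOm (wgradP vG) vG. Qed.

(** The product w phi is again a test function; testing the weak gradient of v with it and expanding
    its derivative gives the product rule. *)
Lemma is_weak_gradient_mul Om v G w : open Om -> is_weak_gradient Om v G ->
  smooth w -> is_weak_gradient Om (fun x => w x * v x) (fun x => w x *: G x + v x *: grad w x).
Proof.
move=> oOm [[mv iv] iG vG] sw; have mOm := measurable_row_open oOm.
have locM (u f : pt -> R) : locally_integrable_on Om u -> continuous f ->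
    locally_integrable_on Om (fun x => f x * u x).
  move=> [mu' iu] cf; split.
    by apply: measurable_funM => //; apply: measurable_funTS; exact: measurable_row_continuous.
  move=> S cS SO; have mS := compact_row_measurable cS.
  have [M fM] := continuous_compact_bnd cS cf.
  apply: (le_integrable mS (g := EFin \o (fun x => M * u x))).
  - apply/measurable_EFinP; apply: measurable_funM; last exact: measurable_funS mu'.
    by apply: measurable_funTS; exact: measurable_row_continuous.
  - move=> x Sx; rewrite /= lee_fin !normrM ler_wpM2r// (le_trans (fM x Sx))//.
    exact: ler_norm.
  - exact: integrableZl (iu _ cS SO).
have cp i : continuous (pderiv i w) by apply: smooth_continuous; exact: smooth_pderiv.
have cw := smooth_continuous sw.
split.
- exact: locM.
- move=> i; have -> : (fun x => (w x *: G x + v x *: grad w x) 0 i) =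
      (fun x => w x * G x 0 i + pderiv i w x * v x).
    by apply/funext => x; rewrite !mxE [v x * _]mulrC.
  by apply: loc_intD => //; apply: locM.
- move=> phi tphi i; have twp := test_functionM sw tphi.
  have twp' := test_functionM (smooth_pderiv i sw) tphi.
  have := vG _ twp i.
  have [sp _] := tphi.
  have -> : pderiv i (fun x => w x * phi x) =
     (fun x => w x * pderiv i phi x + phi x * pderiv i w x).
    by apply/funext => x; apply: pderivM; exact: smooth_differentiable.
  have i1 : mu.-integrable Om (EFin \o (fun x => w x * v x * pderiv i phi x)).
    exact: loc_int_mul_pderiv oOm (locM _ _ (conj mv iv) cw) tphi.
  have i2 : mu.-integrable Om (EFin \o (fun x => v x * (pderiv i w x * phi x))).
    exact: loc_int_mul_test.
  have i3 : mu.-integrable Om (EFin \o (fun x => G x 0 i * (w x * phi x))).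
    exact: loc_int_mul_test.
  have -> : integ Om (fun x => v x * (w x * pderiv i phi x + phi x * pderiv i w x)) =
     integ Om (fun x => w x * v x * pderiv i phi x) + integ Om (fun x => v x * (pderiv i w x * phi x)).
    by rewrite /integ -RintegralD//; apply: eq_Rintegral => x _; ring.
  move=> /(canRL (addrK _)) ->; rewrite -opprD; congr (- _).
  rewrite /integ -RintegralD//; apply: eq_Rintegral => x _; rewrite !mxE; ring.
Qed.

End weak_gradients.

(** * Lebesgue spaces *)

Section integrable_real.
Context d {T : measurableType d} {R : realType}.
Variables (mu : {measure set T -> \bar R}) (D : set T) (mD : measurable D).
Implicit Types f g : T -> R.

Lemma integrableRD f g : mu.-integrable D (EFin \o f) -> mu.-integrable D (EFin \o g) ->
  mu.-integrable D (EFin \o (fun x => f x + g x)).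
Proof. exact: integrableD. Qed.

Lemma integrableRB f g : mu.-integrable D (EFin \o f) -> mu.-integrable D (EFin \o g) ->
  mu.-integrable D (EFin \o (fun x => f x - g x)).
Proof. exact: integrableB. Qed.

Lemma integrableRZ f (c : R) : mu.-integrable D (EFin \o f) ->
  mu.-integrable D (EFin \o (fun x => c * f x)).
Proof. exact: integrableZl. Qed.

Lemma integrable_measurable f : mu.-integrable D (EFin \o f) -> measurable_fun D f.
Proof. by move=> /integrableP[/measurable_EFinP]. Qed.

End integrable_real.

Section Lp_tools.
Context {R : realType} {k : nat}.
Local Notation d := k.+1.
Local Notation pt := 'rV[R]_k.+1.
Local Notation mu := (@lebesgue_row R k.+1).
Implicit Types (D E : set pt) (f g h : pt -> R) (r : R).

Lemma measurable_cutoff D f : measurable D -> measurable_fun D f ->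
  measurable_fun [set: pt] (fun x => f x * \1_D x).
Proof.
move=> mD mf; apply: (eq_measurable_fun _ _ ((measurable_restrictT f mD).1 mf)) => x _.
by rewrite patchE indicE; case: ifPn => xD; rewrite ?mulr1 ?mulr0.
Qed.

Lemma measurable_abs_powR D f r : measurable_fun D f ->
  measurable_fun D (fun x => `|f x| `^ r).
Proof.
move=> mf; apply: (measurableT_comp (measurable_powR r)).
exact: measurableT_comp.
Qed.

Lemma eLpE D f r : 0 < r ->
  eLp r%:E D f = ((\int[mu]_(x in D) (`|f x| `^ r)%:E) `^ r^-1)%E.
Proof.
move=> r0; rewrite /eLp Lnorm.unlock; apply: (f_equal (fun z => poweR z r^-1)).
rewrite [RHS]integral_mkcond; apply: eq_integral => x _.
rewrite patchE indicE; case: ifPn => _; rewrite ?mulr1//=.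
by rewrite mulr0 normr0 powR0// gt_eqF.
Qed.

Lemma LpE D f r : 0 < r -> Lp r%:E D f = (\int[mu]_(x in D) (`|f x| `^ r)) `^ r^-1.
Proof. by move=> r0; rewrite /Lp eLpE// fine_poweR. Qed.

Lemma in_LpP D f r : measurable D -> 0 < r ->
  in_Lp r%:E D f <-> measurable_fun D f /\ mu.-integrable D (EFin \o (fun x => `|f x| `^ r)).
Proof.
move=> mD r0; rewrite /in_Lp eLpE//.
have E : (\int[mu]_(x in D) `|(`|f x| `^ r)%:E| =
    \int[mu]_(x in D) (`|f x| `^ r)%:E)%E.
  by apply: eq_integral => x _; rewrite /= ger0_norm// powR_ge0.
split=> [[mf h]|[mf /integrableP[_ h]]]; split=> //.
  apply/integrableP; split; first by apply/measurable_EFinP; exact: measurable_abs_powR.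
  by rewrite E; apply: (lty_poweRy _ h); rewrite invr_neq0// gt_eqF.
by apply: poweR_lty; rewrite -E.
Qed.

Lemma eLp_ge0 p D f : (0 <= eLp p D f)%E.
Proof. exact: Lnorm_ge0. Qed.

Lemma Lp_ge0 p D f : 0 <= Lp p D f.
Proof. by rewrite /Lp fine_ge0// eLp_ge0. Qed.

Lemma in_Lp_fineK p D f : in_Lp p D f -> (Lp p D f)%:E = eLp p D f.
Proof. by move=> [_ h]; rewrite /Lp fineK// ge0_fin_numE// eLp_ge0. Qed.

Lemma eLp_mono r D f g : measurable D -> 0 < r ->
  measurable_fun D f -> measurable_fun D g ->
  {ae mu, forall x, D x -> `|f x| <= `|g x|} -> (eLp r%:E D f <= eLp r%:E D g)%E.
Proof.
move=> mD r0 mf mg fg; rewrite (eLpE D f r0) (eLpE D g r0); apply: gt0_ler_poweR; first by rewrite invr_ge0 ltW.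
- by rewrite in_itv/= leey andbT integral_ge0// => x _; rewrite lee_fin powR_ge0.
- by rewrite in_itv/= leey andbT integral_ge0// => x _; rewrite lee_fin powR_ge0.
apply: ae_ge0_le_integral => //; try by apply/measurable_EFinP; exact: measurable_abs_powR.
apply: filterS fg => x h Dx; rewrite lee_fin ge0_ler_powR ?nnegrE//; first exact: ltW.
exact: h.
Qed.

Lemma in_Lp_mono r D f g : measurable D -> 0 < r -> measurable_fun D f ->
  in_Lp r%:E D g -> {ae mu, forall x, D x -> `|f x| <= `|g x|} -> in_Lp r%:E D f.
Proof.
move=> mD r0 mf [mg h] fg; split=> //; apply: le_lt_trans h; exact: eLp_mono.
Qed.

Lemma Lp_mono r D f g : measurable D -> 0 < r -> measurable_fun D f ->
  in_Lp r%:E D g -> {ae mu, forall x, D x -> `|f x| <= `|g x|} ->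
  Lp r%:E D f <= Lp r%:E D g.
Proof.
move=> mD r0 mf ig fg; have iff := in_Lp_mono mD r0 mf ig fg.
rewrite -lee_fin !in_Lp_fineK//; apply: eLp_mono => //; exact: ig.1.
Qed.

Lemma eq_Lp r D f g : measurable D -> 0 < r -> measurable_fun D f -> measurable_fun D g ->
  {ae mu, forall x, D x -> f x = g x} -> Lp r%:E D f = Lp r%:E D g.
Proof.
move=> mD r0 mf mg fg; rewrite /Lp; congr fine; apply/eqP; rewrite eq_le.
by rewrite !eLp_mono//; apply: filterS fg => x h Dx; rewrite h.
Qed.

Lemma in_LpS r D E f : measurable D -> measurable E -> 0 < r -> E `<=` D ->
  in_Lp r%:E D f -> in_Lp r%:E E f.
Proof.
move=> mD mE r0 ED /in_LpP[]// mf iff; apply/in_LpP => //; split.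
  exact: measurable_funS mf.
exact: integrableS iff.
Qed.

Lemma LpS r D E f : measurable D -> measurable E -> 0 < r -> E `<=` D ->
  in_Lp r%:E D f -> Lp r%:E E f <= Lp r%:E D f.
Proof.
move=> mD mE r0 ED iD; have iE := in_LpS mD mE r0 ED iD.
rewrite -lee_fin !in_Lp_fineK// (eLpE D f r0) (eLpE E f r0); apply: gt0_ler_poweR; first by rewrite invr_ge0 ltW.
- by rewrite in_itv/= leey andbT integral_ge0// => x _; rewrite lee_fin powR_ge0.
- by rewrite in_itv/= leey andbT integral_ge0// => x _; rewrite lee_fin powR_ge0.
apply: ge0_subset_integral => //.
by apply/measurable_EFinP; apply: measurable_abs_powR; exact: iD.1.
Qed.

Lemma eminkowskiD r D f g : measurable D -> 1 <= r ->
  measurable_fun D f -> measurable_fun D g ->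
  (eLp r%:E D (fun x => (f x + g x)%R) <= eLp r%:E D f + eLp r%:E D g)%E.
Proof.
move=> mD r1 mf mg; rewrite /eLp.
have := @eminkowski _ _ _ mu (fun x => f x * \1_D x) (fun x => g x * \1_D x) r%:E
  (measurable_cutoff mD mf) (measurable_cutoff mD mg).
rewrite lee_fin => /(_ r1); congr (_ <= _)%E.
by apply: eq_Lnorm => x /=; rewrite mulrDl.
Qed.

Lemma in_LpD r D f g : measurable D -> 1 <= r ->
  in_Lp r%:E D f -> in_Lp r%:E D g -> in_Lp r%:E D (fun x => f x + g x).
Proof.
move=> mD r1 [mf hf] [mg hg]; split; first exact: measurable_funD.
by apply: le_lt_trans (eminkowskiD mD r1 mf mg) _; rewrite lte_add_pinfty.
Qed.

Lemma LpD r D f g : measurable D -> 1 <= r ->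
  in_Lp r%:E D f -> in_Lp r%:E D g ->
  Lp r%:E D (fun x => f x + g x) <= Lp r%:E D f + Lp r%:E D g.
Proof.
move=> mD r1 hf hg; rewrite -lee_fin EFinD !in_Lp_fineK//; last exact: in_LpD.
by apply: eminkowskiD => //; [exact: hf.1|exact: hg.1].
Qed.

Lemma eLpN p D f : eLp p D (fun x => - f x) = eLp p D f.
Proof.
rewrite /eLp -[RHS]oppe_Lnorm; apply: eq_Lnorm => x.
by rewrite mulNr EFinN.
Qed.

Lemma in_LpN p D f : in_Lp p D f -> in_Lp p D (fun x => - f x).
Proof. by move=> [mf hf]; split; rewrite ?eLpN//; exact: measurableT_comp. Qed.

Lemma LpN p D f : Lp p D (fun x => - f x) = Lp p D f.
Proof. by rewrite /Lp eLpN. Qed.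

Lemma in_LpB r D f g : measurable D -> 1 <= r ->
  in_Lp r%:E D f -> in_Lp r%:E D g -> in_Lp r%:E D (fun x => f x - g x).
Proof. by move=> mD r1 hf hg; apply: in_LpD => //; exact: in_LpN. Qed.

Lemma LpZ r D f (c : R) : measurable D -> 0 < r -> in_Lp r%:E D f ->
  Lp r%:E D (fun x => c * f x) = `|c| * Lp r%:E D f.
Proof.
move=> mD r0 /in_LpP[]// mf iff; rewrite !LpE//.
have -> : \int[mu]_(x in D) `|c * f x| `^ r = `|c| `^ r * \int[mu]_(x in D) `|f x| `^ r.
  rewrite -RintegralZl//; apply: eq_Rintegral => x _.
  by rewrite normrM powRM.
rewrite powRM ?powR_ge0//; last by apply: Rintegral_ge0 => x _; exact: powR_ge0.
by rewrite -powRrM mulfV ?gt_eqF// powRr1.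
Qed.

Lemma Lp_cst r D (c : R) : measurable D -> 0 < r ->
  Lp r%:E D (fun=> c) = `|c| * fine (mu D) `^ r^-1.
Proof.
move=> mD r0; rewrite LpE// Rintegral_cst// powRM ?powR_ge0 ?fine_ge0//.
by rewrite -powRrM mulfV ?gt_eqF// powRr1.
Qed.

Lemma in_Lp_cst r D (c : R) : measurable D -> (mu D < +oo)%E -> 0 < r ->
  in_Lp r%:E D (fun=> c).
Proof.
move=> mD Doo r0; apply/in_LpP => //; split; first exact: measurable_cst.
exact: integrable_cst_lty.
Qed.

Lemma in_Lp_norm p D f : in_Lp p D f -> in_Lp p D (fun x => `|f x|).
Proof.
move=> [mf hf]; split; first exact: measurableT_comp.
rewrite (_ : eLp p D _ = eLp p D f)// /eLp -[RHS]Lnorm_abse; apply: eq_Lnorm => x /=.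
by rewrite normrM indicE; case: (_ \in _); rewrite ?normr1 ?normr0.
Qed.

Lemma Lp_norm p D f : Lp p D (fun x => `|f x|) = Lp p D f.
Proof.
rewrite /Lp /eLp -[in RHS]Lnorm_abse; congr fine; apply: eq_Lnorm => x /=.
by rewrite normrM indicE; case: (_ \in _); rewrite ?normr1 ?normr0.
Qed.

Lemma Lp_bnd r D f (M : R) : measurable D -> (mu D < +oo)%E -> 0 < r -> 0 <= M ->
  measurable_fun D f -> {ae mu, forall x, D x -> `|f x| <= M} ->
  in_Lp r%:E D f /\ Lp r%:E D f <= M * fine (mu D) `^ r^-1.
Proof.
move=> mD Doo r0 M0 mf fM.
have h : {ae mu, forall x, D x -> `|f x| <= `|cst M x|}.
  by apply: filterS fM => x h Dx; rewrite /= (ger0_norm M0); exact: h.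
have iM := in_Lp_cst M mD Doo r0; split; first exact: in_Lp_mono iM h.
by rewrite -[X in _ <= X * _](ger0_norm M0) -Lp_cst//; exact: Lp_mono.
Qed.

Lemma Lhoelder r s D f g : measurable D -> 0 < r -> 0 < s -> r^-1 + s^-1 = 1 ->
  in_Lp r%:E D f -> in_Lp s%:E D g ->
  mu.-integrable D (EFin \o (fun x => f x * g x)) /\
  \int[mu]_(x in D) `|f x * g x| <= Lp r%:E D f * Lp s%:E D g.
Proof.
move=> mD r0 s0 rs hf hg; have [mf _] := hf; have [mg _] := hg.
have mfg : measurable_fun D (fun x => f x * g x) by exact: measurable_funM.
have := hoelder mu (measurable_cutoff mD mf) (measurable_cutoff mD mg) r0 s0 rs.
rewrite Lnorm1 -/(eLp r%:E D f) -/(eLp s%:E D g) -!in_Lp_fineK// -EFinM.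
have -> : (\int[mu]_x `|(((fun x => f x * \1_D x) \* (fun x => g x * \1_D x)) x)%:E| =
   \int[mu]_(x in D) `|(f x * g x)%:E|)%E.
  rewrite [RHS]integral_mkcond; apply: eq_integral => x _.
  rewrite patchE /= indicE; case: ifPn => _; rewrite ?mulr1//=.
  by rewrite !mulr0 normr0.
move=> le; have ifg : mu.-integrable D (EFin \o (fun x => f x * g x)).
  apply/integrableP; split; first exact/measurable_EFinP.
  by apply: le_lt_trans le _; rewrite ltry.
split=> //; rewrite -lee_fin; apply: le_trans le.
rewrite /Rintegral fineK//.
rewrite ge0_fin_numE; last by apply: integral_ge0 => x _; rewrite lee_fin.
by move: ifg => /integrableP[].
Qed.

Lemma Lhoelder_le r s D f g : measurable D -> 0 < r -> 0 < s -> r^-1 + s^-1 = 1 ->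
  in_Lp r%:E D f -> in_Lp s%:E D g ->
  `|\int[mu]_(x in D) (f x * g x)| <= Lp r%:E D f * Lp s%:E D g.
Proof.
move=> mD r0 s0 rs hf hg; have [ifg le] := Lhoelder mD r0 s0 rs hf hg.
by apply: le_trans le; exact: le_normr_Rintegral.
Qed.

Let sqr_powR (x a b : R) : 0 <= x -> a * 2 = b -> (x `^ a) ^+ 2 = x `^ b.
Proof. by move=> x0 <-; rewrite powRrM (powR_mulrn 2) ?powR_ge0. Qed.

Lemma conj22 : 2^-1 + 2^-1 = 1 :> R.
Proof. by lra. Qed.

Lemma Lp2E D f : Lp 2%:E D f = Num.sqrt (\int[mu]_(x in D) (f x ^+ 2)).
Proof.
rewrite LpE// powR12_sqrt; last by apply: Rintegral_ge0 => x _; exact: powR_ge0.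
by congr Num.sqrt; apply: eq_Rintegral => x _; rewrite (powR_mulrn 2)// real_normK ?num_real.
Qed.

Lemma Lp2_sqr D f : Lp 2%:E D f ^+ 2 = \int[mu]_(x in D) (f x ^+ 2).
Proof. by rewrite Lp2E sqr_sqrtr//; apply: Rintegral_ge0 => x _; exact: sqr_ge0. Qed.

(** Hoelder's inequality with exponents 3/2 and 3 for the squares g^2 and h^2. *)
Lemma Lhoelder36 D g h : measurable D -> in_Lp 3%:E D g -> in_Lp 6%:E D h ->
  in_Lp 2%:E D (fun x => g x * h x) /\
  Lp 2%:E D (fun x => g x * h x) <= Lp 3%:E D g * Lp 6%:E D h.
Proof.
move=> mD ig ih; have [mg _] := ig; have [mh _] := ih.
have sq_powR (f : pt -> R) (a b : R) x : 2 * a = b -> `|f x ^+ 2| `^ a = `|f x| `^ b.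
  by move=> <-; rewrite normrX -powR_mulrn// -powRrM.
have m2 f : measurable_fun D f -> measurable_fun D (fun x => f x ^+ 2).
  by move=> mf; exact: measurable_funX.
have r0 : 0 < 3 / 2 :> R by lra.
have ig2 : in_Lp (3 / 2)%:E D (fun x => g x ^+ 2).
  apply/in_LpP => //; split; first exact: m2.
  move: ig => /in_LpP[]// _; apply: eq_integrable => // x _ /=.
  by rewrite (@sq_powR _ _ 3)//; lra.
have ih2 : in_Lp 3%:E D (fun x => h x ^+ 2).
  apply/in_LpP => //; split; first exact: m2.
  move: ih => /in_LpP[]// _; apply: eq_integrable => // x _ /=.
  by rewrite (@sq_powR _ _ 6)//; lra.
have Eg : Lp (3 / 2)%:E D (fun x => g x ^+ 2) = Lp 3%:E D g ^+ 2.
  rewrite (LpE D _ r0) (LpE D g (ltr0n _ 3)) (@sqr_powR _ _ (3 / 2)^-1); last by field.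
    apply: (f_equal (fun z => z `^ _)); apply: eq_Rintegral => x _.
    by rewrite (@sq_powR _ _ 3)//; lra.
  by apply: Rintegral_ge0 => x _; exact: powR_ge0.
have Eh : Lp 3%:E D (fun x => h x ^+ 2) = Lp 6%:E D h ^+ 2.
  rewrite (LpE D _ (ltr0n _ 3)) (LpE D h (ltr0n _ 6)) (@sqr_powR _ _ 3^-1); last by field.
    apply: (f_equal (fun z => z `^ _)); apply: eq_Rintegral => x _.
    by rewrite (@sq_powR _ _ 6)//; lra.
  by apply: Rintegral_ge0 => x _; exact: powR_ge0.
have conj : (3 / 2)^-1 + 3^-1 = 1 :> R by field.
have [igh le] := Lhoelder mD r0 (ltr0n _ 3) conj ig2 ih2.
have Egh x : (g x * h x) ^+ 2 = `|g x ^+ 2 * h x ^+ 2|.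
  by rewrite exprMn ger0_norm// mulr_ge0// sqr_ge0.
split.
  apply/in_LpP => //; split; first exact: measurable_funM.
  have := integrable_norm igh; apply: eq_integrable => // x _ /=.
  by rewrite (powR_mulrn 2)// real_normK ?num_real// Egh.
rewrite -(@ler_pXn2r _ 2)// ?nnegrE ?mulr_ge0 ?Lp_ge0// Lp2_sqr exprMn -Eg -Eh.
by apply: le_trans le; under eq_Rintegral do rewrite Egh.
Qed.

Lemma Lhoelder236 D f g h : measurable D ->
  in_Lp 2%:E D f -> in_Lp 3%:E D g -> in_Lp 6%:E D h ->
  mu.-integrable D (EFin \o (fun x => f x * (g x * h x))) /\
  `|\int[mu]_(x in D) (f x * (g x * h x))| <= Lp 2%:E D f * (Lp 3%:E D g * Lp 6%:E D h).
Proof.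
move=> mD hf hg hh; have [igh le] := Lhoelder36 mD hg hh.
have [i1 _] := Lhoelder mD (ltr0n _ 2) (ltr0n _ 2) conj22 hf igh.
split=> //; apply: le_trans (Lhoelder_le mD (ltr0n _ 2) (ltr0n _ 2) conj22 hf igh) _.
by rewrite ler_wpM2l ?Lp_ge0.
Qed.

Lemma L2_mul D f g : measurable D -> in_Lp 2%:E D f -> in_Lp 2%:E D g ->
  mu.-integrable D (EFin \o (fun x => f x * g x)).
Proof.
by move=> mD hf hg; have [] := Lhoelder mD (ltr0n _ 2) (ltr0n _ 2) conj22 hf hg.
Qed.

Lemma L2_mul_le D f g : measurable D -> in_Lp 2%:E D f -> in_Lp 2%:E D g ->
  `|\int[mu]_(x in D) (f x * g x)| <= Lp 2%:E D f * Lp 2%:E D g.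
Proof. by move=> mD; apply: Lhoelder_le => //; exact: conj22. Qed.

(** On a set of finite measure, y^2 <= 1 + y^3 for y >= 0. *)
Lemma L3_L2 D f : measurable D -> (mu D < +oo)%E -> in_Lp 3%:E D f -> in_Lp 2%:E D f.
Proof.
move=> mD Doo /in_LpP[]// mf i3; apply/in_LpP => //; split=> //.
apply: (le_integrable mD (g := EFin \o (fun x => 1 + `|f x| `^ 3))).
- by apply/measurable_EFinP; exact: measurable_abs_powR.
- move=> x _; rewrite /= lee_fin [leLHS]ger0_norm ?powR_ge0// [leRHS]ger0_norm ?addr_ge0 ?powR_ge0//.
  rewrite (powR_mulrn 2)// (powR_mulrn 3)//.
  have [h|h] := leP `|f x| 1.
    by rewrite (le_trans (_ : _ <= 1)) ?exprn_ile1// lerDl exprn_ge0.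
  by rewrite (le_trans (_ : _ <= `|f x| ^+ 3)) ?lerDr// ler_eXn2l.
- exact: (integrableD mD (integrable_cst_lty 1 mD Doo) i3).
Qed.

End Lp_tools.

Section essentially_bounded.
Context {R : realType} {k : nat}.
Local Notation d := k.+1.
Local Notation pt := 'rV[R]_k.+1.
Local Notation mu := (@lebesgue_row R k.+1).
Variable (D : set pt).
Hypothesis (mD : measurable D) (Doo : (mu D < +oo)%E).
Implicit Types (f g h : pt -> R).

(** An explicit bound instead of an essential supremum makes stability under sums and products
    elementary. Discrete functions and their weak gradients belong to this class, so the
    integrability of their products is immediate. *)
Definition Linf f : Prop := measurable_fun D f /\
  exists2 M, 0 <= M & {ae mu, forall x, D x -> `|f x| <= M}.

Lemma Linf_in_Lp f (r : R) : 0 < r -> Linf f -> in_Lp r%:E D f.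
Proof. by move=> r0 [mf [M M0 fM]]; have [] := Lp_bnd mD Doo r0 M0 mf fM. Qed.

Lemma Linf_integrable f : Linf f -> mu.-integrable D (EFin \o f).
Proof.
move=> /(Linf_in_Lp (ltr01)) /in_LpP[]// mf; under [in X in X -> _]eq_fun do rewrite powRr1//.
move=> h; apply: (le_integrable mD _ _ h); first exact/measurable_EFinP.
by move=> x _; rewrite /= normr_id.
Qed.

Lemma Linf_cst (c : R) : Linf (fun=> c).
Proof.
split; first exact: measurable_cst.
by exists `|c| => //; apply: aeW.
Qed.

Lemma LinfD f g : Linf f -> Linf g -> Linf (fun x => f x + g x).
Proof.
move=> [mf [M M0 fM]] [mg [N N0 gN]]; split; first exact: measurable_funD.
exists (M + N); first exact: addr_ge0.
apply: filterS2 fM gN => x h1 h2 Dx.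
by rewrite (le_trans (ler_normD _ _))// lerD// ?h1 ?h2.
Qed.

Lemma LinfM f g : Linf f -> Linf g -> Linf (fun x => f x * g x).
Proof.
move=> [mf [M M0 fM]] [mg [N N0 gN]]; split; first exact: measurable_funM.
exists (M * N); first exact: mulr_ge0.
apply: filterS2 fM gN => x h1 h2 Dx.
by rewrite normrM ler_pM// ?h1 ?h2.
Qed.

Lemma LinfZ f (c : R) : Linf f -> Linf (fun x => c * f x).
Proof. by apply: LinfM; exact: Linf_cst. Qed.

Lemma LinfN f : Linf f -> Linf (fun x => - f x).
Proof. by move=> /(LinfZ (-1)); under eq_fun do rewrite mulN1r. Qed.

Lemma LinfB f g : Linf f -> Linf g -> Linf (fun x => f x - g x).
Proof. by move=> hf hg; apply: LinfD => //; exact: LinfN. Qed.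

Lemma Linf_norm f : Linf f -> Linf (fun x => `|f x|).
Proof.
move=> [mf [M M0 fM]]; split; first exact: measurableT_comp.
by exists M => //; apply: filterS fM => x h Dx; rewrite normr_id h.
Qed.

Lemma Linf_sum (I : Type) (s : seq I) (F : I -> pt -> R) :
  (forall i, Linf (F i)) -> Linf (fun x => \sum_(i <- s) F i x).
Proof.
move=> hF; elim: s => [|i s IHs]; first by under eq_fun do rewrite big_nil; exact: Linf_cst.
by under eq_fun do rewrite big_cons; exact: LinfD.
Qed.

Lemma Linf_mul_Lp f g (r : R) : 0 < r -> Linf f -> in_Lp r%:E D g ->
  in_Lp r%:E D (fun x => f x * g x).
Proof.
move=> r0 [mf [M M0 fM]] ig; have [mg _] := ig.
have igM : in_Lp r%:E D (fun x => M * g x).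
  move: ig => /in_LpP[]// _ ig; apply/in_LpP => //; split; first exact: measurable_funM.
  have : mu.-integrable D (EFin \o (fun x => M `^ r * `|g x| `^ r)).
    exact: integrableZl ig.
  by apply: eq_integrable => // x _ /=; rewrite normrM (ger0_norm M0) powRM.
apply: (in_Lp_mono mD r0 _ igM); first exact: measurable_funM.
apply: filterS fM => x h Dx; rewrite !normrM ler_wpM2r// (le_trans (h Dx))//.
exact: ler_norm.
Qed.

Lemma Linf_mul_int f g : Linf f -> mu.-integrable D (EFin \o g) ->
  mu.-integrable D (EFin \o (fun x => f x * g x)).
Proof.
move=> hf ig; have mg : measurable_fun D g by move: ig => /integrableP[/measurable_EFinP].
have : in_Lp 1%:E D g.
  apply/in_LpP => //; split=> //; have := integrable_norm ig.
  by apply: eq_integrable => // x _ /=; rewrite powRr1.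
move=> /(Linf_mul_Lp ltr01 hf) /in_LpP[]// mfg ifg.
apply: (le_integrable mD _ _ ifg); first exact/measurable_EFinP.
by move=> x _; rewrite /= powRr1// normr_id.
Qed.

Lemma in_Lpoo_Linf f : in_Lp +oo%E D f -> Linf f.
Proof.
move=> [mf]; rewrite /eLp unlock; case: ifPn => [T0|] h.
  split=> //; set e := ess_sup _ _ in h.
  have e0 : (0 <= e)%E by apply: ess_sup_gee => //; apply: aeW => x /=.
  exists (fine e); first exact: fine_ge0.
  have := ess_sup_ge mu (abse \o (fun x => (f x * \1_D x)%:E)).
  apply: filterS => x + Dx; rewrite -/e /= indicE mem_set//= mulr1.
  by rewrite -[e]fineK ?lee_fin// ge0_fin_numE.
(* The norm at +oo is 0 by convention when the whole space has measure zero; every property then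
   holds almost everywhere. *)
move=> T0; split=> //; exists 0 => //.
apply: measure0_ae; apply/eqP; rewrite eq_le measure_ge0 andbT leNgt//.
Qed.

Lemma Lpoo_ae f : in_Lp +oo%E D f -> {ae mu, forall x, D x -> `|f x| <= Lp +oo%E D f}.
Proof.
move=> ioo; have [mf h] := ioo; rewrite /Lp; have e0 := @eLp_ge0 R k +oo%E D f.
have {h} : eLp +oo%E D f \is a fin_num by rewrite ge0_fin_numE.
rewrite /eLp unlock; case: ifPn => [T0|T0 _].
  set e := ess_sup _ _ => efin.
  have := ess_sup_ge mu (abse \o (fun x => (f x * \1_D x)%:E)).
  apply: filterS => x + Dx; rewrite -/e /= indicE mem_set//= mulr1.
  by rewrite -[e]fineK ?lee_fin.
apply: measure0_ae; apply/eqP; rewrite eq_le measure_ge0 andbT leNgt//.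
Qed.

End essentially_bounded.

(** * The Euclidean inner product and norm *)

Section euclidean.
Context {R : realType}.

Section dim.
Variable n : nat.
Implicit Types (v w z : 'rV[R]_n).

Lemma dotC v w : dot v w = dot w v.
Proof. by apply: eq_bigr => i _; rewrite mulrC. Qed.

Lemma dotDl v w z : dot (v + w) z = dot v z + dot w z.
Proof. by rewrite /dot -big_split; apply: eq_bigr => i _; rewrite mxE mulrDl. Qed.

Lemma dotZl (c : R) v w : dot (c *: v) w = c * dot v w.
Proof. by rewrite /dot mulr_sumr; apply: eq_bigr => i _; rewrite mxE mulrA. Qed.

Lemma dotDr v w z : dot z (v + w) = dot z v + dot z w.
Proof. by rewrite dotC dotDl !(dotC z). Qed.

Lemma dotZr (c : R) v w : dot w (c *: v) = c * dot w v.
Proof. by rewrite dotC dotZl (dotC w). Qed.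

Lemma dotNl v w : dot (- v) w = - dot v w.
Proof. by rewrite -scaleN1r dotZl mulN1r. Qed.

Lemma dotNr v w : dot w (- v) = - dot w v.
Proof. by rewrite dotC dotNl dotC. Qed.

Lemma dotBl v w z : dot (v - w) z = dot v z - dot w z.
Proof. by rewrite dotDl dotNl. Qed.

Lemma dotBr v w z : dot z (v - w) = dot z v - dot z w.
Proof. by rewrite dotDr dotNr. Qed.

Lemma dot0l v : dot 0 v = 0.
Proof. by rewrite -(scale0r 0) dotZl mul0r. Qed.

Lemma dot_ge0 v : 0 <= dot v v.
Proof. by apply: sumr_ge0 => i _; rewrite -expr2 sqr_ge0. Qed.

Lemma enorm_ge0 v : 0 <= enorm v.
Proof. exact: sqrtr_ge0. Qed.

Lemma enorm_sqr v : enorm v ^+ 2 = dot v v.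
Proof. by rewrite sqr_sqrtr// dot_ge0. Qed.

Lemma dot_eq0 v : dot v v = 0 -> v = 0.
Proof.
move=> /eqP; rewrite psumr_eq0; last by move=> i _; rewrite -expr2 sqr_ge0.
move=> /allP h; apply/rowP => i; rewrite mxE.
by have := h i (mem_index_enum _); rewrite mulf_eq0 orbb => /eqP.
Qed.

Lemma enorm_eq0 v : enorm v = 0 -> v = 0.
Proof. by move=> v0; apply: dot_eq0; rewrite -enorm_sqr v0 expr0n. Qed.

Lemma enorm0 : enorm (0 : 'rV[R]_n) = 0.
Proof. by rewrite /enorm dot0l sqrtr0. Qed.

(** Cauchy-Schwarz, from expanding the squared length of (w.w) v - (v.w) w and dividing by w.w. *)
Lemma dot_sqr_le v w : dot v w ^+ 2 <= dot v v * dot w w.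
Proof.
have [w0|w0] := eqVneq (dot w w) 0.
  by rewrite (dot_eq0 w0) dotC !dot0l expr0n mulr0.
have wgt : 0 < dot w w by rewrite lt_neqAle eq_sym w0 dot_ge0.
have := dot_ge0 (dot w w *: v - dot v w *: w).
rewrite dotBl !dotBr !dotZl !dotZr (dotC w v) => h.
rewrite -(ler_pM2l wgt) -subr_ge0; apply: le_trans h _.
by rewrite le_eqVlt; apply/orP; left; apply/eqP; ring.
Qed.

Lemma norm_dot_le v w : `|dot v w| <= enorm v * enorm w.
Proof.
rewrite -(@ler_pXn2r _ 2)// ?nnegrE ?mulr_ge0 ?enorm_ge0//.
by rewrite real_normK ?num_real// exprMn !enorm_sqr dot_sqr_le.
Qed.

Lemma dot_le v w : dot v w <= enorm v * enorm w.
Proof. exact: le_trans (ler_norm _) (norm_dot_le v w). Qed.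

Lemma enormD v w : enorm (v + w) <= enorm v + enorm w.
Proof.
rewrite -(@ler_pXn2r _ 2)// ?nnegrE ?addr_ge0 ?enorm_ge0//.
rewrite enorm_sqr dotDl !dotDr (dotC w v) sqrrD !enorm_sqr.
by have := dot_le v w; lra.
Qed.

Lemma enormZ (c : R) v : enorm (c *: v) = `|c| * enorm v.
Proof. by rewrite /enorm dotZl dotZr mulrA -expr2 sqrtrM ?sqr_ge0// sqrtr_sqr. Qed.

Lemma enormN v : enorm (- v) = enorm v.
Proof. by rewrite /enorm dotNl dotNr opprK. Qed.

Lemma enorm_distC v w : enorm (v - w) = enorm (w - v).
Proof. by rewrite -enormN opprB. Qed.

Lemma enorm_coord v i : `|v 0 i| <= enorm v.
Proof.
rewrite -(@ler_pXn2r _ 2)// ?nnegrE ?enorm_ge0// enorm_sqr real_normK ?num_real//.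
by rewrite /dot (bigD1 i)//= -expr2 lerDl sumr_ge0// => j _; rewrite -expr2 sqr_ge0.
Qed.

Lemma enorm_le_sum v : enorm v <= \sum_i `|v 0 i|.
Proof.
rewrite -(@ler_pXn2r _ 2)// ?nnegrE ?enorm_ge0 ?sumr_ge0// enorm_sqr expr2.
rewrite mulr_suml ler_sum// => i _; rewrite -expr2 -(real_normK (num_real (v 0 i))) expr2.
by rewrite ler_wpM2l// (bigD1 i)//= lerDl sumr_ge0.
Qed.

End dim.
End euclidean.

Lemma continuous_enorm {R : realType} (k : nat) : continuous (@enorm R k.+1).
Proof.
move=> v; apply: (@continuous_comp _ _ _ (fun v : 'rV[R]_k.+1 => dot v v) (@Num.sqrt R)).
  by apply: smooth_continuous; apply: smooth_sum => i; apply: smoothM; exact: smooth_coord.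
exact: sqrt_continuous.
Qed.

(** * Vector fields in Lebesgue spaces *)

Section vector_Lp.
Context {R : realType} {k : nat}.
Local Notation d := k.+1.
Local Notation pt := 'rV[R]_k.+1.
Local Notation mu := (@lebesgue_row R k.+1).
Implicit Types (D E : set pt) (f g : pt -> R) (w z : pt -> pt).

Lemma measurable_dot D w z : (forall i, measurable_fun D (fun x => w x 0 i)) ->
  (forall i, measurable_fun D (fun x => z x 0 i)) ->
  measurable_fun D (fun x => dot (w x) (z x)).
Proof. by move=> mw mz; apply: measurable_sum => i; exact: measurable_funM. Qed.

Lemma measurable_enorm D w : (forall i, measurable_fun D (fun x => w x 0 i)) ->
  measurable_fun D (fun x => enorm (w x)).
Proof.
move=> mw; exact: (measurableT_comp (continuous_measurable_fun (@sqrt_continuous R))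
  (measurable_dot mw mw)).
Qed.

Lemma in_LpVP D w (r : R) : measurable D -> 1 <= r ->
  in_LpV r%:E D w <-> forall i, in_Lp r%:E D (fun x => w x 0 i).
Proof.
move=> mD r1; have r0 : 0 < r by exact: lt_le_trans r1.
split=> [[mw ew] i|h].
  apply: (@in_Lp_mono _ _ _ _ _ (fun x => enorm (w x))) => //.
    by split=> //; exact: measurable_enorm.
  by apply: aeW => x _; rewrite (ger0_norm (enorm_ge0 _)) enorm_coord.
have mw i : measurable_fun D (fun x => w x 0 i) by exact: (h i).1.
split=> //; suff [] : in_Lp r%:E D (fun x => enorm (w x)) by [].
have hs (s : seq 'I_d) : in_Lp r%:E D (fun x => \sum_(i <- s) `|w x 0 i|).
  elim: s => [|i s IHs].
    under eq_fun do rewrite big_nil.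
    apply/in_LpP => //; split; first exact: measurable_cst.
    under eq_fun do rewrite normr0 powR0 ?gt_eqF//.
    exact: integrable0.
  under eq_fun do rewrite big_cons.
  by apply: in_LpD => //; exact: in_Lp_norm.
apply: (in_Lp_mono mD r0 _ (hs (index_enum _))); first exact: measurable_enorm.
apply: aeW => x _; rewrite !ger0_norm ?enorm_ge0 ?sumr_ge0//.
exact: enorm_le_sum.
Qed.

Lemma in_LpV_enorm D w p : in_LpV p D w -> in_Lp p D (fun x => enorm (w x)).
Proof. by move=> [mw ew]; split=> //; exact: measurable_enorm. Qed.

Lemma LpV_ge0 p D w : 0 <= LpV p D w.
Proof. exact: Lp_ge0. Qed.

Lemma in_LpVD D w z (r : R) : measurable D -> 1 <= r ->
  in_LpV r%:E D w -> in_LpV r%:E D z -> in_LpV r%:E D (fun x => w x + z x).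
Proof.
move=> mD r1 /in_LpVP-/(_ mD r1) hw /in_LpVP-/(_ mD r1) hz; apply/in_LpVP => // i.
by under eq_fun do rewrite mxE; exact: in_LpD.
Qed.

Lemma in_LpVN D w p : in_LpV p D w -> in_LpV p D (fun x => - w x).
Proof.
move=> [mw ew]; split; last by under eq_fun do rewrite enormN.
by move=> i; under eq_fun do rewrite mxE; exact: measurableT_comp.
Qed.

Lemma in_LpVB D w z (r : R) : measurable D -> 1 <= r ->
  in_LpV r%:E D w -> in_LpV r%:E D z -> in_LpV r%:E D (fun x => w x - z x).
Proof. by move=> mD r1 hw hz; apply: in_LpVD => //; exact: in_LpVN. Qed.

Lemma LpVD D w z (r : R) : measurable D -> 1 <= r ->
  in_LpV r%:E D w -> in_LpV r%:E D z ->
  LpV r%:E D (fun x => w x + z x) <= LpV r%:E D w + LpV r%:E D z.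
Proof.
move=> mD r1 hw hz; have r0 : 0 < r by exact: lt_le_trans r1.
have iw := in_LpV_enorm hw; have iz := in_LpV_enorm hz.
apply: le_trans (LpD mD r1 iw iz).
apply: Lp_mono => //; last 2 first.
- exact: in_LpD.
- apply: aeW => x _; rewrite !ger0_norm ?addr_ge0 ?enorm_ge0//; exact: enormD.
by have [] := in_LpV_enorm (in_LpVD mD r1 hw hz).
Qed.

Lemma LpVN D w p : LpV p D (fun x => - w x) = LpV p D w.
Proof. by rewrite /LpV; under eq_fun do rewrite enormN. Qed.

Lemma LpVB D w z (r : R) : measurable D -> 1 <= r ->
  in_LpV r%:E D w -> in_LpV r%:E D z ->
  LpV r%:E D (fun x => w x - z x) <= LpV r%:E D w + LpV r%:E D z.
Proof. by move=> mD r1 hw hz; rewrite -(LpVN D z); apply: LpVD => //; exact: in_LpVN. Qed.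

Lemma eq_LpV D w z (r : R) : measurable D -> 0 < r ->
  (forall i, measurable_fun D (fun x => w x 0 i)) ->
  (forall i, measurable_fun D (fun x => z x 0 i)) ->
  {ae mu, forall x, D x -> w x = z x} -> LpV r%:E D w = LpV r%:E D z.
Proof.
move=> mD r0 mw mz wz; apply: eq_Lp => //; try exact: measurable_enorm.
by apply: filterS wz => x h Dx; rewrite h.
Qed.

Lemma L2V_dot D w z : measurable D -> in_LpV 2%:E D w -> in_LpV 2%:E D z ->
  mu.-integrable D (EFin \o (fun x => dot (w x) (z x))) /\
  `|\int[mu]_(x in D) dot (w x) (z x)| <= LpV 2%:E D w * LpV 2%:E D z.
Proof.
move=> mD hw hz; have iw := in_LpV_enorm hw; have iz := in_LpV_enorm hz.
have iwz := L2_mul mD iw iz.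
have mdot : measurable_fun D (fun x => dot (w x) (z x)).
  by apply: measurable_dot; [exact: hw.1|exact: hz.1].
have idot : mu.-integrable D (EFin \o (fun x => dot (w x) (z x))).
  apply: (le_integrable mD _ _ iwz); first exact/measurable_EFinP.
  move=> x _; rewrite /= lee_fin (ger0_norm (mulr_ge0 (enorm_ge0 _) (enorm_ge0 _))).
  exact: norm_dot_le.
split=> //; apply: le_trans (le_normr_Rintegral mD idot) _.
apply: le_trans (L2_mul_le mD iw iz); apply: le_trans (ler_norm _).
apply: le_Rintegral => //; first exact: integrable_norm idot.
by move=> x _; exact: norm_dot_le.
Qed.

Lemma LpV2_sqr D w : LpV 2%:E D w ^+ 2 = \int[mu]_(x in D) dot (w x) (w x).
Proof. by rewrite /LpV Lp2_sqr; apply: eq_Rintegral => x _; rewrite enorm_sqr. Qed.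

Lemma LpVS (r : R) D E w : measurable D -> measurable E -> 0 < r -> E `<=` D ->
  in_LpV r%:E D w -> LpV r%:E E w <= LpV r%:E D w.
Proof. by move=> mD mE r0 ED /in_LpV_enorm; exact: LpS. Qed.

Lemma in_LpVS (r : R) D E w : measurable D -> measurable E -> 0 < r -> E `<=` D ->
  in_LpV r%:E D w -> in_LpV r%:E E w.
Proof.
move=> mD mE r0 ED hw; have [] := in_LpS mD mE r0 ED (in_LpV_enorm hw).
move=> _ hE; split=> // i; exact: measurable_funS (hw.1 i).
Qed.

Lemma Linf_mul_le D f g (r M : R) : measurable D -> 0 < r -> 0 <= M ->
  measurable_fun D f -> {ae mu, forall x, D x -> `|f x| <= M} -> in_Lp r%:E D g ->
  Lp r%:E D (fun x => f x * g x) <= M * Lp r%:E D g.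
Proof.
move=> mD r0 M0 mf fM ig; rewrite -[X in _ <= X * _](ger0_norm M0) -LpZ//.
have [mg _] := ig.
apply: Lp_mono => //; first exact: measurable_funM.
  by apply: Linf_mul_Lp => //; exact: Linf_cst.
apply: filterS fM => x h Dx; rewrite !normrM ler_wpM2r// (ger0_norm M0).
exact: h.
Qed.

End vector_Lp.

(** * Sobolev spaces *)

Section sobolev.
Context {R : realType} {k : nat}.
Local Notation d := k.+1.
Local Notation pt := 'rV[R]_k.+1.
Local Notation mu := (@lebesgue_row R k.+1).
Variable Om : set pt.
Hypotheses (oOm : open Om) (bOm : (mu Om < +oo)%E).
Implicit Types (D : set pt) (v w phi psi : pt -> R).

Let mOm : measurable Om. Proof. exact: measurable_row_open. Qed.
Let r12 : (1 : R) <= 2. Proof. exact: ler1n. Qed.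

Definition has_wgrad v := exists G, is_weak_gradient Om v G.

Lemma wgrad_weak v : has_wgrad v -> is_weak_gradient Om v (wgrad Om v).
Proof. by move=> [G /wgradP]. Qed.

Lemma measurable_wgrad v i : has_wgrad v -> measurable_fun Om (fun x => wgrad Om v x 0 i).
Proof. by move=> /wgrad_weak[_ /(_ i)[]]. Qed.

Lemma has_wgradB v w : has_wgrad v -> has_wgrad w -> has_wgrad (fun x => v x - w x).
Proof. by move=> [G vG] [H wH]; exists (fun x => G x - H x); exact: is_weak_gradientB. Qed.

Lemma wgradB v w : has_wgrad v -> has_wgrad w ->
  {ae mu, forall x, Om x -> wgrad Om (fun x => v x - w x) x = wgrad Om v x - wgrad Om w x}.
Proof.
by move=> /wgrad_weak hv /wgrad_weak hw; apply: wgradE => //; exact: is_weak_gradientB.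
Qed.

Lemma wgrad_test phi : test_function Om phi ->
  {ae mu, forall x, Om x -> wgrad Om phi x = grad phi x}.
Proof. by move=> tphi; apply: wgradE => //; exact: test_is_weak_gradient. Qed.

Lemma W1_has_wgrad p v : W1 p Om v -> has_wgrad v.
Proof. by move=> [_ [G vG _]]; exists G. Qed.

Lemma W1_wgrad (r : R) v : 0 < r -> W1 r%:E Om v -> in_LpV r%:E Om (wgrad Om v).
Proof.
move=> r0 W; have hv := W1_has_wgrad W; have [_ [G vG [mG eG]]] := W.
split; first by move=> i; exact: measurable_wgrad.
suff [] : in_Lp r%:E Om (fun x => enorm (wgrad Om v x)) by [].
apply: (@in_Lp_mono _ _ _ _ _ (fun x => enorm (G x))) => //.
- by apply: measurable_enorm => i; exact: measurable_wgrad.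
- by split=> //; exact: measurable_enorm.
- by apply: filterS (wgradE oOm vG) => x h Ox; rewrite h.
Qed.

Lemma W1B (r : R) v w : 1 <= r -> W1 r%:E Om v -> W1 r%:E Om w -> W1 r%:E Om (fun x => v x - w x).
Proof.
move=> r1 hv hw; have r0 : 0 < r by exact: lt_le_trans r1.
split; first by apply: in_LpB => //; [exact: hv.1|exact: hw.1].
exists (fun x => wgrad Om v x - wgrad Om w x).
  by apply: is_weak_gradientB => //; apply: wgrad_weak; [exact: W1_has_wgrad hv|exact: W1_has_wgrad hw].
by apply: in_LpVB => //; exact: W1_wgrad.
Qed.

Lemma LpV_wgradB (r : R) D v w : 1 <= r -> measurable D -> D `<=` Om ->
  W1 r%:E Om v -> W1 r%:E Om w ->
  LpV r%:E D (wgrad Om (fun x => v x - w x)) = LpV r%:E D (fun x => wgrad Om v x - wgrad Om w x).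
Proof.
move=> r1 mD DO hv hw; have r0 : 0 < r by exact: lt_le_trans r1.
have gv := W1_has_wgrad hv; have gw := W1_has_wgrad hw.
apply: eq_LpV => //.
- move=> i; apply: measurable_funS (measurable_wgrad i (has_wgradB gv gw)) => //.
- move=> i; under eq_fun do rewrite !mxE.
  by apply: measurable_funB; apply: measurable_funS (measurable_wgrad i _).
- by apply: filterS (wgradB gv gw) => x h /DO; exact: h.
Qed.

(** The triangle inequality of the plane: [H1norm] is the Euclidean length of the pair formed by the
    L^2 norms of the function and of its gradient. *)
Lemma minkowski2 (a b c e : R) : 0 <= a -> 0 <= b -> 0 <= c -> 0 <= e ->
  Num.sqrt ((a + c) ^+ 2 + (b + e) ^+ 2) <=
  Num.sqrt (a ^+ 2 + b ^+ 2) + Num.sqrt (c ^+ 2 + e ^+ 2).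
Proof.
move=> a0 b0 c0 e0; have ac := mulr_ge0 a0 c0; have be := mulr_ge0 b0 e0.
rewrite -(@ler_pXn2r _ 2)// ?nnegrE ?addr_ge0 ?sqrtr_ge0//.
rewrite !sqrrD !sqr_sqrtr ?addr_ge0 ?sqr_ge0//.
have : a * c + b * e <= Num.sqrt (a ^+ 2 + b ^+ 2) * Num.sqrt (c ^+ 2 + e ^+ 2).
  rewrite -sqrtrM ?addr_ge0 ?sqr_ge0// -(ger0_norm (addr_ge0 ac be)).
  rewrite -sqrtr_sqr ler_sqrt ?mulr_ge0 ?addr_ge0 ?sqr_ge0// -subr_ge0.
  have -> : (a ^+ 2 + b ^+ 2) * (c ^+ 2 + e ^+ 2) - (a * c + b * e) ^+ 2 = (a * e - b * c) ^+ 2 by ring.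
  exact: sqr_ge0.
lra.
Qed.

Lemma H1normB D v w : measurable D -> D `<=` Om -> W1 2%:E Om v -> W1 2%:E Om w ->
  H1norm Om D (fun x => v x - w x) <= H1norm Om D v + H1norm Om D w.
Proof.
move=> mD DO hv hw; have r1 : 1 <= 2 :> R by rewrite ler1n.
have r0 : 0 < 2 :> R by [].
apply: le_trans (minkowski2 (Lp_ge0 _ _ _) (Lp_ge0 _ _ _) (Lp_ge0 _ _ _) (Lp_ge0 _ _ _)).
rewrite /H1norm ler_sqrt ?addr_ge0 ?sqr_ge0//.
have iv := in_LpS mOm mD r0 DO hv.1; have iw := in_LpS mOm mD r0 DO hw.1.
rewrite lerD// ler_pXn2r// ?nnegrE ?addr_ge0 ?Lp_ge0//.
  by rewrite -(LpN _ D w); apply: LpD => //; exact: in_LpN.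
rewrite (LpV_wgradB r12)//; apply: LpVB => //; apply: in_LpVS mOm mD r0 DO _; exact: W1_wgrad.
Qed.

Lemma H1norm_ge0 D v : 0 <= H1norm Om D v.
Proof. exact: sqrtr_ge0. Qed.

Lemma Lp_le_H1 D v : Lp 2%:E D v <= H1norm Om D v.
Proof.
rewrite -(ger0_norm (Lp_ge0 _ _ _)) -sqrtr_sqr ler_sqrt ?addr_ge0 ?sqr_ge0//.
by rewrite lerDl sqr_ge0.
Qed.

Lemma LpV_le_H1 D v : LpV 2%:E D (wgrad Om v) <= H1norm Om D v.
Proof.
rewrite -(ger0_norm (LpV_ge0 _ _ _)) -sqrtr_sqr ler_sqrt ?addr_ge0 ?sqr_ge0//.
by rewrite lerDr sqr_ge0.
Qed.

Lemma test_bnd phi : test_function Om phi -> Linf Om phi /\ forall i, Linf Om (pderiv i phi).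
Proof.
move=> [sp [S [cS SO p0]]].
have clS : closed S by apply: compact_closed => //; exact: norm_hausdorff.
split.
  have [M M0 pM] := supp_bnd cS (smooth_continuous sp) p0.
  split; first by apply: measurable_funTS; exact: smooth_measurable.
  by exists M => //; apply: aeW => x _.
move=> i; have spd := smooth_pderiv i sp.
have [M M0 pM] := supp_bnd cS (smooth_continuous spd) (pderiv_supp i clS p0).
split; first by apply: measurable_funTS; exact: smooth_measurable.
by exists M => //; apply: aeW => x _.
Qed.

Lemma test_W1 phi (r : R) : 1 <= r -> test_function Om phi -> W1 r%:E Om phi.
Proof.
move=> r1 tphi; have r0 : 0 < r by exact: lt_le_trans r1.
have [b1 b2] := test_bnd tphi; split; first exact: Linf_in_Lp.
exists (grad phi); first exact: test_is_weak_gradient.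
by apply/in_LpVP => // i; under eq_fun do rewrite mxE; exact: Linf_in_Lp.
Qed.

Lemma test_H10 phi : test_function Om phi -> H10 Om phi.
Proof.
move=> tphi; have Wp := test_W1 r12 tphi; split=> // eps e0; exists phi => //.
have r0 : 0 < 2 :> R by [].
rewrite /H1norm (LpV_wgradB r12)//.
have -> : (fun x => phi x - phi x) = (fun=> 0) by apply/funext => x; rewrite subrr.
rewrite Lp_cst// normr0 mul0r expr0n add0r sqrtr_sqr ger0_norm ?Lp_ge0//.
have -> : (fun x => wgrad Om phi x - wgrad Om phi x) = (fun=> 0).
  by apply/funext => x; rewrite subrr.
by rewrite /LpV; under eq_fun do rewrite enorm0; rewrite Lp_cst// normr0 mul0r.
Qed.

Lemma H10B v w : H10 Om v -> H10 Om w -> H10 Om (fun x => v x - w x).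
Proof.
move=> [Wv hv] [Ww hw]; split; first exact: W1B r12 Wv Ww.
move=> eps e0; have e2 : 0 < eps / 2 by rewrite divr_gt0.
have [phi tphi hphi] := hv _ e2; have [psi tpsi hpsi] := hw _ e2.
exists (fun x => phi x - psi x); first exact: test_functionB.
have -> : (fun x => v x - w x - (phi x - psi x)) =
    (fun x => (v x - phi x) - (w x - psi x)) by apply/funext => x; ring.
apply: (@le_lt_trans _ _ (H1norm Om Om (fun x => v x - phi x) + H1norm Om Om (fun x => w x - psi x))).
  by apply: H1normB => //; apply: W1B r12 _ _ => //; exact: test_W1 r12 _.
by apply: lt_le_trans (ltrD hphi hpsi) _; rewrite -splitr.
Qed.

Lemma H10_approx v (eps : R) : H10 Om v -> 0 < eps ->
  exists phi, [/\ test_function Om phi, Lp 2%:E Om (fun x => v x - phi x) < eps &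
    LpV 2%:E Om (fun x => wgrad Om v x - wgrad Om phi x) < eps].
Proof.
move=> [Wv hv] e0; have [phi tphi hphi] := hv _ e0; exists phi; split=> //.
  exact: le_lt_trans (Lp_le_H1 _ _) hphi.
rewrite -(LpV_wgradB r12)//; last exact: test_W1 r12 _.
exact: le_lt_trans (LpV_le_H1 _ _) hphi.
Qed.

Section parts.
Variables (b : pt -> R) (Gb : pt -> pt) (i : 'I_d).
Hypotheses (bG : is_weak_gradient Om b Gb) (bb : Linf Om b)
  (bGb : Linf Om (fun x => Gb x 0 i)).

(** The defect in the integration by parts, with each function and its derivative as independent
    arguments: this is bilinear and continuous on pairs of L^2 functions, so that a density argument
    applies. *)
Let B (f f' g g' : pt -> R) : R :=
  integ Om (fun x => Gb x 0 i * (f x * g x) + b x * (f' x * g x + f x * g' x)).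

Let L2 (f : pt -> R) := in_Lp 2%:E Om f.

Let B_int f f' g g' : L2 f -> L2 f' -> L2 g -> L2 g' ->
  mu.-integrable Om (EFin \o (fun x => Gb x 0 i * (f x * g x) + b x * (f' x * g x + f x * g' x))).
Proof.
move=> Lf Lf' Lg Lg'; apply: (integrableRD mOm).
  by apply: Linf_mul_int => //; exact: L2_mul.
apply: Linf_mul_int => //; apply: (integrableRD mOm); exact: L2_mul.
Qed.

Let B_le : exists2 M, 0 <= M & forall f f' g g', L2 f -> L2 f' -> L2 g -> L2 g' ->
  `|B f f' g g'| <= M * (Lp 2%:E Om f + Lp 2%:E Om f') * (Lp 2%:E Om g + Lp 2%:E Om g').
Proof.
have [mb [M1 M10 bM1]] := bb; have [mGb [M2 M20 bM2]] := bGb.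
exists (M1 + M2); first exact: addr_ge0.
move=> f f' g g' Lf Lf' Lg Lg'; have r0 : 0 < 2 :> R by [].
have i1 : mu.-integrable Om (EFin \o (fun x => Gb x 0 i * (f x * g x))).
  by apply: Linf_mul_int => //; exact: L2_mul.
have i2 : mu.-integrable Om (EFin \o (fun x => b x * (f' x * g x))).
  by apply: Linf_mul_int => //; exact: L2_mul.
have i3 : mu.-integrable Om (EFin \o (fun x => b x * (f x * g' x))).
  by apply: Linf_mul_int => //; exact: L2_mul.
have -> : B f f' g g' = integ Om (fun x => Gb x 0 i * (f x * g x)) +
   (integ Om (fun x => b x * (f' x * g x)) + integ Om (fun x => b x * (f x * g' x))).
  rewrite /B /integ -RintegralD//.
  rewrite -RintegralD//; first by apply: eq_Rintegral => x _; rewrite mulrDr.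
  exact: (integrableRD mOm i2 i3).
have bnd (c e h : pt -> R) M : 0 <= M -> measurable_fun Om c ->
    {ae mu, forall x, Om x -> `|c x| <= M} -> L2 e -> L2 h ->
    `|integ Om (fun x => c x * (e x * h x))| <= M * (Lp 2%:E Om e * Lp 2%:E Om h).
  move=> M0 mc cM Le Lh.
  have Lce : L2 (fun x => c x * e x) by apply: Linf_mul_Lp => //; split=> //; exists M.
  rewrite /integ (@eq_Rintegral _ _ _ mu Om (fun x => (c x * e x) * h x)); last first.
    by move=> x _; rewrite mulrA.
  apply: le_trans (L2_mul_le mOm Lce Lh) _; rewrite mulrA ler_wpM2r ?Lp_ge0//.
  exact: Linf_mul_le.
have h1 := bnd _ _ _ _ M20 mGb bM2 Lf Lg.
have h2 := bnd _ _ _ _ M10 mb bM1 Lf' Lg.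
have h3 := bnd _ _ _ _ M10 mb bM1 Lf Lg'.
apply: le_trans (ler_normD _ _) _; apply: le_trans (lerD h1 (ler_normD _ _)) _.
apply: le_trans (lerD (lexx _) (lerD h2 h3)) _.
have := Lp_ge0 2%:E Om f; have := Lp_ge0 2%:E Om f'; have := Lp_ge0 2%:E Om g; have := Lp_ge0 2%:E Om g'.
move: (Lp _ _ f) (Lp _ _ f') (Lp _ _ g) (Lp _ _ g') => x1 x2 x3 x4 p4 p3 p2 p1.
rewrite -subr_ge0.
have -> : (M1 + M2) * (x1 + x2) * (x3 + x4) - (M2 * (x1 * x3) + (M1 * (x2 * x3) + M1 * (x1 * x4))) =
  M1 * (x1 * x3) + M1 * (x2 * x4) + M2 * (x1 * x4) + M2 * (x2 * x3) + M2 * (x2 * x4) by ring.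
by rewrite !addr_ge0// !mulr_ge0.
Qed.

Let BBl f f' h h' g g' : L2 f -> L2 f' -> L2 h -> L2 h' -> L2 g -> L2 g' ->
  B (fun x => f x - h x) (fun x => f' x - h' x) g g' = B f f' g g' - B h h' g g'.
Proof.
move=> Lf Lf' Lh Lh' Lg Lg'; rewrite /B /integ -RintegralB//; try exact: B_int.
by apply: eq_Rintegral => x _; ring.
Qed.

Let Bsym f f' g g' : B f f' g g' = B g g' f f'.
Proof. by apply: eq_Rintegral => x _; ring. Qed.

Let pd v x := wgrad Om v x 0 i.

Let L2v v : H10 Om v -> L2 v /\ L2 (pd v).
Proof.
move=> [Wv _]; split; first exact: Wv.1.
by have := W1_wgrad (ltr0n _ 2) Wv; move=> /in_LpVP-/(_ mOm r12); exact.
Qed.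

Let B_test phi psi : test_function Om phi -> test_function Om psi -> B phi (pd phi) psi (pd psi) = 0.
Proof.
move=> tp tq; have [sp _] := tp; have [sq _] := tq.
have tpq : test_function Om (fun x => phi x * psi x) by exact: test_functionM.
have [_ iG wG] := bG; have := wG _ tpq i => E.
have [bp bdp] := test_bnd tp; have [bq bdq] := test_bnd tq.
have [bb1 bb2] := test_bnd tpq.
have i1 : mu.-integrable Om (EFin \o (fun x => Gb x 0 i * (phi x * psi x))).
  by apply: Linf_integrable => //; apply: LinfM => //; exact: LinfM.
have i2 : mu.-integrable Om (EFin \o (fun x => b x * pderiv i (fun x => phi x * psi x) x)).
  by apply: Linf_integrable => //; exact: LinfM.
transitivity (integ Om (fun x => Gb x 0 i * (phi x * psi x)) +
  integ Om (fun x => b x * pderiv i (fun x => phi x * psi x) x)); last by rewrite E addrN.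
rewrite /B /integ -RintegralD//.
have [Lp1 Lp2] := L2v (test_H10 tp); have [Lq1 Lq2] := L2v (test_H10 tq).
apply: ae_Rintegral => //.
- have /integrableP[/measurable_EFinP//] := B_int Lp1 Lp2 Lq1 Lq2.
- by have /integrableP[/measurable_EFinP//] := integrableRD mOm i1 i2.
- apply: filterS2 (wgrad_test tp) (wgrad_test tq) => x h1 h2 Ox.
  rewrite /pd h1// h2// !mxE pderivM; try exact: smooth_differentiable.
  by ring.
Qed.

(** Test functions are dense in H^1_0, and B is continuous in the pair formed by w and its
    derivative. *)
Let B_zero f f' : L2 f -> L2 f' -> (forall psi, test_function Om psi -> B f f' psi (pd psi) = 0) ->
  forall w, H10 Om w -> B f f' w (pd w) = 0.
Proof.
move=> Lf Lf' h w hw; have [M M0 BM] := B_le; have [Lw Lw'] := L2v hw.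
set N := M * (Lp 2%:E Om f + Lp 2%:E Om f').
have N0 : 0 <= N by rewrite mulr_ge0 ?addr_ge0 ?Lp_ge0.
apply/eqP; rewrite -normr_le0; apply/ler_addgt0Pr => e e0; rewrite add0r.
have e1 : 0 < e / (2 * N + 1) by rewrite divr_gt0// ltr_wpDl// mulr_ge0.
have [psi [tpsi h1 h2]] := H10_approx hw e1.
have [Lp1 Lp2] := L2v (test_H10 tpsi).
have -> : B f f' w (pd w) = B f f' (fun x => w x - psi x) (fun x => pd w x - pd psi x).
  by rewrite Bsym [RHS]Bsym BBl// [X in _ - X]Bsym h// subr0.
apply: le_trans (BM _ _ _ _ Lf Lf' (in_LpB mOm r12 Lw Lp1) (in_LpB mOm r12 Lw' Lp2)) _.
rewrite -/N; have h3 : Lp 2%:E Om (fun x => pd w x - pd psi x) <= e / (2 * N + 1).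
  apply: le_trans (ltW h2); apply: Lp_mono => //.
  - by have [] := in_LpB mOm r12 Lw' Lp2.
  - apply: in_LpV_enorm; apply: in_LpVB => //; apply: W1_wgrad => //; [exact: hw.1|exact: test_W1 r12 _].
  - apply: aeW => x _; rewrite (ger0_norm (enorm_ge0 _)).
    by have := enorm_coord (wgrad Om w x - wgrad Om psi x) i; rewrite !mxE.
apply: le_trans (ler_wpM2l N0 (lerD (ltW h1) h3)) _.
have eE : e = (2 * N + 1) * (e / (2 * N + 1)).
  by rewrite mulrCA mulfV ?mulr1// gt_eqF// ltr_wpDl// mulr_ge0.
rewrite [leRHS]eE; move: (e / _) e1 => q q0; rewrite -subr_ge0.
have -> : (2 * N + 1) * q - N * (q + q) = q by ring.
exact: ltW.
Qed.

(** For two test functions this is the definition of the weak gradient of b applied to their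
    product. It passes to H^1_0 in one factor with the other one a test function, then, by symmetry,
    in the other factor. *)
Lemma parts_H10 v w : H10 Om v -> H10 Om w ->
  integ Om (fun x => Gb x 0 i * (v x * w x)) =
  - integ Om (fun x => b x * (wgrad Om v x 0 i * w x + v x * wgrad Om w x 0 i)).
Proof.
move=> hv hw; have [Lv Lv'] := L2v hv; have [Lw Lw'] := L2v hw.
have B0 : B v (pd v) w (pd w) = 0.
  apply: B_zero => // psi tpsi; have [Lp1 Lp2] := L2v (test_H10 tpsi).
  rewrite Bsym; apply: B_zero => // phi tphi; exact: B_test.
apply/eqP; rewrite -addr_eq0 -B0 /B /integ -RintegralD//.
  by apply: Linf_mul_int => //; exact: L2_mul.
by apply: Linf_mul_int => //; apply: (integrableRD mOm); exact: L2_mul.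
Qed.

End parts.
End sobolev.

(** * Geometry of simplices and meshes *)

Section enorm_balls.
Context {R : realType} {k : nat}.
Local Notation d := k.+1.
Local Notation pt := 'rV[R]_k.+1.

Lemma smooth_sqdist (c : pt) : smooth (fun x => dot (x - c) (x - c)).
Proof.
apply: smooth_sum => i.
have sc : smooth (fun x : pt => (x - c) 0 i).
  have -> : (fun x : pt => (x - c) 0 i) = (fun x => x 0 i + - c 0 i).
    by apply/funext => x; rewrite !mxE.
  by apply: smoothD; [exact: smooth_coord|exact: smooth_cst].
exact: smoothM.
Qed.

Lemma continuous_edist (c : pt) : continuous (fun x : pt => enorm (x - c)).
Proof.
move=> v; apply: (@continuous_comp _ _ _ (fun x : pt => dot (x - c) (x - c)) (@Num.sqrt R)).
  exact: smooth_continuous (smooth_sqdist c) v.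
exact: sqrt_continuous.
Qed.

Definition eball (c : pt) (r : R) : set pt := [set x | enorm (x - c) < r].

Lemma open_eball c r : open (eball c r).
Proof.
rewrite /eball (_ : [set x | _] = (fun x : pt => enorm (x - c)) @^-1` [set y | y < r])//.
apply: open_comp; last exact: open_lt.
by move=> x _; exact: continuous_edist.
Qed.

Lemma nbhs_eball (x : pt) r : 0 < r -> nbhs x (eball x r).
Proof.
move=> r0; apply: open_nbhs_nbhs; split; first exact: open_eball.
by rewrite /eball /= subrr enorm0.
Qed.

Lemma closed_eball c r : closed [set x : pt | enorm (x - c) <= r].
Proof.
rewrite (_ : [set x | _] = (fun x : pt => enorm (x - c)) @^-1` [set y | y <= r])//.
apply: closed_comp; last exact: closed_le.
by move=> x _; exact: continuous_edist.
Qed.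

Lemma mx_norm_le_enorm (x : pt) : `|x| <= enorm x.
Proof.
rewrite [leLHS]mx_normrE; apply: bigmax_le; first exact: enorm_ge0.
by move=> [i j] _ /=; rewrite (ord1 i) enorm_coord.
Qed.

Lemma compact_closed_eball c r : compact [set x : pt | enorm (x - c) <= r].
Proof.
apply: bounded_closed_compact; last exact: closed_eball.
exists (enorm c + r); split; first exact: num_real.
move=> M cM x /= xc; rewrite (le_trans (mx_norm_le_enorm x))// ltW// (le_lt_trans _ cM)//.
by rewrite -[x](subrK c) (le_trans (enormD _ _))// addrC lerD2l.
Qed.

Lemma nbhs_enorm (x : pt) (U : set pt) : nbhs x U ->
  exists2 e : R, 0 < e & eball x e `<=` U.
Proof.
move=> /nbhs_ballP[e /= e0 eU]; exists e => // y; rewrite /eball /= => xy.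
apply: eU; apply/row_ballP; split=> // i; rewrite distrC.
by have := enorm_coord (y - x) i; rewrite !mxE => h; exact: le_lt_trans h xy.
Qed.

Lemma measurable_eball c r : measurable (eball c r).
Proof. by apply: measurable_row_open; exact: open_eball. Qed.

End enorm_balls.

Section domain_geometry.
Context {R : realType} {k : nat}.
Local Notation d := k.+1.
Local Notation pt := 'rV[R]_k.+1.
Local Notation mu := (@lebesgue_row R k.+1).
Implicit Types (Om U : set pt) (a b : simplex R k).

Lemma enorm_col' n (v : 'rV[R]_n.+1) : enorm (col' ord0 v) <= enorm v.
Proof.
rewrite -(@ler_pXn2r _ 2)// ?nnegrE ?enorm_ge0// !enorm_sqr /dot big_ord_recl.
rewrite (eq_bigr (fun i => v 0 (lift ord0 i) * v 0 (lift ord0 i))).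
  by rewrite lerDr -expr2 sqr_ge0.
by move=> i _; rewrite !mxE.
Qed.

Lemma enorm_orthogonal (Q : 'M[R]_d) (v : pt) : Q *m Q^T = 1%:M -> enorm (v *m Q) = enorm v.
Proof.
move=> QQ; have dotE (x y : pt) : dot x y = (x *m y^T) 0 0.
  by rewrite mxE; apply: eq_bigr => i _; rewrite mxE.
by rewrite /enorm !dotE trmx_mul mulmxA -(mulmxA v) QQ mulmx1.
Qed.

Lemma col'B n (A B : 'rV[R]_n.+1) : col' ord0 A - col' ord0 B = col' ord0 (A - B).
Proof. by apply/rowP => i; rewrite !mxE. Qed.

(* A Lipschitz domain lies locally on one side of its boundary. *)
Lemma open_sub_lipschitz Om U : open Om -> lipschitz_boundary Om ->
  open U -> U `<=` closure Om -> U `<=` Om.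
Proof.
move=> oOm lip oU UO x Ux; apply: contrapT => nOx.
have bx : boundary Om x by split; [exact: UO|rewrite /interior => /nbhs_singleton].
have [Q [phi [L [r [QQ r0 phiL AE]]]]] := lip _ bx.
have QQ' : Q^T *m Q = 1%:M by exact: mulmx1C.
(* The unit vector which Q turns into the first axis, the direction in which Om lies above the
   graph. *)
pose w : pt := delta_mx 0 ord0 *m Q^T.
have wQ : w *m Q = delta_mx 0 ord0 by rewrite /w -mulmxA QQ' mulmx1.
have ew : enorm w = 1.
  rewrite -(enorm_orthogonal w QQ) wQ /enorm /dot (bigD1 ord0)//= big1.
    by rewrite !mxE !eqxx mulr1 addr0 sqrtr1.
  by move=> i i0; rewrite !mxE (negbTE i0) andbF mul0r.
have [e e0 eU] := nbhs_enorm (open_nbhs_nbhs (conj oU Ux)).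
pose t := Num.min e r / 2.
have t0 : 0 < t by rewrite divr_gt0// lt_min e0 r0.
have tlt : t < Num.min e r by rewrite ltr_pdivrMr// ltr_pMr ?lt_min ?e0 ?r0// ltr1n.
have te : t < e by rewrite (lt_le_trans tlt)// ge_min lexx.
have tr : t < r by rewrite (lt_le_trans tlt)// ge_min lexx orbT.
pose y := x - t *: w.
have yx : enorm (y - x) = t.
  by rewrite /y addrAC subrr add0r enormN enormZ ew mulr1 gtr0_norm.
have Uy : U y by apply: eU; rewrite /eball /= yx.
have yQ : y *m Q = x *m Q - t *: delta_mx 0 ord0.
  by rewrite /y mulmxBl -scalemxAl wQ.
have cy : col' ord0 (y *m Q) = col' ord0 (x *m Q).
  apply/rowP => i; rewrite yQ !mxE.
  by rewrite (_ : (lift ord0 i == ord0) = false)// andbF mulr0 subr0.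
have y0 : (y *m Q) 0 ord0 = (x *m Q) 0 ord0 - t.
  by rewrite yQ !mxE !eqxx mulr1.
have nphi : (x *m Q) 0 ord0 <= phi (col' ord0 (x *m Q)).
  rewrite leNgt; apply/negP => h; apply: nOx; apply/AE => //.
  by rewrite subrr enorm0.
(* The point y lies at depth at least t below the graph of the Lipschitz function, while a
   displacement smaller than [del] changes height and graph together by less than t: no point of Om
   is that close to y. *)
pose del := Num.min (r - t) (t / (`|L| + 1 + 1)).
have L0 : 0 < `|L| + 1 + 1 by rewrite ltr_wpDl// addr_ge0.
have del0 : 0 < del by rewrite lt_min subr_gt0 tr divr_gt0.
have [z [Omz]] : Om `&` eball y del !=set0.
  by apply: (UO _ Uy); exact: nbhs_eball.
rewrite /eball /= => zy.
have zr : enorm (z - x) < r.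
  rewrite -(subrK y z) -addrA (le_lt_trans (enormD _ _))// yx -ltrBrDr.
  by rewrite (lt_le_trans zy)// /del ge_min lexx.
have zt : enorm (z - y) * (`|L| + 1 + 1) < t.
  by rewrite -ltr_pdivlMr// (lt_le_trans zy)// /del ge_min lexx orbT.
move: Omz; rewrite AE// => h.
have h1 : `|phi (col' ord0 (z *m Q)) - phi (col' ord0 (y *m Q))| <= `|L| * enorm (z - y).
  apply: le_trans (phiL _ _) _; apply: (le_trans (ler_wpM2r (enorm_ge0 _) (ler_norm L))).
  rewrite ler_wpM2l// col'B -mulmxBl (le_trans (enorm_col' _))//.
  by rewrite enorm_orthogonal.
have h2 : `|(z *m Q) 0 ord0 - (y *m Q) 0 ord0| <= enorm (z - y).
  rewrite -(enorm_orthogonal _ QQ) (mulmxBl z y Q).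
  by have := enorm_coord (z *m Q - y *m Q) ord0; rewrite !mxE.
move: h1 h2; rewrite !ler_norml cy => /andP[h1 _] /andP[_ h2].
have e1 := enorm_ge0 (z - y).
have : `|L| * enorm (z - y) + enorm (z - y) <= enorm (z - y) * (`|L| + 1 + 1).
  by rewrite -subr_ge0 (_ : _ - _ = enorm (z - y)) ?enorm_ge0//; ring.
lra.
Qed.

Lemma mul_bary_mx a (l : 'rV[R]_d.+1) :
  l *m bary_mx a = row_mx (l *m (const_mx 1 : 'M[R]_(d.+1, 1))) (l *m a).
Proof. exact: (@mul_mx_row R 1 d.+1 1 d). Qed.

Lemma baryK a (x : pt) : Defs.nondegenerate a ->
  bary a x *m a = x /\ \sum_i bary a x 0 i = 1.
Proof.
move=> na; have h' : row_mx (bary a x *m (const_mx 1 : 'M[R]_(d.+1, 1))) (bary a x *m a)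
    = row_mx (const_mx 1 : 'M[R]_(1, 1)) x.
  by apply: etrans (esym (mul_bary_mx _ _)) _; rewrite /bary mulmxKV.
have [h1 h2] := eq_row_mx h'; split=> //.
move: h1 => /matrixP/(_ 0 0); rewrite !mxE => <-.
by apply: eq_bigr => i _; rewrite !mxE mulr1.
Qed.

Lemma bary_unique a (l : 'rV[R]_d.+1) : Defs.nondegenerate a -> \sum_i l 0 i = 1 ->
  bary a (l *m a) = l.
Proof.
move=> na l1; rewrite /bary.
have -> : row_mx (const_mx 1 : 'M[R]_(1, 1)) (l *m a) = (l *m bary_mx a : 'rV_(1 + d)).
  rewrite mul_bary_mx; congr row_mx; apply/matrixP => i j; rewrite !ord1 !mxE.
  by rewrite -[LHS]l1; apply: eq_bigr => m _; rewrite [X in _ * X]mxE mulr1.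
by rewrite mulmxK.
Qed.

Lemma hullE a (x : pt) : Defs.nondegenerate a -> hull a x <-> forall i, 0 <= bary a x 0 i.
Proof.
move=> na; split=> [[l [l0 l1 ->]] i|h]; first by rewrite bary_unique.
by have [h1 h2] := baryK x na; exists (bary a x).
Qed.

Definition bgrad a i : pt := \row_j (dsubmx (invmx (bary_mx a) : 'M[R]_(1 + d, d.+1))) j i.
Definition bcst a i : R := (usubmx (invmx (bary_mx a) : 'M[R]_(1 + d, d.+1))) 0 i.

Lemma baryE a (x : pt) i : bary a x 0 i = dot (bgrad a i) x + bcst a i.
Proof.
have -> : bary a x =
    const_mx 1 *m usubmx (invmx (bary_mx a) : 'M[R]_(1 + d, d.+1)) +
    x *m dsubmx (invmx (bary_mx a) : 'M[R]_(1 + d, d.+1)).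
  by rewrite -[RHS](@mul_row_col R 1 1 d d.+1) (@vsubmxK R 1 d d.+1).
rewrite mxE addrC; congr (_ + _).
  by rewrite mxE; apply: eq_bigr => j _; rewrite [in RHS]mxE mulrC.
by rewrite mxE big_ord_recl big_ord0 addr0 mxE mul1r.
Qed.

Lemma baryD a (x v : pt) i : bary a (x + v) 0 i = bary a x 0 i + dot (bgrad a i) v.
Proof. by rewrite !baryE dotDr addrAC. Qed.

Lemma bary_vertex a j : Defs.nondegenerate a -> bary a (row j a) = delta_mx 0 j.
Proof.
move=> na; rewrite rowE bary_unique// (bigD1 j)//= big1 ?addr0 ?mxE ?eqxx//.
by move=> i ij; rewrite mxE (negbTE ij) andbF.
Qed.

Lemma bgrad_neq0 a i : Defs.nondegenerate a -> bgrad a i != 0.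
Proof.
move=> na; apply/eqP => g0.
have [j ji] : exists j, j != i.
  by exists (lift i ord0); rewrite eq_sym neq_lift.
have := baryD a (row j a) (row i a - row j a) i.
rewrite g0 dot0l addr0 addrC subrK !bary_vertex// !mxE !eqxx eq_sym (negbTE ji)/=.
by move/eqP; rewrite oner_eq0.
Qed.

Lemma continuous_bary a i : continuous (fun x => bary a x 0 i).
Proof.
have -> : (fun x => bary a x 0 i) = (fun x => dot (bgrad a i) x + bcst a i).
  by apply/funext => x; exact: baryE.
apply: smooth_continuous; apply: smoothD; last exact: smooth_cst.
apply: smooth_sum => j; apply: smoothM; [exact: smooth_cst|exact: smooth_coord].
Qed.

Lemma closed_hull a : Defs.nondegenerate a -> closed (hull a).
Proof.
move=> na; rewrite (_ : hull a = \bigcap_(i in [set: 'I_d.+1]) [set x | 0 <= bary a x 0 i]).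
  apply: closed_bigI => i _.
  rewrite (_ : [set x | _] = (fun x => bary a x 0 i) @^-1` [set y | 0 <= y])//.
  apply: closed_comp; [by move=> x _; exact: continuous_bary|exact: closed_ge].
by apply/seteqP; split=> x; [move=> /hullE h i _; exact: h|move=> h; apply/hullE => // i; exact: h].
Qed.

Lemma measurable_hull a : Defs.nondegenerate a -> measurable (hull a).
Proof. by move=> na; apply: measurable_row_closed; exact: closed_hull. Qed.

Definition open_hull a : set pt := [set x | forall i, 0 < bary a x 0 i].

Lemma open_open_hull a : open (open_hull a).
Proof.
rewrite openE => x xa.
apply: (@filter_forall _ _ _ (nbhs x) _) => i.
have op : open [set x : pt | 0 < bary a x 0 i].
  rewrite (_ : [set x | _] = (fun x => bary a x 0 i) @^-1` [set y | 0 < y])//.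
  apply: open_comp; [by move=> y _; exact: continuous_bary|exact: open_gt].
exact: open_nbhs_nbhs (conj op (xa i)).
Qed.

Lemma open_hull_sub a : Defs.nondegenerate a -> open_hull a `<=` (hull a)°.
Proof.
move=> na x xa; have : nbhs x (open_hull a).
  by apply: open_nbhs_nbhs; split=> //; exact: open_open_hull.
by apply: filterS => y ya; apply/hullE => // i; exact: ltW.
Qed.

Lemma hull_row_bound a : exists M : R, forall x, hull a x -> forall i, `|x 0 i| <= M.
Proof.
exists (\sum_j \sum_i `|a i j|) => x [l [l0 l1 ->]] j.
rewrite mxE (le_trans (ler_norm_sum _ _ _))// (bigD1 j)//= ler_wpDr//.
  by apply: sumr_ge0 => m _; apply: sumr_ge0.
apply: ler_sum => i _; rewrite normrM ler_piMl// ger0_norm// -l1.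
by rewrite (bigD1 i)//= lerDl sumr_ge0.
Qed.

(** A point of the simplex outside its interior has a vanishing barycentric coordinate.
    [null_translates], along the normal [bgrad a i], shows that each of these finitely many faces is
    null. *)
Lemma hull_interior_ae a : Defs.nondegenerate a ->
  {ae mu, forall x, hull a x -> (hull a)° x}.
Proof.
move=> na; have [M hM] := hull_row_bound a.
pose N i : set pt := hull a `&` [set x | bary a x 0 i = 0].
have mN i : measurable (N i).
  apply: measurableI; first exact: measurable_hull.
  apply: measurable_row_closed.
  rewrite (_ : [set x | _] = (fun x => bary a x 0 i) @^-1` [set 0])//.
  by apply: closed_comp; [move=> x _; exact: continuous_bary|exact: closed_eq].
have N0 i : mu (N i) = 0%E.
  apply: (null_translates (v := bgrad a i) (M := M)) => //.
    by move=> x [hx _]; exact: hM.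
  move=> x s [_ /= x0] [_ /=]; rewrite baryD x0 add0r dotZr => /eqP.
  rewrite mulf_eq0 => /orP[/eqP//|/eqP/dot_eq0 g0].
  by have := bgrad_neq0 i na; rewrite g0 eqxx.
exists (\bigcup_(i in [set: 'I_d.+1]) N i); split.
- by apply: fin_bigcup_measurable => // i _.
- apply/eqP; rewrite -measure_le0.
  have : mu.-negligible (\bigcup_(i in [set: 'I_d.+1]) N i).
    rewrite (_ : \bigcup_(i in _) N i = \big[setU/set0]_(i < d.+1) N i).
      by elim/big_ind: _ => //; [exact: negligible_set0|move=> A B; exact: negligibleU|move=> i _; exists (N i); split].
    by rewrite -bigcup_seq; apply/seteqP; split=> x [i _ Ni]; exists i => //=; rewrite mem_index_enum.
  move=> /negligibleP ->//; apply: fin_bigcup_measurable => // i _; exact: mN.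
- move=> x /= /not_implyP[hx nix]; apply: contrapT => nN; apply: nix.
  apply: open_hull_sub => // i; rewrite lt_neqAle.
  move: (hx) => /hullE-/(_ na i) ->; rewrite andbT; apply/eqP => /esym b0.
  by apply: nN; exists i.
Qed.

End domain_geometry.

Section mesh_geometry.
Context {R : realType} {k : nat}.
Local Notation d := k.+1.
Local Notation pt := 'rV[R]_k.+1.
Local Notation mu := (@lebesgue_row R k.+1).
Implicit Types (Om : set pt) (a b : simplex R k) (T : seq (simplex R k)).

Lemma hull_diam a (x y : pt) : hull a x -> hull a y -> enorm (x - y) <= diam (hull a).
Proof.
move=> hx hy; apply: ub_le_sup; last by exists (x, y).
have [M hM] := hull_row_bound a.
exists (\sum_(i < d) (M + M)) => _ [[z w] /= [hz hw] <-].
apply: le_trans (enorm_le_sum _) _; apply: ler_sum => i _.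
by rewrite !mxE (le_trans (ler_normB _ _))// lerD// hM.
Qed.

Lemma diam_le m (e : 'M[R]_(m.+1, d)) (M : R) :
  (forall x y, hull e x -> hull e y -> enorm (x - y) <= M) -> diam (hull e) <= M.
Proof.
move=> hM; apply: ge_sup; last by move=> _ [[x y] [/= hx hy] <-]; exact: hM.
have h0 : hull e (row ord0 e).
  exists (delta_mx 0 ord0); split; last by rewrite rowE.
    by move=> i; rewrite mxE ler0n.
  rewrite (bigD1 ord0)//= big1 ?addr0 ?mxE ?eqxx// => i i0.
  by rewrite mxE (negbTE i0) andbF.
by exists (enorm (row ord0 e - row ord0 e)); exists (row ord0 e, row ord0 e).
Qed.

Lemma hull_convex a (x w : pt) (s : R) : Defs.nondegenerate a -> 0 <= s <= 1 ->
  hull a x -> hull a (x + w) -> hull a (x + s *: w).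
Proof.
move=> na /andP[s0 s1] /hullE-/(_ na) hx /hullE-/(_ na) hy; apply/hullE => // i.
have := hx i; have := hy i; rewrite !baryD dotZr => h1 h2.
rewrite (_ : _ + _ = (1 - s) * bary a x 0 i + s * (bary a x 0 i + dot (bgrad a i) w)).
  by rewrite addr_ge0// mulr_ge0// subr_ge0.
by ring.
Qed.

Definition barycenter a : pt := (const_mx (k.+2%:R^-1) : 'rV[R]_d.+1) *m a.

Lemma bary_barycenter a : Defs.nondegenerate a -> bary a (barycenter a) = const_mx k.+2%:R^-1.
Proof.
move=> na; rewrite bary_unique//.
rewrite (eq_bigr (fun=> k.+2%:R^-1)); last by move=> i _; rewrite mxE.
by rewrite sumr_const card_ord -[LHS]mulr_natr mulVf// pnatr_eq0.
Qed.

Lemma open_hull_barycenter a : Defs.nondegenerate a -> open_hull a (barycenter a).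
Proof. by move=> na i; rewrite bary_barycenter// mxE invr_gt0. Qed.

Lemma hull_closure_open a : Defs.nondegenerate a -> hull a `<=` closure (open_hull a).
Proof.
move=> na x /hullE-/(_ na) hx U /nbhs_enorm[e e0 eU].
(* Moving from x towards the barycentre makes all barycentric coordinates positive; t keeps the
   displacement below e. *)
pose c := barycenter a; pose t := e / (e + enorm (c - x)).
have D0 : 0 < e + enorm (c - x) by rewrite ltr_wpDr// enorm_ge0.
have t0 : 0 < t by rewrite divr_gt0.
have t1 : t <= 1 by rewrite ler_pdivrMr// mul1r lerDl enorm_ge0.
exists (x + (t / 2) *: (c - x)); split.
  move=> i; rewrite baryD dotZr.
  have := open_hull_barycenter na i; rewrite -/c -[in bary a c](subrK x c) addrC baryD => h.
  rewrite (_ : _ + _ = (1 - t / 2) * bary a x 0 i +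
     t / 2 * (bary a x 0 i + dot (bgrad a i) (c - x))); last by ring.
  rewrite ltr_wpDl ?mulr_gt0 ?divr_gt0 ?invr_gt0// mulr_ge0// subr_ge0.
  by rewrite ler_pdivrMr// mul1r (le_trans t1)// ler1n.
apply: eU; rewrite /eball /= addrAC subrr add0r enormZ ger0_norm; last first.
  by rewrite divr_ge0// ltW.
have : t * enorm (c - x) <= e.
  by rewrite /t mulrAC ler_pdivrMr// ler_pM2l// lerDr ltW.
move=> h; apply: (@le_lt_trans _ _ (e / 2)).
  by rewrite mulrAC ler_pM2r// invr_gt0.
by rewrite ltr_pdivrMr// ltr_pMr// ltr1n.
Qed.

(** The supremum in [inscribed_diam] is not shown to be attained. A ball whose diameter exceeds half
    of it is enough, whence the divisor 4 for the radius. *)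
Lemma inscribed_ball a : Defs.nondegenerate a ->
  0 < inscribed_diam (hull a) /\
  exists c : pt, forall x, enorm (x - c) <= inscribed_diam (hull a) / 4 -> hull a x.
Proof.
move=> na; pose S : set R := [set 2 * r | r in
    [set r | 0 <= r /\ exists c : pt, [set x | enorm (x - c) <= r] `<=` hull a]].
have [r r0 hr] : exists2 r : R, 0 < r & [set x | enorm (x - barycenter a) <= r] `<=` hull a.
  have [e e0 he] : exists2 e : R, 0 < e & eball (barycenter a) e `<=` hull a.
    apply: nbhs_enorm; apply: open_hull_sub => //; exact: open_hull_barycenter.
  exists (e / 2); first by rewrite divr_gt0.
  move=> x /= xe; apply: he; rewrite /eball /= (le_lt_trans xe)//.
  by rewrite ltr_pdivrMr// ltr_pMr// ltr1n.
have hS : has_sup S.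
  split; first by exists (2 * r); exists r => //; split; [exact: ltW|exists (barycenter a)].
  exists (2 * diam (hull a)) => _ [s [s0 [c hc]] <-]; rewrite ler_pM2l//.
  have cc : hull a c by apply: hc; rewrite /= subrr enorm0.
  pose e : pt := delta_mx 0 ord0.
  have ee : enorm e = 1.
    rewrite /enorm /dot (bigD1 ord0)//= big1; first by rewrite !mxE !eqxx mulr1 addr0 sqrtr1.
    by move=> i i0; rewrite !mxE (negbTE i0) andbF mul0r.
  have := @hull_diam a (c + s *: e) c.
  rewrite [_ + _ - _]addrAC subrr add0r enormZ ee mulr1 ger0_norm//; apply=> //.
  by apply: hc; rewrite /= addrAC subrr add0r enormZ ee mulr1 ger0_norm.
have i0 : 0 < inscribed_diam (hull a).
  apply: (@lt_le_trans _ _ (2 * r)); first by rewrite mulr_gt0.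
  apply: ub_le_sup; first by case: hS.
  by exists r => //; split; [exact: ltW|exists (barycenter a)].
split=> //.
have [_ [s [s0 [c hc]] <-]] := sup_adherent (divr_gt0 i0 (ltr0n R 2)) hS.
rewrite -/(inscribed_diam (hull a)) => h; exists c => x xc; apply: hc => /=.
by apply: le_trans xc _; move: h; set I := inscribed_diam _; lra.
Qed.

Section family.
Variables (Om : set pt) (J : Type) (Th : J -> seq (simplex R k)) (sigma beta0 : R).
Hypotheses (hOm : polyhedral_domain Om) (hTh : regular_family Om Th sigma beta0).

Lemma domain_open : open Om. Proof. by case: hOm => -[]. Qed.

Lemma domain_neq0 : Om !=set0. Proof. by case: hOm => -[]. Qed.

Lemma domain_coord_bound : exists2 M : R, 0 <= M & forall x, closure Om x -> forall i, `|x 0 i| <= M.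
Proof.
have [[_ _ bO _ _] _] := hOm; case: bO => M [_ hM].
have M1 : M < `|M| + 1 by rewrite (le_lt_trans (ler_norm M))// ltrDl.
exists (`|M| + 1 + 1) => [|x cx i]; first by rewrite !addr_ge0.
have [y [Oy]] := cx _ (nbhs_eball x ltr01); rewrite /eball /= => yx.
have := hM _ M1 y Oy; rewrite /= [leLHS]mx_normrE => h.
have hy : `|y 0 i| <= `|M| + 1.
  by apply: le_trans h; apply: (le_bigmax _ (fun ij : 'I_1 * 'I_d => `|y ij.1 ij.2|) (0, i)).
have := enorm_coord (y - x) i; rewrite !mxE => h2.
have := ler_normB (y 0 i) (y 0 i - x 0 i); rewrite subKr => /le_trans; apply.
by rewrite lerD// (le_trans h2)// ltW.
Qed.

Lemma domain_lty : (mu Om < +oo)%E.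
Proof.
have [M _ hM] := domain_coord_bound.
apply: (@lebesgue_row_lty _ _ _ M); first exact: measurable_row_open domain_open.
by move=> x Ox; apply: hM; exact: subset_closure.
Qed.

Variable j : J.

Lemma mesh_nondegenerate a : a \in Th j -> Defs.nondegenerate a.
Proof. by move=> aT; have [_ /(_ j)[[_ + _ _] _]] := hTh; apply. Qed.

Lemma mesh_cover : closure Om = \bigcup_(a in [set` Th j]) hull a.
Proof. by have [_ /(_ j)[[]]] := hTh. Qed.

Lemma hull_sub_closure a : a \in Th j -> hull a `<=` closure Om.
Proof. by move=> aT x ax; rewrite mesh_cover; exists a. Qed.

Lemma interior_hull_sub a : a \in Th j -> (hull a)° `<=` Om.
Proof.
move=> aT; apply: open_sub_lipschitz; first exact: domain_open.
- by have [[]] := hOm.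
- exact: open_interior.
- by move=> x /interior_subset; exact: hull_sub_closure.
Qed.

Lemma open_sub_domain U : open U -> U `<=` closure Om -> U `<=` Om.
Proof. by apply: open_sub_lipschitz; [exact: domain_open|have [[]] := hOm]. Qed.

Lemma mesh_exists : exists a, a \in Th j.
Proof.
have [x /subset_closure] := domain_neq0; rewrite mesh_cover => -[a aT _]; by exists a.
Qed.

Lemma diam_mesh a : a \in Th j -> diam (hull a) <= mesh_size (Th j).
Proof. by move=> aT; apply: (@le_bigmax_seq _ _ _ _ _ a xpredT (fun a => diam (hull a))). Qed.

Lemma mesh_diam a (x y : pt) : a \in Th j -> hull a x -> hull a y ->
  enorm (x - y) <= mesh_size (Th j).
Proof. by move=> aT hx hy; apply: le_trans (diam_mesh aT); exact: hull_diam. Qed.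

(** Uniform regularity gives beta0 h <= diam <= sigma [inscribed_diam], and [inscribed_ball]
    provides the radius [inscribed_diam] / 4. The maximum with 1 keeps the denominator positive. *)
Definition ball_ratio : R := beta0 / (4 * Num.max sigma 1).

Lemma beta0_gt0 : 0 < beta0. Proof. by case: hTh. Qed.

Lemma ball_ratio_gt0 : 0 < ball_ratio.
Proof. by rewrite divr_gt0 ?beta0_gt0// mulr_gt0// lt_max ltr01 orbT. Qed.

Lemma mesh_ball a : a \in Th j ->
  exists c : pt, forall x, enorm (x - c) <= ball_ratio * mesh_size (Th j) -> hull a x.
Proof.
move=> aT; have [i0 [c hc]] := inscribed_ball (mesh_nondegenerate aT).
exists c => x xc; apply: hc; apply: le_trans xc _.
have [_ /(_ j)[_ /(_ a aT)[h1 h2]]] := hTh.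
rewrite /ball_ratio mulrAC ler_pdivrMr; last by rewrite mulr_gt0// lt_max ltr01 orbT.
apply: le_trans h2 _; move: h1; rewrite ler_pdivrMr// => /le_trans; apply.
rewrite [leRHS](_ : _ = Num.max sigma 1 * inscribed_diam (hull a)); last by field.
by rewrite ler_pM2r// le_max lexx.
Qed.

Lemma mesh_gt0 : 0 < mesh_size (Th j).
Proof.
have [a aT] := mesh_exists; apply: lt_le_trans (diam_mesh aT).
have [i0 [c hc]] := inscribed_ball (mesh_nondegenerate aT).
pose e : pt := delta_mx 0 ord0; set r := inscribed_diam (hull a) in i0 hc.
have ee : enorm e = 1.
  rewrite /enorm /dot (bigD1 ord0)//= big1; first by rewrite !mxE !eqxx mulr1 addr0 sqrtr1.
  by move=> i i0'; rewrite !mxE (negbTE i0') andbF mul0r.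
have r4 : 0 < r / 4 by rewrite divr_gt0.
apply: (@lt_le_trans _ _ (r / 4)) => //.
have := @hull_diam a (c + (r / 4) *: e) c.
rewrite [_ + _ - _]addrAC subrr add0r enormZ ee mulr1 gtr0_norm//; apply.
  by apply: hc; rewrite addrAC subrr add0r enormZ ee mulr1 gtr0_norm.
by apply: hc; rewrite subrr enorm0 ltW.
Qed.

Lemma mesh_ae : {ae mu, forall x, Om x -> exists2 a, a \in Th j & (hull a)° x}.
Proof.
suff : forall s : seq (simplex R k), (forall a, a \in s -> Defs.nondegenerate a) ->
    {ae mu, forall x, forall a, a \in s -> hull a x -> (hull a)° x}.
  move=> /(_ _ mesh_nondegenerate); apply: filterS => x h Ox.
  have := subset_closure Ox; rewrite mesh_cover => -[a aT ax].
  by exists a => //; exact: h.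
elim=> [_|a s IHs hs]; first by apply: filterE.
have h1 := hull_interior_ae (hs a (mem_head _ _)).
have h2 := IHs (fun b bs => hs b (mem_behead (s := a :: s) bs)).
apply: filterS2 h1 h2 => x h1 h2 b; rewrite inE => /orP[/eqP->|]; [exact: h1|exact: h2].
Qed.

End family.

(** The bound is taken at least 1, so that its powers increase with the exponent. *)
Lemma mesh_bound Om J (Th : J -> seq (simplex R k)) sigma beta0 :
  polyhedral_domain Om -> regular_family Om Th sigma beta0 ->
  exists2 H : R, 1 <= H & forall j, mesh_size (Th j) <= H.
Proof.
move=> hOm hTh; have [M M0 hM] := domain_coord_bound hOm.
exists (1 + \sum_(i < d) (M + M)).
  by rewrite lerDl; apply: sumr_ge0 => i _; rewrite addr_ge0.
move=> j; rewrite /mesh_size big_seq; apply: bigmax_le => [|a aT].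
  by rewrite addr_ge0// sumr_ge0// => i _; rewrite addr_ge0.
rewrite (@le_trans _ _ (\sum_(i < d) (M + M)))// ?lerDr//.
apply: diam_le => x y hx hy; apply: le_trans (enorm_le_sum _) _; apply: ler_sum => i _.
by rewrite !mxE (le_trans (ler_normB _ _))// lerD// hM//; exact: (hull_sub_closure hTh aT).
Qed.

End mesh_geometry.

(** * Piecewise polynomials *)

Section polynomial_functions.
Context {R : realType} {k : nat}.
Local Notation d := k.+1.
Local Notation pt := 'rV[R]_k.+1.
Implicit Types (f g : pt -> R) (x v : pt).

(** Polynomial functions with a bound on the degree, generated syntactically. Only smoothness,
    stability under differentiation and restriction to lines are needed, and each follows by
    induction on the derivation. *)
Inductive polyf : nat -> (pt -> R) -> Prop :=
| polyf_cst n c : polyf n (fun=> c)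
| polyf_coord n i : polyf n.+1 (fun x => x 0 i)
| polyfD n f g : polyf n f -> polyf n g -> polyf n (fun x => f x + g x)
| polyfM m n f g : polyf m f -> polyf n g -> polyf (m + n) (fun x => f x * g x).

Lemma polyf_le m n f : (m <= n)%N -> polyf m f -> polyf n f.
Proof.
move=> mn pf; elim: pf n mn => {m f}.
- by move=> m c n _; exact: polyf_cst.
- by move=> m i [//|n] _; exact: polyf_coord.
- by move=> m f g _ IHf _ IHg n mn; apply: polyfD; [exact: IHf|exact: IHg].
- move=> m m' f g _ IHf _ IHg n mn.
  rewrite -(subnKC (leq_trans (leq_addr m' m) mn)); apply: polyfM; first exact: IHf.
  by apply: IHg; rewrite leq_subRL// (leq_trans (leq_addr m' m) mn).
Qed.

Lemma polyf_smooth n f : polyf n f -> smooth f.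
Proof.
elim=> {n f} [n c|n i|n f g _ sf _ sg|m n f g _ sf _ sg].
- exact: smooth_cst.
- exact: smooth_coord.
- exact: smoothD.
- exact: smoothM.
Qed.

Lemma polyfZ n f c : polyf n f -> polyf n (fun x => c * f x).
Proof. by move=> pf; apply: (@polyfM 0) => //; exact: polyf_cst. Qed.

Lemma polyfN n f : polyf n f -> polyf n (fun x => - f x).
Proof.
move=> pf; rewrite (_ : (fun x => _) = (fun x => -1 * f x)); first exact: polyfZ.
by apply/funext => x; rewrite mulN1r.
Qed.

Lemma polyfB n f g : polyf n f -> polyf n g -> polyf n (fun x => f x - g x).
Proof. by move=> pf pg; apply: polyfD => //; exact: polyfN. Qed.

Lemma polyf_sum n (I : Type) (s : seq I) (F : I -> pt -> R) :
  (forall i, polyf n (F i)) -> polyf n (fun x => \sum_(i <- s) F i x).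
Proof.
move=> pF; elim: s => [|i s IHs].
  rewrite (_ : (fun x => _) = fun=> 0); first exact: polyf_cst.
  by apply/funext => x; rewrite big_nil.
rewrite (_ : (fun x => _) = fun x => F i x + \sum_(i <- s) F i x); first exact: polyfD.
by apply/funext => x; rewrite big_cons.
Qed.

Lemma polyf_pderiv n f i : polyf n f -> polyf n (pderiv i f).
Proof.
elim=> {n f} [n c|n j|n f g pf IHf pg IHg|m n f g pf IHf pg IHg].
- rewrite (_ : pderiv i _ = fun=> 0); first exact: polyf_cst.
  by apply/funext => x; exact: pderiv_cst.
- rewrite (_ : pderiv i _ = fun=> (i == j)%:R); first exact: polyf_cst.
  by apply/funext => x; exact: pderiv_coord.
- rewrite (_ : pderiv i _ = fun x => pderiv i f x + pderiv i g x); first exact: polyfD.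
  by apply/funext => x; apply: pderivD; apply: smooth_differentiable;
    [exact: (polyf_smooth pf)|exact: (polyf_smooth pg)].
- rewrite (_ : pderiv i _ = fun x => f x * pderiv i g x + g x * pderiv i f x).
    by apply: polyfD; [exact: polyfM|rewrite addnC; exact: polyfM].
  by apply/funext => x; apply: pderivM; apply: smooth_differentiable;
    [exact: (polyf_smooth pf)|exact: (polyf_smooth pg)].
Qed.

Lemma polyf_dot (q : pt) n : polyf n.+1 (fun x => dot q x).
Proof. by apply: polyf_sum => i; apply: polyfZ; exact: polyf_coord. Qed.

Lemma polyf_bary (a : simplex R k) i n : polyf n.+1 (fun x => bary a x 0 i).
Proof.
rewrite (_ : (fun x => _) = fun x => dot (bgrad a i) x + bcst a i).
  by apply: polyfD; [exact: polyf_dot|exact: polyf_cst].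
by apply/funext => x; exact: baryE.
Qed.

Lemma polyf_bubble (a : simplex R k) : polyf k.+2 (bubble a).
Proof.
rewrite (_ : bubble a = fun x => \prod_(i <- enum 'I_d.+1) bary a x 0 i); last first.
  by apply/funext => x; rewrite big_enum.
rewrite -[in polyf _](size_enum_ord k.+2); elim: (enum _) => [|i s IHs].
  rewrite (_ : (fun x => _) = fun=> 1); first exact: polyf_cst.
  by apply/funext => x; rewrite big_nil.
rewrite (_ : (fun x => _) = fun x => bary a x 0 i * \prod_(i <- s) bary a x 0 i).
  by apply: (@polyfM 1%N) => //; exact: polyf_bary.
by apply/funext => x; rewrite big_cons.
Qed.

(** Restriction to lines reduces growth estimates in several variables to univariate polynomials of
    bounded degree. *)
Lemma polyf_line n f x v : polyf n f ->
  exists p : {poly R}, (size p <= n.+1)%N /\ forall t : R, f (x + t *: v) = p.[t].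
Proof.
elim=> {n f} [n c|n i|n f g _ [p [sp hp]] _ [q [sq hq]]|m n f g _ [p [sp hp]] _ [q [sq hq]]].
- exists c%:P; split; last by move=> t; rewrite hornerC.
  by rewrite (leq_trans (size_polyC_leq1 _)).
- exists ((v 0 i)%:P * 'X + (x 0 i)%:P); split.
    by rewrite size_MXaddC; case: ifP => // _; rewrite ltnS (leq_trans (size_polyC_leq1 _)).
  by move=> t; rewrite !hornerE !mxE addrC mulrC.
- exists (p + q); split; last by move=> t; rewrite hornerD hp hq.
  by rewrite (leq_trans (size_polyD _ _))// geq_max sp sq.
- exists (p * q); split; last by move=> t; rewrite hornerM hp hq.
  by rewrite (leq_trans (size_polyMleq _ _))//; move: sp sq; case: (size p) => [_|a am] sq /=;
    [rewrite add0n (leq_trans (leq_pred _))// (leq_trans sq)// ltnS leq_addl|rewrite -addnS leq_add].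
Qed.

End polynomial_functions.

(** * Lipschitz bounds glued along a closed cover of an interval *)

Section closed_covers.
Context {R : realType}.

(* Let m be the last point of the set containing a; the other sets of the cover
   are closed and cover ]m, b], hence also m. *)
Lemma lip_closed_cover (I : choiceType) (s : seq I) (F : I -> set R) (phi : R -> R) (L : R) :
  (forall i, i \in s -> closed (F i)) ->
  (forall i, i \in s -> forall x y, F i x -> F i y -> x <= y -> `|phi y - phi x| <= L * (y - x)) ->
  forall a b, a <= b -> (forall t, a <= t <= b -> exists2 i, i \in s & F i t) ->
  `|phi b - phi a| <= L * (b - a).
Proof.
have [n sn] := ubnP (size s); elim: n s sn => // n IHn s sn clF lipF a b ab cov.
have [i si Fa] : exists2 i, i \in s & F i a by apply: cov; rewrite lexx.
pose A := F i `&` [set t | a <= t <= b].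
have Aa : A a by split=> //=; rewrite lexx.
have hA : has_sup A by split; [exists a|exists b => t [_ /= /andP[]]].
pose m := sup A.
have am : a <= m by apply: ub_le_sup => //; case: hA.
have mb : m <= b by apply: ge_sup; [exists a|move=> t [_ /= /andP[]]].
have Fm : F i m.
  have cA : closed A.
    apply: closedI; first exact: clF.
    rewrite (_ : [set t | _] = [set t | t >= a] `&` [set t | t <= b]).
      by apply: closedI; [exact: closed_ge|exact: closed_le].
    by apply/seteqP; split=> t /=; [move=> /andP[]|move=> [-> ->]].
  have : closure A m by apply: closure_sup => //; case: hA.
  by rewrite -(closure_id A).1// => -[].
have h1 : `|phi m - phi a| <= L * (m - a) by exact: lipF Fa Fm am.
have [<-//|mltb] := eqVneq m b.
have {mltb}mltb : m < b by rewrite lt_neqAle mltb.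
have mem t : m < t -> t <= b -> exists2 j, j \in rem i s & F j t.
  move=> mt tb; have [j sj Fj] : exists2 j, j \in s & F j t.
    by apply: cov; rewrite tb andbT (le_trans am)// ltW.
  exists j => //; have [ji|ji] := eqVneq j i; last exact: rem_mem.
  exfalso; have := mt; rewrite ltNge => /negP; apply; apply: ub_le_sup; first by case: hA.
  by split; [rewrite -ji|rewrite /= tb andbT (le_trans am)// ltW].
have h2 : `|phi b - phi m| <= L * (b - m).
  apply: (IHn (rem i s)) => //.
  - by rewrite size_rem//; case: (s) si sn => [//|? ?] /=; rewrite ltnS.
  - by move=> j /mem_rem; exact: clF.
  - by move=> j /mem_rem; exact: lipF.
  - move=> t /andP[mt tb]; have [tm|] := eqVneq m t; last first.
      by move=> tm; apply: mem => //; rewrite lt_neqAle tm.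
    rewrite -tm; pose B := \bigcup_(j in [set` rem i s]) F j.
    have cB : closed B.
      by apply: closed_bigcup => [|j /= /mem_rem]; [exact: finite_seq|exact: clF].
    suff : closure B m by rewrite -(closure_id B).1// => -[j]; exists j.
    move=> U /nbhs_ballP[e /= e0 eU].
    pose t' := m + Num.min (e / 2) (b - m).
    have mt' : m < t' by rewrite ltrDl lt_min divr_gt0// subr_gt0.
    have tb' : t' <= b by rewrite -lerBrDl ge_min lexx orbT.
    have [j sj Fj] := mem t' mt' tb'; exists t'; split; first by exists j.
    apply: eU; rewrite /ball /= /t' opprD addrA subrr add0r normrN gtr0_norm.
      rewrite (@le_lt_trans _ _ (e / 2))// ?ge_min ?lexx//.
      by rewrite ltr_pdivrMr// ltr_pMr// ltr1n.
    by rewrite lt_min divr_gt0// subr_gt0.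
rewrite -(subrK (phi m) (phi b)) -addrA (le_trans (ler_normD _ _))//.
apply: le_trans (lerD h2 h1) _; by rewrite -mulrDr addrA subrK.
Qed.

End closed_covers.

Section measurable_pieces.
Context {R : realType} {k : nat}.
Local Notation pt := 'rV[R]_k.+1.

Lemma measurable_pieces (I : choiceType) (s : seq I) (A : I -> set pt) (F : I -> pt -> R)
    (D : set pt) (f : pt -> R) :
  (forall i, i \in s -> measurable (A i)) ->
  (forall i, i \in s -> measurable_fun [set: pt] (F i)) ->
  (forall x, D x -> exists2 i, i \in s & A i x) ->
  (forall i x, i \in s -> A i x -> D x -> f x = F i x) ->
  measurable_fun D f.
Proof.
move=> mA mF cov fF mD Y mY.
rewrite (_ : _ `&` _ = \bigcup_(i in [set` s]) (D `&` (A i `&` (F i @^-1` Y)))).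
  apply: fin_bigcup_measurable; first exact: finite_seq.
  move=> i /= si; apply: measurableI => //; apply: measurableI; first exact: mA.
  by rewrite -[X in measurable X]setTI; exact: mF.
apply/seteqP; split=> [x [Dx fx]|x [i si [Dx [Ax Fx]]]].
  by have [i si Ai] := cov x Dx; exists i => //; split=> //; split=> //=; rewrite -(fF i).
by split=> //=; rewrite (fF i).
Qed.

End measurable_pieces.

(** * Weak gradients of continuous piecewise smooth functions *)

Section piecewise.
Context {R : realType} {k : nat}.
Local Notation d := k.+1.
Local Notation pt := 'rV[R]_k.+1.
Local Notation mu := (@lebesgue_row R k.+1).
Local Notation e_ i := (delta_mx 0 i : 'rV[R]_k.+1).
Implicit Types (a b : simplex R k) (f v : pt -> R).

Lemma compact_hull a : Defs.nondegenerate a -> compact (hull a).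
Proof.
move=> na; have [M hM] := hull_row_bound a.
pose b : pt := const_mx M.
apply: (@subclosed_compact _ _ (closed_box (- b) b)).
- exact: closed_hull.
- exact: compact_closed_box.
- by move=> x hx i; rewrite !mxE -ler_norml; exact: hM.
Qed.

Lemma smooth_hull_bnd a f : Defs.nondegenerate a -> smooth f ->
  exists2 M, 0 <= M & forall x, hull a x -> `|f x| <= M /\ forall i, `|pderiv i f x| <= M.
Proof.
move=> na sf; have ch := compact_hull na.
have [M0 h0] := continuous_compact_bnd ch (smooth_continuous sf).
have [M1 h1] := choice (fun i => continuous_compact_bnd ch (smooth_continuous (smooth_pderiv i sf))).
exists (`|M0| + \sum_i `|M1 i|); first by rewrite addr_ge0// sumr_ge0.
move=> x hx; split.
  by rewrite (le_trans (h0 x hx))// ler_wpDr ?sumr_ge0// ler_norm.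
move=> i; rewrite (le_trans (h1 i x hx))// (bigD1 i)//= ler_wpDl// ler_wpDr ?ler_norm//.
by rewrite sumr_ge0.
Qed.

Variables (Om : set pt) (J : Type) (Th : J -> seq (simplex R k)) (sigma beta0 : R).
Hypotheses (hOm : polyhedral_domain Om) (hTh : regular_family Om Th sigma beta0).
Variable j : J.
Local Notation T := (Th j).

(** Agreement is required on the closed elements, which builds continuity across the faces into the
    notion. *)
Definition piecewise v (F : simplex R k -> pt -> R) :=
  forall a, a \in T -> smooth (F a) /\ forall x, hull a x -> v x = F a x.

(** On the skeleton of the mesh, a null set, any value would do; 0 keeps the function measurable. *)
Definition pwgrad v : pt -> pt := fun x =>
  if `[< exists2 a, a \in T & (hull a)° x >] then grad v x else 0.

Variables (v : pt -> R) (F : simplex R k -> pt -> R).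
Hypothesis vF : piecewise v F.

Lemma piecewise_near a x : a \in T -> (hull a)° x -> \forall y \near x, F a y = v y.
Proof.
move=> aT ax; apply: filterS ax => y ay; exact/esym/(vF aT).2.
Qed.

Lemma piecewise_derive a x w : a \in T -> (hull a)° x -> 'D_w v x = 'D_w (F a) x.
Proof. by move=> aT ax; apply/esym/near_eq_derive; exact: piecewise_near. Qed.

Lemma pwgrad_interior a x : a \in T -> (hull a)° x -> pwgrad v x = grad (F a) x.
Proof.
move=> aT ax; rewrite /pwgrad ifT; last by apply/asboolP; exists a.
by apply/rowP => i; rewrite !mxE /pderiv (piecewise_derive _ aT).
Qed.

Let sub_hull x : Om x -> exists2 a, a \in T & hull a x.
Proof.
by move=> /subset_closure; rewrite (mesh_cover hTh j) => -[a aT ax]; exists a.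
Qed.

Lemma piecewise_bnd : exists2 M, 0 <= M &
  forall a x, a \in T -> hull a x -> `|F a x| <= M /\ forall i, `|pderiv i (F a) x| <= M.
Proof.
suff : forall s : seq (simplex R k), {subset s <= T} -> exists2 M, 0 <= M &
  forall a x, a \in s -> hull a x -> `|F a x| <= M /\ forall i, `|pderiv i (F a) x| <= M.
  exact.
elim=> [_|a s IHs st]; first by exists 0.
have [M M0 hM] := IHs (fun b bs => st b (mem_behead (s := a :: s) bs)).
have aT : a \in T by apply: st; exact: mem_head.
have [N N0 hN] := smooth_hull_bnd (mesh_nondegenerate hTh aT) (vF aT).1.
exists (M + N); first exact: addr_ge0.
move=> b x; rewrite inE => /orP[/eqP->|bs] hx.
  by have [h1 h2] := hN x hx; split=> [|i]; rewrite ler_wpDl.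
by have [h1 h2] := hM b x bs hx; split=> [|i]; rewrite ler_wpDr.
Qed.

Lemma piecewise_measurable : measurable_fun Om v.
Proof.
apply: (@measurable_pieces _ _ _ T (@hull R k.+2 k.+1) F) => //.
- by move=> a /(mesh_nondegenerate hTh); exact: measurable_hull.
- by move=> a aT; apply: smooth_measurable; exact: (vF aT).1.
- by move=> a x aT ax _; exact: (vF aT).2.
Qed.

Lemma pwgrad_measurable i : measurable_fun Om (fun x => pwgrad v x 0 i).
Proof.
pose U := \bigcup_(a in [set` T]) (hull a)°.
have oU : open U by apply: bigcup_open => a _; exact: open_interior.
pose A (o : option (simplex R k)) := if o is Some a then (hull a)° else ~` U.
pose G (o : option (simplex R k)) : pt -> R := if o is Some a then pderiv i (F a) else fun=> 0.
apply: (@measurable_pieces _ _ _ (None :: map Some T) A G).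
- move=> [a|] _ /=; first by apply: measurable_row_open; exact: open_interior.
  by apply: measurableC; exact: measurable_row_open.
- move=> [a|] /=; last by move=> _; exact: measurable_cst.
  rewrite inE /= => /mapP[b bT [->]]; apply: smooth_measurable; apply: smooth_pderiv.
  exact: (vF bT).1.
- move=> x _; have [[a aT ax]|nU] := pselect (U x); last by exists None.
  by exists (Some a) => //; rewrite inE /=; apply/mapP; exists a.
- move=> [a|] x; last first.
    move=> _ /= nU _; rewrite /pwgrad ifF ?mxE//.
    by apply/asboolPn => -[a aT ax]; apply: nU; exists a.
  by rewrite inE /= => /mapP[b bT [->]] /= bx _; rewrite (pwgrad_interior bT)// mxE.
Qed.

Lemma piecewise_ae_derive i : {ae mu, forall x, Om x -> is_derive x (e_ i) v (pwgrad v x 0 i)}.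
Proof.
have := mesh_ae hTh j; apply: filterS => x h Ox; have [a aT ax] := h Ox.
rewrite (pwgrad_interior aT ax) mxE; apply: (near_eq_is_derive (piecewise_near aT ax)).
by apply: DeriveDef => //; apply: diff_derivable; apply: smooth_differentiable; exact: (vF aT).1.
Qed.

(** A segment contained in Om is covered by finitely many closed parameter sets, one per element.
    Elements are convex, so the mean value theorem bounds the increments within each set, and
    [lip_closed_cover] joins them. *)
Lemma piecewise_lip i : exists L : R, forall x (t : R),
  (forall s : R, 0 <= s <= 1 -> Om (x + (s * t) *: e_ i)) ->
  `|v (x + t *: e_ i) - v x| <= L * `|t|.
Proof.
have [M M0 hM] := piecewise_bnd; exists M => x t xt.
pose phi s := v (x + (s * t) *: e_ i).
pose FF a := [set s : R | hull a (x + (s * t) *: e_ i)].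
have := @lip_closed_cover R _ T FF phi (M * `|t|) _ _ 0 1 ler01.
rewrite /phi mul1r mul0r scale0r addr0 subr0 mulr1; apply.
- move=> a aT; rewrite (_ : FF a = (fun s : R => x + (s * t) *: e_ i) @^-1` hull a)//.
  apply: closed_comp; last exact/closed_hull/(mesh_nondegenerate hTh aT).
  move=> s _; apply: cvgD; first exact: cvg_cst.
  by apply: cvgZr_tmp; apply: cvgMr_tmp; exact: cvg_id.
- move=> a aT s s' hs hs' ss'; have na := mesh_nondegenerate hTh aT.
  rewrite !(vF aT).2//.
  pose y := x + (s * t) *: e_ i; pose w := ((s' - s) * t) *: e_ i.
  have yw : x + (s' * t) *: e_ i = y + w by rewrite /y /w -addrA -scalerDl; congr (_ + _ *: _); ring.
  have sF := (vF aT).1.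
  have hy (r : R) : 0 <= r <= 1 -> hull a (y + r *: w).
    by move=> r1; apply: hull_convex => //; rewrite -yw.
  have dF (r : R) : 0 <= r <= 1 -> derivable (F a) (y + r *: w) w.
    by move=> _; apply: diff_derivable; exact: smooth_differentiable.
  have [r r1 ->] : exists2 r : R, 0 <= r <= 1 & F a (x + (s' * t) *: e_ i) - F a (x + (s * t) *: e_ i) = 'D_w (F a) (y + r *: w).
    by rewrite yw; exact: MVT_line.
  rewrite deriveZv; last exact: smooth_differentiable.
  rewrite normrM normrM (ger0_norm (_ : 0 <= s' - s)) ?subr_ge0//.
  rewrite -[leRHS]mulrA [leRHS]mulrC [`|t| * _]mulrC.
  by apply: ler_wpM2l; [rewrite mulr_ge0// subr_ge0|exact: (hM a _ aT (hy r r1)).2].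
- by move=> s /xt; exact: sub_hull.
Qed.

Lemma pwgrad_bnd i : Linf Om (fun x => pwgrad v x 0 i).
Proof.
split; first exact: pwgrad_measurable.
have [M M0 hM] := piecewise_bnd; exists M => //; apply: filterE => x Ox.
rewrite /pwgrad; case: asboolP => [[a aT ax]|_]; last by rewrite mxE normr0.
rewrite mxE /pderiv (piecewise_derive _ aT ax).
by apply: (hM a x aT _).2; exact: interior_subset.
Qed.

Lemma piecewise_Linf : Linf Om v.
Proof.
split; first exact: piecewise_measurable.
have [M M0 hM] := piecewise_bnd; exists M => //; apply: filterE => x /sub_hull[a aT ax].
by rewrite (vF aT).2//; exact: (hM a x aT ax).1.
Qed.

Let oOm : open Om. Proof. exact: domain_open hOm. Qed.
Let bOm : (mu Om < +oo)%E. Proof. exact: domain_lty hOm. Qed.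
Let mOm : measurable Om. Proof. exact: measurable_row_open. Qed.

Lemma Linf_loc_int f : Linf Om f -> locally_integrable_on Om f.
Proof.
move=> bf; split; first by case: bf.
move=> S cS SO; apply: (integrableS mOm) => //; first exact: compact_row_measurable.
exact: Linf_integrable.
Qed.

Lemma piecewise_weak : is_weak_gradient Om v (pwgrad v).
Proof.
split; first exact/Linf_loc_int/piecewise_Linf.
  by move=> i; apply/Linf_loc_int; exact: pwgrad_bnd.
move=> phi tphi i; have [L hL] := piecewise_lip i.
have [M M0 hM] := piecewise_bnd.
apply: (@lip_weak _ _ Om v _ i L M oOm) => //.
- exact: piecewise_measurable.
- exact: pwgrad_measurable.
- by move=> x /sub_hull[a aT ax]; rewrite (vF aT).2//; exact: (hM a x aT ax).1.
- exact: piecewise_ae_derive.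
Qed.

Lemma piecewise_has_wgrad : has_wgrad Om v.
Proof. by exists (pwgrad v); exact: piecewise_weak. Qed.

Lemma wgrad_piecewise :
  {ae mu, forall x, forall a, a \in T -> (hull a)° x -> wgrad Om v x = grad (F a) x}.
Proof.
apply: filterS (wgradE oOm piecewise_weak) => x h a aT ax.
by rewrite h ?(pwgrad_interior aT)//; exact: (interior_hull_sub hOm hTh aT).
Qed.

Lemma wgrad_piecewise_Linf i : Linf Om (fun x => wgrad Om v x 0 i).
Proof.
split; first exact: measurable_wgrad piecewise_has_wgrad.
have [_ [M M0 hM]] := pwgrad_bnd i; exists M => //.
by apply: filterS2 hM (wgradE oOm piecewise_weak) => x h1 h2 Ox; rewrite h2// h1.
Qed.

Lemma piecewise_W1 (r : R) : 1 <= r -> W1 r%:E Om v.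
Proof.
move=> r1; have r0 : 0 < r by exact: lt_le_trans r1.
split; first by apply: Linf_in_Lp => //; exact: piecewise_Linf.
exists (wgrad Om v); first exact: wgrad_weak piecewise_has_wgrad.
by apply/in_LpVP => // i; apply: Linf_in_Lp => //; exact: wgrad_piecewise_Linf.
Qed.

End piecewise.

(** * Coercivity of the inverse tensor *)

Section inverse_tensor.
Context {R : realType}.

Section rayleigh.
Context {n : nat}.
Implicit Types (A K : 'M[R]_n.+1) (v w : 'rV[R]_n.+1).

Lemma dot_mulmx_sym A v w : A^T = A -> dot (v *m A) w = dot (w *m A) v.
Proof.
move=> sA; have dotE (x y : 'rV[R]_n.+1) : dot x y = (x *m y^T) 0 0.
  by rewrite mxE; apply: eq_bigr => i _; rewrite mxE.
rewrite !dotE -[in LHS](trmxK (v *m A *m w^T)) [LHS]mxE !trmx_mul trmxK sA.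
by rewrite mulmxA.
Qed.

Lemma quadratic_ge0_linear (a b : R) : (forall t, 0 <= a * t ^+ 2 + b * t) -> b = 0.
Proof.
move=> h; apply/eqP; rewrite -sqrf_eq0 -[_ == 0](inj_eq oppr_inj) oppr0.
have a1 : 0 < `|a| + 1 by rewrite ltr_wpDl.
(* Near 0 the linear term dominates: at this t the value is negative unless b = 0. *)
have := h (- b / (`|a| + 1) / 2).
rewrite (_ : _ + _ = b ^+ 2 * (a / (`|a| + 1) - 2) / (`|a| + 1) / 4); last first.
  by field; rewrite gt_eqF.
move=> h1; have a2 : a / (`|a| + 1) <= 1.
  by rewrite ler_pdivrMr// mul1r (le_trans (ler_norm a))// lerDl.
have b2 : 0 <= b ^+ 2 by exact: sqr_ge0.
rewrite oppr_eq0 -[_ == _]negbK; apply/negP => b0.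
have b3 : 0 < b ^+ 2 by rewrite lt_neqAle eq_sym b0.
move: h1; rewrite leNgt => /negP; apply.
by rewrite pmulr_llt0 ?invr_gt0// pmulr_llt0 ?invr_gt0// pmulr_rlt0// subr_lt0 (le_lt_trans a2)// ltr1n.
Qed.

(* The minimum of the Rayleigh quotient is an eigenvalue. *)
Lemma rayleigh A (l : R) : A^T = A -> (forall c, eigenvalue A c -> l <= c) ->
  forall v, l * dot v v <= dot (v *m A) v.
Proof.
move=> sA hl.
pose q v := dot (v *m A) v.
have cq : continuous q.
  apply: smooth_continuous; apply: smooth_sum => i; apply: smoothM; last exact: smooth_coord.
  rewrite (_ : (fun v => _) = fun v => \sum_j v 0 j * A j i); last first.
    by apply/funext => v; rewrite mxE.
  by apply: smooth_sum => j; apply: smoothM; [exact: smooth_coord|exact: smooth_cst].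
pose S : set 'rV[R]_n.+1 := [set v | enorm v = 1].
have e1 : enorm (delta_mx 0 ord0 : 'rV[R]_n.+1) = 1.
  rewrite /enorm /dot (bigD1 ord0)//= big1; first by rewrite !mxE !eqxx mulr1 addr0 sqrtr1.
  by move=> i i0; rewrite !mxE (negbTE i0) andbF mul0r.
have cS : compact S.
  apply: (@subclosed_compact _ _ [set v : 'rV[R]_n.+1 | enorm (v - 0) <= 1]).
  - rewrite (_ : S = @enorm R n.+1 @^-1` [set 1])//.
    apply: closed_comp; [by move=> v _; exact: continuous_enorm|exact: closed_eq].
  - exact: compact_closed_eball.
  - by move=> v /= ev; rewrite subr0 ev.
have [v0 Sv0 hv0] : exists2 v0, S v0 & forall v, S v -> q v0 <= q v.
  have Sn0 : S !=set0 by exists (delta_mx 0 ord0).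
  have [v0 Sv0 hv0] := @compact_EVT_min _ R q S Sn0 cS (continuous_subspaceT cq).
  by exists v0 => [|v Sv]; [exact: set_mem|apply: hv0; exact: mem_set].
have qZ c v : q (c *: v) = c ^+ 2 * q v.
  by rewrite /q -scalemxAl dotZl dotZr mulrA expr2.
have hq v : q v0 * dot v v <= q v.
  have [->|vn0] := eqVneq v 0; first by rewrite /q mul0mx dot0l mulr0.
  have ev : 0 < enorm v.
    by rewrite lt_neqAle enorm_ge0 andbT eq_sym; apply/eqP => /enorm_eq0/eqP; rewrite (negbTE vn0).
  have Sv : S ((enorm v)^-1 *: v).
    by rewrite /S /= enormZ gtr0_norm ?invr_gt0// mulVf// gt_eqF.
  have := hv0 _ Sv; rewrite qZ -enorm_sqr.
  by rewrite exprVn mulrC ler_pdivlMr// exprn_gt0.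
(* First variation at the minimum: q(v) - q(v0) |v|^2 is nonnegative and vanishes at v0, so its
   derivative in every direction w vanishes. *)
have v0A : v0 *m A = q v0 *: v0.
  apply/eqP; rewrite -subr_eq0; apply/eqP; set z := _ - _.
  suff h w : dot z w = 0 by apply: dot_eq0; exact: h.
  have h t : 0 <= (q w - q v0 * dot w w) * t ^+ 2 + 2 * dot z w * t.
    have := hq (v0 + t *: w); rewrite -subr_ge0; congr (_ <= _).
    have v01 : dot v0 v0 = 1 by rewrite -enorm_sqr (Sv0 : enorm v0 = 1) expr1n.
    rewrite /z dotBl dotZl /q mulmxDl -scalemxAl !(dotDl, dotDr, dotZl, dotZr) -/(q v0) -/(q w).
    rewrite (dot_mulmx_sym w v0 sA) v01 (dotC w v0).
    by ring.
  have := quadratic_ge0_linear h; move/eqP; rewrite mulf_eq0 pnatr_eq0/=.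
  by move/eqP.
have lq : l <= q v0.
  apply: hl; apply/eigenvalueP; exists v0 => //.
  by apply/eqP => v00; move: Sv0; rewrite /S /= v00 enorm0 => /eqP; rewrite eq_sym oner_eq0.
move=> v; apply: le_trans (hq v); apply: ler_wpM2r => //; exact: dot_ge0.
Qed.

(** For a row w of the inverse, w K is a unit vector, so k0 |w|^2 <= |w|. *)
Lemma posdef_inv K (k0 : R) : 0 < k0 -> (forall v, k0 * dot v v <= dot (v *m K) v) ->
  K \in unitmx /\ forall i j, `|invmx K i j| <= k0^-1.
Proof.
move=> k00 hK.
have uK : K \in unitmx.
  rewrite -row_free_unit -kermx_eq0; apply/rowV0P => v /sub_kermxP vK.
  apply: dot_eq0; have := hK v; rewrite vK dot0l pmulr_rle0// => h.
  by apply/eqP; rewrite eq_le h dot_ge0.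
split=> // i j; pose w := delta_mx 0 i *m invmx K : 'rV[R]_n.+1.
have wK : w *m K = delta_mx 0 i by rewrite mulmxKV.
have e1 : enorm (delta_mx 0 i : 'rV[R]_n.+1) = 1.
  rewrite /enorm /dot (bigD1 i)//= big1; first by rewrite !mxE !eqxx mulr1 addr0 sqrtr1.
  by move=> m i0; rewrite !mxE (negbTE i0) andbF mul0r.
have wij : w 0 j = invmx K i j by rewrite /w -rowE mxE.
have ew : enorm w <= k0^-1.
  have := hK w; rewrite wK -enorm_sqr => /le_trans/(_ (dot_le _ _)); rewrite e1 mul1r.
  have [->|w0] := eqVneq (enorm w) 0; first by move=> _; rewrite invr_ge0 ltW.
  have wp : 0 < enorm w by rewrite lt_neqAle eq_sym w0 enorm_ge0.
  by rewrite expr2 mulrA ger_pMl// -ler_pdivlMl// mulr1.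
by rewrite -wij (le_trans (enorm_coord _ _)).
Qed.

End rayleigh.

Section measurable_inverse.
Context {k : nat}.
Local Notation pt := 'rV[R]_k.+1.
Variables (D : set pt) (mD : measurable D).

Lemma measurable_det n (A : pt -> 'M[R]_n) :
  (forall i j, measurable_fun D (fun x => A x i j)) -> measurable_fun D (fun x => \det (A x)).
Proof.
move=> mA; apply: measurable_sum => s.
apply: measurable_funM; first exact: measurable_cst.
by apply: measurable_prod => i _; exact: mA.
Qed.

Lemma measurable_invr (f : pt -> R) : measurable_fun D f -> measurable_fun D (fun x => (f x)^-1).
Proof.
move=> mf; rewrite (_ : (fun x => _) = fun x => f x * (f x ^+ 2) `^ (-1)).
  apply: measurable_funM => //.
  by apply: (measurableT_comp (measurable_powR (-1))); exact: measurable_funX.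
apply/funext => x; rewrite powR_inv1 ?sqr_ge0//.
have [->|f0] := eqVneq (f x) 0; first by rewrite invr0 mul0r.
by field.
Qed.

Lemma measurable_invmx n (A : pt -> 'M[R]_n.+1) i j :
  (forall i j, measurable_fun D (fun x => A x i j)) ->
  measurable_fun D (fun x => invmx (A x) i j).
Proof.
move=> mA; have md := measurable_det mA.
(* The cofactor formula; by convention [invmx] returns a singular matrix unchanged. *)
rewrite (_ : (fun x => _) = fun x => if \det (A x) == 0 then A x i j
    else (\det (A x))^-1 * ((-1) ^+ (j + i) * \det (row' j (col' i (A x))))); last first.
  apply/funext => x; rewrite /invmx unitmxE unitfE; case: eqVneq => //= _.
  by rewrite !mxE.
apply: measurable_fun_if => //.
- by apply: measurable_fun_eqr => //; exact: measurable_cst.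
- by apply: measurable_funS (mA i j) => //; exact: subIsetl.
- apply: (measurable_funS mD); first exact: subIsetl.
  apply: measurable_funM; first exact: measurable_invr.
  apply: measurable_funM; first exact: measurable_cst.
  apply: measurable_det => a b; rewrite (_ : (fun x => _) = fun x => A x (lift j a) (lift i b)).
    exact: mA.
  by apply/funext => x; rewrite !mxE.
Qed.

End measurable_inverse.

Section coercivity.
Context {k : nat}.
Local Notation pt := 'rV[R]_k.+1.
Local Notation mu := (@lebesgue_row R k.+1).
Variables (Om : set pt) (oOm : open Om) (P : pde_data R k) (hP : admissible Om P).

Lemma Kinv_coercive : {ae mu, forall x, Om x -> forall v : pt,
  Km P * dot v v <= dot (v *m (invmx (Kt P x))^T) v}.
Proof.
have [_ [_ [k0 k00 hK] _] [_ _ _ hE] _ _] := hP.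
apply: filterS2 hK hE => x hK hE Ox v; have [sK pK] := hK Ox.
rewrite trmx_inv sK; apply: rayleigh; last exact: hE.
by rewrite trmx_inv sK.
Qed.

Lemma Kinv_Linf i j : Linf Om (fun x => invmx (Kt P x) i j).
Proof.
have [_ [mK [k0 k00 hK] _] _ _ _] := hP.
split; first by apply: measurable_invmx => //; exact: measurable_row_open.
exists k0^-1; first by rewrite invr_ge0 ltW.
by apply: filterS hK => x h Ox; have [_ h2] := h Ox; exact: (posdef_inv k00 h2).2.
Qed.

Lemma KM_gt0 : 0 < KM P.
Proof.
have [_ _ [K0 h1 h2 _] _ _] := hP.
by rewrite -lte_fin (lt_le_trans _ h2)// (lt_le_trans _ h1)// lte_fin.
Qed.

End coercivity.
End inverse_tensor.

(** * Rules for integrals of bounded scalar and vector functions *)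

Section integ_rules.
Context {R : realType} {k : nat}.
Local Notation d := k.+1.
Local Notation pt := 'rV[R]_k.+1.
Local Notation mu := (@lebesgue_row R k.+1).
Variable D : set pt.
Hypotheses (mD : measurable D) (Doo : (mu D < +oo)%E).
Implicit Types (f g : pt -> R) (w z : pt -> pt).

Local Notation int f := (mu.-integrable D (EFin \o f)).

Lemma integD f g : int f -> int g -> integ D (fun x => f x + g x) = integ D f + integ D g.
Proof. by move=> hf hg; exact: RintegralD. Qed.

Lemma integB f g : int f -> int g -> integ D (fun x => f x - g x) = integ D f - integ D g.
Proof. by move=> hf hg; exact: RintegralB. Qed.

Lemma integZ f (c : R) : int f -> integ D (fun x => c * f x) = c * integ D f.
Proof. by move=> hf; exact: RintegralZl. Qed.

Lemma integN f : int f -> integ D (fun x => - f x) = - integ D f.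
Proof.
move=> hf; rewrite -mulN1r -integZ//.
by apply: eq_Rintegral => x _; rewrite mulN1r.
Qed.

Lemma eq_integ f g : {in D, f =1 g} -> integ D f = integ D g.
Proof. by move=> h; apply: eq_Rintegral => x xD; exact: h. Qed.

Lemma integ_sum (F : 'I_d -> pt -> R) : (forall i, int (F i)) ->
  integ D (fun x => \sum_i F i x) = \sum_i integ D (F i).
Proof.
move=> hF; rewrite /integ /Rintegral.
under eq_integral do rewrite -sumEFin.
rewrite integral_sum//.
rewrite (eq_bigr (fun i => (fine (\int[mu]_(x in D) (F i x)%:E))%:E)) ?sumEFin//.
by move=> i _; rewrite fineK//; apply: integrable_fin_num; [exact: mD|exact: hF].
Qed.

Lemma ae_integ_le f g : int f -> int g -> {ae mu, forall x, D x -> f x <= g x} ->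
  integ D f <= integ D g.
Proof.
move=> hf hg fg; have hgf := integrableRB mD hg hf.
rewrite -subr_ge0 -integB//.
rewrite (_ : integ D _ = integ D (fun x => `|g x - f x|)); first exact: Rintegral_ge0.
have m := integrable_measurable hgf.
apply: ae_Rintegral => //; first exact: measurableT_comp.
by apply: filterS fg => x h /h fgx; rewrite ger0_norm// subr_ge0.
Qed.

Lemma integ_ge0 f : (forall x, D x -> 0 <= f x) -> 0 <= integ D f.
Proof. exact: Rintegral_ge0. Qed.

Definition LinfV w := forall i, Linf D (fun x => w x 0 i).

Lemma LinfV_dot w z : LinfV w -> LinfV z -> Linf D (fun x => dot (w x) (z x)).
Proof. by move=> hw hz; apply: Linf_sum => i; exact: LinfM. Qed.

Lemma LinfVB w z : LinfV w -> LinfV z -> LinfV (fun x => w x - z x).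
Proof.
move=> hw hz i; rewrite (_ : (fun x => _) = fun x => w x 0 i - z x 0 i); first exact: LinfB.
by apply/funext => x; rewrite !mxE.
Qed.

Lemma LinfV_enorm w : LinfV w -> Linf D (fun x => enorm (w x)).
Proof.
move=> hw; split; first by apply: measurable_enorm => i; case: (hw i).
have [_ [N N0 hN]] : Linf D (fun x => \sum_i `|w x 0 i|).
  by apply: Linf_sum => i; exact: Linf_norm.
exists N => //; apply: filterS hN => x h Dx.
rewrite ger0_norm ?enorm_ge0// (le_trans (enorm_le_sum _))//.
by rewrite (le_trans _ (h Dx))// ler_norm.
Qed.

Lemma LinfV_in_LpV w (r : R) : 1 <= r -> LinfV w -> in_LpV r%:E D w.
Proof.
move=> r1 hw; apply/in_LpVP => // i; apply: Linf_in_Lp => //.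
exact: lt_le_trans r1.
Qed.

Lemma Linf_int f : Linf D f -> int f.
Proof. exact: Linf_integrable. Qed.

End integ_rules.

(** * The discrete spaces and the skew form of the convection *)

Section discrete_spaces.
Context {R : realType} {k : nat}.
Local Notation d := k.+1.
Local Notation pt := 'rV[R]_k.+1.
Local Notation mu := (@lebesgue_row R k.+1).
Implicit Types (v z : pt -> R) (w : pt -> pt).

Lemma smooth_affine (q : pt) (s : R) : smooth (fun x => dot q x + s).
Proof. by apply: (@polyf_smooth _ _ 1); apply: polyfD; [exact: polyf_dot|exact: polyf_cst]. Qed.

Lemma pderiv_sum (I : Type) (s : seq I) (F : I -> pt -> R) i x :
  (forall m, smooth (F m)) ->
  pderiv i (fun x => \sum_(m <- s) F m x) x = \sum_(m <- s) pderiv i (F m) x.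
Proof.
move=> sF; elim: s => [|m s IHs].
  rewrite big_nil (_ : (fun x => _) = fun=> 0) ?pderiv_cst//.
  by apply/funext => y; rewrite big_nil.
rewrite big_cons -IHs -pderivD; first by congr pderiv; apply/funext => y; rewrite big_cons.
  exact: smooth_differentiable.
by apply: smooth_differentiable; exact: smooth_sum.
Qed.

Lemma grad_affine (q : pt) (s : R) x : grad (fun x => dot q x + s) x = q.
Proof.
apply/rowP => i; rewrite mxE pderivD; last 2 first.
- exact/smooth_differentiable/(polyf_smooth (polyf_dot q 0)).
- exact/smooth_differentiable/smooth_cst.
rewrite pderiv_cst addr0 /dot.
rewrite pderiv_sum; last by move=> m; apply: smoothM; [exact: smooth_cst|exact: smooth_coord].
rewrite (bigD1 i)//= big1 ?addr0.
  rewrite pderivM; [|exact/smooth_differentiable/smooth_cst|exact/smooth_differentiable/smooth_coord].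
  by rewrite pderiv_coord pderiv_cst eqxx mulr1 mulr0 addr0.
move=> m mi; rewrite pderivM; [|exact/smooth_differentiable/smooth_cst|exact/smooth_differentiable/smooth_coord].
by rewrite pderiv_coord pderiv_cst eq_sym (negbTE mi) !mulr0 addr0.
Qed.

Variables (Om : set pt) (J : Type) (Th : J -> seq (simplex R k)) (sigma beta0 : R).
Hypotheses (hOm : polyhedral_domain Om) (hTh : regular_family Om Th sigma beta0).
Variable j : J.
Local Notation T := (Th j).

Lemma P1h_pieces v : spaceP1h Om T v -> exists (q : simplex R k -> pt) (s : simplex R k -> R),
  forall a, a \in T -> forall x, hull a x -> v x = dot (q a) x + s a.
Proof.
move=> [_ h].
have h' a : exists qs : pt * R, a \in T -> forall x, hull a x -> v x = dot qs.1 x + qs.2.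
  have [aT|_] := boolP (a \in T); last by exists (0, 0).
  by have [q [s hqs]] := h a aT; exists (q, s).
have [f hf] := choice h'; exists (fun a => (f a).1), (fun a => (f a).2) => a aT.
exact: hf.
Qed.

Lemma P1h_piecewise v q s : (forall a, a \in T -> forall x, hull a x -> v x = dot (q a) x + s a) ->
  piecewise Th j v (fun a x => dot (q a) x + s a).
Proof. by move=> h a aT; split; [exact: smooth_affine|exact: h]. Qed.

Lemma Xh_pieces w : spaceXh Om T w -> exists F : simplex R k -> 'I_d -> pt -> R,
  forall a, a \in T -> forall i, polyf k.+2 (F a i) /\ forall x, hull a x -> w x 0 i = F a i x.
Proof.
move=> [_ h].
have h' (ai : simplex R k * 'I_d) : exists f : pt -> R, ai.1 \in T ->
    polyf k.+2 f /\ forall x, hull ai.1 x -> w x 0 ai.2 = f x.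
  case: ai => a i /=; have [aT|_] := boolP (a \in T); last by exists (fun=> 0).
  have [q [s [t hf]]] := h a aT i; exists (fun x => dot q x + s + t * bubble a x) => _.
  split=> //; apply: polyfD; first by apply: polyfD; [exact: polyf_dot|exact: polyf_cst].
  by apply: polyfZ; exact: polyf_bubble.
have [f hf] := choice h'; exists (fun a i => f (a, i)) => a aT i.
exact: (hf (a, i)).
Qed.

Lemma Xh_piecewise w F : (forall a, a \in T -> forall i,
    polyf k.+2 (F a i) /\ forall x, hull a x -> w x 0 i = F a i x) ->
  forall i, piecewise Th j (fun x => w x 0 i) (fun a => F a i).
Proof. by move=> h i a aT; have [h1 h2] := h a aT i; split=> //; exact: (polyf_smooth h1). Qed.

Lemma P1h_Linf v : spaceP1h Om T v ->
  [/\ Linf Om v, LinfV Om (wgrad Om v), has_wgrad Om v & W1 2%:E Om v].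
Proof.
move=> /P1h_pieces[q [s /P1h_piecewise pv]]; split.
- exact: (piecewise_Linf hTh pv).
- by move=> i; exact: (wgrad_piecewise_Linf hOm hTh pv i).
- exact: (piecewise_has_wgrad hOm hTh pv).
- by apply: (piecewise_W1 hOm hTh pv); exact: ler1n.
Qed.

Lemma Xh_Linf w : spaceXh Om T w ->
  [/\ LinfV Om w, forall i, has_wgrad Om (fun x => w x 0 i),
     forall i, LinfV Om (wgrad Om (fun x => w x 0 i)) & Linf Om (wdiv Om w)].
Proof.
move=> /Xh_pieces[F /Xh_piecewise pw].
have h i : LinfV Om (wgrad Om (fun x => w x 0 i)).
  by move=> m; exact: (wgrad_piecewise_Linf hOm hTh (pw i) m).
split=> //.
- by move=> i; exact: (piecewise_Linf hTh (pw i)).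
- by move=> i; exact: (piecewise_has_wgrad hOm hTh (pw i)).
- by apply: Linf_sum => i; exact: h.
Qed.

Lemma XhB (w z : pt -> pt) : spaceXh Om T w -> spaceXh Om T z -> spaceXh Om T (fun x => w x - z x).
Proof.
move=> [cw hw] [cz hz]; split; first by move=> x; apply: cvgB; [exact: cw|exact: cz].
move=> a aT i; have [q [s [t h]]] := hw a aT i; have [q' [s' [t' h']]] := hz a aT i.
exists (q - q'), (s - s'), (t - t') => x ax.
by rewrite !mxE h// h'// dotBl; ring.
Qed.

Lemma P1hB v z : spaceP1h Om T v -> spaceP1h Om T z -> spaceP1h Om T (fun x => v x - z x).
Proof.
move=> [cw hw] [cz hz]; split; first by move=> x; apply: cvgB; [exact: cw|exact: cz].
move=> a aT; have [q [s h]] := hw a aT; have [q' [s' h']] := hz a aT.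
exists (q - q'), (s - s') => x ax.
by rewrite h// h'// dotBl; ring.
Qed.

Let oOm : open Om. Proof. exact: domain_open hOm. Qed.
Let bOm : (mu Om < +oo)%E. Proof. exact: domain_lty hOm. Qed.
Let mOm : measurable Om. Proof. exact: measurable_row_open. Qed.

Lemma YhB v z : spaceYh Om T v -> spaceYh Om T z -> spaceYh Om T (fun x => v x - z x).
Proof. by move=> [h1 h2] [h3 h4]; split; [exact: P1hB|exact: H10B]. Qed.

Lemma H10_L2 v : H10 Om v -> [/\ in_Lp 2%:E Om v, in_LpV 2%:E Om (wgrad Om v) & has_wgrad Om v].
Proof.
move=> [[h1 h2] _]; split=> //; first by apply: W1_wgrad.
by exact: (W1_has_wgrad (conj h1 h2)).
Qed.

(** A discrete velocity is not solenoidal. With this identity, the convection term plus half of the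
    divergence term becomes half of the difference of (w . grad v) z and (w . grad z) v, which is
    antisymmetric in v and z. *)
Lemma integ_wdiv w v z : spaceXh Om T w -> H10 Om v -> H10 Om z ->
  integ Om (fun x => wdiv Om w x * v x * z x) =
  - integ Om (fun x => dot (w x) (wgrad Om v x) * z x)
  - integ Om (fun x => dot (w x) (wgrad Om z x) * v x).
Proof.
move=> hw hv hz; have [bw hgw bgw bdw] := Xh_Linf hw.
have [v2 gv2 _] := H10_L2 hv; have [z2 gz2 _] := H10_L2 hz.
have r1 : (1 : R) <= 2 by exact: ler1n.
have L2g (y : pt -> R) : in_LpV 2%:E Om (wgrad Om y) -> forall i, in_Lp 2%:E Om (fun x => wgrad Om y x 0 i).
  by move=> h i; exact: (in_LpVP _ mOm r1).1.
have i1 i : mu.-integrable Om (EFin \o (fun x => w x 0 i * (wgrad Om v x 0 i * z x))).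
  by apply: Linf_mul_int => //; apply: L2_mul => //; exact: L2g.
have i2 i : mu.-integrable Om (EFin \o (fun x => w x 0 i * (wgrad Om z x 0 i * v x))).
  by apply: Linf_mul_int => //; apply: L2_mul => //; exact: L2g.
have i0 i : mu.-integrable Om (EFin \o (fun x => wgrad Om (fun y => w y 0 i) x 0 i * (v x * z x))).
  by apply: Linf_mul_int => //; [exact: bgw|exact: L2_mul].
have -> : integ Om (fun x => wdiv Om w x * v x * z x) =
    \sum_i integ Om (fun x => wgrad Om (fun y => w y 0 i) x 0 i * (v x * z x)).
  rewrite -integ_sum//; apply: eq_integ => x _.
  by rewrite /wdiv -mulrA mulr_suml.
have E (y t : pt -> R) : (forall i, mu.-integrable Om (EFin \o (fun x => w x 0 i * (wgrad Om y x 0 i * t x)))) ->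
    integ Om (fun x => dot (w x) (wgrad Om y x) * t x) =
    \sum_i integ Om (fun x => w x 0 i * (wgrad Om y x 0 i * t x)).
  move=> h; rewrite -integ_sum//; apply: eq_integ => x _.
  by rewrite /dot mulr_suml; apply: eq_bigr => i _; rewrite mulrA.
rewrite !E// -opprD -big_split/= -sumrN; apply: eq_bigr => i _.
rewrite (parts_H10 oOm bOm (wgrad_weak (hgw i)) (bw i) (bgw i i) hv hz).
by congr (- _); rewrite -integD//; apply: eq_integ => x _; ring.
Qed.

End discrete_spaces.

(** * Convergence of the iterates *)

Section hoelder333.
Context {R : realType} {k : nat}.
Local Notation pt := 'rV[R]_k.+1.
Local Notation mu := (@lebesgue_row R k.+1).

(** Hoelder with exponents 3 and 3/2, then Cauchy-Schwarz for |g|^{3/2} and |h|^{3/2}. *)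
Lemma Lhoelder333 (D : set pt) (f g h : pt -> R) : measurable D ->
  in_Lp 3%:E D f -> in_Lp 3%:E D g -> in_Lp 3%:E D h ->
  \int[mu]_(x in D) `|f x * (g x * h x)| <= Lp 3%:E D f * (Lp 3%:E D g * Lp 3%:E D h).
Proof.
move=> mD hf hg hh.
have r0 : 0 < 3 / 2 :> R by lra.
have pw (x : pt) (v : pt -> R) : `| `|v x| `^ (3 / 2) | `^ 2 = `|v x| `^ 3.
  by rewrite ger0_norm ?powR_ge0// -powRrM; apply: f_equal; field.
have key (v : pt -> R) : in_Lp 3%:E D v -> in_Lp 2%:E D (fun x => `|v x| `^ (3 / 2)) /\
    (Lp 2%:E D (fun x => `|v x| `^ (3 / 2))) `^ (3 / 2)^-1 = Lp 3%:E D v.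
  move=> hv; have [mv _] := hv; split.
    apply/in_LpP => //; split; first exact: measurable_abs_powR.
    move: hv => /in_LpP[]// _; apply: eq_integrable => // x _ /=.
    by rewrite pw.
  rewrite (LpE D _ (ltr0n _ 2)) (LpE D v (ltr0n _ 3)) -powRrM.
  rewrite (_ : \int[mu]_(x in D) _ = \int[mu]_(x in D) (`|v x| `^ 3)).
    by apply: f_equal; field.
  by apply: eq_Rintegral => x _; rewrite pw.
have [g2 Eg] := key g hg; have [h2 Eh] := key h hh.
have [igh le] := Lhoelder mD (ltr0n _ 2) (ltr0n _ 2) (@conj22 R) g2 h2.
have Egh x : `|g x * h x| `^ (3 / 2) = `|g x| `^ (3 / 2) * `|h x| `^ (3 / 2).
  by rewrite normrM powRM.
have mgh : measurable_fun D (fun x => g x * h x) by apply: measurable_funM; [case: hg|case: hh].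
have hgh : in_Lp (3 / 2)%:E D (fun x => g x * h x).
  apply/in_LpP => //; split => //.
  by apply: eq_integrable igh => // x _ /=; rewrite Egh.
have conj : 3^-1 + (3 / 2)^-1 = 1 :> R by field.
have [_ le2] := Lhoelder mD (ltr0n _ 3) r0 conj hf hgh.
apply: le_trans le2 _; rewrite ler_wpM2l ?Lp_ge0// (LpE D _ r0) -Eg -Eh -powRM ?Lp_ge0//.
have I0 : 0 <= \int[mu]_(x in D) (`|g x * h x| `^ (3 / 2)).
  by apply: Rintegral_ge0 => x _; exact: powR_ge0.
apply: ge0_ler_powR; rewrite ?nnegrE ?mulr_ge0 ?Lp_ge0//.
apply: le_trans le; rewrite le_eqVlt; apply/orP; left; apply/eqP; apply: eq_Rintegral => x _.
by rewrite Egh [RHS]ger0_norm// mulr_ge0 ?powR_ge0.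
Qed.

End hoelder333.

Section real_sequences.
Context {R : realType}.

(** b is the fixed point of the affine recursion, so a i - b is dominated by a geometric
    sequence. *)
Lemma contraction_limsup (a : nat -> R) (q b : R) i0 : 0 <= q < 1 ->
  (forall i, (i0 <= i)%N -> a i.+1 <= q * a i + (1 - q) * b) ->
  forall eps, 0 < eps -> exists i1, forall i, (i1 <= i)%N -> a i <= b + eps.
Proof.
move=> /andP[q0 q1] ha eps eps0.
have h n : a (i0 + n)%N - b <= q ^+ n * `|a i0 - b|.
  elim: n => [|n IHn]; first by rewrite addn0 expr0 mul1r ler_norm.
  have := ha (i0 + n)%N (leq_addr _ _); rewrite addnS => h.
  apply: (@le_trans _ _ (q * (a (i0 + n)%N - b))); first by lra.
  by rewrite exprS -mulrA ler_wpM2l.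
have c1 : 0 < eps / (`|a i0 - b| + 1) by rewrite divr_gt0// ltr_wpDl.
have q2 : `|q| < 1 by rewrite ger0_norm.
have /cvgrPdist_lt/(_ _ c1)[N _ hN] := cvg_expr q2.
exists (i0 + N)%N => i iN.
have [n nN ->] : exists2 n, (N <= n)%N & i = (i0 + n)%N.
  by exists (i - i0)%N; rewrite ?subnKC// ?leq_subRL// (leq_trans (leq_addr N i0)).
rewrite -lerBlDl (le_trans (h n))//.
have := hN n nN; rewrite sub0r normrN ger0_norm ?exprn_ge0// => /ltW qn.
apply: le_trans (ler_wpM2r (normr_ge0 _) qn) _.
rewrite mulrAC ler_pdivrMr ?ltr_wpDl// ler_pM2l//.
by rewrite lerDl.
Qed.

(** T1 and T2 come from C, T3 and T4 from the discretisation error of C. The last hypothesis, which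
    expresses that h is small, bounds the second pair by as much as the first; the factor 1/2 of the
    skew form compensates the doubling. *)
Lemma convection_algebra (T1 T2 T3 T4 n G A B S c kap : R) :
  T1 <= n * (A * (S * G)) -> T2 <= n * (B * G) ->
  T3 <= c * (kap * n * (S * G)) -> T4 <= G * (kap * n * (S * c)) ->
  n * G * (2 * (kap * c) * S) <= n * G * (S * A + B) ->
  2^-1 * (T1 + T2 + (T3 + T4)) <= (S * A + B) * n * G.
Proof.
move=> h1 h2 h3 h4 h5; rewrite mulrC ler_pdivrMr//.
apply: (le_trans (lerD (lerD h1 h2) (lerD h3 h4))).
apply: (@le_trans _ _ (n * G * (S * A + B) + n * G * (2 * (kap * c) * S))).
  by rewrite le_eqVlt; apply/orP; left; apply/eqP; ring.
rewrite (_ : (S * A + B) * n * G * 2 = n * G * (S * A + B) + n * G * (S * A + B)).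
  by rewrite lerD2l.
by ring.
Qed.

Lemma ler_mul_sqr (a c G : R) : 0 <= G -> 0 <= c -> a * G ^+ 2 <= c * G -> a * G <= c.
Proof.
move=> G0 c0 h; have [->|Gn] := eqVneq G 0; first by rewrite mulr0.
have Gp : 0 < G by rewrite lt_neqAle eq_sym Gn.
by rewrite -(ler_pM2r Gp) -mulrA -expr2.
Qed.

Lemma skew_algebra (al r x1 x2 x3 x4 x5 x6 x7 x8 x9 G E y t : R) :
  al * x1 + x3 + 2^-1 * (- x3 - x5) + r * x7 = x9 ->
  al * x2 + x4 + 2^-1 * (- x4 - x6) + r * x8 = x9 ->
  y = x4 - x3 - (x6 - x5) -> x2 - x1 = G -> x8 - x7 = E -> 0 <= r * E -> - y <= t ->
  al * G <= 2^-1 * t.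
Proof. by move=> e1 e2 -> <- <-; rewrite !mulrBr => h1 h2; lra. Qed.

End real_sequences.

Section estimates.
Context {R : realType} {k : nat}.
Local Notation d := k.+1.
Local Notation pt := 'rV[R]_k.+1.
Local Notation mu := (@lebesgue_row R k.+1).
Variables (Om : set pt) (hOm : polyhedral_domain Om) (P : pde_data R k) (hP : admissible Om P).
Variables (J : Type) (Th : J -> seq (simplex R k)) (sigma beta0 : R)
  (hTh : regular_family Om Th sigma beta0) (j : J).
Local Notation T := (Th j).
Local Notation h := (mesh_size (Th j)).
Local Notation nrm w := (LpV 2%:E Om w).
Local Notation int f := (mu.-integrable Om (EFin \o f)).
Let oOm : open Om. Proof. exact: domain_open hOm. Qed.
Let bOm : (mu Om < +oo)%E. Proof. exact: domain_lty hOm. Qed.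
Let mOm : measurable Om. Proof. exact: measurable_row_open. Qed.
Let r12 : (1 : R) <= 2. Proof. exact: ler1n. Qed.

Lemma params_gt0 : [/\ 0 < Defs.mu P, 0 < rho P, 0 < beta P, 0 < alpha P & 0 < r0 P].
Proof. by case: hP. Qed.

Lemma Km_gt0 : 0 < Km P. Proof. by have [_ _ [h0 _ _ _] _ _] := hP. Qed.

Lemma cf1_gt0 : 0 < cf1 P. Proof. by have [_ _ _ [_ + _ _] _] := hP. Qed.

Lemma g_L2 : in_Lp 2%:E Om (g P). Proof. by case: hP. Qed.

Definition mcoer : R := Defs.mu P * Km P / rho P.

Lemma mcoer_gt0 : 0 < mcoer.
Proof. by have [m0 r0 _ _ _] := params_gt0; rewrite divr_gt0// mulr_gt0// Km_gt0. Qed.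

Lemma abs_integ_le (f g : pt -> R) : int f -> int g ->
  {ae mu, forall x, Om x -> `|f x| <= g x} -> `|integ Om f| <= integ Om g.
Proof.
move=> hf hg fg; rewrite ler_norml -integN//.
have hN : int (fun x => - g x).
  rewrite (_ : (fun x => - g x) = fun x => -1 * g x); first exact: integrableRZ.
  by apply/funext => x; rewrite mulN1r.
apply/andP; split; apply: ae_integ_le => //; apply: filterS fg => x fg Ox.
  by have := fg Ox; rewrite ler_norml => /andP[].
exact: le_trans (ler_norm _) (fg Ox).
Qed.

Lemma nrm_sqr w : nrm w ^+ 2 = integ Om (fun x => dot (w x) (w x)).
Proof. exact: LpV2_sqr. Qed.

Lemma measurable_lipschitz (f : R -> R) (c : R) (D : set pt) (v : pt -> R) :
  (forall s t, `|f s - f t| <= c * `|s - t|) -> measurable_fun D v ->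
  measurable_fun D (f \o v).
Proof.
move=> lf mv; apply: measurableT_comp => //; apply: continuous_measurable_fun => x.
apply/cvgrPdist_lt => e e0; near=> y.
have c0 : 0 < `|c| + 1 by rewrite ltr_wpDl.
rewrite (le_lt_trans (lf x y))// (@le_lt_trans _ _ ((`|c| + 1) * `|x - y|))//.
  by rewrite ler_wpM2r// (le_trans (ler_norm c))// lerDl.
rewrite mulrC -ltr_pdivlMr//; near: y.
have e1 : 0 < e / (`|c| + 1) by rewrite divr_gt0.
by near=> y; near: y; have /cvgrPdist_lt := @cvg_id _ (nbhs x); apply.
Unshelve. all: by end_near. Qed.

Lemma f1_diff (C C' : pt -> R) : in_Lp 2%:E Om C -> in_Lp 2%:E Om C' ->
  in_LpV 2%:E Om (fun x => f1 P (C x) - f1 P (C' x)) /\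
  nrm (fun x => f1 P (C x) - f1 P (C' x)) <= cf1 P * Lp 2%:E Om (fun x => C x - C' x).
Proof.
move=> hC hC'; have [_ _ _ [_ cf10 f10 lf] _] := hP.
have [mC _] := hC; have [mC' _] := hC'.
have lfi i s t : `|f1 P s 0 i - f1 P t 0 i| <= cf1 P * `|s - t|.
  apply: le_trans (lf s t); have := enorm_coord (f1 P s - f1 P t) i.
  by rewrite !mxE.
have m i : measurable_fun Om (fun x => (f1 P (C x) - f1 P (C' x)) 0 i).
  rewrite (_ : (fun x => _) = fun x => f1 P (C x) 0 i - f1 P (C' x) 0 i); last first.
    by apply/funext => x; rewrite !mxE.
  apply: measurable_funB.
    exact: (measurable_lipschitz (f := fun s => f1 P s 0 i) (lfi i) mC).
  exact: (measurable_lipschitz (f := fun s => f1 P s 0 i) (lfi i) mC').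
have hB : in_Lp 2%:E Om (fun x => C x - C' x) by exact: in_LpB.
have hZ : in_Lp 2%:E Om (fun x => cf1 P * (C x - C' x)).
  by apply: Linf_mul_Lp => //; exact: Linf_cst.
have le x : `|enorm (f1 P (C x) - f1 P (C' x))| <= `|cf1 P * (C x - C' x)|.
  by rewrite ger0_norm ?enorm_ge0// normrM (gtr0_norm cf10).
have ae : {ae mu, forall x, Om x ->
    `|enorm (f1 P (C x) - f1 P (C' x))| <= `|cf1 P * (C x - C' x)|} by exact: aeW.
have me : measurable_fun Om (fun x => enorm (f1 P (C x) - f1 P (C' x))).
  exact: measurable_enorm.
split; last first.
  rewrite -[X in X * _](gtr0_norm cf10) -LpZ//.
  exact: (Lp_mono mOm _ me hZ ae).
by split=> //; have [] := in_Lp_mono mOm (ltr0n _ 2) me hZ ae.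
Qed.

Lemma source_L2 (C : pt -> R) : in_LpV 2%:E Om (f0 P) -> in_Lp 2%:E Om C ->
  in_LpV 2%:E Om (source P C) /\
  nrm (source P C) <= nrm (f0 P) + cf1 P * Lp 2%:E Om C.
Proof.
move=> hf hC; have [_ _ _ [_ _ f10 _] _] := hP.
have h0 : in_Lp 2%:E Om (fun=> 0 : R) by exact: in_Lp_cst.
have [h1 h2] := f1_diff hC h0.
have E : (fun x => f1 P (C x) - f1 P 0) = (fun x => f1 P (C x)).
  by apply/funext => x; rewrite f10 subr0.
have E2 : (fun x => C x - 0) = C by apply/funext => x; rewrite subr0.
rewrite E E2 in h1 h2; split; first exact: in_LpVD.
by apply: (le_trans (LpVD mOm r12 hf h1)); rewrite lerD2l.
Qed.

Section transport.
Variables (S2 : R) (hS2 : poincare_sobolev_constant Om 2 S2).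

(** Tested with C itself, the skew convection vanishes. The bounds therefore do not depend on the
    velocity, and they hold for every iterate and for the discrete solution alike. *)
Lemma transport_energy (w : pt -> pt) (C : pt -> R) : spaceXh Om T w -> spaceYh Om T C ->
  transport_eq Om P T w C ->
  alpha P * nrm (wgrad Om C) <= S2 * Lp 2%:E Om (g P) /\
  Lp 2%:E Om C <= S2 ^+ 2 / alpha P * Lp 2%:E Om (g P).
Proof.
move=> hw hC eqC; have [_ _ _ a0 r0] := params_gt0; have [S20 hS] := hS2.
have [P1C H10C] := hC; have [C2 gC2 _] := H10_L2 hOm H10C.
have /= := eqC C hC; rewrite (integ_wdiv hOm hTh hw H10C H10C).
rewrite (_ : integ Om (fun x => C x * C x) = Lp 2%:E Om C ^+ 2); last first.
  by rewrite Lp2_sqr; apply: eq_integ => x _; rewrite expr2.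
rewrite -nrm_sqr => E.
have le1 : integ Om (fun x => g P x * C x) <= Lp 2%:E Om (g P) * Lp 2%:E Om C.
  by apply: le_trans (ler_norm _) _; apply: L2_mul_le => //; exact: g_L2.
have le2 : Lp 2%:E Om C <= S2 * nrm (wgrad Om C) by exact: hS.
have g0 := Lp_ge0 2%:E Om (g P); have C0 := Lp_ge0 2%:E Om C.
have G0 : 0 <= nrm (wgrad Om C) by exact: LpV_ge0.
have le3 : alpha P * nrm (wgrad Om C) <= S2 * Lp 2%:E Om (g P).
  have [->|Gn] := eqVneq (nrm (wgrad Om C)) 0; first by rewrite mulr0 mulr_ge0// ltW.
  have Gp : 0 < nrm (wgrad Om C) by rewrite lt_neqAle eq_sym Gn.
  rewrite -(ler_pM2r Gp) -mulrA -expr2.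
  have rC : 0 <= Defs.r0 P * Lp 2%:E Om C ^+ 2 by rewrite mulr_ge0 ?sqr_ge0// ltW.
  have : Lp 2%:E Om (g P) * Lp 2%:E Om C <= Lp 2%:E Om (g P) * (S2 * nrm (wgrad Om C)).
    by rewrite ler_wpM2l.
  move: E le1; set I1 := integ _ _; set I2 := integ _ _.
  by move=> E le1 le4; lra.
split=> //; apply: (le_trans le2); rewrite expr2 -!mulrA ler_pM2l//.
by rewrite mulrCA ler_pdivlMl.
Qed.

Variables (S6 : R) (hS6 : poincare_sobolev_constant Om 6 S6).
Variables (cI : R) (hcI : inverse_constant Om Th cI).

Lemma inverse3 w : spaceXh Om T w -> LpV 3%:E Om w <= cI * h `^ (d%:R / 3 - d%:R / 2) * nrm w.
Proof. by move=> hw; have [_] := hcI; apply => //; left. Qed.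

(* The skew-symmetry of the discrete convection cancels all the terms which are
   quadratic in the difference of the concentrations. *)
Lemma transport_diff (C : pt -> R) (c1 : R) (w w' : pt -> pt) (D D' : pt -> R) :
  H10 Om C -> in_Lp +oo%E Om C -> in_LpV 3%:E Om (wgrad Om C) ->
  spaceXh Om T w -> spaceXh Om T w' -> spaceYh Om T D -> spaceYh Om T D' ->
  transport_eq Om P T w D -> transport_eq Om P T w' D' ->
  W1seminorm 2%:E Om (fun x => C x - D x) <= c1 * h ->
  cI * h `^ (d%:R / 3 - d%:R / 2) * (c1 * h) <=
    2^-1 * (W1seminorm 3%:E Om C + Lp +oo%E Om C / S6) ->
  alpha P * W1seminorm 2%:E Om (fun x => D' x - D x) <=
    (S6 * W1seminorm 3%:E Om C + Lp +oo%E Om C) * nrm (fun x => w' x - w x).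
Proof.
move=> hC inC gC3 hw hw' hD hD' eqD eqD' hc1 hh.
have [_ _ _ a0 r0] := params_gt0; have [S60 hS] := hS6.
pose E x := D' x - D x; pose e x := w' x - w x; pose del x := C x - D x.
have hE : spaceYh Om T E := YhB hOm hD' hD.
have he : spaceXh Om T e := XhB hw' hw.
have hdel : H10 Om del := H10B oOm bOm hC hD.2.
have [bD gD wD _] := P1h_Linf hOm hTh hD.1.
have [bD' gD' wD' _] := P1h_Linf hOm hTh hD'.1.
have [bE gE wE _] := P1h_Linf hOm hTh hE.1.
have [bw _ _ bdw] := Xh_Linf hOm hTh hw.
have [bw' _ _ bdw'] := Xh_Linf hOm hTh hw'.
have [be _ _ _] := Xh_Linf hOm hTh he.
have [C2 gC2 wC] := H10_L2 hOm hC.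
have [del2 gdel2 wdel] := H10_L2 hOm hdel.
have gEE := wgradB oOm wD' wD; have gdelE := wgradB oOm wC wD.
have bC := in_Lpoo_Linf inC.
have ii (f : pt -> R) : Linf Om f -> int f by exact: Linf_int.
have ldot (y z : pt -> pt) : LinfV Om y -> LinfV Om z -> Linf Om (fun x => dot (y x) (z x)) by exact: LinfV_dot.
have eq1 := eqD E hE; have eq2 := eqD' E hE.
rewrite /= (integ_wdiv hOm hTh hw hD.2 hE.2) in eq1.
rewrite /= (integ_wdiv hOm hTh hw' hD'.2 hE.2) in eq2.
pose G := nrm (wgrad Om E).
have EG : integ Om (fun x => dot (wgrad Om D' x) (wgrad Om E x)) -
          integ Om (fun x => dot (wgrad Om D x) (wgrad Om E x)) = G ^+ 2.
  rewrite /G nrm_sqr -integB//; [|exact/ii/ldot..].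
  apply: ae_Rintegral => //.
  - by apply: integrable_measurable; apply/ii/LinfB; exact: ldot.
  - by apply: integrable_measurable; exact/ii/ldot.
  - by apply: filterS gEE => x hx /hx; rewrite -dotBl /E => ->.
have EE : integ Om (fun x => D' x * E x) - integ Om (fun x => D x * E x) = Lp 2%:E Om E ^+ 2.
  rewrite -integB//; [|exact/ii/LinfM..].
  by rewrite Lp2_sqr; apply: eq_integ => x _; rewrite -mulrBl expr2.
pose T1 := integ Om (fun x => enorm (e x) * (enorm (wgrad Om C x) * `|E x|)).
pose T2 := integ Om (fun x => enorm (e x) * (enorm (wgrad Om E x) * `|C x|)).
pose T3 := integ Om (fun x => enorm (wgrad Om del x) * (enorm (e x) * `|E x|)).
pose T4 := integ Om (fun x => enorm (wgrad Om E x) * (enorm (e x) * `|del x|)).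
have en2 : in_Lp 2%:E Om (fun x => enorm (e x)).
  by apply: in_LpV_enorm; exact: LinfV_in_LpV.
have en3 : in_Lp 3%:E Om (fun x => enorm (e x)).
  by apply: in_LpV_enorm; apply: LinfV_in_LpV => //; exact: ler1n.
have gE2 : in_Lp 2%:E Om (fun x => enorm (wgrad Om E x)).
  by apply: in_LpV_enorm; exact: LinfV_in_LpV.
have E6 : in_Lp 6%:E Om (fun x => `|E x|) by apply/in_Lp_norm/Linf_in_Lp.
have bdel : Linf Om del by exact: LinfB.
have del6 : in_Lp 6%:E Om (fun x => `|del x|) by apply/in_Lp_norm/Linf_in_Lp.
have ae_E := Linf_norm bE; have ae_C := Linf_norm bC.
have [i1 le1] := Lhoelder236 mOm en2 (in_LpV_enorm gC3) E6.
have [i3 le3] := Lhoelder236 mOm (in_LpV_enorm gdel2) en3 E6.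
have [i4 le4] := Lhoelder236 mOm gE2 en3 del6.
have bT2 : Linf Om (fun x => enorm (e x) * (enorm (wgrad Om E x) * `|C x|)).
  by do 2 (apply: LinfM; [exact: LinfV_enorm|]).
have i2 := ii _ bT2.
have le2 : T2 <= nrm e * (Lp +oo%E Om C * G).
  have mC : in_Lp +oo%E Om C -> {ae mu, forall x, Om x -> `|C x| <= Lp +oo%E Om C} by exact: Lpoo_ae.
  have B0 : 0 <= Lp +oo%E Om C by exact: Lp_ge0.
  have ie : int (fun x => Lp +oo%E Om C * (enorm (e x) * enorm (wgrad Om E x))).
    by apply/ii/LinfZ/LinfM; exact: LinfV_enorm.
  have h2 : T2 <= integ Om (fun x => Lp +oo%E Om C * (enorm (e x) * enorm (wgrad Om E x))).
    apply: ae_integ_le => //; apply: filterS (mC inC) => x hx /hx Cx.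
    by rewrite mulrA [leRHS]mulrC ler_wpM2l// mulr_ge0 ?enorm_ge0.
  apply: (le_trans h2); rewrite integZ//; last first.
    by apply/ii/LinfM; exact: LinfV_enorm.
  rewrite [leRHS]mulrCA; apply: ler_wpM2l => //.
  by apply: le_trans (ler_norm _) _; exact: L2_mul_le.
pose Z x := dot (w' x) (wgrad Om D' x) * E x - dot (w x) (wgrad Om D x) * E x -
  (dot (w' x) (wgrad Om E x) * D' x - dot (w x) (wgrad Om E x) * D x).
have bZ1 : Linf Om (fun x => dot (w' x) (wgrad Om D' x) * E x) by apply: LinfM => //; exact: ldot.
have bZ2 : Linf Om (fun x => dot (w x) (wgrad Om D x) * E x) by apply: LinfM => //; exact: ldot.
have bZ3 : Linf Om (fun x => dot (w' x) (wgrad Om E x) * D' x) by apply: LinfM => //; exact: ldot.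
have bZ4 : Linf Om (fun x => dot (w x) (wgrad Om E x) * D x) by apply: LinfM => //; exact: ldot.
have bZ : Linf Om Z by apply: LinfB; exact: LinfB.
have EZ : integ Om Z = integ Om (fun x => dot (w' x) (wgrad Om D' x) * E x) -
    integ Om (fun x => dot (w x) (wgrad Om D x) * E x) -
    (integ Om (fun x => dot (w' x) (wgrad Om E x) * D' x) -
     integ Om (fun x => dot (w x) (wgrad Om E x) * D x)).
  rewrite integB//; [|exact/ii/LinfB|exact/ii/LinfB].
  by rewrite integB ?integB//; exact/ii.
have Zle : `|integ Om Z| <= T1 + T2 + (T3 + T4).
  rewrite -integD// -integD//.
  have i12 := integrableRD mOm i1 i2; have i34 := integrableRD mOm i3 i4.
  rewrite -integD//; apply: abs_integ_le; [exact/ii|exact: integrableRD|].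
  apply: filterS2 gEE gdelE => x h1 h2 Ox; rewrite /Z.
  have CS (p q : pt) (c : R) : `|dot p q * c| <= enorm p * (enorm q * `|c|).
    by rewrite normrM mulrA; apply: ler_wpM2r => //; exact: norm_dot_le.
  (* Writing D' = D + E, the terms (w' . grad E) E cancel and only e = w' - w remains as velocity;
     then D = C - del replaces D by the exact concentration, whose norms are small, and its
     error. *)
  have ZE : Z x = dot (e x) (wgrad Om C x) * E x - dot (e x) (wgrad Om E x) * C x
     - dot (e x) (wgrad Om del x) * E x + dot (e x) (wgrad Om E x) * del x.
    by rewrite /Z (h1 Ox) (h2 Ox) /e /E /del !(dotBl, dotBr); ring.
  rewrite -/(Z x) ZE (le_trans (ler_normD _ _))// -addrA [leRHS]addrA.
  rewrite (_ : enorm (wgrad Om del x) * (enorm (e x) * `|E x|) =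
               enorm (e x) * (enorm (wgrad Om del x) * `|E x|)); last by ring.
  rewrite (_ : enorm (wgrad Om E x) * (enorm (e x) * `|del x|) =
               enorm (e x) * (enorm (wgrad Om E x) * `|del x|)); last by ring.
  rewrite !addrA lerD// (le_trans (ler_normB _ _))// lerD//.
  by rewrite (le_trans (ler_normB _ _))// lerD.
have key : alpha P * G ^+ 2 <= 2^-1 * (T1 + T2 + (T3 + T4)).
  have rE : 0 <= Defs.r0 P * Lp 2%:E Om E ^+ 2 by rewrite mulr_ge0 ?sqr_ge0// ltW.
  have := ler_norm (- integ Om Z); rewrite normrN => /le_trans/(_ Zle).
  exact: (skew_algebra eq1 eq2 EZ EG EE rE).
have ne0 : 0 <= nrm e by exact: LpV_ge0.
have G0 : 0 <= G by exact: LpV_ge0.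
set kap := cI * h `^ _ in hh.
set A := W1seminorm 3%:E Om C in hh *; set B := Lp +oo%E Om C in hh le2 *.
have A0 : 0 <= A by exact: LpV_ge0.
have e3 : LpV 3%:E Om e <= kap * nrm e by exact: inverse3.
have E6' : Lp 6%:E Om (fun x => `|E x|) <= S6 * G by rewrite Lp_norm; apply: hS; case: hE.
have d6' : Lp 6%:E Om (fun x => `|del x|) <= S6 * (c1 * h).
  by rewrite Lp_norm (le_trans (hS _ hdel))// ler_pM2l.
have le1' : T1 <= nrm e * (A * (S6 * G)).
  apply: (le_trans (ler_norm _)); apply: (le_trans le1).
  by rewrite ler_wpM2l// ler_wpM2l.
have kne0 : 0 <= kap * nrm e by apply: le_trans e3; exact: LpV_ge0.
have le3' : T3 <= c1 * h * (kap * nrm e * (S6 * G)).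
  apply: (le_trans (ler_norm _)); apply: (le_trans le3).
  by rewrite ler_pM ?mulr_ge0 ?Lp_ge0// ler_pM ?Lp_ge0.
have le4' : T4 <= G * (kap * nrm e * (S6 * (c1 * h))).
  apply: (le_trans (ler_norm _)); apply: (le_trans le4).
  by rewrite ler_wpM2l// ler_pM ?Lp_ge0.
have hX : 2 * (kap * (c1 * h)) * S6 <= S6 * A + B.
  have : kap * (c1 * h) * (2 * S6) <= 2^-1 * (A + B / S6) * (2 * S6).
    by rewrite ler_pM2r// mulr_gt0.
  rewrite (_ : 2^-1 * (A + B / S6) * (2 * S6) = S6 * A + B); last by field; rewrite gt_eqF.
  by rewrite (_ : kap * (c1 * h) * (2 * S6) = 2 * (kap * (c1 * h)) * S6); last by ring.
have key2 : alpha P * G ^+ 2 <= (S6 * A + B) * nrm e * G.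
  apply: (le_trans key).
  apply: (convection_algebra le1' le2 le3' le4').
  by rewrite ler_wpM2l// mulr_ge0.
have c0 : 0 <= (S6 * A + B) * nrm e.
  by apply: mulr_ge0 => //; apply: addr_ge0; [apply: mulr_ge0 => //; exact: ltW|exact: Lp_ge0].
exact: (ler_mul_sqr G0 c0 key2).
Qed.

End transport.
End estimates.

(** * Monotonicity of the Forchheimer term |v| v *)

Section cubic.
Context {R : realType} {n : nat}.
Implicit Types (a b c : 'rV[R]_n).

Lemma enorm_lipschitz a b : `|enorm a - enorm b| <= enorm (b - a).
Proof.
rewrite ler_norml; apply/andP; split.
  by rewrite lerBrDl lerBlDr (le_trans _ (enormD _ _))// addrC subrK.
by rewrite lerBlDr enorm_distC (le_trans _ (enormD _ _))// subrK.
Qed.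

(** By Cauchy-Schwarz the expression is at least (|b| - |c|)^2 (|b| + |c|). *)
Lemma cubic_monotone b c : 0 <= enorm b * dot b (b - c) - enorm c * dot c (b - c).
Proof.
rewrite !dotBr (dotC c b) -!enorm_sqr.
have h := dot_le b c; have b0 := enorm_ge0 b; have c0 := enorm_ge0 c.
apply: (@le_trans _ _ ((enorm b - enorm c) ^+ 2 * (enorm b + enorm c))).
  by rewrite mulr_ge0 ?sqr_ge0// addr_ge0.
have : (enorm b + enorm c) * dot b c <= (enorm b + enorm c) * (enorm b * enorm c).
  by rewrite ler_wpM2l// addr_ge0.
by move: (enorm b) (enorm c) (dot b c) => x y z; rewrite !expr2; lra.
Qed.

(** Here a is the lagged velocity, b the new one and c the limit. Replacing |a| by |b| costs at most
    |b - a| |b| |b - c|, and what remains is monotone. *)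
Lemma cubic_diff a b c : - (enorm (b - a) * (enorm b * enorm (b - c))) <=
  enorm a * dot b (b - c) - enorm c * dot c (b - c).
Proof.
have h1 := cubic_monotone b c.
have h2 : - (enorm (b - a) * (enorm b * enorm (b - c))) <= (enorm a - enorm b) * dot b (b - c).
  have : `|(enorm a - enorm b) * dot b (b - c)| <= enorm (b - a) * (enorm b * enorm (b - c)).
    by rewrite normrM ler_pM// ?enorm_lipschitz// norm_dot_le.
  by rewrite ler_norml => /andP[].
apply: (le_trans h2); rewrite -subr_ge0.
by rewrite mulrBl in h2 *; move: h1; lra.
Qed.

Lemma polarization a b : dot (b - a) b = 2^-1 * (dot b b - dot a a + dot (b - a) (b - a)).
Proof. by rewrite !(dotBl, dotBr) (dotC b a); field. Qed.

Lemma momentum_algebra (x1 x2 x3 x4 x5 x6 x7 x8 : R) : x7 + x1 + x3 - (x2 + x4) <= x6 ->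
  x8 <= x1 - x2 -> - x5 <= x3 - x4 -> x7 + x8 <= x6 + x5.
Proof. by lra. Qed.

End cubic.

(** * Energy estimates for the iteration and its convergence *)

Section momentum.
Context {R : realType} {k : nat}.
Local Notation d := k.+1.
Local Notation pt := 'rV[R]_k.+1.
Local Notation mu := (@lebesgue_row R k.+1).
Variables (Om : set pt) (hOm : polyhedral_domain Om) (P : pde_data R k) (hP : admissible Om P).
Variables (J : Type) (Th : J -> seq (simplex R k)) (sigma beta0 : R)
  (hTh : regular_family Om Th sigma beta0) (j : J).
Local Notation T := (Th j).
Local Notation h := (mesh_size (Th j)).
Local Notation nrm w := (LpV 2%:E Om w).
Local Notation int f := (mu.-integrable Om (EFin \o f)).
Local Notation m := (mcoer P).
Let oOm : open Om. Proof. exact: domain_open hOm. Qed.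
Let bOm : (mu Om < +oo)%E. Proof. exact: domain_lty hOm. Qed.
Let mOm : measurable Om. Proof. exact: measurable_row_open. Qed.
Let r12 : (1 : R) <= 2. Proof. exact: ler1n. Qed.
Let ii (f : pt -> R) : Linf Om f -> int f. Proof. exact: Linf_int. Qed.

Lemma mcoerE : m = Defs.mu P / rho P * Km P.
Proof. by rewrite /mcoer mulrAC. Qed.

Lemma KinvB y z (x : pt) : Kinv P (fun x => y x - z x) x = Kinv P y x - Kinv P z x.
Proof. by rewrite /Kinv mulmxBl. Qed.

Lemma Kinv_LinfV y : LinfV Om y -> LinfV Om (Kinv P y).
Proof.
move=> hy i; rewrite (_ : (fun x => _) = fun x => \sum_l y x 0 l * invmx (Kt P x) i l).
  by apply: Linf_sum => l; apply: LinfM => //; exact: Kinv_Linf.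
by apply/funext => x; rewrite mxE; apply: eq_bigr => l _; rewrite mxE.
Qed.

Lemma integ_Kinv_ge y : LinfV Om y ->
  Km P * nrm y ^+ 2 <= integ Om (fun x => dot (Kinv P y x) (y x)).
Proof.
move=> hy; have hyy := LinfV_dot hy hy.
rewrite nrm_sqr -integZ//; last exact: ii.
apply: ae_integ_le => //; [exact/ii/LinfZ|exact/ii/LinfV_dot/hy/Kinv_LinfV|].
by apply: filterS (Kinv_coercive hP) => x hx /hx; apply.
Qed.

Lemma integ_polarization (v w : pt -> pt) : LinfV Om v -> LinfV Om w ->
  integ Om (fun x => dot (w x - v x) (w x)) =
  2^-1 * (nrm w ^+ 2 - nrm v ^+ 2 + nrm (fun x => w x - v x) ^+ 2).
Proof.
move=> hv hw; have hB := LinfVB hw hv.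
rewrite !nrm_sqr -integB//; [|exact/ii/LinfV_dot..].
rewrite -integD//; [|exact/ii/LinfB/LinfV_dot/hv/hv/LinfV_dot|exact/ii/LinfV_dot].
rewrite -integZ//; first by apply: eq_integ => x _; exact: polarization.
by apply/ii/LinfD; [apply: LinfB; exact: LinfV_dot|exact: LinfV_dot].
Qed.

Section step.
Variables (gamma : R) (gamma0 : 0 < gamma) (u u' : pt -> pt) (C p' C' : pt -> R).
Hypotheses (hu : spaceXh Om T u) (hf0 : in_LpV 2%:E Om (f0 P)) (hC : spaceYh Om T C).
Hypothesis (pb : problem_Vahi Om P T gamma u C u' p' C').

Let bu : LinfV Om u. Proof. by have [] := Xh_Linf hOm hTh hu. Qed.
Let hu' : spaceXh Om T u'. Proof. by case: pb => -[]. Qed.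
Let bu' : LinfV Om u'. Proof. by have [] := Xh_Linf hOm hTh hu'. Qed.
Let C2 : in_Lp 2%:E Om C. Proof. by have [+ _ _] := H10_L2 hOm hC.2. Qed.

(** The test function is u' itself: the pressure drops out because u' is discretely solenoidal, and
    the cubic term with the lagged factor |u| is nonnegative. *)
Lemma momentum_energy : gamma / 2 * (nrm u' ^+ 2 - nrm u ^+ 2) + m * nrm u' ^+ 2 <=
  nrm (source P C) * nrm u'.
Proof.
have [m0 r0 b0 _ _] := params_gt0 hP.
have [_ [eq1 eq2 _]] := pb; have hM : spaceMh Om T p' by case: pb => -[].
have := eq1 u' hu'; rewrite (eq2 p' hM) addr0 (integ_polarization bu bu').
have [s2 _] := source_L2 hOm hP hf0 C2.
have le1 : integ Om (fun x => dot (source P C x) (u' x)) <= nrm (source P C) * nrm u'.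
  exact: le_trans (ler_norm _) (L2V_dot mOm s2 (LinfV_in_LpV mOm bOm r12 bu')).2.
move=> E; rewrite -E in le1.
have le2 := integ_Kinv_ge bu'.
have le3 : 0 <= integ Om (fun x => enorm (u x) * dot (u' x) (u' x)).
  by apply: integ_ge0 => x _; rewrite mulr_ge0 ?enorm_ge0 ?dot_ge0.
apply: le_trans le1.
have le2' : m * nrm u' ^+ 2 <= Defs.mu P / rho P * integ Om (fun x => dot (Kinv P u' x) (u' x)).
  by rewrite mcoerE -mulrA ler_wpM2l// divr_ge0// ltW.
have le3' : 0 <= beta P / rho P * integ Om (fun x => enorm (u x) * dot (u' x) (u' x)).
  by rewrite mulr_ge0// divr_ge0// ltW.
have le4 : 0 <= gamma * (2^-1 * nrm (fun x => u' x - u x) ^+ 2).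
  by apply: mulr_ge0; [exact: ltW|apply: mulr_ge0; [rewrite invr_ge0|exact: sqr_ge0]].
apply: (@le_trans _ _ (gamma * (2^-1 * (nrm u' ^+ 2 - nrm u ^+ 2 + nrm (fun x => u' x - u x) ^+ 2)) +
  m * nrm u' ^+ 2)).
  by rewrite lerD2r -[leLHS]mulrA [X in _ <= gamma * X]mulrDr [leRHS]mulrDr lerDl.
by rewrite -[leRHS]addrA lerD2l (le_trans le2')// lerDl.
Qed.

Variables (cI : R) (hcI : inverse_constant Om Th cI).
Variables (uh : pt -> pt) (ph Ch : pt -> R) (pbh : problem_Vah Om P T uh ph Ch).
Let huh : spaceXh Om T uh. Proof. by case: pbh => -[]. Qed.
Let buh : LinfV Om uh. Proof. by have [] := Xh_Linf hOm hTh huh. Qed.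
Let Ch2 : in_Lp 2%:E Om Ch.
Proof. by case: pbh => -[_ _ [_ H]] _; have [+ _ _] := H10_L2 hOm H. Qed.
Local Notation e := (fun x => u x - uh x).
Local Notation e' := (fun x => u' x - uh x).
Local Notation dd := (fun x => u' x - u x).
Let be : LinfV Om e. Proof. exact: LinfVB. Qed.
Let be' : LinfV Om e'. Proof. exact: LinfVB. Qed.
Let bdd : LinfV Om dd. Proof. exact: LinfVB. Qed.

(** The constant of the lagged cubic term in L^2 norms: each of its three L^3 norms costs one
    inverse inequality. *)
Definition Ncubic : R := beta P / rho P * (cI * h `^ (d%:R / 3 - d%:R / 2)) ^+ 3.

Lemma pressure_zero : integ Om (fun x => dot (wgrad Om p' x) (e' x)) = 0 /\
  integ Om (fun x => dot (wgrad Om ph x) (e' x)) = 0.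
Proof.
have [_ [_ eq2 _]] := pb; have [_ [_ eqh2 _]] := pbh.
have hM : spaceMh Om T p' by case: pb => -[].
have hMh : spaceMh Om T ph by case: pbh => -[].
have split_ (q : pt -> R) : spaceMh Om T q -> integ Om (fun x => dot (wgrad Om q x) (e' x)) = 0.
  move=> hq; have [_ gq _ _] := P1h_Linf hOm hTh hq.1.
  rewrite (_ : integ Om _ = integ Om (fun x => dot (wgrad Om q x) (u' x) - dot (wgrad Om q x) (uh x))).
    by rewrite integB//; [rewrite eq2// eqh2// subr0|exact/ii/LinfV_dot..].
  by apply: eq_integ => x _; rewrite dotBr.
by split; exact: split_.
Qed.

(** Both new velocities are discretely solenoidal, so the pressures drop out of the difference.
    Monotonicity leaves only the lagged part of the cubic term, and inverse inequalities turn its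
    L^3 norms into [Ncubic]. *)
Lemma momentum_diff : gamma / 2 * (nrm e' ^+ 2 - nrm e ^+ 2 + nrm dd ^+ 2) + m * nrm e' ^+ 2 <=
  cf1 P * Lp 2%:E Om (fun x => C x - Ch x) * nrm e' + Ncubic * (nrm dd * (nrm u' * nrm e')).
Proof.
have [m0 r0 b0 _ _] := params_gt0 hP.
have [_ [eq1 _ _]] := pb; have [_ [eqh1 _ _]] := pbh.
have he' : spaceXh Om T e' := XhB hu' huh.
have hdd : spaceXh Om T dd := XhB hu' hu.
have [pz phz] := pressure_zero.
have E1 := eq1 e' he'; have E2 := eqh1 e' he'.
rewrite pz addr0 in E1; rewrite phz addr0 in E2.
have J1 : integ Om (fun x => dot (dd x) (e' x)) = 2^-1 * (nrm e' ^+ 2 - nrm e ^+ 2 + nrm dd ^+ 2).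
  have eE : (fun x => e' x - e x) = dd by apply/funext => x; rewrite opprB addrA subrK.
  rewrite -[in nrm dd]eE -(integ_polarization be be').
  by apply: eq_integ => x _; congr dot; rewrite opprB addrA subrK.
have J2 : m * nrm e' ^+ 2 <= Defs.mu P / rho P * (integ Om (fun x => dot (Kinv P u' x) (e' x)) -
    integ Om (fun x => dot (Kinv P uh x) (e' x))).
  rewrite -integB//; [|exact/ii/LinfV_dot/be'/Kinv_LinfV..].
  rewrite (_ : integ Om _ = integ Om (fun x => dot (Kinv P e' x) (e' x))); last first.
    by apply: eq_integ => x _; rewrite KinvB dotBl.
  rewrite mcoerE -mulrA ler_wpM2l//.
    by rewrite divr_ge0// ltW.
  exact: integ_Kinv_ge.
pose T3 := integ Om (fun x => enorm (dd x) * (enorm (u' x) * enorm (e' x))).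
have bT3 : Linf Om (fun x => enorm (dd x) * (enorm (u' x) * enorm (e' x))).
  by apply: LinfM; [exact: LinfV_enorm|apply: LinfM; exact: LinfV_enorm].
have J3 : - T3 <= integ Om (fun x => enorm (u x) * dot (u' x) (e' x)) -
    integ Om (fun x => enorm (uh x) * dot (uh x) (e' x)).
  have b1 : Linf Om (fun x => enorm (u x) * dot (u' x) (e' x)).
    by apply: LinfM; [exact: LinfV_enorm|exact: LinfV_dot].
  have b2 : Linf Om (fun x => enorm (uh x) * dot (uh x) (e' x)).
    by apply: LinfM; [exact: LinfV_enorm|exact: LinfV_dot].
  rewrite -integB//; [|exact: ii..]; rewrite -integN//; last exact: ii.
  apply: ae_integ_le => //; [exact/ii/LinfN|exact/ii/LinfB|].
  by apply: aeW => x _; exact: cubic_diff.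
have L3 (w : pt -> pt) : LinfV Om w -> in_Lp 3%:E Om (fun x => enorm (w x)).
  by move=> hw; apply: in_LpV_enorm; apply: LinfV_in_LpV => //; exact: ler1n.
have J3' : T3 <= (cI * h `^ (d%:R / 3 - d%:R / 2)) ^+ 3 * (nrm dd * (nrm u' * nrm e')).
  have le3 := Lhoelder333 mOm (L3 _ bdd) (L3 _ bu') (L3 _ be').
  have -> : T3 = \int[mu]_(x in Om) `|enorm (dd x) * (enorm (u' x) * enorm (e' x))|.
    apply: eq_Rintegral => x _; rewrite ger0_norm//.
    by rewrite mulr_ge0 ?enorm_ge0// mulr_ge0 ?enorm_ge0.
  apply: (le_trans le3).
  have i1 := inverse3 hcI hdd; have i2 := inverse3 hcI hu'; have i3 := inverse3 hcI he'.
  set kap := cI * _ in i1 i2 i3 *.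
  rewrite (_ : kap ^+ 3 * _ = (kap * nrm dd) * ((kap * nrm u') * (kap * nrm e'))); last first.
    by rewrite !exprS expr0 mulr1; ring.
  by rewrite ler_pM ?mulr_ge0 ?Lp_ge0// ler_pM ?Lp_ge0.
have J4 : integ Om (fun x => dot (source P C x) (e' x)) - integ Om (fun x => dot (source P Ch x) (e' x)) <=
    cf1 P * Lp 2%:E Om (fun x => C x - Ch x) * nrm e'.
  have [s2 _] := source_L2 hOm hP hf0 C2; have [sh2 _] := source_L2 hOm hP hf0 Ch2.
  have e2 := LinfV_in_LpV mOm bOm r12 be'.
  have [f2 fle] := f1_diff hOm hP C2 Ch2.
  have i1 := (L2V_dot mOm s2 e2).1; have i2 := (L2V_dot mOm sh2 e2).1.
  rewrite -integB//.
  rewrite (_ : integ Om _ = integ Om (fun x => dot (f1 P (C x) - f1 P (Ch x)) (e' x))); last first.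
    by apply: eq_integ => x _; rewrite -dotBl /source opprD addrACA subrr add0r.
  apply: (le_trans (ler_norm _)); apply: (le_trans (L2V_dot mOm f2 e2).2).
  by rewrite ler_wpM2r// LpV_ge0.
have J3'' : - (Ncubic * (nrm dd * (nrm u' * nrm e'))) <=
   beta P / rho P * (integ Om (fun x => enorm (u x) * dot (u' x) (e' x)) -
    integ Om (fun x => enorm (uh x) * dot (uh x) (e' x))).
  rewrite /Ncubic -mulrA -mulrN ler_wpM2l//; first by rewrite divr_ge0// ltW.
  by apply: le_trans J3; rewrite lerN2.
rewrite -E1 -E2 J1 in J4.
move: J4 J2 J3''; set a := nrm _ ^+ 2 - _ + _; rewrite !mulrBr -[gamma / 2 * a]mulrA.
exact: momentum_algebra.
Qed.

End step.

(** Young's inequality F n <= F^2 / (2 c) + c n^2 / 2 leaves (gamma + c) n^2 <= gamma x + F^2 / c,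
    an affine recursion with fixed point (F / c)^2. *)
Lemma energy_algebra (gamma c n x F : R) : 0 < gamma -> 0 < c ->
  gamma / 2 * (n ^+ 2 - x) + c * n ^+ 2 <= F * n ->
  n ^+ 2 <= gamma / (gamma + c) * x + (1 - gamma / (gamma + c)) * (F ^+ 2 / c ^+ 2).
Proof.
move=> g0 c0 h1; have gc : 0 < gamma + c by exact: addr_gt0.
have h2 : F * n <= F ^+ 2 / (2 * c) + c / 2 * n ^+ 2.
  rewrite -subr_ge0 (_ : _ - _ = (F - c * n) ^+ 2 / (2 * c)); last by field; rewrite gt_eqF.
  by rewrite divr_ge0 ?sqr_ge0// mulr_ge0// ltW.
rewrite (_ : _ + _ = (gamma * x + F ^+ 2 / c) / (gamma + c)); last by field; rewrite !gt_eqF.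
rewrite ler_pdivlMr//.
have : F ^+ 2 / (2 * c) = F ^+ 2 / c / 2 by field; rewrite gt_eqF.
by move: h2; set y := F ^+ 2 / (2 * c); set z := F ^+ 2 / c => h2 yz; nra.
Qed.

(** The coupling takes c/4 of e'^2 and c/8 of e^2, which is Young's inequality with the constant c /
    (2 sqrt 2) of the smallness assumption. The cubic term takes gamma/2 of D^2 and c/2 of e'^2. So
    c/4 remains on the left against c/8 on the right. *)
Lemma contraction_algebra (gamma c e e' D v N A : R) : 0 < gamma -> 0 < c ->
  0 <= e -> 0 <= e' ->
  gamma / 2 * (e' ^+ 2 - e ^+ 2 + D ^+ 2) + c * e' ^+ 2 <= A * e' + N * (D * (v * e')) ->
  A <= c / (2 * Num.sqrt 2) * e -> N ^+ 2 * v ^+ 2 <= c * gamma ->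
  e' ^+ 2 <= (gamma / 2 + c / 8) / (gamma / 2 + c / 4) * e ^+ 2.
Proof.
move=> g0 c0 e0 e0' h1 h2 h3.
have s2 : Num.sqrt 2 ^+ 2 = 2 :> R by rewrite sqr_sqrtr.
have s0 : 0 < Num.sqrt 2 :> R by rewrite sqrtr_gt0.
have h4 : A * e' <= c / 4 * e' ^+ 2 + c / 8 * e ^+ 2.
  apply: (@le_trans _ _ (c / (2 * Num.sqrt 2) * e * e')); first by rewrite ler_wpM2r.
  rewrite -subr_ge0 (_ : _ - _ = c / 8 * (Num.sqrt 2 * e' - e) ^+ 2).
    by rewrite mulr_ge0 ?sqr_ge0// divr_ge0// ltW.
  have -> : c / (2 * Num.sqrt 2) = c / 4 * Num.sqrt 2.
    by rewrite -[in RHS](mulfK (lt0r_neq0 s0) (c / 4 * _)) -(mulrA (c / 4)) -expr2 s2; field; rewrite gt_eqF.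
  rewrite sqrrB exprMn s2; move: (Num.sqrt 2) => s.
  by field.
have h5 : N * (D * (v * e')) <= gamma / 2 * D ^+ 2 + c / 2 * e' ^+ 2.
  apply: (@le_trans _ _ (gamma / 2 * D ^+ 2 + N ^+ 2 * v ^+ 2 / (2 * gamma) * e' ^+ 2)).
    rewrite -subr_ge0 (_ : _ - _ = (gamma * D - N * v * e') ^+ 2 / (2 * gamma)); last by field; rewrite gt_eqF.
    by rewrite divr_ge0 ?sqr_ge0// mulr_ge0// ltW.
  rewrite lerD2l ler_wpM2r ?sqr_ge0// ler_pdivrMr ?mulr_gt0//.
  by rewrite (le_trans h3)// le_eqVlt; apply/orP; left; apply/eqP; field.
have gc : 0 < gamma / 2 + c / 4 by rewrite addr_gt0// divr_gt0.
rewrite mulrAC ler_pdivlMr//.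
have := le_trans h1 (lerD h4 h5); move: (e' ^+ 2) (e ^+ 2) (D ^+ 2) => x y z.
by lra.
Qed.

Section convergence.
Variables (S2 S6 cI c1 : R) (hS2 : poincare_sobolev_constant Om 2 S2)
  (hS6 : poincare_sobolev_constant Om 6 S6) (hcI : inverse_constant Om Th cI) (c10 : 0 < c1).
Variables (C : pt -> R) (hC : H10 Om C) (Coo : in_Lp +oo%E Om C)
  (gC3 : in_LpV 3%:E Om (wgrad Om C)) (hf0 : in_LpV 2%:E Om (f0 P)).
Local Notation Lam := (S6 * W1seminorm 3%:E Om C + Lp +oo%E Om C).
Hypothesis hLam : Lam <= alpha P * Defs.mu P * Km P / (2 * Num.sqrt 2 * rho P * cf1 P * S2).
Variables (uh : pt -> pt) (ph Ch : pt -> R) (gamma : R) (us : nat -> pt -> pt)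
  (ps Cs : nat -> pt -> R).
Hypotheses (pbh : problem_Vah Om P T uh ph Ch) (gamma0 : 0 < gamma)
  (its : iterates Om P T gamma us ps Cs)
  (hgamma : gamma_star Om P S2 cI h < gamma)
  (hCh : W1seminorm 2%:E Om (fun x => C x - Ch x) <= c1 * h)
  (hh : cI * h `^ (d%:R / 3 - d%:R / 2) * (c1 * h) <=
    2^-1 * (W1seminorm 3%:E Om C + Lp +oo%E Om C / S6)).
Local Notation F := (data_norm Om P S2).
Local Notation N := (Ncubic cI).

Let h0 : 0 < h. Proof. exact: mesh_gt0 hOm hTh j. Qed.
Let m0 : 0 < m. Proof. exact: mcoer_gt0 hP. Qed.

Let usX i : spaceXh Om T (us i).
Proof. by case: i => [|i]; have [h1 _ h3] := its; [exact: h1|have [[]] := h3 i]. Qed.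

Let CsY i : spaceYh Om T (Cs i).
Proof. by case: i => [|i]; have [_ h2 h3] := its; [exact: h2|have [[]] := h3 i]. Qed.

Let CsE i : transport_eq Om P T (us i.+1) (Cs i.+1).
Proof. by have [_ _ h3] := its; have [_ []] := h3 i. Qed.

Let uhX : spaceXh Om T uh. Proof. by case: pbh => -[]. Qed.
Let ChY : spaceYh Om T Ch. Proof. by case: pbh => -[]. Qed.
Let ChE : transport_eq Om P T uh Ch. Proof. by case: pbh => _ []. Qed.

(** Stated for [i.+1]: the initial concentration is arbitrary and satisfies no transport
    equation. *)
Lemma source_bound i : nrm (source P (Cs i.+1)) <= F.
Proof.
have [_ le1] := transport_energy hOm hP hTh hS2 (usX i.+1) (CsY i.+1) (CsE i).
have [C2 _ _] := H10_L2 hOm (CsY i.+1).2.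
have [_ le2] := source_L2 hOm hP hf0 C2.
apply: (le_trans le2); rewrite /data_norm lerD2l -mulrA ler_wpM2l//.
exact/ltW/(cf1_gt0 hP).
Qed.

(** The second summand of [gamma_star] equals 32/27 times N^2 F^2 / m^3, and the first is
    nonnegative. *)
Lemma gamma_cubic : N ^+ 2 * (F ^+ 2 / m ^+ 2) < m * gamma.
Proof.
have [mu0 r0 b0 _ _] := params_gt0 hP; have K0 := Km_gt0 hP; have K1 := KM_gt0 hP.
have [cI0 _] := hcI; have F0 : 0 <= F.
  rewrite /data_norm addr_ge0 ?LpV_ge0// mulr_ge0 ?Lp_ge0// mulr_ge0//; first exact/ltW/(cf1_gt0 hP).
  by rewrite divr_ge0 ?sqr_ge0//; have [_ _ _ a0 _] := params_gt0 hP; exact: ltW.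
have hp : (h `^ (d%:R / 3 - d%:R / 2)) ^+ 6 = h `^ (- d%:R).
  by rewrite -powR_mulrn ?powR_ge0// -powRrM; apply: f_equal; field.
have := hgamma; rewrite /gamma_star -hp.
set q1 := _ * (_ + _) * _; set z := h `^ _; set q2 := _ * z ^+ 6 * _.
have q10 : 0 <= q1.
  rewrite mulr_ge0// mulr_ge0//; last first.
    by rewrite addr_ge0// divr_ge0 ?mulr_ge0 ?sqr_ge0 ?ltW.
  rewrite mulr_ge0 ?powR_ge0// mulr_ge0 ?exprn_ge0 ?(ltW cI0)//.
  by rewrite divr_ge0// mulr_ge0// ltW.
have E : N ^+ 2 * (F ^+ 2 / m ^+ 2) * (32 / 27) = m * q2.
  by rewrite /N /q2 /mcoer -/z; field; rewrite !gt_eqF.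
move=> hg; have q20 : 0 <= q2.
  rewrite mulr_ge0 ?sqr_ge0// mulr_ge0 ?exprn_ge0 ?powR_ge0// mulr_ge0 ?exprn_ge0 ?(ltW cI0)//.
  rewrite divr_ge0 ?mulr_ge0 ?exprn_ge0 ?sqr_ge0 ?(ltW r0) ?(ltW mu0) ?(ltW K0) ?(ltW b0)//.
have h1 : q2 < gamma by rewrite (le_lt_trans _ hg)// lerDr.
have h2 : m * q2 < m * gamma by rewrite ltr_pM2l.
have h3 : 0 <= N ^+ 2 * (F ^+ 2 / m ^+ 2).
  by rewrite mulr_ge0 ?sqr_ge0// divr_ge0 ?sqr_ge0.
by move: E h2 h3; set y := N ^+ 2 * _; lra.
Qed.

(** The stability of the transport equation, the smallness of C and Poincare's inequality combine
    into the factor m / (2 sqrt 2) that [contraction_algebra] expects. *)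
Lemma concentration_step i : alpha P * W1seminorm 2%:E Om (fun x => Cs i.+1 x - Ch x) <=
    Lam * nrm (fun x => us i.+1 x - uh x) /\
  cf1 P * Lp 2%:E Om (fun x => Cs i.+1 x - Ch x) <=
    m / (2 * Num.sqrt 2) * nrm (fun x => us i.+1 x - uh x).
Proof.
have [mu0 r0 b0 a0 _] := params_gt0 hP; have K0 := Km_gt0 hP; have cf0 := cf1_gt0 hP.
have [S20 hS] := hS2; have s0 : 0 < Num.sqrt 2 :> R by rewrite sqrtr_gt0.
have le1 := transport_diff hOm hP hTh hS6 hcI hC Coo gC3 uhX (usX i.+1) ChY (CsY i.+1) ChE (CsE i) hCh hh.
split=> //; have hE := (YhB hOm (CsY i.+1) ChY).2.
have le2 := hS _ hE; apply: (le_trans (ler_wpM2l (ltW cf0) le2)).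
have n0 : 0 <= nrm (fun x => us i.+1 x - uh x) by exact: LpV_ge0.
have le3 := le_trans le1 (ler_wpM2r n0 hLam).
have ca : 0 < cf1 P * S2 / alpha P by rewrite divr_gt0// mulr_gt0.
have := ler_wpM2l (ltW ca) le3.
set n := nrm _; set w := W1seminorm _ _ _.
rewrite (_ : cf1 P * S2 / alpha P * (alpha P * w) = cf1 P * (S2 * w)); last by field; rewrite gt_eqF.
rewrite (_ : cf1 P * S2 / alpha P * _ = m / (2 * Num.sqrt 2) * n)//.
by rewrite /mcoer; field; rewrite !gt_eqF.
Qed.

(** The energy recursion has fixed point (F / m)^2, and [gamma_cubic] places N^2 (F / m)^2 strictly
    below m gamma. After finitely many steps the velocities satisfy the bound required by
    [contraction_algebra]. *)
Lemma velocity_bounded : exists i1, forall i, (i1 <= i)%N -> N ^+ 2 * nrm (us i) ^+ 2 <= m * gamma.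
Proof.
have gm : 0 < gamma + m by rewrite addr_gt0.
have q1 : 0 <= gamma / (gamma + m) < 1.
  by rewrite divr_ge0 ?ltW//= ltr_pdivrMr// mul1r ltrDl.
have step i : (1 <= i)%N -> nrm (us i.+1) ^+ 2 <=
    gamma / (gamma + m) * nrm (us i) ^+ 2 + (1 - gamma / (gamma + m)) * (F ^+ 2 / m ^+ 2).
  case: i => // i _; apply: energy_algebra => //.
  have [_ _ h3] := its.
  apply: (le_trans (momentum_energy gamma0 (usX i.+1) hf0 (CsY i.+1) (h3 i.+1))).
  by rewrite ler_wpM2r ?LpV_ge0//; exact: source_bound.
have N1 : 0 < N ^+ 2 + 1 by rewrite ltr_wpDl ?sqr_ge0.
(* The gap in [gamma_cubic], divided by N^2 + 1 so that N^2 eps stays within it. *)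
have eps0 : 0 < (m * gamma - N ^+ 2 * (F ^+ 2 / m ^+ 2)) / (N ^+ 2 + 1).
  by rewrite divr_gt0// subr_gt0 gamma_cubic.
have [i1 hi1] := contraction_limsup q1 step eps0.
exists i1 => i /hi1 hx; apply: (le_trans (ler_wpM2l (sqr_ge0 N) hx)).
rewrite [leLHS]mulrDr -lerBrDl [leLHS]mulrA ler_pdivrMr// [leLHS]mulrC ler_wpM2l//.
  by rewrite subr_ge0 ltW// gamma_cubic.
by rewrite lerDl.
Qed.

Lemma velocity_converges (eps : R) : 0 < eps ->
  exists i1, forall i, (i1 <= i)%N -> nrm (fun x => us i x - uh x) ^+ 2 <= eps.
Proof.
move=> eps0; have [i1 hi1] := velocity_bounded.
pose q := (gamma / 2 + m / 8) / (gamma / 2 + m / 4).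
have d0 : 0 < gamma / 2 + m / 4 by rewrite addr_gt0// divr_gt0.
have q1 : 0 <= q < 1.
  have n0 : 0 < gamma / 2 + m / 8 by rewrite addr_gt0// divr_gt0.
  rewrite divr_ge0 ?(ltW n0) ?(ltW d0)//= ltr_pdivrMr// mul1r ltrD2l.
  by rewrite ltr_pM2l// ltf_pV2 ?posrE// ltr_nat.
(* The index has to be positive, since [concentration_step] concerns only concentrations that solve
   a transport equation. *)
have step i : (maxn i1 1 <= i)%N -> nrm (fun x => us i.+1 x - uh x) ^+ 2 <=
    q * nrm (fun x => us i x - uh x) ^+ 2 + (1 - q) * 0.
  rewrite geq_max mulr0 addr0; case: i => [/andP[_ //]|i /andP[i1i _]].
  have [_ _ h3] := its.
  have := momentum_diff (usX i.+1) hf0 (CsY i.+1) (h3 i.+1) hcI pbh.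
  move/contraction_algebra; apply=> //; try exact: LpV_ge0.
    exact: (concentration_step i).2.
  by apply: hi1; rewrite (leq_trans i1i).
have [i2 hi2] := contraction_limsup q1 step eps0.
by exists i2 => i /hi2; rewrite add0r.
Qed.

Lemma iterates_converge : exists i1, forall i, (i1 <= i)%N ->
  W1seminorm 2%:E Om (fun x => C x - Cs i.+1 x) <= (c1 + 1) * h.
Proof.
have [mu0 r0 b0 a0 _] := params_gt0 hP; have [S60 _] := hS6.
have L0 : 0 <= Lam by rewrite addr_ge0 ?Lp_ge0// mulr_ge0 ?(ltW S60)// LpV_ge0.
have L1 : 0 < Lam + 1 by rewrite ltr_wpDl.
(* Once the velocity error is below this value, [concentration_step] places C^{i+1} within h of C_h
   in the H^1 seminorm. The added 1 allows Lam to vanish. *)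
have t0 : 0 < alpha P * h / (Lam + 1) by rewrite divr_gt0// mulr_gt0.
have [i1 hi1] := velocity_converges (exprn_gt0 2 t0).
exists i1 => i i1i; have := hi1 i.+1 (leqW i1i).
rewrite ler_pXn2r// ?nnegrE ?LpV_ge0 ?(ltW t0)// => ne.
have [le1 _] := concentration_step i.
have le2 : W1seminorm 2%:E Om (fun x => Cs i.+1 x - Ch x) <= h.
  rewrite -(ler_pM2l a0); apply: (le_trans le1); apply: (le_trans (ler_wpM2l L0 ne)).
  by rewrite mulrA ler_pdivrMr// mulrC ler_wpM2l ?lerDl// mulr_ge0// ltW.
have W (v : pt -> R) : H10 Om v -> W1 2%:E Om v by case.
have E : (fun x => (C x - Ch x) - (Cs i.+1 x - Ch x)) = (fun x => C x - Cs i.+1 x).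
  by apply/funext => x; rewrite opprB addrA subrK.
have w1 : W1 2%:E Om (fun x => C x - Ch x) := W _ (H10B oOm bOm hC ChY.2).
have w2 : W1 2%:E Om (fun x => Cs i.+1 x - Ch x) := W _ (YhB hOm (CsY i.+1) ChY).2.
rewrite -E /W1seminorm (LpV_wgradB oOm r12 mOm (@subset_refl _ Om) w1 w2).
have [_ g1 _] := H10_L2 hOm (H10B oOm bOm hC ChY.2).
have [_ g2 _] := H10_L2 hOm (YhB hOm (CsY i.+1) ChY).2.
apply: (le_trans (LpVB mOm r12 g1 g2)).
by rewrite mulrDl mul1r lerD.
Qed.

End convergence.
End momentum.

(** * Radial bumps and polynomials on balls *)

Section ball_volume.
Context {R : realType} {k : nat}.
Local Notation d := k.+1.
Local Notation pt := 'rV[R]_k.+1.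
Local Notation mu := (@lebesgue_row R k.+1).

Lemma box_volume (c : pt) (t : R) : 0 <= t ->
  mu (open_box (c - const_mx t) (c + const_mx t)) = ((2 * t) ^+ d)%:E.
Proof.
move=> t0; rewrite lebesgue_open_box; last by move=> i; rewrite !mxE; lra.
congr EFin; rewrite (eq_bigr (fun=> 2 * t)) ?prodr_const ?card_ord//.
by move=> i _; rewrite !mxE; ring.
Qed.

Lemma eball_lty (c : pt) r : (mu (eball c r) < +oo)%E.
Proof.
apply: (@lebesgue_row_lty _ _ _ (r + \sum_i `|c 0 i|)); first exact: measurable_eball.
move=> x xc i; rewrite -[x](subrK c) mxE (le_trans (ler_normD _ _))// lerD//.
  by rewrite (le_trans (enorm_coord _ _))// ltW.
by rewrite (bigD1 i)//= lerDl sumr_ge0.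
Qed.

(** The volume of the cube of half side r / d, which lies in the ball because the Euclidean norm is
    at most the sum of the coordinates in absolute value. *)
Definition eball_vol (r : R) := (2 * (r / d%:R)) ^+ d.

Lemma eball_volume (c : pt) r : 0 < r ->
  eball_vol r <= fine (mu (eball c r)) <= (2 * r) ^+ d.
Proof.
move=> r0; have mB := measurable_eball c r.
have fB : mu (eball c r) \is a fin_num by rewrite ge0_fin_numE// eball_lty.
rewrite -!lee_fin fineK//; apply/andP; split.
  rewrite -(@box_volume c); last by rewrite divr_ge0 ?ltW.
  apply: le_measure; rewrite ?inE//; first exact: measurable_open_box.
  move=> x xb; rewrite /eball /= (le_lt_trans (enorm_le_sum _))//.
  rewrite (@lt_le_trans _ _ (\sum_(i < d) r / d%:R))//.
    apply: ltr_sum; first by apply/hasP; exists ord0; rewrite ?mem_index_enum.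
    move=> i _; have := xb i; rewrite !mxE ltr_norml; move: (r / d%:R) => t.
    by move=> /andP[h1 h2]; apply/andP; split; lra.
  by rewrite sumr_const card_ord -[_ *+ _]mulr_natr divfK// pnatr_eq0.
rewrite -(box_volume c (ltW r0)); apply: le_measure; rewrite ?inE//.
  exact: measurable_open_box.
move=> x; rewrite /eball /= => xc i; have := le_lt_trans (enorm_coord (x - c) i) xc.
by rewrite !mxE ltr_norml => /andP[h1 h2]; apply/andP; split; lra.
Qed.

End ball_volume.

Section polynomial_bounds.
Context {R : realType}.

(** The coefficients are recovered from the values at the n + 1 nodes j / (n + 1) by the inverse of
    a Vandermonde matrix, which depends on n only. *)
Lemma poly_coef_bound n : exists2 K : R, 0 <= K & forall (p : {poly R}) (A : R),
  (size p <= n.+1)%N -> (forall t, 0 <= t <= 1 -> `|p.[t]| <= A) -> forall i, `|p`_i| <= K * A.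
Proof.
pose a : 'rV[R]_n.+1 := \row_j ((j : nat)%:R / n.+1%:R).
pose V : 'M[R]_n.+1 := Vandermonde n.+1 a.
have uV : V \in unitmx.
  rewrite unitmxE unitfE det_Vandermonde; apply/prodf_neq0 => i _; apply/prodf_neq0 => j ij.
  by rewrite !mxE -mulrBl mulf_neq0 ?invr_neq0 ?pnatr_eq0// subr_eq0 eqr_nat gtn_eqF.
exists (\sum_i \sum_j `|invmx V i j|); first by apply: sumr_ge0 => i _; apply: sumr_ge0.
move=> p A sp hA i.
have A0 : 0 <= A by apply: le_trans (hA 0 _); rewrite ?lexx ?ler01// normr_ge0.
pose c : 'rV[R]_n.+1 := \row_m p`_m.
have cV j : (c *m V) 0 j = p.[a 0 j].
  rewrite mxE (horner_coef_wide _ sp); apply: eq_bigr => m _.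
  by rewrite /V /c !mxE.
have [ni|ni] := leqP n.+1 i.
  rewrite nth_default ?normr0 ?(leq_trans sp)// mulr_ge0//.
  by apply: sumr_ge0 => m _; apply: sumr_ge0.
have -> : p`_i = ((c *m V) *m invmx V) 0 (Ordinal ni) by rewrite mulmxK// mxE.
rewrite mxE (le_trans (ler_norm_sum _ _ _))// mulr_suml; apply: ler_sum => m _.
rewrite normrM mulrC ler_pM//.
  by rewrite (bigD1 (Ordinal ni))//= lerDl sumr_ge0.
rewrite cV; apply: hA; rewrite mxE divr_ge0//= ler_pdivrMr ?ltr0n// mul1r ler_nat.
exact/ltnW.
Qed.

Context {k : nat}.
Local Notation d := k.+1.
Local Notation pt := 'rV[R]_k.+1.

(* The centre y is a maximum point of |f| on B(c, r / 2). *)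
Lemma polyf_large_ball n (Q : R) : 1 <= Q -> exists del K : R,
  [/\ 0 < del, 0 < K & forall (f : pt -> R) (c : pt) (r : R), polyf n f -> 0 < r ->
    exists (y : pt) (m : R) (b : bool),
    [/\ 0 <= m, eball y (del * r) `<=` [set x | enorm (x - c) <= r],
        forall x, enorm (x - c) <= Q * r -> `|f x| <= K * m &
        forall x, eball y (del * r) x -> m <= (-1) ^+ b * f x]].
Proof.
move=> Q1; have [K1 K10 hK1] := poly_coef_bound n.
have Q0 : 0 < Q by exact: lt_le_trans Q1.
have Q2 : 1 <= 2 * Q by lra.
pose K2 := K1 * (2 * Q) ^+ n * n.+1%:R.
have K20 : 0 <= K2 by rewrite !mulr_ge0// exprn_ge0// mulr_ge0// ltW.
pose K3 := K1 * K2 * n.+1%:R.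
have K30 : 0 <= K3 by rewrite /K3 mulr_ge0// mulr_ge0.
(* Chosen so that 2 del K3 <= 1/2: f then varies by at most half of its maximum A on the small ball
   around y. *)
pose del := (4 * (K3 + 1))^-1.
have del0 : 0 < del by rewrite invr_gt0 mulr_gt0// ltr_wpDl.
have del2 : 2 * del <= 1.
  by rewrite ler_pdivrMr ?mulr_gt0 ?ltr_wpDl// mul1r; lra.
exists del, (2 * K2 + 1); split=> //; first by rewrite ltr_wpDl// mulr_ge0.
move=> f c r pf r0; pose S : set pt := [set x | enorm (x - c) <= r / 2].
have cf : continuous f by apply: smooth_continuous; exact: polyf_smooth pf.
have cS : compact S by exact: compact_closed_eball.
have Sc : S c by rewrite /S /= subrr enorm0 divr_ge0// ltW.
have [y Sy hy] : exists2 y, S y & forall x, S x -> `|f x| <= `|f y|.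
  have cn : {within S, continuous (fun x => `|f x|)}.
    by apply: continuous_subspaceT => x; apply: continuous_comp; [exact: cf|exact: norm_continuous].
  have [y Sy hy] := @compact_EVT_max _ R (fun x => `|f x|) S (ex_intro _ c Sc) cS cn.
  by exists y => [|x Sx]; [exact: set_mem|apply: hy; exact: mem_set].
set A := `|f y| in hy.
(* Extrapolation from the ball of radius r / 2: v is scaled so that the parameters in [0, 1] stay in
   that ball, and x corresponds to the parameter 2 Q. *)
have bound1 x : enorm (x - c) <= Q * r -> `|f x| <= K2 * A.
  move=> xc; pose v := (2 * Q)^-1 *: (x - c).
  have [p [sp hp]] := polyf_line c v pf.
  have hv t : 0 <= t <= 1 -> `|p.[t]| <= A.
    move=> /andP[t0 t1]; rewrite -hp; apply: hy; rewrite /S /= addrAC subrr add0r !enormZ.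
    rewrite ger0_norm// ger0_norm ?invr_ge0 ?mulr_ge0 ?(ltW Q0)//.
    rewrite (@le_trans _ _ (1 * ((2 * Q)^-1 * (Q * r))))//.
      rewrite ler_pM// ?mulr_ge0 ?enorm_ge0 ?invr_ge0 ?mulr_ge0 ?(ltW Q0)//.
      by rewrite ler_wpM2l// invr_ge0 mulr_ge0 ?(ltW Q0).
    by rewrite le_eqVlt; apply/orP; left; apply/eqP; field; rewrite gt_eqF.
  have -> : f x = p.[2 * Q].
    rewrite -hp /v scalerA mulfV ?scale1r ?[c + _]addrC ?subrK//.
    by rewrite mulf_neq0 ?gt_eqF.
  rewrite (horner_coef_wide _ sp) (le_trans (ler_norm_sum _ _ _))//.
  apply: (@le_trans _ _ (\sum_(i < n.+1) K1 * (2 * Q) ^+ n * A)).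
    apply: ler_sum => i _; rewrite normrM normrX (ger0_norm (_ : 0 <= 2 * Q)); last lra.
    rewrite mulrAC; apply: ler_pM => //; [by rewrite exprn_ge0//; lra|exact: (hK1 p A sp hv)|].
    by apply: ler_weXn2l => //; rewrite -ltnS.
  by rewrite sumr_const card_ord -[_ *+ _]mulr_natr mulrAC.
(* Along the line from y the parameters in [0, 1] stay within r of c, where [bound1] applies. At the
   parameter 2 del the constant coefficient cancels and each other coefficient carries a factor 2
   del. *)
have bound2 x : eball y (del * r) x -> `|f x - f y| <= A / 2.
  rewrite /eball /= => xy; pose v := (2 * del)^-1 *: (x - y).
  have d2 : 0 < 2 * del by rewrite mulr_gt0.
  have ev : enorm v <= r / 2.
    rewrite enormZ gtr0_norm ?invr_gt0// mulrC ler_pdivrMr//.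
    by rewrite (le_trans (ltW xy))// le_eqVlt; apply/orP; left; apply/eqP; field.
  have [p [sp hp]] := polyf_line y v pf.
  have hv t : 0 <= t <= 1 -> `|p.[t]| <= K2 * A.
    move=> /andP[t0 t1]; rewrite -hp; apply: bound1.
    rewrite addrAC (le_trans (enormD _ _))// enormZ ger0_norm//.
    apply: (@le_trans _ _ (r / 2 + 1 * (r / 2))).
      by rewrite lerD// ler_pM// enorm_ge0.
    rewrite (_ : _ + _ = r); last by field.
    by rewrite ler_peMl// ltW.
  have -> : f x = p.[2 * del].
    by rewrite -hp /v scalerA mulfV ?gt_eqF// scale1r addrC subrK.
  have -> : f y = p`_0 by rewrite -horner_coef0 -hp scale0r addr0.
  rewrite (horner_coef_wide _ sp) big_ord_recl expr0 mulr1 addrAC subrr add0r.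
  rewrite (le_trans (ler_norm_sum _ _ _))//.
  apply: (@le_trans _ _ (\sum_(i < n) K1 * (K2 * A) * (2 * del))).
    apply: ler_sum => i _; rewrite normrM normrX (gtr0_norm d2).
    apply: ler_pM => //; [by rewrite exprn_ge0 ?(ltW d2)|exact: (hK1 p _ sp hv)|].
    by rewrite exprS ler_piMr ?(ltW d2)// exprn_ile1// ltW.
  rewrite sumr_const card_ord -[_ *+ _]mulr_natr.
  apply: (@le_trans _ _ (K3 * (2 * del) * A)).
    rewrite /K3 (_ : K1 * (K2 * A) * (2 * del) * n%:R = K1 * K2 * n%:R * (2 * del) * A); last by ring.
    have K12 : 0 <= K1 * K2 by exact: mulr_ge0.
    have nn : 0 <= n.+1%:R - n%:R :> R by rewrite subr_ge0 ler_nat.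
    have A0 : 0 <= A by exact: normr_ge0.
    rewrite -subr_ge0 -!mulrBl -mulrBr.
    by do 2 (apply: mulr_ge0 => //); [exact: mulr_ge0|exact: ltW].
  rewrite mulrC ler_wpM2l ?normr_ge0// /del.
  rewrite invfM !mulrA ler_pdivrMr ?ltr_wpDl//; lra.
exists y, (A / 2), (f y < 0); split.
- by rewrite divr_ge0// normr_ge0.
- move=> x; rewrite /eball /= => xy; rewrite -(subrK y x) -addrA (le_trans (enormD _ _))//.
  have dr : del * r <= r / 2 by rewrite mulrC ler_wpM2l ?(ltW r0)//; lra.
  by move: Sy; rewrite /S /=; lra.
- move=> x xc; apply: (le_trans (bound1 x xc)).
  rewrite (_ : (2 * K2 + 1) * (A / 2) = K2 * A + A / 2); last by field.
  by rewrite lerDl divr_ge0// normr_ge0.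
- move=> x /bound2; rewrite ler_norml /A => /andP[h1 h2].
  have [fy|fy] := ltP (f y) 0; move: h1 h2.
    by rewrite (ltr0_norm fy) expr1 mulN1r; lra.
  by rewrite (ger0_norm fy) expr0 mul1r; lra.
Qed.

End polynomial_bounds.

Section radial_bump.
Context {R : realType} {k : nat}.
Local Notation d := k.+1.
Local Notation pt := 'rV[R]_k.+1.
Local Notation mu := (@lebesgue_row R k.+1).
Variables (c : pt) (s : R) (s0 : 0 < s).

Definition bump_arg (x : pt) : R := 1 - dot (x - c) (x - c) / s ^+ 2.
(** The standard mollifier profile exp(-1 / (1 - |x - c|^2 / s^2)), extended by 0. *)
Definition rbump (x : pt) : R := flat 1 (bump_arg x).

Lemma smooth_bump_arg : smooth bump_arg.
Proof.
rewrite (_ : bump_arg = fun x => 1 + (- s ^- 2) * dot (x - c) (x - c)).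
  apply: smoothD; first exact: smooth_cst.
  by apply: smoothM; [exact: smooth_cst|exact: smooth_sqdist].
by apply/funext => x; rewrite /bump_arg mulNr mulrC.
Qed.

Lemma smooth_bump : smooth rbump.
Proof. by apply: smooth_flat; exact: smooth_bump_arg. Qed.

Lemma bump_bnd x : 0 <= rbump x <= 1.
Proof. by rewrite flat1_ge0 flat1_le1. Qed.

Lemma bump_arg_le0 x : s <= enorm (x - c) -> bump_arg x <= 0.
Proof.
move=> xs; rewrite subr_le0 ler_pdivlMr ?exprn_gt0// mul1r -enorm_sqr.
by rewrite ler_pXn2r ?nnegrE ?enorm_ge0 ?(ltW s0).
Qed.

Lemma bump_out x : ~ eball c s x -> rbump x = 0.
Proof. by move=> /negP; rewrite -leNgt => xs; apply: flat_le0; exact: bump_arg_le0. Qed.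

Lemma bump_test Om : [set x | enorm (x - c) <= s] `<=` Om -> test_function Om rbump.
Proof.
move=> hs; split; first exact: smooth_bump.
exists [set x | enorm (x - c) <= s]; split=> //; first exact: compact_closed_eball.
by move=> x nx; apply: bump_out => xs; apply: nx; exact: ltW.
Qed.

(** The gradient is a nonnegative multiple of c - x; the constant sign in the face estimate comes
    from this. *)
Lemma grad_bump x : grad rbump x = - (2 / s ^+ 2 * flat ('X^2) (bump_arg x)) *: (x - c).
Proof.
apply/rowP => i; rewrite !mxE.
have [_ ->] := pderiv_flat 1 i (smooth_differentiable x smooth_bump_arg).
rewrite (_ : flat_diff 1 = 'X^2); last by rewrite /flat_diff derivC subr0 mulr1.
have cs m : smooth (fun y : pt => (y - c) 0 m).
  rewrite (_ : (fun y : pt => (y - c) 0 m) = fun y => y 0 m + - c 0 m).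
    by apply: smoothD; [exact: smooth_coord|exact: smooth_cst].
  by apply/funext => y; rewrite !mxE.
have pc m y : pderiv i (fun y : pt => (y - c) 0 m) y = (i == m)%:R.
  rewrite (_ : (fun y : pt => (y - c) 0 m) = fun y => y 0 m + - c 0 m); last first.
    by apply/funext => z; rewrite !mxE.
  rewrite pderivD; [|exact/smooth_differentiable/smooth_coord|exact/smooth_differentiable/smooth_cst].
  by rewrite pderiv_coord pderiv_cst addr0.
rewrite (_ : bump_arg = fun x => 1 + (- s ^- 2) * dot (x - c) (x - c)); last first.
  by apply/funext => y; rewrite /bump_arg mulNr mulrC.
rewrite pderivD; [|exact/smooth_differentiable/smooth_cst|]; last first.
  apply/smooth_differentiable/smoothM; [exact: smooth_cst|exact: smooth_sqdist].
rewrite pderivM; [|exact/smooth_differentiable/smooth_cst|exact/smooth_differentiable/smooth_sqdist].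
rewrite !pderiv_cst mulr0 addr0 add0r.
have -> : pderiv i (fun y : pt => dot (y - c) (y - c)) x = 2 * (x - c) 0 i.
  rewrite /dot pderiv_sum; last by move=> m; exact: smoothM.
  rewrite (bigD1 i)//= big1 ?addr0; last first.
    move=> m mi; rewrite pderivM; [|exact/smooth_differentiable/cs..].
    by rewrite pc eq_sym (negbTE mi) !mulr0 addr0.
  rewrite pderivM; [|exact/smooth_differentiable/cs..].
  by rewrite pc eqxx mulr1; ring.
rewrite !mxE; set y := flat _ _.
by rewrite -[s ^- 2]mulr1; field; rewrite gt_eqF.
Qed.

(** For y = 1/t, y^2 <= 2 e^y. *)
Lemma flatX2_le t : 0 <= flat ('X^2 : {poly R}) t <= 2.
Proof.
rewrite /flat; case: ifP => t0; last by rewrite lexx ler0n.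
rewrite hornerXn; set y := t^-1; have y0 : 0 < y by rewrite invr_gt0.
apply/andP; split; first by rewrite mulr_ge0 ?sqr_ge0 ?expR_ge0.
rewrite expRN ler_pdivrMr ?expR_gt0//.
have := expR_ge1Dxn 1 (ltW y0); rewrite (_ : 2`!%:R = 2 :> R)// => h.
by rewrite mulrC -ler_pdivrMr// (le_trans _ h)// lerDr.
Qed.

(** The range [1/4, 1] contains the values of [bump_arg] at all points within 3/4 of the radius,
    where it is at least 7/16. *)
Lemma flat_ge t : 4^-1 <= t <= 1 ->
  expR (- 4) <= flat (1 : {poly R}) t /\ expR (- 4) <= flat ('X^2 : {poly R}) t.
Proof.
move=> /andP[t4 t1]; have t0 : 0 < t by apply: lt_le_trans t4; rewrite invr_gt0.
have h : expR (- 4 : R) <= expR (- t^-1).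
  by rewrite ler_expR lerN2 -[4]invrK lef_pV2// posrE invr_gt0.
rewrite /flat t0 hornerC hornerXn mul1r; split=> //.
rewrite (le_trans h)// ler_peMl ?expR_ge0// exprn_ege1// invf_ge1//.
Qed.

Lemma enorm_grad_bump x : enorm (grad rbump x) <= 4 / s.
Proof.
rewrite grad_bump enormZ normrN.
have /andP[f0 f2] := flatX2_le (bump_arg x).
have s4 : 0 <= 4 / s by rewrite divr_ge0// ltW.
rewrite ger0_norm; last by rewrite mulr_ge0// divr_ge0// exprn_ge0// ltW.
have [xs|xs] := leP s (enorm (x - c)).
  by rewrite flat_le0 ?bump_arg_le0// mulr0 mul0r.
apply: (@le_trans _ _ (2 / s ^+ 2 * 2 * s)).
  rewrite ler_pM ?enorm_ge0 ?(ltW xs)//.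
    by rewrite mulr_ge0// divr_ge0// exprn_ge0// ltW.
  by rewrite ler_wpM2l// divr_ge0// exprn_ge0// ltW.
by rewrite le_eqVlt; apply/orP; left; apply/eqP; field; rewrite gt_eqF.
Qed.

Lemma grad_bump_out x : ~ eball c s x -> grad rbump x = 0.
Proof.
by move=> /negP; rewrite -leNgt => xs; rewrite grad_bump flat_le0 ?bump_arg_le0// mulr0 oppr0 scale0r.
Qed.

Lemma bump_arg_ge (q : R) x : enorm (x - c) <= q * s -> 1 - q ^+ 2 <= bump_arg x <= 1.
Proof.
move=> xq; rewrite /bump_arg gerBl divr_ge0 ?dot_ge0 ?exprn_ge0 ?(ltW s0)// andbT.
rewrite lerD2l lerN2 ler_pdivrMr ?exprn_gt0// -enorm_sqr -exprMn.
rewrite ler_pXn2r ?nnegrE ?enorm_ge0//.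
exact: le_trans (enorm_ge0 _) xq.
Qed.

Lemma measurable_bump (D : set pt) : measurable D -> measurable_fun D rbump.
Proof. by move=> mD; apply: measurable_funTS; apply: smooth_measurable; exact: smooth_bump. Qed.

End radial_bump.

(** * Element residuals *)

Section residual.
Context {R : realType} {k : nat}.
Local Notation d := k.+1.
Local Notation pt := 'rV[R]_k.+1.
Local Notation mu := (@lebesgue_row R k.+1).
Variables (Om : set pt) (hOm : polyhedral_domain Om) (P : pde_data R k) (hP : admissible Om P).
Variables (u : pt -> pt) (p C : pt -> R) (hsol : problem_Va Om P u p C).
Local Notation int f := (mu.-integrable Om (EFin \o f)).
Let oOm : open Om. Proof. exact: domain_open hOm. Qed.
Let bOm : (mu Om < +oo)%E. Proof. exact: domain_lty hOm. Qed.
Let mOm : measurable Om. Proof. exact: measurable_row_open. Qed.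
Let r12 : (1 : R) <= 2. Proof. exact: ler1n. Qed.
Let ii (f : pt -> R) : Linf Om f -> int f. Proof. exact: Linf_int. Qed.

Lemma domain_measure_gt0 : 0 < fine (mu Om).
Proof.
have [x Ox] := domain_neq0 hOm.
have [e e0 eO] := nbhs_enorm (open_nbhs_nbhs (conj oOm Ox)).
have /andP[h _] := eball_volume x e0.
apply: (@lt_le_trans _ _ (eball_vol (k := k) e)).
  by rewrite exprn_gt0// mulr_gt0// divr_gt0.
apply: (le_trans h); rewrite fine_le ?ge0_fin_numE ?eball_lty//.
by apply: le_measure; rewrite ?inE//; exact: measurable_eball.
Qed.

(** It permits the subtraction of a mean value, and shows that derivatives of test functions have
    integral zero. *)
Lemma cst_weak_gradient (c : R) : is_weak_gradient Om (fun=> c) (fun=> 0).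
Proof.
split; first by apply: Linf_loc_int => //; exact: Linf_cst.
  move=> i; apply: Linf_loc_int => //.
  by rewrite (_ : (fun x => _) = fun=> 0); [exact: Linf_cst|apply/funext => x; rewrite mxE].
move=> phi tphi i.
apply: (@lip_weak _ _ Om (fun=> c) _ i 0 `|c| oOm) => //.
- by move=> x t _; rewrite subrr normr0 mul0r.
- by apply: aeW => x _; rewrite mxE; exact: is_derive_cst.
Qed.

Lemma integ_pderiv_test psi i : test_function Om psi -> integ Om (pderiv i psi) = 0.
Proof.
move=> tpsi; have [_ _ /(_ psi tpsi i)] := cst_weak_gradient 1.
under [X in X = _]eq_integ do rewrite mul1r.
move=> ->; rewrite (_ : integ Om _ = integ Om (fun=> 0)).
  by rewrite /integ Rintegral_cst// mul0r oppr0.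
by apply: eq_integ => x _; rewrite mxE mul0r.
Qed.

Lemma velocity_L3 : in_LpV 3%:E Om u. Proof. by case: hsol => -[]. Qed.

Lemma velocity_L2 : in_LpV 2%:E Om u.
Proof.
have h13 : (1 : R) <= 3 by exact: ler1n.
apply/in_LpVP => // i; apply: L3_L2 => //.
by have /in_LpVP := velocity_L3; apply.
Qed.

Lemma concentration_H10 : H10 Om C. Proof. by case: hsol => -[]. Qed.

Section mul_test.
Variables (v : pt -> R) (psi : pt -> R).
Hypotheses (bv : Linf Om v) (gv : LinfV Om (wgrad Om v)) (wv : has_wgrad Om v)
  (tpsi : test_function Om psi).

Lemma test_LinfV : LinfV Om (grad psi).
Proof.
have [_ h] := test_bnd tpsi; move=> i.
by rewrite (_ : (fun x => _) = pderiv i psi)//; apply/funext => x; rewrite mxE.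
Qed.

(** The function psi v minus its mean is an admissible pressure test function of the exact problem,
    and u is orthogonal to its gradient. *)
Lemma velocity_solenoidal : integ Om (fun x => dot (u x) (wgrad Om v x) * psi x) +
  integ Om (fun x => dot (u x) (grad psi x) * v x) = 0.
Proof.
have [bpsi _] := test_bnd tpsi.
pose f x := psi x * v x; pose c := integ Om f / fine (mu Om).
pose G x := psi x *: wgrad Om v x + v x *: grad psi x.
have bf : Linf Om f by exact: LinfM.
have bG : LinfV Om G.
  move=> i; rewrite (_ : (fun x => _) = fun x => psi x * wgrad Om v x 0 i + v x * grad psi x 0 i).
    by apply: LinfD; apply: LinfM => //; exact: test_LinfV.
  by apply/funext => x; rewrite !mxE.
have wf : is_weak_gradient Om (fun x => f x - c) (fun x => G x - 0).
  apply: is_weak_gradientB => //; last exact: cst_weak_gradient.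
  apply: is_weak_gradient_mul => //; [exact: wgrad_weak|by case: tpsi].
have bfc : Linf Om (fun x => f x - c) by apply: LinfB => //; exact: Linf_cst.
have r32 : (1 : R) <= 3 / 2 by lra.
have hM : spaceM Om (fun x => f x - c).
  split; [split|split].
  - by apply: Linf_in_Lp => //; lra.
  - exists (fun x => G x - 0) => //; apply: LinfV_in_LpV => //.
    by rewrite (_ : (fun x => G x - 0) = G)//; apply/funext => x; rewrite subr0.
  - exact: Linf_in_Lp.
  - rewrite integB//; [|exact: ii|exact/ii/Linf_cst].
    by rewrite {2}/integ Rintegral_cst// /c divfK ?subrr// gt_eqF// domain_measure_gt0.
have [_ [_ /(_ _ hM) E _]] := hsol.
have L2mul (w : pt -> pt) (z : pt -> R) : LinfV Om w -> Linf Om z ->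
    int (fun x => dot (u x) (w x) * z x).
  move=> hw hz; have [h _] := L2V_dot mOm velocity_L2 (LinfV_in_LpV mOm bOm r12 hw).
  rewrite (_ : _ \o _ = EFin \o (fun x => z x * dot (u x) (w x))); last first.
    by apply/funext => x /=; rewrite mulrC.
  exact: Linf_mul_int.
rewrite -integD//; [|exact: L2mul|exact: L2mul test_LinfV _].
rewrite -[RHS]E; apply: ae_Rintegral => //.
- apply: integrable_measurable; apply: integrableRD => //; first exact: L2mul.
  by apply: L2mul => //; exact: test_LinfV.
- apply: measurable_dot => i; last by have [+ _] := velocity_L3; apply.
  by apply: measurable_wgrad; exists (fun x => G x - 0).
- apply: filterS (wgradE oOm wf) => x h Ox; rewrite h// /G subr0.
  by rewrite dotDl !dotZl !(dotC _ (u x)); ring.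
Qed.

End mul_test.

Variables (J : Type) (Th : J -> seq (simplex R k)) (sigma beta0 : R)
  (hTh : regular_family Om Th sigma beta0) (j : J).
Variables (u' : pt -> pt) (C' : pt -> R) (hu' : spaceXh Om (Th j) u') (hC' : spaceYh Om (Th j) C').

(** The term alpha Laplacian C' is absent because C' is affine on each element; its singular part,
    carried by the faces, reappears as the gradient term of [residual_identity]. The exact g is used
    instead of its approximation. *)
Definition strong_residual (x : pt) : R :=
  g P x - dot (u' x) (wgrad Om C' x) - 2^-1 * wdiv Om u' x * C' x - Defs.r0 P * C' x.

Let bu' : LinfV Om u'. Proof. by have [] := Xh_Linf hOm hTh hu'. Qed.
Let bdu' : Linf Om (wdiv Om u'). Proof. by have [] := Xh_Linf hOm hTh hu'. Qed.
Let bC' : Linf Om C'. Proof. by have [] := P1h_Linf hOm hTh hC'.1. Qed.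
Let gC' : LinfV Om (wgrad Om C'). Proof. by have [] := P1h_Linf hOm hTh hC'.1. Qed.
Let wC' : has_wgrad Om C'. Proof. by have [] := P1h_Linf hOm hTh hC'.1. Qed.

Lemma strong_residual_L2 : in_Lp 2%:E Om strong_residual.
Proof.
rewrite (_ : strong_residual = fun x => g P x - (dot (u' x) (wgrad Om C' x) +
    (2^-1 * (wdiv Om u' x * C' x) + Defs.r0 P * C' x))).
  apply: in_LpB => //; first exact: g_L2 hP.
  apply: Linf_in_Lp => //; apply: LinfD; first exact: LinfV_dot.
  by apply: LinfD; apply: LinfZ => //; exact: LinfM.
by apply/funext => x; rewrite /strong_residual; ring.
Qed.

Let del (x : pt) := C x - C' x.

Lemma L2_int (f z : pt -> R) : in_Lp 2%:E Om f -> Linf Om z -> int (fun x => f x * z x).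
Proof. by move=> hf hz; apply: L2_mul => //; exact: Linf_in_Lp. Qed.

Lemma L2V_int (w y : pt -> pt) (z : pt -> R) : in_LpV 2%:E Om w -> in_LpV 2%:E Om y -> Linf Om z ->
  int (fun x => dot (w x) (y x) * z x).
Proof.
move=> hw hy hz; have [h _] := L2V_dot mOm hw hy.
rewrite (_ : _ \o _ = EFin \o (fun x => z x * dot (w x) (y x))).
  exact: Linf_mul_int.
by apply/funext => x /=; rewrite mulrC.
Qed.

Lemma residual_algebra (al r z0 z1 z2 z3 z4 z5 z6 z7 z8 z9 zw : R) :
  z3 + z5 = 0 -> zw = - z4 - z6 -> al * z1 + z2 + r * z7 = z9 ->
  z9 - z4 - 2^-1 * zw - r * z8 =
  al * z0 + (al * (z1 - z0) + (z2 - z3) - 2^-1 * (z4 - z3) + 2^-1 * (z6 - z5) + r * (z7 - z8)).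
Proof. by move=> E1 -> <-; lra. Qed.

(* The discrete equation plays no role here: the residual is tested against a
   smooth function, for which only the exact problem is used. *)
Lemma residual_identity psi : test_function Om psi ->
  integ Om (fun x => strong_residual x * psi x) =
  alpha P * integ Om (fun x => dot (wgrad Om C' x) (grad psi x)) +
  (alpha P * integ Om (fun x => dot (wgrad Om del x) (grad psi x)) +
   integ Om (fun x => dot (u x) (wgrad Om del x) * psi x) -
   2^-1 * integ Om (fun x => dot (u' x - u x) (wgrad Om C' x) * psi x) +
   2^-1 * integ Om (fun x => dot (u' x - u x) (grad psi x) * C' x) +
   Defs.r0 P * integ Om (fun x => del x * psi x)).
Proof.
move=> tpsi; have [bpsi _] := test_bnd tpsi.
have gpsi := test_LinfV tpsi.
have Hpsi := test_H10 oOm bOm tpsi.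
have E1 := velocity_solenoidal bC' gC' wC' tpsi.
have E2 := integ_wdiv hOm hTh hu' hC'.2 Hpsi.
have [_ [_ _ /(_ psi Hpsi) /= E3]] := hsol.
have [C2 gC2 wC] := H10_L2 hOm concentration_H10.
have u2 := velocity_L2; have g2 := g_L2 hP.
have V2 w : LinfV Om w -> in_LpV 2%:E Om w by exact: LinfV_in_LpV.
have wpsi := wgrad_test oOm tpsi.
have wdel := wgradB oOm wC wC'.
have mw i : measurable_fun Om (fun x => wgrad Om psi x 0 i).
  by apply: measurable_wgrad => //; have [_ _] := H10_L2 hOm Hpsi.
have mwdel i : measurable_fun Om (fun x => wgrad Om del x 0 i).
  by apply: measurable_wgrad => //; exact: has_wgradB.
have mV (w : pt -> pt) : in_LpV 2%:E Om w -> forall i, measurable_fun Om (fun x => w x 0 i).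
  by case.
have mpsi : measurable_fun Om psi by case: bpsi.
have mC' : measurable_fun Om C' by case: bC'.
have mgpsi := mV _ (V2 _ gpsi); have mgC' := mV _ (V2 _ gC'); have mu' := mV _ (V2 _ bu').
have mvel := mV _ u2; have mgC := mV _ gC2.
have mdot (w y : pt -> pt) : (forall i, measurable_fun Om (fun x => w x 0 i)) ->
    (forall i, measurable_fun Om (fun x => y x 0 i)) -> measurable_fun Om (fun x => dot (w x) (y x)).
  exact: measurable_dot.
pose i0 := integ Om (fun x => dot (wgrad Om C' x) (grad psi x)).
pose i1 := integ Om (fun x => dot (wgrad Om C x) (grad psi x)).
pose i2 := integ Om (fun x => dot (u x) (wgrad Om C x) * psi x).
pose i3 := integ Om (fun x => dot (u x) (wgrad Om C' x) * psi x).
pose i4 := integ Om (fun x => dot (u' x) (wgrad Om C' x) * psi x).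
pose i5 := integ Om (fun x => dot (u x) (grad psi x) * C' x).
pose i6 := integ Om (fun x => dot (u' x) (grad psi x) * C' x).
pose i7 := integ Om (fun x => C x * psi x); pose i8 := integ Om (fun x => C' x * psi x).
pose i9 := integ Om (fun x => g P x * psi x).
pose iw := integ Om (fun x => wdiv Om u' x * C' x * psi x).
have F1 : integ Om (fun x => dot (wgrad Om C x) (wgrad Om psi x)) = i1.
  apply: ae_Rintegral => //; [exact: mdot|exact: mdot|].
  by apply: filterS wpsi => x h /h ->.
have F2 : integ Om (fun x => dot (u' x) (wgrad Om psi x) * C' x) = i6.
  apply: ae_Rintegral => //; [by apply: measurable_funM => //; exact: mdot..|].
  by apply: filterS wpsi => x h /h ->.
have h1 : int (fun x => dot (wgrad Om C x) (grad psi x)) := (L2V_dot mOm gC2 (V2 _ gpsi)).1.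
have h0 : int (fun x => dot (wgrad Om C' x) (grad psi x)) := ii (LinfV_dot gC' gpsi).
have h2 : int (fun x => dot (u x) (wgrad Om C x) * psi x) := L2V_int u2 gC2 bpsi.
have h3 : int (fun x => dot (u x) (wgrad Om C' x) * psi x) := L2V_int u2 (V2 _ gC') bpsi.
have h4 : int (fun x => dot (u' x) (wgrad Om C' x) * psi x) := L2V_int (V2 _ bu') (V2 _ gC') bpsi.
have h5 : int (fun x => dot (u x) (grad psi x) * C' x) := L2V_int u2 (V2 _ gpsi) bC'.
have h6 : int (fun x => dot (u' x) (grad psi x) * C' x) := L2V_int (V2 _ bu') (V2 _ gpsi) bC'.
have h7 : int (fun x => C x * psi x) := L2_int C2 bpsi.
have h8 : int (fun x => C' x * psi x) := ii (LinfM bC' bpsi).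
have h9 : int (fun x => g P x * psi x) := L2_int g2 bpsi.
have hw : int (fun x => wdiv Om u' x * C' x * psi x) := ii (LinfM (LinfM bdu' bC') bpsi).
have F3 : integ Om (fun x => dot (wgrad Om del x) (grad psi x)) = i1 - i0.
  rewrite /i1 /i0 -(integB mOm h1 h0).
  apply: ae_Rintegral => //; [exact: mdot|by apply: measurable_funB; exact: mdot|].
  by apply: filterS wdel => x h /h; rewrite -dotBl => ->.
have F4 : integ Om (fun x => dot (u x) (wgrad Om del x) * psi x) = i2 - i3.
  rewrite /i2 /i3 -(integB mOm h2 h3).
  apply: ae_Rintegral => //.
  - by apply: measurable_funM => //; exact: mdot.
  - by apply: measurable_funB; apply: measurable_funM => //; exact: mdot.
  - by apply: filterS wdel => x h /h; rewrite -mulrBl -dotBr => ->.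
have F5 : integ Om (fun x => dot (u' x - u x) (wgrad Om C' x) * psi x) = i4 - i3.
  by rewrite /i4 /i3 -(integB mOm h4 h3); apply: eq_integ => x _; rewrite dotBl mulrBl.
have F6 : integ Om (fun x => dot (u' x - u x) (grad psi x) * C' x) = i6 - i5.
  by rewrite /i6 /i5 -(integB mOm h6 h5); apply: eq_integ => x _; rewrite dotBl mulrBl.
have F7 : integ Om (fun x => del x * psi x) = i7 - i8.
  by rewrite /i7 /i8 -(integB mOm h7 h8); apply: eq_integ => x _; rewrite mulrBl.
have F8 : integ Om (fun x => strong_residual x * psi x) = i9 - i4 - 2^-1 * iw - Defs.r0 P * i8.
  have hw' := integrableRZ mOm 2^-1 hw; have h8' := integrableRZ mOm (Defs.r0 P) h8.
  have h94 := integrableRB mOm h9 h4.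
  rewrite /i9 /i4 /iw /i8 -(integZ mOm _ hw) -(integZ mOm _ h8) -(integB mOm h9 h4).
  rewrite -(integB mOm h94 hw') -(integB mOm (integrableRB mOm h94 hw') h8').
  by apply: eq_integ => x _; rewrite /strong_residual; ring.
rewrite F1 in E3; rewrite F2 in E2.
rewrite F3 F4 F5 F6 F7 F8.
exact: residual_algebra E1 E2 E3.
Qed.

End residual.

(** * The residual against a bump, bounded by the local error *)

Section local_bounds.
Context {R : realType} {k : nat}.
Local Notation d := k.+1.
Local Notation pt := 'rV[R]_k.+1.
Local Notation mu := (@lebesgue_row R k.+1).
Variables (Om : set pt) (hOm : polyhedral_domain Om) (P : pde_data R k) (hP : admissible Om P).
Variables (u : pt -> pt) (p C : pt -> R) (hsol : problem_Va Om P u p C).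
Variables (J : Type) (Th : J -> seq (simplex R k)) (sigma beta0 : R)
  (hTh : regular_family Om Th sigma beta0).
Local Notation int f := (mu.-integrable Om (EFin \o f)).
Let oOm : open Om. Proof. exact: domain_open hOm. Qed.
Let bOm : (mu Om < +oo)%E. Proof. exact: domain_lty hOm. Qed.
Let mOm : measurable Om. Proof. exact: measurable_row_open. Qed.
Let r12 : (1 : R) <= 2. Proof. exact: ler1n. Qed.
Let ii (f : pt -> R) : Linf Om f -> int f. Proof. exact: Linf_int. Qed.

(** Cauchy-Schwarz on the supporting ball; the root of its volume is the source of the factor
    h^{d/2}. *)
Lemma ball_bound (F f : pt -> R) (N : R) (y : pt) (s : R) (D : set pt) :
  int F -> (forall x, ~ eball y s x -> F x = 0) -> eball y s `<=` Om ->
  measurable D -> eball y s `<=` D -> in_Lp 2%:E D f -> 0 <= N ->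
  {ae mu, forall x, eball y s x -> `|F x| <= N * `|f x|} ->
  `|integ Om F| <= N * Num.sqrt (fine (mu (eball y s))) * Lp 2%:E D f.
Proof.
move=> iF F0 BO mD BD f2 N0 hF; set B := eball y s.
have mB : measurable B by exact: measurable_eball.
have Boo : (mu B < +oo)%E by exact: eball_lty.
have -> : integ Om F = integ B F by exact: Rintegral_supp.
have iFB : mu.-integrable B (EFin \o F) by exact: integrableS iF.
have fB2 : in_Lp 2%:E B f by exact: in_LpS BD f2.
have i1 : mu.-integrable B (EFin \o (fun x => `|f x| * 1)).
  by apply: L2_mul => //; [exact: in_Lp_norm|exact: in_Lp_cst].
have iN : mu.-integrable B (EFin \o (fun x => N * (`|f x| * 1))) by exact: integrableRZ.
apply: (le_trans (le_normr_Rintegral mB iFB)).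
apply: (@le_trans _ _ (integ B (fun x => N * (`|f x| * 1)))).
  apply: ae_integ_le => //.
    by have := integrable_norm iFB; apply: eq_integrable.
  by apply: filterS hF => x h Bx; rewrite mulr1; exact: h.
rewrite (integZ mB _ i1) -mulrA ler_wpM2l//.
have le1 := L2_mul_le mB (in_Lp_norm fB2) (in_Lp_cst 1 mB Boo (ltr0n R 2)).
apply: (le_trans (ler_norm _)); apply: (le_trans le1).
rewrite Lp_norm Lp_cst// normr1 mul1r powR12_sqrt ?fine_ge0// mulrC ler_wpM2l ?sqrtr_ge0//.
exact: LpS BD f2.
Qed.

Lemma half_volume (y : pt) (lam h : R) : 0 < lam -> 0 < h ->
  Num.sqrt (fine (mu (eball y (lam * h)))) <= Num.sqrt ((2 * lam) ^+ d) * Num.sqrt (h ^+ d).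
Proof.
move=> l0 h0; rewrite -sqrtrM ?exprn_ge0 ?mulr_ge0 ?(ltW l0)//.
rewrite ler_wsqrtr// -exprMn -mulrA.
by have /andP[_] := eball_volume y (mulr_gt0 l0 h0).
Qed.

(** The comparison h^{d/6} <= H h^{d/2 - 1} amounts to h^3 <= H^3 h^d, which holds because d <= 3
    and h <= H. *)
Lemma sixth_volume (d23 : (k.+1 <= 3)%N) (y : pt) (lam h H : R) : 0 < lam -> 0 < h -> h <= H -> 1 <= H ->
  fine (mu (eball y (lam * h))) `^ 6^-1 <=
  ((2 * lam) ^+ d) `^ 6^-1 * H * (Num.sqrt (h ^+ d) / h).
Proof.
move=> l0 h0 hH H1; have H0 : 0 < H by exact: lt_le_trans H1.
have hd0 : 0 < h ^+ d by rewrite exprn_gt0.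
have /andP[_ V] := eball_volume y (mulr_gt0 l0 h0).
rewrite mulrA exprMn in V.
apply: (@le_trans _ _ (((2 * lam) ^+ d * h ^+ d) `^ 6^-1)).
  by apply: ge0_ler_powR => //; rewrite ?nnegrE ?fine_ge0// mulr_ge0// exprn_ge0// ?mulr_ge0 ?ltW.
rewrite powRM ?exprn_ge0 ?mulr_ge0 ?(ltW l0) ?(ltW h0)// -mulrA ler_wpM2l ?powR_ge0//.
rewrite mulrA ler_pdivlMr// -powR12_sqrt ?(ltW hd0)//.
rewrite (_ : 2^-1 = 6^-1 + 3^-1 :> R); last by field.
rewrite powRD ?(gt_eqF hd0) ?implybT// mulrCA ler_wpM2l ?powR_ge0//.
have hh : h ^+ 3 <= H ^+ 3 * h ^+ d.
  have -> : h ^+ 3 = h ^+ (3 - d) * h ^+ d by rewrite -exprD subnK.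
  rewrite ler_wpM2r ?(ltW hd0)//.
  apply: (@le_trans _ _ (H ^+ (3 - d))); first by rewrite lerXn2r ?nnegrE ?(ltW h0) ?(ltW H0).
  by apply: ler_weXn2l => //; exact: leq_subr.
have c3 (x : R) : 0 < x -> (x ^+ 3) `^ 3^-1 = x.
  by move=> x0; rewrite -powR_mulrn ?(ltW x0)// -powRrM mulfV ?pnatr_eq0// powRr1// ltW.
rewrite -[leLHS](c3 _ h0) -[X in _ <= X * _](c3 _ H0) -powRM ?exprn_ge0 ?(ltW H0) ?(ltW hd0)//; last exact: ltW.
by apply: ge0_ler_powR => //; rewrite ?nnegrE ?mulr_ge0 ?exprn_ge0 ?(ltW h0) ?(ltW H0).
Qed.

Lemma residual_sum (al r i1 i2 i3 i4 i5 k1 k2 k3 k4 k5 T E : R) : 0 <= al -> 0 <= r ->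
  0 <= T * E ->
  `|i1| <= k1 * T * E -> `|i2| <= k2 * T * E -> `|i3| <= k3 * T * E -> `|i4| <= k4 * T * E ->
  `|i5| <= k5 * T * E ->
  `|al * i1 + i2 - 2^-1 * i3 + 2^-1 * i4 + r * i5| <=
  (al * k1 + k2 + 2^-1 * k3 + 2^-1 * k4 + r * k5 + 1) * T * E.
Proof.
move=> a0 r0 TE h1 h2 h3 h4 h5.
have e2 : 0 <= 2^-1 :> R by rewrite invr_ge0.
rewrite (le_trans (ler_normD _ _))// (le_trans (lerD (ler_normD _ _) (lexx _)))//.
rewrite (le_trans (lerD (lerD (ler_normB _ _) (lexx _)) (lexx _)))//.
rewrite (le_trans (lerD (lerD (lerD (ler_normD _ _) (lexx _)) (lexx _)) (lexx _)))//.
rewrite !normrM (ger0_norm a0) (ger0_norm r0) (ger0_norm e2).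
have g1 := ler_wpM2l a0 h1; have g3 := ler_wpM2l e2 h3; have g4 := ler_wpM2l e2 h4.
have g5 := ler_wpM2l r0 h5.
apply: (le_trans (lerD (lerD (lerD (lerD g1 h2) g3) g4) g5)).
rewrite -subr_ge0 (_ : _ - _ = T * E)//; by ring.
Qed.

Definition local_error (D : set pt) (u' : pt -> pt) (C' : pt -> R) : R :=
  LpV 2%:E D (fun x => u' x - u x) + H1norm Om D (fun x => C x - C' x).

(** Each of the five error terms of [residual_identity] is at most a constant times (h^{d/2} / h)
    times the local error: grad psi costs 4 / (lam h), grad C' costs L / h, C' costs M, and a term
    with neither gradient gains a factor h <= H. *)
Lemma residual_bound (d23 : (k.+1 <= 3)%N) (H lam M L : R) :
  1 <= H -> 0 < lam -> 0 <= M -> 0 <= L -> exists2 Kr : R, 0 < Kr &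
  forall j (u' : pt -> pt) (C' : pt -> R) (y : pt) (D : set pt),
  let h := mesh_size (Th j) in let psi := rbump y (lam * h) in
  h <= H -> spaceXh Om (Th j) u' -> spaceYh Om (Th j) C' ->
  (forall x, Om x -> `|C' x| <= M) ->
  {ae mu, forall x, Om x -> enorm (wgrad Om C' x) <= L / h} ->
  [set x | enorm (x - y) <= lam * h] `<=` Om -> measurable D -> eball y (lam * h) `<=` D -> D `<=` Om ->
  `|integ Om (fun x => strong_residual Om P u' C' x * psi x) -
    alpha P * integ Om (fun x => dot (wgrad Om C' x) (grad psi x))| <=
  Kr * (Num.sqrt (h ^+ d) / h) * local_error D u' C'.
Proof.
move=> H1 l0 M0 L0; have [_ _ _ a0 r0] := params_gt0 hP.
pose k1 := Num.sqrt ((2 * lam) ^+ d); pose k2 := ((2 * lam) ^+ d) `^ 6^-1 * H.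
have k10 : 0 <= k1 by exact: sqrtr_ge0.
have H0 : 0 < H by exact: lt_le_trans H1.
have k20 : 0 <= k2 by rewrite mulr_ge0 ?powR_ge0 ?ltW.
pose U := LpV 3%:E Om u; have U0 : 0 <= U by exact: LpV_ge0.
pose Kr := alpha P * (4 / lam * k1) + U * k2 + 2^-1 * (L * k1) + 2^-1 * (4 / lam * M * k1) +
  Defs.r0 P * (k1 * H).
have c1 : 0 <= 4 / lam * k1 by rewrite mulr_ge0// divr_ge0// ltW.
have c4 : 0 <= 4 / lam * M * k1 by rewrite mulr_ge0// mulr_ge0// divr_ge0// ltW.
have e2 : 0 <= 2^-1 :> R by rewrite invr_ge0.
have Kr0 : 0 <= Kr.
  rewrite /Kr; repeat apply: addr_ge0; apply: mulr_ge0 => //.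
  - exact: ltW.
  - exact: mulr_ge0.
  - exact: ltW.
  - by rewrite mulr_ge0 ?(ltW H0).
exists (Kr + 1); first by rewrite ltr_wpDl.
move=> j u' C' y D h psi hH hu' hC' hM hL clO mD BD DO.
have h0 : 0 < h by exact: mesh_gt0 hOm hTh j.
have s0 : 0 < lam * h by exact: mulr_gt0.
set t := Num.sqrt (h ^+ d); have t0 : 0 <= t by exact: sqrtr_ge0.
have th0 : 0 <= t / h by rewrite divr_ge0// ltW.
have BO : eball y (lam * h) `<=` Om by exact: subset_trans BD DO.
have tpsi : test_function Om psi by exact: bump_test.
have [bpsi _] := test_bnd tpsi; have gpsi := test_LinfV tpsi.
have [bu' _ _ _] := Xh_Linf hOm hTh hu'; have [bC' gC' wC' _] := P1h_Linf hOm hTh hC'.1.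
have hd := H10B oOm bOm (concentration_H10 hsol) hC'.2.
have [d2 gd2 wd] := H10_L2 hOm hd.
set del := fun x => C x - C' x in hd d2 gd2 wd.
have u2 := velocity_L2 hOm hsol.
have V2 w : LinfV Om w -> in_LpV 2%:E Om w by exact: LinfV_in_LpV.
have er2 : in_LpV 2%:E Om (fun x => u' x - u x) by apply: in_LpVB => //; exact: V2.
rewrite (residual_identity hOm hP hsol hTh hu' hC' tpsi) addrC addKr.
have vol := half_volume y l0 h0; rewrite -/t -/k1 in vol.
set V := Num.sqrt _ in vol; have V0 : 0 <= V by exact: sqrtr_ge0.
have E1 : LpV 2%:E D (wgrad Om del) <= local_error D u' C'.
  by apply: (le_trans (LpV_le_H1 _ _ _)); rewrite /local_error lerDr LpV_ge0.
have E2 : Lp 2%:E D del <= local_error D u' C'.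
  by apply: (le_trans (Lp_le_H1 Om _ _)); rewrite /local_error lerDr LpV_ge0.
have E3 : LpV 2%:E D (fun x => u' x - u x) <= local_error D u' C'.
  by rewrite /local_error lerDl H1norm_ge0.
set E := local_error D u' C' in E1 E2 E3 *.
have E0 : 0 <= E by apply: le_trans E2; exact: Lp_ge0.
have psi0 x : ~ eball y (lam * h) x -> psi x = 0 by exact: bump_out.
have gpsi0 x : ~ eball y (lam * h) x -> grad psi x = 0 by exact: grad_bump_out.
have psi1 x : `|psi x| <= 1 by have /andP[p0 p1] := bump_bnd y (lam * h) x; rewrite ger0_norm.
have gpsi1 x : enorm (grad psi x) <= 4 / (lam * h) by exact: enorm_grad_bump.
have LD (f : pt -> R) : in_Lp 2%:E Om f -> in_Lp 2%:E D f by move=> hf; exact: in_LpS DO hf.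
have fin (N N' X : R) : 0 <= N -> 0 <= X -> X <= E -> N * V <= N' * (t / h) -> N * V * X <= N' * (t / h) * E.
  by move=> N0 X0 XE h1; rewrite ler_pM// mulr_ge0.
have s4 : 0 <= 4 / (lam * h) by rewrite divr_ge0// ltW.
have lV : 4 / (lam * h) * V <= 4 / lam * k1 * (t / h).
  apply: (le_trans (ler_wpM2l s4 vol)).
  by rewrite le_eqVlt; apply/orP; left; apply/eqP; field; rewrite !gt_eqF.
have T1 : `|integ Om (fun x => dot (wgrad Om del x) (grad psi x))| <= 4 / lam * k1 * (t / h) * E.
  have i1 := (L2V_dot mOm gd2 (V2 _ gpsi)).1.
  have F0 x : ~ eball y (lam * h) x -> dot (wgrad Om del x) (grad psi x) = 0.
    by move=> /gpsi0 ->; rewrite dotC dot0l.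
  apply: (le_trans (ball_bound i1 F0 BO mD BD (LD _ (in_LpV_enorm gd2)) s4 _)).
    apply: aeW => x _; rewrite (le_trans (norm_dot_le _ _))// mulrC ler_pM ?enorm_ge0//.
    by rewrite ger0_norm ?enorm_ge0.
  by apply: fin => //; exact: LpV_ge0.
have T3 : `|integ Om (fun x => dot (u' x - u x) (wgrad Om C' x) * psi x)| <= L * k1 * (t / h) * E.
  have i1 := L2V_int hOm er2 (V2 _ gC') bpsi.
  have F0 x : ~ eball y (lam * h) x -> dot (u' x - u x) (wgrad Om C' x) * psi x = 0.
    by move=> /psi0 ->; rewrite mulr0.
  have Lh : 0 <= L / h by rewrite divr_ge0// ltW.
  apply: (le_trans (ball_bound i1 F0 BO mD BD (LD _ (in_LpV_enorm er2)) Lh _)).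
    apply: filterS hL => x hx /BO/hx h1; rewrite normrM.
    rewrite (ger0_norm (enorm_ge0 _)) (le_trans (ler_pM _ _ (norm_dot_le _ _) (psi1 x)))//.
    by rewrite mulr1 mulrC ler_wpM2r ?enorm_ge0.
  apply: fin => //; first exact: LpV_ge0.
  apply: (le_trans (ler_wpM2l Lh vol)).
  by rewrite le_eqVlt; apply/orP; left; apply/eqP; field; rewrite !gt_eqF.
have T4 : `|integ Om (fun x => dot (u' x - u x) (grad psi x) * C' x)| <= 4 / lam * M * k1 * (t / h) * E.
  have i1 := L2V_int hOm er2 (V2 _ gpsi) bC'.
  have F0 x : ~ eball y (lam * h) x -> dot (u' x - u x) (grad psi x) * C' x = 0.
    by move=> /gpsi0 ->; rewrite dotC dot0l mul0r.
  have N0 : 0 <= 4 / (lam * h) * M by exact: mulr_ge0.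
  apply: (le_trans (ball_bound i1 F0 BO mD BD (LD _ (in_LpV_enorm er2)) N0 _)).
    apply: aeW => x Bx; rewrite normrM (ger0_norm (enorm_ge0 _)) mulrAC.
    apply: ler_pM => //; last by apply: hM; exact: BO.
    by rewrite (le_trans (norm_dot_le _ _))// mulrC ler_wpM2r ?enorm_ge0.
  apply: fin => //; first exact: LpV_ge0.
  apply: (le_trans (ler_wpM2l N0 vol)).
  by rewrite le_eqVlt; apply/orP; left; apply/eqP; field; rewrite !gt_eqF.
have T5 : `|integ Om (fun x => del x * psi x)| <= k1 * H * (t / h) * E.
  have i1 := L2_int hOm d2 bpsi.
  have F0 x : ~ eball y (lam * h) x -> del x * psi x = 0 by move=> /psi0 ->; rewrite mulr0.
  apply: (le_trans (ball_bound i1 F0 BO mD BD (LD _ d2) ler01 _)).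
    by apply: aeW => x Bx; rewrite normrM mulrC ler_wpM2r.
  apply: fin => //; first exact: Lp_ge0.
  rewrite mul1r (le_trans vol)// -mulrA ler_wpM2l// mulrCA ler_peMr//.
  by rewrite ler_pdivlMr// mul1r.
(* u is controlled in L^3 only, so Hoelder with exponents 2, 3 and 6 puts psi in L^6, whence the
   sixth root of the volume. *)
have T2 : `|integ Om (fun x => dot (u x) (wgrad Om del x) * psi x)| <= U * k2 * (t / h) * E.
  have i1 := L2V_int hOm u2 gd2 bpsi; set B := eball y (lam * h).
  have mB : measurable B by exact: measurable_eball.
  have Boo : (mu B < +oo)%E by exact: eball_lty.
  have iB : mu.-integrable B (EFin \o (fun x => dot (u x) (wgrad Om del x) * psi x)) by exact: integrableS i1.
  have -> : integ Om (fun x => dot (u x) (wgrad Om del x) * psi x) = integ B (fun x => dot (u x) (wgrad Om del x) * psi x).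
    by apply: Rintegral_supp => // x /psi0 ->; rewrite mulr0.
  have u3 := velocity_L3 hsol.
  have mpsiB : measurable_fun B psi by exact: measurable_bump.
  have [p6 lp6] : in_Lp 6%:E B (fun x => `|psi x|) /\ Lp 6%:E B (fun x => `|psi x|) <= 1 * fine (mu B) `^ 6^-1.
    apply: Lp_bnd => //; first exact: measurableT_comp.
    by apply: aeW => x _; rewrite normr_id.
  have u3B : in_Lp 3%:E B (fun x => enorm (u x)) by exact: in_LpS (in_LpV_enorm u3).
  have g2B : in_Lp 2%:E B (fun x => enorm (wgrad Om del x)) by exact: in_LpS (in_LpV_enorm gd2).
  have [i2 le2] := Lhoelder236 mB g2B u3B p6.
  apply: (le_trans (le_normr_Rintegral mB iB)).
  apply: (@le_trans _ _ (integ B (fun x => enorm (wgrad Om del x) * (enorm (u x) * `|psi x|)))).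
    apply: ae_integ_le => //; first by have := integrable_norm iB; apply: eq_integrable.
    apply: aeW => x _; rewrite normrM mulrA ler_wpM2r// mulrC; exact: norm_dot_le.
  apply: (le_trans (ler_norm _)); apply: (le_trans le2).
  rewrite [leRHS]mulrC; apply: ler_pM; rewrite ?mulr_ge0 ?Lp_ge0//.
    by apply: le_trans E1; apply: LpVS => //; exact: in_LpVS gd2.
  rewrite -mulrA; apply: ler_pM; rewrite ?Lp_ge0//; first exact: LpS BO (in_LpV_enorm u3).
  by apply: (le_trans lp6); rewrite mul1r; exact: sixth_volume.
exact: (residual_sum (ltW a0) (ltW r0) (mulr_ge0 th0 E0) T1 T2 T3 T4 T5).
Qed.

End local_bounds.

(** * Uniform bounds of the discrete concentration and interior residuals *)

Section element.
Context {R : realType} {k : nat}.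
Local Notation d := k.+1.
Local Notation pt := 'rV[R]_k.+1.
Local Notation mu := (@lebesgue_row R k.+1).
Variables (Om : set pt) (hOm : polyhedral_domain Om) (P : pde_data R k) (hP : admissible Om P).
Variables (u : pt -> pt) (p C : pt -> R) (hsol : problem_Va Om P u p C).
Variables (J : Type) (Th : J -> seq (simplex R k)) (sigma beta0 : R)
  (hTh : regular_family Om Th sigma beta0).
Local Notation int f := (mu.-integrable Om (EFin \o f)).
Local Notation rr := (ball_ratio sigma beta0).
Let oOm : open Om. Proof. exact: domain_open hOm. Qed.
Let bOm : (mu Om < +oo)%E. Proof. exact: domain_lty hOm. Qed.
Let mOm : measurable Om. Proof. exact: measurable_row_open. Qed.
Let ii (f : pt -> R) : Linf Om f -> int f. Proof. exact: Linf_int. Qed.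
Let rr0 : 0 < rr. Proof. exact: ball_ratio_gt0 hTh. Qed.
(** Each element contains a ball of radius rr h and lies in the concentric ball enlarged by the
    factor Q; [polyf_large_ball] asks for Q >= 1. *)
Let Q := Num.max 1 rr^-1.
Let Q1 : 1 <= Q. Proof. by rewrite le_max lexx. Qed.

Lemma element_ball j a : a \in Th j -> exists c : pt,
  [set x | enorm (x - c) <= rr * mesh_size (Th j)] `<=` hull a /\
  forall x, hull a x -> enorm (x - c) <= Q * (rr * mesh_size (Th j)).
Proof.
move=> aT; have [c hc] := mesh_ball hTh aT; exists c; split=> //.
have h0 := mesh_gt0 hOm hTh j.
have cc : hull a c by apply: hc; rewrite subrr enorm0 mulr_ge0// ltW.
move=> x ax; apply: (le_trans (mesh_diam aT ax cc)).
rewrite mulrA ler_peMl ?(ltW h0)//.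
by rewrite -(mulVf (lt0r_neq0 rr0)) ler_wpM2r ?(ltW rr0)// le_max lexx orbT.
Qed.

Lemma integ_ge_sub (B B' : set pt) (f : pt -> R) (N : R) : measurable B -> measurable B' ->
  B' `<=` B -> (mu B' < +oo)%E -> mu.-integrable B (EFin \o f) ->
  (forall x, B x -> 0 <= f x) -> (forall x, B' x -> N <= f x) -> N * fine (mu B') <= integ B f.
Proof.
move=> mB mB' BB Boo fB f0 fN; rewrite -Rintegral_cst//.
have fB' : mu.-integrable B' (EFin \o f) by exact: integrableS fB.
apply: (@le_trans _ _ (integ B' f)).
  by apply: le_Rintegral => //; exact: integrable_cst_lty.
rewrite /integ /Rintegral fine_le ?integrable_fin_num//.
apply: ge0_subset_integral => //.
by apply: measurable_int fB.
Qed.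

(** If |C'| >= m on a ball B of radius comparable to h while |C| <= M0, then (m - M0) |B|^{1/6} <=
    S6 c h. As d <= 6, |B|^{1/6} is at least [kw] h, and h cancels. *)
Lemma concentration_sup (d6 : (k.+1 <= 6)%N) (S6 c H : R) : poincare_sobolev_constant Om 6 S6 ->
  0 <= c -> 1 <= H -> in_Lp +oo%E Om C -> exists2 M : R, 0 <= M &
  forall j (C' : pt -> R), mesh_size (Th j) <= H -> spaceYh Om (Th j) C' ->
    W1seminorm 2%:E Om (fun x => C x - C' x) <= c * mesh_size (Th j) ->
    forall a x, a \in Th j -> hull a x -> `|C' x| <= M.
Proof.
move=> [S60 hS] c0 H1 Coo; have H0 : 0 < H by exact: lt_le_trans H1.
have [del [K [del0 K0 hball]]] := polyf_large_ball (k := k) 1 Q1.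
pose M0 := Lp +oo%E Om C; have M00 : 0 <= M0 by exact: Lp_ge0.
pose kv := (2 * (del * rr / d%:R)) ^+ d.
have kv0 : 0 < kv by rewrite exprn_gt0// mulr_gt0// divr_gt0// mulr_gt0.
pose kw := (kv / H ^+ 6) `^ 6^-1.
have kw0 : 0 < kw by rewrite powR_gt0// divr_gt0// exprn_gt0.
exists (K * (M0 + S6 * c / kw)).
  by rewrite mulr_ge0 ?(ltW K0)// addr_ge0// divr_ge0 ?(ltW kw0)// mulr_ge0// ltW.
move=> j C' hH hC' hE a x aT ax; set h := mesh_size (Th j) in hH hE.
have h0 : 0 < h by exact: mesh_gt0 hOm hTh j.
have [ce [ball_hull hull_ball]] := element_ball aT.
have [q [s hqs]] := P1h_pieces hC'.1.
have pf : polyf 1 (fun x => dot (q a) x + s a) by apply: polyfD; [exact: polyf_dot|exact: polyf_cst].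
have r0 : 0 < rr * h by rewrite mulr_gt0.
have [y [m [b [m0 By hK hm]]]] := hball _ ce _ pf r0.
rewrite (hqs a aT x ax); apply: (le_trans (hK x (hull_ball x ax))).
rewrite ler_wpM2l ?(ltW K0)//.
have [mM|Mm] := leP m M0; first by rewrite (le_trans mM)// lerDl divr_ge0 ?(ltW kw0)// mulr_ge0// ltW.
set B := eball y (del * (rr * h)) in By hm.
have Bh : B `<=` hull a by move=> z /By; exact: ball_hull.
have BO : B `<=` Om.
  apply: (open_sub_domain hOm); first exact: open_eball.
  by move=> z /Bh; exact: (hull_sub_closure hTh aT).
have mB : measurable B by exact: measurable_eball.
have Boo : (mu B < +oo)%E by exact: eball_lty.
have bC := in_Lpoo_Linf Coo; have [bC' _ _ _] := P1h_Linf hOm hTh hC'.1.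
have bd : Linf Om (fun x => C x - C' x) by exact: LinfB.
have d6O : in_Lp 6%:E Om (fun x => C x - C' x) by exact: Linf_in_Lp.
have le1 : (m - M0) * fine (mu B) `^ 6^-1 <= S6 * (c * h).
  rewrite -[m - M0]gtr0_norm ?subr_gt0// -Lp_cst//.
  apply: (@le_trans _ _ (Lp 6%:E B (fun x => C x - C' x))).
    apply: Lp_mono => //; first exact: in_LpS d6O.
    apply: filterS (Lpoo_ae Coo) => z hz Bz.
    rewrite gtr0_norm ?subr_gt0//.
    have h1 := hz (BO z Bz); have h2 := hm z Bz; rewrite -(hqs a aT z (Bh z Bz)) in h2.
    have h3 : m <= `|C' z|.
      apply: (le_trans h2); apply: (le_trans (ler_norm _)).
      by rewrite normrM normrX normrN1 expr1n mul1r.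
    rewrite distrC; have := lerB_dist (C' z) (C z); move: h1 h3; rewrite -/M0.
    by move: (`|C z|) (`|C' z|) `|_ - _| => e1 e2 e3; lra.
  apply: (@le_trans _ _ (Lp 6%:E Om (fun x => C x - C' x))); first exact: LpS.
  apply: (le_trans (hS _ (H10B oOm bOm (concentration_H10 hsol) hC'.2))).
  by rewrite ler_pM2l.
have V6 : kw * h <= fine (mu B) `^ 6^-1.
  have -> : kw * h = (kv / H ^+ 6 * h ^+ 6) `^ 6^-1.
    have e1 : 0 <= kv / H ^+ 6 by rewrite divr_ge0 ?(ltW kv0)// exprn_ge0// ltW.
    have e2 : 0 <= h ^+ 6 by rewrite exprn_ge0// ltW.
    rewrite (powRM _ e1 e2); congr (_ * _).
    by rewrite -powR_mulrn ?(ltW h0)// -powRrM mulfV ?pnatr_eq0// powRr1// ltW.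
  have /andP[V _] := eball_volume y (mulr_gt0 del0 r0).
  apply: ge0_ler_powR; rewrite ?nnegrE ?fine_ge0//.
    by rewrite mulr_ge0 ?exprn_ge0 ?(ltW h0)// divr_ge0 ?(ltW kv0)// exprn_ge0// ltW.
  apply: le_trans V; rewrite (_ : eball_vol _ = kv * h ^+ d); last first.
    by rewrite /eball_vol /kv -exprMn; congr (_ ^+ _); ring.
  rewrite -mulrA ler_wpM2l ?(ltW kv0)// mulrC ler_pdivrMr ?exprn_gt0//.
  have -> : h ^+ 6 = h ^+ d * h ^+ (6 - d) by rewrite -exprD subnKC.
  rewrite ler_wpM2l ?exprn_ge0 ?(ltW h0)//.
  apply: (@le_trans _ _ (H ^+ (6 - d))); first by rewrite lerXn2r ?nnegrE ?(ltW h0) ?(ltW H0).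
  by apply: ler_weXn2l => //; exact: leq_subr.
have : (m - M0) * (kw * h) <= S6 * (c * h).
  by apply: le_trans le1; rewrite ler_wpM2l// subr_ge0 ltW.
by rewrite !mulrA ler_pM2r// -lerBlDl ler_pdivlMr.
Qed.

(** On an element C' is affine with gradient q. Its values at the two ends of a diameter of the
    inner ball in the direction of q differ by 2 rr h |q|, and by at most 2 M. *)
Lemma gradient_sup j (C' : pt -> R) (M : R) : spaceYh Om (Th j) C' -> 0 <= M ->
  (forall a x, a \in Th j -> hull a x -> `|C' x| <= M) ->
  {ae mu, forall x, Om x -> enorm (wgrad Om C' x) <= M / rr / mesh_size (Th j)}.
Proof.
move=> hC' M0 hM; have [q [s hqs]] := P1h_pieces hC'.1.
have h0 := mesh_gt0 hOm hTh j.
have qb a : a \in Th j -> enorm (q a) <= M / rr / mesh_size (Th j).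
  move=> aT; have [c [hc _]] := element_ball aT; set h := mesh_size (Th j) in h0 hc *.
  have r0 : 0 < rr * h by rewrite mulr_gt0.
  have [->|qn] := eqVneq (enorm (q a)) 0.
    by rewrite divr_ge0 ?(ltW h0)// divr_ge0// (ltW rr0).
  have q0 : 0 < enorm (q a) by rewrite lt_neqAle eq_sym qn enorm_ge0.
  pose v := (rr * h / enorm (q a)) *: q a.
  have ev : enorm v = rr * h.
    by rewrite enormZ gtr0_norm ?divr_gt0// divfK.
  have hp : hull a (c + v) by apply: hc; rewrite /= addrAC subrr add0r ev.
  have hm : hull a (c - v) by apply: hc; rewrite /= addrAC subrr add0r enormN ev.
  have h1 := hM a _ aT hp; have h2 := hM a _ aT hm.
  rewrite (hqs a aT _ hp) dotDr in h1; rewrite (hqs a aT _ hm) dotBr in h2.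
  have ed : dot (q a) v = rr * h * enorm (q a).
    by rewrite dotZr -enorm_sqr expr2 mulrA divfK.
  rewrite ed !ler_norml in h1 h2.
  rewrite -mulrA -invfM ler_pdivlMr//.
  by rewrite mulrC; move: h1 h2 => /andP[_ h1] /andP[h2 _]; lra.
apply: filterS2 (mesh_ae hTh j) (wgrad_piecewise hOm hTh (P1h_piecewise hqs)) => x h1 h2 Ox.
have [a aT ax] := h1 Ox; rewrite (h2 a aT ax) grad_affine; exact: qb.
Qed.

Lemma integ_affine_bump (q : pt) (psi : pt -> R) : test_function Om psi ->
  integ Om (fun x => dot q (grad psi x)) = 0.
Proof.
move=> tpsi; have [_ h] := test_bnd tpsi.
rewrite (_ : integ Om _ = integ Om (fun x => \sum_i q 0 i * pderiv i psi x)); last first.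
  by apply: eq_integ => x _; apply: eq_bigr => i _; rewrite mxE.
have hi i : int (fun x => q 0 i * pderiv i psi x) by exact/ii/LinfZ.
rewrite integ_sum// big1// => i _.
by rewrite (integZ mOm _ (ii (h i))) (integ_pderiv_test hOm i tpsi) mulr0.
Qed.

Definition element_residual (a : simplex R k) (gh : simplex R k -> R) (u' : pt -> pt) (C' : pt -> R)
    (x : pt) : R :=
  alpha P * laplacian C' x - dot (u' x) (wgrad Om C' x) - 2^-1 * wdiv Om u' x * C' x
    - Defs.r0 P * C' x + gh a.

Lemma laplacian_interior j a (C' : pt -> R) x : a \in Th j ->
  spaceYh Om (Th j) C' -> (hull a)° x -> laplacian C' x = 0.
Proof.
move=> aT hC' ax; have [q [s hqs]] := P1h_pieces hC'.1.
rewrite /laplacian big1// => i _.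
rewrite (_ : pderiv i _ x = pderiv i (fun=> q a 0 i) x); first exact: pderiv_cst.
apply: near_eq_derive; have : \forall y \near x, (hull a)° y.
  by apply: open_nbhs_nbhs; split=> //; exact: open_interior.
apply: filterS => y ay.
have := piecewise_derive (P1h_piecewise hqs) (delta_mx 0 i) aT ay.
rewrite -/(pderiv i C' y) => ->.
by have := grad_affine (q a) (s a) y; move/rowP/(_ i); rewrite mxE.
Qed.

Lemma element_residualE j a gh (u' : pt -> pt) (C' : pt -> R) x : a \in Th j ->
  spaceYh Om (Th j) C' -> (hull a)° x ->
  element_residual a gh u' C' x = strong_residual Om P u' C' x - (g P x - gh a).
Proof.
move=> aT hC' ax; rewrite /element_residual (laplacian_interior aT hC' ax) mulr0.
by rewrite /strong_residual; ring.
Qed.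

(** The components of u' have degree k + 2 because of the bubble, and multiplying the divergence by
    the affine C' gives the bound k + 3. Only the oscillation g - g_h is not polynomial. *)
Lemma element_residual_poly j a gh (u' : pt -> pt) (C' : pt -> R) : a \in Th j ->
  spaceXh Om (Th j) u' -> spaceYh Om (Th j) C' -> exists2 f : pt -> R, polyf k.+3 f &
  {ae mu, forall x, (hull a)° x -> element_residual a gh u' C' x = f x /\
    strong_residual Om P u' C' x = f x + (g P x - gh a)}.
Proof.
move=> aT hu' hC'; have [q [s hqs]] := P1h_pieces hC'.1; have [F hF] := Xh_pieces hu'.
pose f x := - (\sum_i F a i x * q a 0 i) - 2^-1 * (\sum_i pderiv i (F a i) x) * (dot (q a) x + s a)
  - Defs.r0 P * (dot (q a) x + s a) + gh a.
have pF i : polyf k.+2 (F a i) by have [] := hF a aT i.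
have pa n : polyf n.+1 (fun x => dot (q a) x + s a).
  by apply: polyfD; [exact: polyf_dot|exact: polyf_cst].
exists f.
  apply: polyfD; last exact: polyf_cst.
  apply: polyfB; last by apply: polyfZ; exact: pa.
  apply: polyfB.
    apply: (polyf_le (leqnSn _)); apply: polyfN; apply: polyf_sum => i.
    rewrite (_ : (fun x => _) = fun x => q a 0 i * F a i x); first exact: polyfZ.
    by apply/funext => x; rewrite mulrC.
  rewrite -[k.+3]addn1; apply: polyfM; last exact: pa.
  by apply: polyfZ; apply: polyf_sum => i; exact: polyf_pderiv.
have hw : {ae mu, forall x, forall i, forall b, b \in Th j -> (hull b)° x ->
    wgrad Om (fun y => u' y 0 i) x = grad (F b i) x}.
  by apply: filter_forall => i; exact: (wgrad_piecewise hOm hTh (Xh_piecewise hF i)).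
apply: filterS2 hw (wgrad_piecewise hOm hTh (P1h_piecewise hqs)) => x h1 h2 ax.
have hx : hull a x by exact: interior_subset.
have gC : wgrad Om C' x = q a by rewrite (h2 a aT ax) grad_affine.
have Cx : C' x = dot (q a) x + s a := hqs a aT x hx.
have dv : wdiv Om u' x = \sum_i pderiv i (F a i) x.
  by apply: eq_bigr => i _; rewrite (h1 i a aT ax) mxE.
have du : dot (u' x) (q a) = \sum_i F a i x * q a 0 i.
  by apply: eq_bigr => i _; have [_ ->] := hF a aT i.
split.
  by rewrite /element_residual (laplacian_interior aT hC' ax) mulr0 sub0r gC Cx dv du /f.
by rewrite /strong_residual gC Cx dv du /f; ring.
Qed.

(* The residual is tested with a bump supported where it has a constant sign
   and is comparable with its maximum; this plays the role of an element bubble. *)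
Lemma element_bound (d3 : (k.+1 <= 3)%N) (H M : R) : 1 <= H -> 0 <= M -> exists2 Ke : R, 0 < Ke &
  forall j (u' : pt -> pt) (C' : pt -> R) gh a (D : set pt),
  let h := mesh_size (Th j) in h <= H ->
  spaceXh Om (Th j) u' -> spaceYh Om (Th j) C' ->
  (forall a x, a \in Th j -> hull a x -> `|C' x| <= M) ->
  a \in Th j -> measurable D -> (hull a)° `<=` D -> D `<=` Om ->
  h * Lp 2%:E (hull a)° (element_residual a gh u' C') <=
  Ke * (local_error Om u C D u' C' + h * Lp 2%:E (hull a)° (fun x => g P x - gh a)).
Proof.
move=> H1 M0; have [del [K [del0 K0 hball]]] := polyf_large_ball (k := k) k.+3 Q1.
(* Half of the radius on which the polynomial keeps its sign, so that the closed support of the bump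
   lies inside that ball. *)
pose lam := del * rr / 2; have l0 : 0 < lam by rewrite divr_gt0// mulr_gt0.
have MR : 0 <= M / rr by rewrite divr_ge0// ltW.
have [Kr Kr0 hKr] := residual_bound hOm hP hsol hTh d3 H1 l0 M0 MR.
pose kv := expR (- 4) * (lam / d%:R) ^+ d.
have kv0 : 0 < kv by rewrite mulr_gt0 ?expR_gt0// exprn_gt0// divr_gt0.
pose k1 := Num.sqrt ((2 * lam) ^+ d); have k10 : 0 <= k1 by exact: sqrtr_ge0.
pose k4 := Num.sqrt ((2 * 2) ^+ d) : R; have k40 : 0 <= k4 by exact: sqrtr_ge0.
exists (K * k4 / kv * (Kr + k1) + 1).
  by rewrite ltr_wpDl// mulr_ge0 ?addr_ge0 ?(ltW Kr0)// divr_ge0 ?(ltW kv0)// mulr_ge0// ltW.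
move=> j u' C' gh a D h hH hu' hC' hM aT mD aD DO.
have h0 : 0 < h by exact: mesh_gt0 hOm hTh j.
have r0 : 0 < rr * h by rewrite mulr_gt0.
have [ce [ball_hull hull_ball]] := element_ball aT.
have [f pf fE] := element_residual_poly gh aT hu' hC'.
have [y [m [b [m0 By hK hm]]]] := hball _ ce _ pf r0.
have s0 : 0 < lam * h by exact: mulr_gt0.
have s2 : lam * h < del * (rr * h).
  have x0 : 0 < del * (rr * h) by rewrite mulr_gt0.
  have -> : lam * h = del * (rr * h) / 2 by rewrite /lam; field.
  by rewrite ltr_pdivrMr// ltr_pMr ?ltr1n.
have clB : [set x | enorm (x - y) <= lam * h] `<=` eball y (del * (rr * h)).
  by move=> x /= xs; rewrite /eball /= (le_lt_trans xs).
have BhO : eball y (del * (rr * h)) `<=` (hull a)°.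
  move=> x xB; have : nbhs x (eball y (del * (rr * h))).
    by apply: open_nbhs_nbhs; split=> //; exact: open_eball.
  by apply: filterS => z /By; exact: ball_hull.
set B := eball y (lam * h).
have Bcl : B `<=` [set x | enorm (x - y) <= lam * h] by move=> x; exact: ltW.
have Ba : B `<=` (hull a)° by move=> x /Bcl/clB/BhO.
have BD : B `<=` D by move=> x /Ba/aD.
have BO : B `<=` Om by exact: subset_trans BD DO.
have clO : [set x | enorm (x - y) <= lam * h] `<=` Om by move=> x /clB/BhO/aD/DO.
pose psi := rbump y (lam * h).
have tpsi : test_function Om psi by exact: bump_test.
have [bpsi _] := test_bnd tpsi.
have mB : measurable B by exact: measurable_eball.
have ma : measurable (hull a)° by apply: measurable_row_open; exact: open_interior.
have hMO x : Om x -> `|C' x| <= M.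
  move=> /subset_closure; rewrite (mesh_cover hTh j) => -[e eT ex]; exact: hM e x eT ex.
have hL := gradient_sup hC' M0 hM.
have := hKr j u' C' y D hH hu' hC' hMO hL clO mD BD DO.
(* The support lies in one element, where grad C' is constant, and a constant vector is orthogonal
   to the gradient of a test function. *)
have -> : integ Om (fun x => dot (wgrad Om C' x) (grad (rbump y (lam * mesh_size (Th j))) x)) = 0.
  have [q [s hqs]] := P1h_pieces hC'.1.
  have gpsi := test_LinfV tpsi; have [_ gC' _ _] := P1h_Linf hOm hTh hC'.1.
  rewrite -[RHS](integ_affine_bump (q a) tpsi); apply: ae_Rintegral => //.
  - by apply: integrable_measurable; apply/ii/LinfV_dot.
  - apply: measurable_dot => i; first exact: measurable_cst.
    by have [] := gpsi i.
  - apply: filterS (wgrad_piecewise hOm hTh (P1h_piecewise hqs)) => x h1 Ox.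
    have [/Ba ax|nB] := pselect (B x); first by rewrite (h1 a aT ax) grad_affine.
    by rewrite grad_bump_out// dotC dot0l dotC dot0l.
rewrite mulr0 subr0 -/psi -/h; set E := local_error _ _ _ _ _ _; set t := Num.sqrt (h ^+ d) => le1.
have Z2 := strong_residual_L2 hOm hP hTh hu' hC'.
have iZ := L2_int hOm Z2 bpsi.
have gg2 : in_Lp 2%:E Om (fun x => g P x - gh a).
  by apply: in_LpB => //; [exact: ler1n|exact: g_L2 hP|exact: in_Lp_cst].
have iG := L2_int hOm gg2 bpsi.
have aO : (hull a)° `<=` Om by exact: (interior_hull_sub hOm hTh aT).
have le2 : `|integ Om (fun x => (g P x - gh a) * psi x)| <= k1 * t * Lp 2%:E (hull a)° (fun x => g P x - gh a).
  have F0 x : ~ B x -> (g P x - gh a) * psi x = 0 by move=> nB; rewrite /psi bump_out// mulr0.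
  have g2a : in_Lp 2%:E (hull a)° (fun x => g P x - gh a) by exact: in_LpS aO gg2.
  apply: (le_trans (ball_bound hOm iG F0 BO ma Ba g2a ler01 _)).
    apply: aeW => x _; rewrite normrM mul1r ler_piMr//.
    by have /andP[p0 p1] := bump_bnd y (lam * h) x; rewrite ger0_norm.
  by rewrite mul1r ler_wpM2r ?Lp_ge0//; exact: half_volume.
have cf : continuous f by exact: (smooth_continuous (polyf_smooth pf)).
have mf : measurable_fun [set: pt] f by exact: measurable_row_continuous.
have ifB : mu.-integrable B (EFin \o (fun x => f x * psi x)).
  have Boo : (mu B < +oo)%E by exact: eball_lty.
  have fb x : B x -> `|f x * psi x| <= K * m.
    move=> /Ba/interior_subset/hull_ball/hK fx; rewrite normrM.
    apply: le_trans fx; rewrite ler_piMr//.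
    by have /andP[p0 p1] := bump_bnd y (lam * h) x; rewrite ger0_norm.
  apply: (integrable_bounded mB Boo _ fb).
  by apply: measurable_funM; [exact: measurable_funTS|exact: measurable_bump].
have EB : integ B (fun x => f x * psi x) =
    integ Om (fun x => strong_residual Om P u' C' x * psi x) - integ Om (fun x => (g P x - gh a) * psi x).
  rewrite -(integB mOm iZ iG).
  have -> : integ Om (fun x => strong_residual Om P u' C' x * psi x - (g P x - gh a) * psi x) =
      integ B (fun x => strong_residual Om P u' C' x * psi x - (g P x - gh a) * psi x).
    by apply: Rintegral_supp => // x nB; rewrite /psi bump_out// !mulr0 subr0.
  apply: ae_Rintegral => //; first exact: integrable_measurable ifB.
    by apply: integrable_measurable; apply: integrableS (integrableRB mOm iZ iG).
  by apply: filterS fE => x hx /Ba/hx[_ ->]; rewrite mulrDl addrK.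
have le3 : kv * m * t ^+ 2 <= `|integ B (fun x => f x * psi x)|.
  (* On the ball of half the radius the bump is at least exp(-4); its volume is at least (lam / d)^d
     h^d, which explains [kv]. *)
  pose B2 := eball y (lam * h / 2).
  have s20 : 0 < lam * h / 2 by rewrite divr_gt0.
  have B2B : B2 `<=` B.
    by move=> x; rewrite /B2 /B /eball /= => /lt_le_trans; apply; rewrite ler_pdivrMr// ler_peMr ?ler1n// ltW.
  have iS : mu.-integrable B (EFin \o (fun x => (-1) ^+ b * (f x * psi x))) by exact: integrableRZ.
  have := @integ_ge_sub B B2 (fun x => (-1) ^+ b * (f x * psi x)) (expR (- 4) * m).
  rewrite (integZ mB _ ifB) => h2.
  apply: (@le_trans _ _ ((-1) ^+ b * integ B (fun x => f x * psi x))); last first.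
    by rewrite (le_trans (ler_norm _))// normrM normrX normrN1 expr1n mul1r.
  apply: le_trans (h2 _ _ _ _ _ _ _) => //.
  - have /andP[V _] := eball_volume y s20.
    rewrite /kv /t sqr_sqrtr ?exprn_ge0 ?(ltW h0)//.
    rewrite (_ : _ * m * h ^+ d = expR (- 4) * m * ((lam / d%:R) ^+ d * h ^+ d)); last by ring.
    rewrite ler_wpM2l ?mulr_ge0 ?expR_ge0//; apply: le_trans V.
    rewrite /eball_vol -exprMn le_eqVlt; apply/orP; left; apply/eqP; congr (_ ^+ _).
    by field.
  - exact: measurable_eball.
  - exact: eball_lty.
  - move=> x Bx; rewrite mulrA mulr_ge0//; last by have /andP[] := bump_bnd y (lam * h) x.
    by apply: le_trans m0 (hm x _); apply: clB; exact: Bcl.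
  - move=> x B2x; have fx : m <= (-1) ^+ b * f x by apply: hm; exact/clB/Bcl/B2B.
    rewrite mulrA mulrC ler_pM ?expR_ge0//.
    have hq : enorm (x - y) <= 2^-1 * (lam * h) by rewrite mulrC; exact: ltW.
    have /andP[a1 a2] := bump_arg_ge s0 hq.
    have ha : 4^-1 <= bump_arg y (lam * h) x <= 1 by rewrite a2 andbT; lra.
    by have [] := flat_ge ha.
have t0 : 0 < t by rewrite sqrtr_gt0 exprn_gt0.
set G := Lp 2%:E _ _ in le2 *; have G0 : 0 <= G by exact: Lp_ge0.
have E0 : 0 <= E by rewrite addr_ge0 ?LpV_ge0 ?H1norm_ge0.
have key : kv * (h * m * t) <= (Kr + k1) * (E + h * G).
  have le4 : kv * m * t ^+ 2 <= Kr * (t / h) * E + k1 * t * G.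
    by apply: (le_trans le3); rewrite EB (le_trans (ler_normB _ _))// lerD.
  have hG0 : 0 <= h * G by rewrite mulr_ge0// ltW.
  have le5 : kv * (h * m * t) <= Kr * E + k1 * (h * G).
    have := ler_wpM2r (divr_ge0 (ltW h0) (ltW t0)) le4.
    rewrite (_ : kv * m * t ^+ 2 * (h / t) = kv * (h * m * t)); last by field; rewrite gt_eqF.
    by rewrite (_ : _ * (h / t) = Kr * E + k1 * (h * G)); last by field; rewrite !gt_eqF.
  apply: (le_trans le5); clearbody E; clearbody G k1; rewrite mulrDl !mulrDr lerD//.
    by rewrite lerDl mulr_ge0 ?(ltW Kr0).
  by rewrite lerDr mulr_ge0.
have aoo : (mu (hull a)° < +oo)%E by apply: le_lt_trans bOm; apply: le_measure; rewrite ?inE.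
have Ra : Lp 2%:E (hull a)° (element_residual a gh u' C') <= K * m * (k4 * t).
  have -> : Lp 2%:E (hull a)° (element_residual a gh u' C') = Lp 2%:E (hull a)° f.
    apply: eq_Lp => //; [|exact: measurable_funTS|by apply: filterS fE => x hx /hx[]].
    apply: (eq_measurable_fun (fun x => strong_residual Om P u' C' x - (g P x - gh a))).
      by move=> x /set_mem ax; rewrite (element_residualE gh u' aT hC' ax).
    by apply: (measurable_funS mOm aO); apply: measurable_funB; [case: Z2|case: gg2].
  have fb : {ae mu, forall x, (hull a)° x -> `|f x| <= K * m}.
    by apply: aeW => x /interior_subset/hull_ball/hK.
  have Km0 : 0 <= K * m by rewrite mulr_ge0// ltW.
  have mfa : measurable_fun (hull a)° f by exact: measurable_funTS.
  have [_ le6] := Lp_bnd ma aoo (ltr0n R 2) Km0 mfa fb.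
  apply: (le_trans le6); rewrite ler_wpM2l// powR12_sqrt ?fine_ge0//.
  rewrite (le_trans _ (half_volume ce (ltr0n R 2) h0))// ler_wsqrtr//.
  have m2 : measurable (eball ce (2 * h)) by exact: measurable_eball.
  have l2 : (mu (eball ce (2 * h)) < +oo)%E by exact: eball_lty.
  apply: fine_le; [by rewrite ge0_fin_numE|by rewrite ge0_fin_numE|].
  apply: le_measure; [by rewrite inE|by rewrite inE|].
  have hce : hull a ce by apply: ball_hull; rewrite /= subrr enorm0 ltW.
  move=> x /interior_subset ax; rewrite /eball /= (le_lt_trans (mesh_diam aT ax hce))//.
  by rewrite -/h ltr_pMl ?ltr1n.
apply: (@le_trans _ _ (K * k4 / kv * (Kr + k1) * (E + h * G))).
  apply: (@le_trans _ _ (K * k4 / kv * (kv * (h * m * t)))).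
    rewrite (_ : _ / kv * _ = h * (K * m * (k4 * t))); last by field; rewrite gt_eqF.
    by rewrite ler_wpM2l// ltW.
  by rewrite -[leRHS]mulrA ler_wpM2l// divr_ge0 ?(ltW kv0)// mulr_ge0// ltW.
have hEG : 0 <= E + h * G by rewrite addr_ge0// mulr_ge0// ltW.
by rewrite ler_wpM2r// lerDl.
Qed.

End element.

(** * Jumps across faces *)

Section adjacent_simplices.
Context {R : realType} {k : nat}.
Local Notation d := k.+1.
Local Notation pt := 'rV[R]_k.+1.
Implicit Types (a b : simplex R k).

Lemma hull_row m n (a : 'M[R]_(m, n)) i : hull a (row i a).
Proof.
exists (delta_mx 0 i); split; last by rewrite -rowE.
  by move=> j; rewrite mxE eqxx /= ler0n.
rewrite (bigD1 i)//= mxE !eqxx big1 ?addr0// => j ji.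
by rewrite mxE eqxx (negbTE ji).
Qed.

Lemma hull_rows m m' n (a : 'M[R]_(m, n)) (b : 'M[R]_(m', n)) :
  (forall i, hull b (row i a)) -> hull a `<=` hull b.
Proof.
move=> h; have [L hL] : exists L : 'I_m -> 'rV[R]_m', forall i,
    [/\ forall j, 0 <= L i 0 j, \sum_j L i 0 j = 1 & row i a = L i *m b].
  by have [L hL] := choice h; exists L.
move=> x [l [l0 l1 ->]]; exists (\sum_i l 0 i *: L i); split.
- move=> j; rewrite summxE sumr_ge0// => i _; rewrite mxE mulr_ge0//.
  by have [] := hL i.
- under eq_bigr do rewrite summxE.
  rewrite exchange_big/= -l1; apply: eq_bigr => i _.
  under eq_bigr do rewrite mxE.
  by rewrite -mulr_sumr; have [_ -> _] := hL i; rewrite mulr1.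
- rewrite mulmx_sum_row mulmx_suml; apply: eq_bigr => i _.
  by rewrite -scalemxAl; have [_ _ <-] := hL i.
Qed.

Lemma bary_rows a b (l : 'rV[R]_d.+1) i : \sum_n l 0 n = 1 ->
  bary a (l *m b) 0 i = \sum_n l 0 n * bary a (row n b) 0 i.
Proof.
move=> l1; rewrite baryE; under eq_bigr do rewrite baryE mulrDr.
rewrite big_split/= -mulr_suml l1 mul1r; congr (_ + _).
rewrite /dot; under [RHS]eq_bigr do rewrite mulr_sumr.
rewrite exchange_big/=; apply: eq_bigr => j _.
rewrite !mxE mulr_sumr; apply: eq_bigr => n _; rewrite mxE; ring.
Qed.

Lemma bary_le1 a (x : pt) i : Defs.nondegenerate a -> hull a x -> bary a x 0 i <= 1.
Proof.
move=> na ax; have [_ <-] := baryK x na; rewrite (bigD1 i)//= lerDl sumr_ge0// => j _.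
by have /(_ j) := (hullE x na).1 ax.
Qed.

Lemma row_inj_nondegenerate a m n : Defs.nondegenerate a -> row m a = row n a -> m = n.
Proof.
move=> na e; have := bary_vertex m na; rewrite e (bary_vertex n na) => /matrixP/(_ 0 m).
rewrite !mxE !eqxx /=; case: eqP => //= _ /eqP; by rewrite eq_sym oner_eq0.
Qed.

Lemma shared_hull_eq a b : Defs.nondegenerate a ->
  (forall m, exists n, row m a = row n b) -> hull a = hull b.
Proof.
move=> na h; have [g hg] := choice h.
have gi : injective g by move=> m n e; apply: (row_inj_nondegenerate na); rewrite !hg e.
apply/seteqP; split; apply: hull_rows => i.
  by rewrite hg; exact: hull_row.
have [g' _ gK] := injF_bij gi.
by rewrite -(gK i) -hg; exact: hull_row.
Qed.

Lemma face_row a i m : m != i -> hull (face a i) (row m a).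
Proof.
rewrite eq_sym => /unlift_some[m' -> _].
have -> : row (lift i m') a = row m' (face a i) by apply/rowP => j; rewrite !mxE.
exact: hull_row.
Qed.

(** From the centre of the ball to the point at distance r along the gradient, the coordinate grows
    by r |bgrad|, and on the simplex it stays in [0, 1]. *)
Lemma bgrad_le a m (r : R) : Defs.nondegenerate a -> 0 < r ->
  (exists c : pt, forall x, enorm (x - c) <= r -> hull a x) -> enorm (bgrad a m) <= r^-1.
Proof.
move=> na r0 [c hc].
have g0 : 0 < enorm (bgrad a m).
  rewrite lt_neqAle enorm_ge0 andbT eq_sym; apply/eqP => /enorm_eq0/eqP.
  by rewrite (negbTE (bgrad_neq0 m na)).
pose v := (r / enorm (bgrad a m)) *: bgrad a m.
have h1 : hull a c by apply: hc; rewrite subrr enorm0 ltW.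
have h2 : hull a (c + v).
  by apply: hc; rewrite addrAC subrr add0r enormZ gtr0_norm ?divr_gt0// divfK ?gt_eqF.
have := bary_le1 m na h2; rewrite baryD dotZr -enorm_sqr expr2 mulrA divfK ?gt_eqF//.
have /(_ m) := (hullE c na).1 h1 => b0 b1.
rewrite -div1r ler_pdivlMr// mulrC; lra.
Qed.

Definition face_center a i : pt :=
  (\row_m (if m == i then 0 else d%:R^-1) : 'rV[R]_d.+1) *m a.

Let center_sum (i : 'I_d.+1) :
  \sum_m (\row_m (if m == i then 0 else d%:R^-1) : 'rV[R]_d.+1) 0 m = 1.
Proof.
under eq_bigr do rewrite mxE.
rewrite (bigD1 i)//= eqxx add0r.
rewrite (eq_bigr (fun=> d%:R^-1)); last by move=> m /negbTE->.
by rewrite sumr_const cardC1 card_ord /= -[_ *+ _]mulr_natl mulfV// pnatr_eq0.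
Qed.

Lemma bary_face_center a i m : Defs.nondegenerate a ->
  bary a (face_center a i) 0 m = if m == i then 0 else d%:R^-1.
Proof. by move=> na; rewrite /face_center (bary_unique na (center_sum i)) mxE. Qed.

Lemma affine_face a i (q : pt) (s : R) : Defs.nondegenerate a ->
  (forall m, m != i -> dot q (row m a) + s = 0) ->
  (forall x, dot q x + s = bary a x 0 i * (dot q (row i a) + s)) /\
  q = (dot q (row i a) + s) *: bgrad a i.
Proof.
move=> na h.
have E x : dot q x + s = bary a x 0 i * (dot q (row i a) + s).
  have [ex sx] := baryK x na; rewrite -{1}ex.
  have -> : dot q (bary a x *m a) + s = \sum_m bary a x 0 m * (dot q (row m a) + s).
    under [RHS]eq_bigr do rewrite mulrDr.
    rewrite big_split/= -mulr_suml sx mul1r; congr (_ + _).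
    rewrite /dot; under [RHS]eq_bigr do rewrite mulr_sumr.
    rewrite exchange_big/=; apply: eq_bigr => j _.
    rewrite mxE mulr_sumr; apply: eq_bigr => n _; by rewrite [row n a 0 j]mxE mulrCA.
  by rewrite (bigD1 i)//= big1 ?addr0// => m mi; rewrite h// mulr0.
split=> //; apply/rowP => j.
have e1 := E (delta_mx 0 j); have e0 := E 0.
rewrite -[X in bary a X]add0r baryD mulrDl -e0 in e1.
have dj (v : pt) : dot v (delta_mx 0 j) = v 0 j.
  rewrite /dot (bigD1 j)//= mxE !eqxx mulr1 big1 ?addr0// => l lj.
  by rewrite mxE (negbTE lj) andbF mulr0.
move: e1; rewrite !dj dotC dot0l => e1; rewrite mxE mulrC.
by apply: (addIr s); rewrite e1 add0r addrC.
Qed.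

Section neighbours.
Variables (a b : simplex R k) (i : 'I_d.+1).
Hypotheses (na : Defs.nondegenerate a) (nb : Defs.nondegenerate b) (nab : hull a <> hull b)
  (conf : hull a `&` hull b = subhull [pred i | [exists j, row i a == row j b]] a)
  (fb : hull (face a i) `<=` hull b).

(** By conformity a common point is a convex combination of common vertices, and barycentric
    coordinates are unique. *)
Lemma shared_vertex x m : hull a x -> hull b x -> bary a x 0 m != 0 -> exists n, row m a = row n b.
Proof.
move=> ax bx xm; have : (hull a `&` hull b) x by [].
rewrite conf => -[l [l0 l1 l2 xl]].
have e : bary a x = l by rewrite xl bary_unique.
have := l2 m; rewrite -e; case hm: [exists j, row m a == row j b].
  by move: hm => /existsP[n /eqP hn] _; exists n.
by rewrite /= hm => /(_ isT) z; rewrite z eqxx in xm.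
Qed.

Lemma face_vertex m : m != i -> exists n, row m a = row n b.
Proof.
move=> mi; apply: (@shared_vertex (row m a)); first exact: hull_row.
  exact/fb/face_row.
by rewrite (bary_vertex m na) mxE !eqxx oner_neq0.
Qed.

(* If tau were positive, the two elements would overlap near the face, so that
   by conformity they would share all their vertices. *)
Lemma adjacent_bary : exists i' tau,
  [/\ tau < 0, forall x, bary a x 0 i = tau * bary b x 0 i' &
      forall n, n != i' -> exists2 m, m != i & row m a = row n b].
Proof.
have [g hg] : exists g : 'I_d.+1 -> 'I_d.+1, forall m, m != i -> row m a = row (g m) b.
  have h m : exists n, m != i -> row m a = row n b.
    by have [->|mi] := eqVneq m i; [exists i|have [n hn] := face_vertex mi; exists n].
  by have [g hg] := choice h; exists g.
(* g sends the vertices of the face to vertices of b. Being injective, it misses exactly one of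
   them, the vertex i' of b opposite to the face. *)
have gi : {in [set~ i]%SET &, injective g}.
  move=> m n; rewrite !inE => mi ni e; apply: (row_inj_nondegenerate na).
  by rewrite !hg ?e.
have /eqP/cards1P[i' hi'] : #|(~: (g @: [set~ i]))%SET| = 1%N.
  have := cardsC (g @: [set~ i])%SET; rewrite (card_in_imset gi) cardsC1 card_ord => e.
  by apply/eqP; rewrite -(eqn_add2l k.+1) e addn1.
have im n : n != i' -> exists2 m, m != i & row m a = row n b.
  move=> ni; have : n \notin (~: (g @: [set~ i]))%SET by rewrite hi' inE.
  rewrite inE negbK => /imsetP[m]; rewrite !inE => mi ->.
  by exists m => //; rewrite hg.
pose tau := bary a (row i' b) 0 i.
have E x : bary a x 0 i = tau * bary b x 0 i'.
  have [ex sx] := baryK x nb; rewrite -{1}ex bary_rows// (bigD1 i')//= big1 ?addr0.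
    by rewrite mulrC.
  move=> n /im[m mi <-].
  have -> : bary a (row m a) 0 i = 0.
    by rewrite (bary_vertex m na) mxE eqxx /= eq_sym (negbTE mi).
  by rewrite mulr0.
exists i', tau; split=> //.
have Ei : 1 = tau * bary b (row i a) 0 i'.
  by rewrite -E (bary_vertex i na) mxE !eqxx.
have [//|t0|t0] := ltgtP tau 0; last first.
  by move/eqP: Ei; rewrite t0 mul0r oner_eq0.
exfalso; apply: nab; apply: (shared_hull_eq na) => m.
pose w := row i a - face_center a i.
have Bb n : n != i' -> 0 < bary b (face_center a i) 0 n.
  move=> /im[m0 m0i em]; rewrite bary_rows// (bigD1 m0)//= ltr_wpDr//.
    apply: sumr_ge0 => n0 n0m; rewrite mxE; case: eqP => [_|/eqP ni]; first by rewrite mul0r.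
    rewrite mulr_ge0//.
    exact: ((hullE _ nb).1 (fb (face_row a ni)) n).
  by rewrite mxE (negbTE m0i) em (bary_vertex n nb) mxE !eqxx mulr1 invr_gt0.
have Ba m0 : m0 != i -> 0 < bary a (face_center a i) 0 m0.
  by move=> mi; rewrite bary_face_center// (negbTE mi) invr_gt0.
(* So small that moving from the face centre towards the vertex i of a keeps the coordinates of b
   other than i' positive. *)
have [e [e0 e1 he]] : exists e : R, [/\ 0 < e, e < 1 & forall n, n != i' ->
    0 < bary b (face_center a i) 0 n + e * dot (bgrad b n) w].
  pose M := 1 + \sum_n `|dot (bgrad b n) w| / `|bary b (face_center a i) 0 n|.
  have M1 : 1 <= M by rewrite lerDl sumr_ge0// => n _; rewrite divr_ge0.
  have M0 : 0 < M by exact: lt_le_trans M1.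
  exists (2^-1 / M); split; first by rewrite divr_gt0.
    by rewrite ltr_pdivrMr// mul1r; lra.
  move=> n ni; have B0 := Bb n ni.
  have h : `|dot (bgrad b n) w| <= M * bary b (face_center a i) 0 n.
    rewrite -ler_pdivrMr// /M -{1}(gtr0_norm B0) (bigD1 n)//=.
    by rewrite ler_wpDl// lerDl sumr_ge0// => n0 _; rewrite divr_ge0.
  have h2 : - (M * bary b (face_center a i) 0 n) <= dot (bgrad b n) w by move: h; rewrite ler_norml => /andP[].
  have : 2^-1 / M * - (M * bary b (face_center a i) 0 n) <= 2^-1 / M * dot (bgrad b n) w.
    by rewrite ler_wpM2l// ltW// divr_gt0.
  rewrite mulrN mulrA divfK ?gt_eqF//; lra.
pose x := face_center a i + e *: w.
have Bx m0 : bary a x 0 m0 = (1 - e) * bary a (face_center a i) 0 m0 + e * (m0 == i)%:R.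
  have -> : x = (1 - e) *: face_center a i + e *: row i a.
    by rewrite /x /w scalerBr scalerBl scale1r addrAC addrA.
  rewrite baryE dotDr !dotZr.
  have e2 := baryE a (face_center a i) m0; have e3 := baryE a (row i a) m0.
  move: e3; rewrite (bary_vertex i na) mxE eqxx /= => e3.
  by rewrite e3 e2; ring.
have Bxp m0 : 0 < bary a x 0 m0.
  rewrite Bx; have [->|mi] := eqVneq m0 i.
    by rewrite mulr1 bary_face_center// eqxx mulr0 add0r.
  by rewrite mulr0 addr0 mulr_gt0 ?Ba// subr_gt0.
apply: (@shared_vertex x); last by rewrite gt_eqF.
  by apply/(hullE x na) => m0; exact: ltW.
apply/(hullE x nb) => n; have [->|ni] := eqVneq n i'.
  have := Bxp i; rewrite E => h; rewrite -(pmulr_rge0 _ t0); exact: ltW.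
by rewrite /x baryD dotZr ltW// he.
Qed.

(* The hyperplane of the face separates the two elements. *)
Lemma face_ball (r : R) x : 0 < r ->
  (exists c : pt, forall x, enorm (x - c) <= r -> hull a x) ->
  (exists c : pt, forall x, enorm (x - c) <= r -> hull b x) ->
  enorm (x - face_center a i) <= r / d%:R ->
  (0 <= bary a x 0 i -> hull a x) /\ (bary a x 0 i <= 0 -> hull b x).
Proof.
move=> r0 ha hb xr; have [i' [tau [t0 E im]]] := adjacent_bary.
(* A displacement of at most r / d changes a barycentric coordinate by at most 1/d, and the
   coordinates in question are at least 1/d at the face centre. *)
have sm c n : (forall m, enorm (bgrad c m) <= r^-1) -> d%:R^-1 <= bary c (face_center a i) 0 n ->
    0 <= bary c x 0 n.
  move=> hg hd; have -> : x = face_center a i + (x - face_center a i) by rewrite addrC subrK.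
  rewrite baryD; have := norm_dot_le (bgrad c n) (x - face_center a i).
  have : enorm (bgrad c n) * enorm (x - face_center a i) <= d%:R^-1.
    apply: (le_trans (ler_pM (enorm_ge0 _) (enorm_ge0 _) (hg n) xr)).
    by rewrite mulrA mulVf ?gt_eqF// mul1r.
  move=> h1 h2; have := le_trans h2 h1; rewrite ler_norml => /andP[+ _]; move: hd.
  by move: (bary c _ 0 n) (dot _ _) => e1 e2; set t := d%:R^-1; lra.
have hs (m : 'I_d.+1) := bgrad_le m na r0 ha; have hs' m := bgrad_le m nb r0 hb.
split=> h.
  apply/(hullE x na) => m; have [->//|mi] := eqVneq m i.
  by apply: sm => //; rewrite bary_face_center// (negbTE mi).
apply/(hullE x nb) => n; have [->|ni] := eqVneq n i'.
  by move: h; rewrite E nmulr_rle0.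
apply: sm => //; have [m0 m0i em] := im n ni.
rewrite bary_rows// (bigD1 m0)//= mxE (negbTE m0i) em (bary_vertex n nb) mxE !eqxx mulr1.
rewrite lerDl; apply: sumr_ge0 => n0 n0m; rewrite mxE; case: eqP => [_|/eqP n0i]; first by rewrite mul0r.
by rewrite mulr_ge0//; exact: ((hullE _ nb).1 (fb (face_row a n0i)) n).
Qed.

Lemma hull_adjacent_le0 x : hull b x -> bary a x 0 i <= 0.
Proof.
move=> bx; have [i' [tau [t0 E _]]] := adjacent_bary.
by rewrite E nmulr_rle0//; exact: ((hullE x nb).1 bx i').
Qed.

End neighbours.

End adjacent_simplices.

(** * The residual across a single face *)

Section face_estimate.
Context {R : realType} {k : nat}.
Local Notation d := k.+1.
Local Notation pt := 'rV[R]_k.+1.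
Local Notation mu := (@lebesgue_row R k.+1).
Variables (Om : set pt) (hOm : polyhedral_domain Om) (P : pde_data R k) (hP : admissible Om P).
Variables (u : pt -> pt) (p C : pt -> R) (hsol : problem_Va Om P u p C).
Variables (J : Type) (Th : J -> seq (simplex R k)) (sigma beta0 : R)
  (hTh : regular_family Om Th sigma beta0).
Local Notation int f := (mu.-integrable Om (EFin \o f)).
Local Notation rr := (ball_ratio sigma beta0).
Let oOm : open Om. Proof. exact: domain_open hOm. Qed.
Let bOm : (mu Om < +oo)%E. Proof. exact: domain_lty hOm. Qed.
Let mOm : measurable Om. Proof. exact: measurable_row_open. Qed.
Let ii (f : pt -> R) : Linf Om f -> int f. Proof. exact: Linf_int. Qed.
Let rr0 : 0 < rr. Proof. exact: ball_ratio_gt0 hTh. Qed.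
(** Half of the radius in [face_ball]: the ball of radius 2 lam h around the face centre is covered
    by the two elements, and the closed support of the bump lies in its interior. *)
Let lam := rr / d%:R / 2.
Let lam0 : 0 < lam. Proof. by rewrite /lam divr_gt0// divr_gt0. Qed.

Section one_face.
Variables (j : J) (a b : simplex R k) (i : 'I_d.+1).
Hypotheses (aT : a \in Th j) (bT : b \in Th j) (ab : a != b)
  (fb : hull (face a i) `<=` hull b).
Local Notation h := (mesh_size (Th j)).
Let h0 : 0 < h. Proof. exact: mesh_gt0 hOm hTh j. Qed.
Let s := lam * h.
Let s0 : 0 < s. Proof. exact: mulr_gt0. Qed.
Let na : Defs.nondegenerate a. Proof. exact: (mesh_nondegenerate hTh aT). Qed.
Let nb : Defs.nondegenerate b. Proof. exact: (mesh_nondegenerate hTh bT). Qed.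
Let nab : hull a <> hull b.
Proof. by have [_ /(_ j) [[_ _ _ /(_ a b aT bT ab)[]]]] := hTh. Qed.
Let conf : hull a `&` hull b = subhull [pred i | [exists j, row i a == row j b]] a.
Proof. by have [_ /(_ j) [[_ _ _ /(_ a b aT bT ab)[]]]] := hTh. Qed.
Let y := face_center a i.

Lemma ball_face x : enorm (x - y) <= 2 * s ->
  (0 <= bary a x 0 i -> hull a x) /\ (bary a x 0 i <= 0 -> hull b x).
Proof.
move=> xs; have r0 : 0 < rr * h by rewrite mulr_gt0.
apply: (face_ball na nb nab conf fb r0 (mesh_ball hTh aT) (mesh_ball hTh bT)).
by apply: (le_trans xs); rewrite le_eqVlt; apply/orP; left; apply/eqP; rewrite /s /lam; field.
Qed.

Lemma ball_face_cover x : enorm (x - y) <= 2 * s -> hull a x \/ hull b x.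
Proof.
move=> /ball_face[h1 h2]; have [/h1|/ltW/h2] := leP 0 (bary a x 0 i); [by left|by right].
Qed.

Lemma eball_face : eball y (2 * s) `<=` (hull a `|` hull b)°.
Proof.
rewrite -open_subsetE; last exact: open_eball.
by move=> x /ltW/ball_face_cover.
Qed.

Lemma hull2_interior_sub : (hull a `|` hull b)° `<=` Om.
Proof.
apply: (open_sub_domain hOm); first exact: open_interior.
move=> x /interior_subset[]; [exact: (hull_sub_closure hTh aT)|exact: (hull_sub_closure hTh bT)].
Qed.

Let B := eball y s.
Let clB : [set x | enorm (x - y) <= s] `<=` (hull a `|` hull b)°.
Proof.
by move=> x /= xs; apply: eball_face; rewrite /eball /= (le_lt_trans xs)// ltr_pMl ?ltr1n.
Qed.
Let clO : [set x | enorm (x - y) <= s] `<=` Om.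
Proof. by move=> x /clB/hull2_interior_sub. Qed.
Let Bcl : B `<=` [set x | enorm (x - y) <= s]. Proof. by move=> x; exact: ltW. Qed.
Let BO : B `<=` Om. Proof. by move=> x /Bcl/clO. Qed.
Let mB : measurable B. Proof. exact: measurable_eball. Qed.
Let Boo : (mu B < +oo)%E. Proof. exact: eball_lty. Qed.
Let psi := rbump y s.
Let tpsi : test_function Om psi. Proof. exact: bump_test. Qed.

Lemma ball_face_ae : {ae mu, forall x, B x -> (hull a)° x \/ (hull b)° x}.
Proof.
apply: filterS2 (hull_interior_ae na) (hull_interior_ae nb) => x h1 h2 /Bcl xs.
have /ball_face_cover[/h1|/h2] : enorm (x - y) <= 2 * s; [|by left|by right].
by rewrite (le_trans xs)// ler_pMl ?ler1n.
Qed.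

(** Almost every point of the ball is interior to one of the two elements, so |Z| psi is dominated
    by the sum of its truncations to both, and Cauchy-Schwarz applies to each. *)
Lemma face_residual_test (Z : pt -> R) : in_Lp 2%:E Om Z ->
  `|integ Om (fun x => Z x * psi x)| <=
  Num.sqrt ((2 * lam) ^+ d) * Num.sqrt (h ^+ d) * (Lp 2%:E (hull a)° Z + Lp 2%:E (hull b)° Z).
Proof.
move=> Z2; have [bpsi _] := test_bnd tpsi.
have mi (c : simplex R k) : measurable ((hull c)° : set pt) by apply: measurable_row_open; exact: open_interior.
have aO : (hull a)° `<=` Om by exact: (interior_hull_sub hOm hTh aT).
have bO : (hull b)° `<=` Om by exact: (interior_hull_sub hOm hTh bT).
pose F (c : simplex R k) x := `|Z x| * \1_((hull c)° : set pt) x * psi x.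
have L1 (c : simplex R k) : Linf Om (\1_((hull c)° : set pt) : pt -> R).
  split; first exact: measurable_indic.
  by exists 1 => //; apply: aeW => x _; rewrite ger0_norm indicE ?ler0n// lern1 leq_b1.
have Z1 (c : simplex R k) : in_Lp 2%:E Om (fun x => `|Z x| * \1_((hull c)° : set pt) x).
  rewrite (_ : (fun x => _) = fun x => \1_((hull c)° : set pt) x * `|Z x|).
    by apply: Linf_mul_Lp => //; exact: in_Lp_norm.
  by apply/funext => x; rewrite mulrC.
have iF c : int (F c) by exact: L2_int.
have Fb c : (hull c)° `<=` Om -> `|integ Om (F c)| <=
    Num.sqrt ((2 * lam) ^+ d) * Num.sqrt (h ^+ d) * Lp 2%:E (hull c)° Z.
  move=> cO.
  have -> : Lp 2%:E (hull c)° Z = Lp 2%:E Om (fun x => `|Z x| * \1_((hull c)° : set pt) x).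
    rewrite -(Lp_norm _ (hull c)°) /Lp /eLp; congr (fine (Lnorm _ _ _)); apply/funext => x.
    congr EFin; rewrite !indicE -mulrA -natrM mulnb; congr (_ * (nat_of_bool _)%:R).
    by apply/idP/andP => [xc|[]//]; split=> //; apply/mem_set/cO/set_mem.
  have F0 x : ~ B x -> F c x = 0 by move=> nB; rewrite /F /psi bump_out ?mulr0.
  apply: (le_trans (ball_bound hOm (iF c) F0 BO mOm BO (Z1 c) ler01 _)).
    apply: aeW => x _; rewrite mul1r /F normrM ler_piMr//.
    by have /andP[p0 p1] := bump_bnd y s x; rewrite ger0_norm.
  rewrite mul1r ler_wpM2r ?Lp_ge0//; exact: half_volume.
have iZ := L2_int hOm Z2 bpsi.
rewrite mulrDr; apply: le_trans (lerD (Fb a aO) (Fb b bO)).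
apply: le_trans (lerD (ler_norm _) (ler_norm _)); rewrite -(integD mOm (iF a) (iF b)).
apply: abs_integ_le => //; first exact: integrableRD.
apply: filterS ball_face_ae => x hx Ox.
have [/hx xab|nB] := pselect (B x); last first.
  by rewrite /F /psi bump_out// !mulr0 normr0 addr0.
have /andP[p0 _] := bump_bnd y s x.
rewrite normrM (ger0_norm p0) /F -mulrDl ler_wpM2r// -mulrDr ler_peMr//.
rewrite !indicE -natrD ler1n; case: xab => xc; first by rewrite mem_set.
by rewrite (mem_set xc) addn1.
Qed.

Variables (C' : pt -> R) (q : simplex R k -> pt) (t : simplex R k -> R).
Hypotheses (hC' : spaceYh Om (Th j) C')
  (hqt : forall a, a \in Th j -> forall x, hull a x -> C' x = dot (q a) x + t a).

(** C' is continuous, so the difference of its two affine pieces vanishes at the vertices of the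
    face and is a multiple of the barycentric coordinate i of a. *)
Lemma gradient_jump : exists D : R, q a - q b = D *: bgrad a i.
Proof.
exists (dot (q a - q b) (row i a) + (t a - t b)).
have [|_ <-//] := @affine_face R k a i (q a - q b) (t a - t b) na _.
move=> m mi; have am := hull_row a m; have bm := fb (face_row a mi).
by have := hqt aT am; rewrite (hqt bT bm) dotBl => e; rewrite addrACA -opprD e subrr.
Qed.

(* The gradient of the bump points towards the centre y of the face, so that the
   integrand, once the gradient on b is subtracted, has a constant sign. *)
Lemma gradient_jump_test :
  expR (- 4) / (2 * lam) * (lam / (2 * d%:R)) ^+ d * enorm (q a - q b) * (h ^+ d / h) <=
  `|integ Om (fun x => dot (wgrad Om C' x) (grad psi x))|.
Proof.
have [D eD] := gradient_jump.
(* Up to a constant factor, the integrand after subtraction of q b. On a, the product of [bgrad a i]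
   and x - y is the barycentric coordinate itself; on b the maximum is 0. *)
pose W x := flat ('X^2 : {poly R}) (bump_arg y s x) * Num.max (bary a x 0 i) 0.
have g0 : 0 < enorm (bgrad a i).
  rewrite lt_neqAle enorm_ge0 andbT eq_sym; apply/eqP => /enorm_eq0/eqP.
  by rewrite (negbTE (bgrad_neq0 i na)).
have yi : bary a y 0 i = 0 by rewrite bary_face_center// eqxx.
have bE x : bary a x 0 i = dot (bgrad a i) (x - y).
  by rewrite -{1}(subrK y x) addrC baryD yi add0r.
have W0 x : 0 <= W x.
  by rewrite mulr_ge0 ?le_max ?lexx ?orbT//; have /andP[] := flatX2_le (bump_arg y s x).
have mW : measurable_fun [set: pt] W.
  apply: measurable_funM.
    by apply: smooth_measurable; apply: smooth_flat; exact: smooth_bump_arg.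
  apply: measurable_maxr; last exact: measurable_cst.
  by apply: measurable_row_continuous; exact: continuous_bary.
have iW : mu.-integrable B (EFin \o W).
  apply: (integrable_bounded (M := 2 * (enorm (bgrad a i) * s))) => //; first exact: measurable_funTS.
  move=> x Bx; rewrite ger0_norm//; apply: ler_pM => //.
  - by have /andP[] := flatX2_le (bump_arg y s x).
  - by rewrite le_max lexx orbT.
  - by have /andP[] := flatX2_le (bump_arg y s x).
  rewrite ge_max mulr_ge0 ?(ltW g0) ?(ltW s0)// andbT bE (le_trans (dot_le _ _))//.
  by rewrite ler_wpM2l ?enorm_ge0//; exact: Bcl.
have gpsi := test_LinfV tpsi; have [_ gC' _ _] := P1h_Linf hOm hTh hC'.1.
have Lq : LinfV Om (fun=> q b) by move=> m; exact: Linf_cst.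
have i1 : int (fun x => dot (wgrad Om C' x) (grad psi x)) by apply/ii/LinfV_dot.
have i2 : int (fun x => dot (q b) (grad psi x)).
  by have /ii := LinfV_dot Lq gpsi.
pose c0 := - (2 / s ^+ 2 * D).
have E : integ Om (fun x => dot (wgrad Om C' x) (grad psi x)) = c0 * integ B W.
  rewrite -[LHS]subr0 -(integ_affine_bump hOm (q b) tpsi) -(integB mOm i1 i2) -(integZ mB _ iW).
  transitivity (integ B (fun x => dot (wgrad Om C' x) (grad psi x) - dot (q b) (grad psi x))).
    apply: Rintegral_supp => // x nB.
    by rewrite grad_bump_out// dotC dot0l dotC dot0l subr0.
  apply: ae_Rintegral => //.
  - by apply: integrable_measurable; apply: integrableS (integrableRB mOm i1 i2).
  - by apply: measurable_funM; [exact: measurable_cst|exact: measurable_funTS].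
  apply: filterS2 ball_face_ae (wgrad_piecewise hOm hTh (P1h_piecewise hqt)) => x h1 h2 Bx.
  rewrite -dotBl (grad_bump y s0 x) dotZr /W.
  case: (h1 Bx) => xc.
    rewrite (h2 a aT xc) grad_affine eD dotZl -bE max_l; last first.
      by have /(_ i) := (hullE x na).1 (interior_subset xc).
    by rewrite /c0; ring.
  rewrite (h2 b bT xc) grad_affine subrr dot0l mulr0 max_r ?mulr0//.
  exact: (hull_adjacent_le0 na nb nab conf fb (interior_subset xc)).
pose nu := (enorm (bgrad a i))^-1 *: bgrad a i.
(* A ball on the side of a: its points are within 3 s / 4 of y, and their barycentric coordinate is
   at least |bgrad| s / 4. *)
pose B' := eball (y + (s / 2) *: nu) (s / 4).
have nu1 : enorm nu = 1 by rewrite enormZ ger0_norm ?invr_ge0 ?(ltW g0)// mulVf// gt_eqF.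
have B'3 x : B' x -> enorm (x - y) <= 3 / 4 * s.
  rewrite /B' /eball /= opprD addrA => xs.
  rewrite -(subrK ((s / 2) *: nu) (x - y)) (le_trans (enormD _ _))// enormZ nu1 mulr1.
  rewrite ger0_norm; last by rewrite divr_ge0// ltW.
  by rewrite (le_trans (lerD (ltW xs) (lexx _)))// le_eqVlt; apply/orP; left; apply/eqP; field.
have B'B : B' `<=` B.
  move=> x /B'3; rewrite /B /eball /= => /le_lt_trans; apply.
  by rewrite gtr_pMl//; lra.
have s4 : 0 < s / 4 by rewrite divr_gt0.
have B'oo : (mu B' < +oo)%E by exact: eball_lty.
have mB' : measurable B' by exact: measurable_eball.
have low : expR (- 4) * (enorm (bgrad a i) * (s / 4)) * fine (mu B') <= integ B W.
  apply: integ_ge_sub => // x B'x; apply: ler_pM.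
  - exact: expR_ge0.
  - by rewrite mulr_ge0// ltW.
  - have /andP[a1 a2] := bump_arg_ge s0 (B'3 x B'x).
    have ha : 4^-1 <= bump_arg y s x <= 1 by rewrite a2 andbT; lra.
    by have [] := flat_ge ha.
  rewrite le_max; apply/orP; left; rewrite bE.
  move: B'x; rewrite /B' /eball /= opprD addrA => xs.
  rewrite -(subrK ((s / 2) *: nu) (x - y)) dotDr dotZr /nu dotZr -enorm_sqr.
  have := norm_dot_le (bgrad a i) (x - y - (s / 2) *: nu); rewrite ler_norml => /andP[h3 _].
  have h4 : enorm (bgrad a i) * enorm (x - y - (s / 2) *: nu) <= enorm (bgrad a i) * (s / 4).
    by rewrite ler_wpM2l ?(ltW g0)// ltW.
  rewrite expr2 mulKf ?gt_eqF//; rewrite -/nu.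
  by move: h3 h4; move: (dot _ _) (enorm (bgrad a i)) (enorm _) => e1 e2 e3; lra.
have /andP[V _] := eball_volume (y + (s / 2) *: nu) s4.
have IW0 : 0 <= integ B W by apply: integ_ge0.
rewrite E normrM (ger0_norm IW0).
have nD : `|c0| * enorm (bgrad a i) = 2 / s ^+ 2 * enorm (q a - q b).
  rewrite eD enormZ mulrA /c0 normrN normrM; congr (_ * _ * _).
  by rewrite ger0_norm// divr_ge0// exprn_ge0// ltW.
apply: (@le_trans _ _ (`|c0| * (expR (- 4) * (enorm (bgrad a i) * (s / 4)) * @eball_vol R k (s / 4)))).
  rewrite [leRHS](_ : _ = `|c0| * enorm (bgrad a i) * (expR (- 4) * (s / 4) * @eball_vol R k (s / 4))); last by ring.
  rewrite nD /eball_vol.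
  have -> : 2 * (s / 4 / d%:R) = lam / (2 * d%:R) * h by rewrite /s; field.
  rewrite le_eqVlt; apply/orP; left; apply/eqP; rewrite /s [(_ * h) ^+ d]exprMn.
  by move: (expR _) (enorm _) ((_ / _) ^+ d) (h ^+ d) => e1 e2 e3 e4; field; rewrite !gt_eqF.
rewrite ler_wpM2l//; apply: le_trans low; rewrite ler_wpM2l//.
by rewrite mulr_ge0 ?expR_ge0// mulr_ge0// ltW.
Qed.

End one_face.

Lemma face_algebra (al kf kr ke k1 T h E Ga Gb Za Zb Q ra rg : R) :
  0 < al -> 0 < kf -> 0 <= k1 -> 0 <= ke -> 0 <= kr -> 0 < T -> 0 < h ->
  0 <= E -> 0 <= Ga -> 0 <= Gb ->
  `|ra - al * rg| <= kr * (T / h) * E -> `|ra| <= k1 * T * (Za + Zb) ->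
  kf * Q * (T ^+ 2 / h) <= `|rg| ->
  h * Za <= ke * E + (ke + 1) * (h * Ga) -> h * Zb <= ke * E + (ke + 1) * (h * Gb) ->
  Q * T <= (k1 * (2 * ke + 1) + kr) / (al * kf) * (E + h * Ga + h * Gb).
Proof.
move=> al0 kf0 k10 ke0 kr0 T0 h0 E0 Ga0 Gb0 e1 e2 e3 ea eb.
have hG0 := mulr_ge0 (ltW h0) Ga0; have hG1 := mulr_ge0 (ltW h0) Gb0.
have f1 : al * `|rg| <= `|ra| + kr * (T / h) * E.
  rewrite -{1}(gtr0_norm al0) -normrM (le_trans _ (lerD (lexx _) e1))//.
  by rewrite -{1}(subKr ra (al * rg)) ler_normB.
have f2 : al * (kf * Q * (T ^+ 2 / h)) <= k1 * T * (Za + Zb) + kr * (T / h) * E.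
  apply: (le_trans (ler_wpM2l (ltW al0) e3)); apply: (le_trans f1).
  by rewrite lerD2r.
have f3 : al * kf * (Q * T) <= k1 * (h * Za + h * Zb) + kr * E.
  have := ler_wpM2r (divr_ge0 (ltW h0) (ltW T0)) f2.
  rewrite (_ : al * _ * (h / T) = al * kf * (Q * T)); last by field; rewrite !gt_eqF.
  by rewrite (_ : _ * (h / T) = k1 * (h * Za + h * Zb) + kr * E)//; field; rewrite !gt_eqF.
rewrite mulrAC ler_pdivlMr ?mulr_gt0// mulrC; apply: (le_trans f3).
have f4 : h * Za + h * Zb <= (2 * ke + 1) * (E + h * Ga + h * Gb).
  apply: (le_trans (lerD ea eb)).
  rewrite (_ : ke * E + _ + _ = 2 * ke * E + (ke + 1) * (h * Ga) + (ke + 1) * (h * Gb)); last by ring.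
  rewrite !mulrDr !lerD// ler_wpM2r//; lra.
rewrite mulrDl; apply: lerD; first by rewrite -mulrA ler_wpM2l.
by rewrite ler_wpM2l// -addrA lerDl addr_ge0.
Qed.

(** [residual_bound] isolates the jump from the residual tested with the face bump, and that tested
    residual is in turn controlled by [element_bound] on both sides of the face. *)
Lemma face_bound (d3 : (k.+1 <= 3)%N) (H M : R) : 1 <= H -> 0 <= M -> exists2 Kf : R, 0 < Kf &
  forall j (u' : pt -> pt) (C' : pt -> R) gh a b i (D : set pt) q t,
  let h := mesh_size (Th j) in h <= H ->
  spaceXh Om (Th j) u' -> spaceYh Om (Th j) C' ->
  (forall a x, a \in Th j -> hull a x -> `|C' x| <= M) ->
  (forall a, a \in Th j -> forall x, hull a x -> C' x = dot (q a) x + t a) ->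
  a \in Th j -> b \in Th j -> a != b -> hull (face a i) `<=` hull b ->
  measurable D -> (hull a `|` hull b)° `<=` D -> D `<=` Om ->
  enorm (q a - q b) * Num.sqrt (h ^+ d) <=
  Kf * (local_error Om u C D u' C' + h * Lp 2%:E (hull a)° (fun x => g P x - gh a)
     + h * Lp 2%:E (hull b)° (fun x => g P x - gh b)).
Proof.
move=> H1 M0; have MR : 0 <= M / rr by rewrite divr_ge0// ltW.
have [Kr Kr0 hKr] := residual_bound hOm hP hsol hTh d3 H1 lam0 M0 MR.
have [Ke Ke0 hKe] := element_bound hOm hP hsol hTh d3 H1 M0.
have al0 : 0 < alpha P by case: (hP) => -[].
pose kf := expR (- 4) / (2 * lam) * (lam / (2 * d%:R)) ^+ d.
have kf0 : 0 < kf.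
  rewrite /kf mulr_gt0//; first by rewrite divr_gt0 ?expR_gt0// mulr_gt0.
  by rewrite exprn_gt0// divr_gt0// mulr_gt0.
pose k1 := Num.sqrt ((2 * lam) ^+ d); have k10 : 0 <= k1 by exact: sqrtr_ge0.
exists ((k1 * (2 * Ke + 1) + Kr) / (alpha P * kf)).
  rewrite divr_gt0//; last exact: mulr_gt0.
  by rewrite ltr_wpDl// mulr_ge0// addr_ge0// mulr_ge0// ltW.
move=> j u' C' gh a b i D q t h hH hu' hC' hM hqt aT bT ab fb mD abD DO.
have h0 : 0 < h by exact: mesh_gt0 hOm hTh j.
have mi (c : simplex R k) : measurable ((hull c)° : set pt) by apply: measurable_row_open; exact: open_interior.
have aD : (hull a)° `<=` D.
  by move=> x xa; apply: abD; move: x xa; apply: interiorS; exact: subsetUl.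
have bD : (hull b)° `<=` D.
  by move=> x xa; apply: abD; move: x xa; apply: interiorS; exact: subsetUr.
have hMO x : Om x -> `|C' x| <= M.
  move=> /subset_closure; rewrite (mesh_cover hTh j) => -[e eT ex]; exact: hM e x eT ex.
have hL := gradient_sup hOm hTh hC' M0 hM.
have s0 : 0 < lam * h by exact: mulr_gt0.
have BD2 : [set x | enorm (x - face_center a i) <= lam * h] `<=` D.
  move=> x /= xs; apply: abD; apply: (eball_face aT bT ab fb).
  by rewrite /eball /= (le_lt_trans xs)// ltr_pMl ?ltr1n.
have BD : eball (face_center a i) (lam * h) `<=` D by move=> x /ltW/BD2.
have le1 := hKr j u' C' (face_center a i) D hH hu' hC' hMO hL (subset_trans BD2 DO) mD BD DO.
have Z2 := strong_residual_L2 hOm hP hTh hu' hC'.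
have le2 := face_residual_test aT bT ab fb Z2.
have le3 := gradient_jump_test aT bT ab fb hC' hqt.
have Zc c : c \in Th j -> (hull c)° `<=` D ->
    h * Lp 2%:E (hull c)° (strong_residual Om P u' C') <=
    Ke * local_error Om u C D u' C' + (Ke + 1) * (h * Lp 2%:E (hull c)° (fun x => g P x - gh c)).
  move=> cT cD; have cO := subset_trans cD DO.
  have gg2 : in_Lp 2%:E (hull c)° (fun x => g P x - gh c).
    apply: (in_LpS (D := Om)) => //.
    by apply: in_LpB => //; [exact: ler1n|exact: (g_L2 hP)|exact: in_Lp_cst].
  have Zc2 : in_Lp 2%:E (hull c)° (strong_residual Om P u' C') by exact: (in_LpS (D := Om)).
  have Rc : in_Lp 2%:E (hull c)° (fun x => strong_residual Om P u' C' x - (g P x - gh c)).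
    by apply: in_LpB => //; exact: ler1n.
  have e1 : Lp 2%:E (hull c)° (strong_residual Om P u' C') <=
      Lp 2%:E (hull c)° (element_residual Om P c gh u' C') + Lp 2%:E (hull c)° (fun x => g P x - gh c).
    have -> : Lp 2%:E (hull c)° (element_residual Om P c gh u' C') =
        Lp 2%:E (hull c)° (fun x => strong_residual Om P u' C' x - (g P x - gh c)).
      rewrite /Lp /eLp; congr (fine (Lnorm _ _ _)); apply/funext => x; congr EFin.
      rewrite indicE; case: (boolP (x \in _)) => [/set_mem xc|_]; last by rewrite !mulr0.
      by rewrite (element_residualE P gh u' cT hC' xc).
    apply: le_trans (LpD (mi c) (ler1n R 2) Rc gg2).
    by under [X in _ <= Lp _ _ X]eq_fun do rewrite subrK.
  have e2 := hKe j u' C' gh c D hH hu' hC' hM cT mD cD DO.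
  apply: (le_trans (ler_wpM2l (ltW h0) e1)); rewrite mulrDr.
  apply: (le_trans (lerD e2 (lexx _))).
  by rewrite [in leRHS]mulrDl mul1r [leRHS]addrA -mulrDr.
set ra := integ Om (fun x => strong_residual Om P u' C' x * _) in le1 le2.
set rg := integ Om (fun x => dot (wgrad Om C' x) _) in le1 le3.
have Ea := Zc a aT aD; have Eb := Zc b bT bD.
set E := local_error _ _ _ _ _ _ in le1 Ea Eb *.
have E0 : 0 <= E by rewrite addr_ge0 ?LpV_ge0 ?H1norm_ge0.
set Ga := Lp 2%:E (hull a)° (fun x => g P x - gh a) in Ea *.
set Gb := Lp 2%:E (hull b)° (fun x => g P x - gh b) in Eb *.
have Ga0 : 0 <= Ga by exact: Lp_ge0.
have Gb0 : 0 <= Gb by exact: Lp_ge0.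
set Za := Lp 2%:E (hull a)° _ in le2 Ea; set Zb := Lp 2%:E (hull b)° _ in le2 Eb.
set Q := enorm _ in le3 *.
rewrite -/h -/kf in le1 le2 le3.
move: le1 le2 le3 Ea Eb; set T := Num.sqrt (h ^+ d).
have T0 : 0 < T by rewrite sqrtr_gt0 exprn_gt0.
have -> : h ^+ d = T ^+ 2 by rewrite sqr_sqrtr// exprn_ge0// ltW.
move=> le1 le2 le3 Ea Eb; exact: (face_algebra al0 kf0 k10 (ltW Ke0) (ltW Kr0) T0 h0 E0 Ga0 Gb0 le1 le2 le3 Ea Eb).
Qed.

End face_estimate.

(** * Traces, jumps and surface integrals of affine pieces *)

Section jumps.
Context {R : realType} {k : nat}.
Local Notation d := k.+1.
Local Notation pt := 'rV[R]_k.+1.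
Local Notation mu := (@lebesgue_row R k.+1).
Implicit Types (a b : simplex R k).

(** An inequality suffices for upper bounds of jumps and covers the default value 0 of [xget]. *)
Lemma unit_normal_le1 (e : 'M[R]_(k.+1, k.+1)) : enorm (unit_normal e) <= 1.
Proof. by rewrite /unit_normal; case: xgetP => [n _ [-> _]//|_]; rewrite enorm0. Qed.

Lemma derive_affine (q : pt) (s : R) (n x : pt) : 'D_n (fun y => dot q y + s) x = dot q n.
Proof.
rewrite /derive; apply: cvg_lim => //.
apply: (cvg_trans (G := (fun=> dot q n) @ (0 : R)^')); last exact: cvg_cst.
apply: near_eq_cvg; near=> h.
have h0 : h != 0 by near: h; exact: nbhs_dnbhs_neq.
rewrite /= dotDr dotZr -[_ + _ + s]addrA addrK.
by rewrite /GRing.scale /= mulKf.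
Unshelve. all: by end_near.
Qed.

(** The limit is unique because x adheres to the interior of a, so the restricted filter is proper;
    on that interior the derivative is constant. *)
Lemma normal_trace_affine a (v : pt -> R) (q : pt) (s : R) (n x : pt) :
  Defs.nondegenerate a -> (forall y, hull a y -> v y = dot q y + s) -> hull a x ->
  normal_trace a n v x = dot q n.
Proof.
move=> na hv ax; rewrite /normal_trace.
have pf : ProperFilter (within (hull a)° (nbhs x)).
  apply: within_nbhs_proper; have := hull_closure_open na ax.
  by apply: closure_subset; exact: open_hull_sub.
apply: cvg_lim => //; apply: (cvg_trans (G := (fun=> dot q n) @ within (hull a)° (nbhs x))).
  apply: near_eq_cvg.
  suff H : nbhs x [set y | (hull a)° y -> dot q n = 'D_n v y] by exact: H.
  apply: filterE => y ay; rewrite -(derive_affine q s n y); apply: near_eq_derive.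
  have : nbhs y (hull a)° by apply: open_nbhs_nbhs; split=> //; exact: open_interior.
  by apply: filterS => z /interior_subset/hv.
exact: cvg_cst.
Qed.

Lemma det_le n (A : 'M[R]_n) (M : R) : (forall i j, `|A i j| <= M) ->
  \det A <= n`!%:R * M ^+ n.
Proof.
move=> hA; apply: (le_trans (ler_norm _)); apply: (le_trans (ler_norm_sum _ _ _)).
apply: (@le_trans _ _ (\sum_(s : 'S_n) M ^+ n)).
  apply: ler_sum => s _; rewrite normrM normrX normrN1 expr1n mul1r normr_prod.
  rewrite -[n in M ^+ n](card_ord n) -prodr_const; apply: ler_prod => i _.
  by rewrite normr_ge0 hA.
by rewrite sumr_const card_Sn mulr_natl.
Qed.

Lemma measurable_ref_simplex : measurable (@ref_simplex R k).
Proof.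
rewrite (_ : ref_simplex = (\bigcap_(i in [set: 'I_k])
    ((fun v : 'rV[R]_k => v 0 i : measurableTypeR R) @^-1` `[0, +oo[)) `&`
    (fun v : 'rV[R]_k => \sum_i (v 0 i : measurableTypeR R)) @^-1` `]-oo, 1]).
  apply: measurableI.
    apply: fin_bigcap_measurable => // i _; rewrite -[X in measurable X]setTI.
    exact: measurable_coord.
  rewrite -[X in measurable X]setTI.
  have : measurable_fun [set: 'rV[R]_k] (fun v : 'rV[R]_k => \sum_i (v 0 i : measurableTypeR R)).
    by apply: measurable_sum => i; exact: measurable_coord.
  exact.
apply/seteqP; split=> [v [v0 v1]|v [v0 v1]] /=.
  by split; [move=> i _ /=; rewrite in_itv /= v0|rewrite in_itv].
split; last by move: v1; rewrite /= in_itv.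
by move=> i; have := v0 i I; rewrite /= in_itv /= andbT.
Qed.

Lemma face_point (e : 'M[R]_(k.+1, k.+1)) (t : 'rV[R]_k) : ref_simplex t ->
  hull e (row ord0 e + t *m edge_mx e).
Proof.
move=> [t0 t1]; pose l : 'rV[R]_k.+1 :=
  \row_i (if unlift ord0 i is Some i' then t 0 i' else 1 - \sum_i t 0 i).
have l0 : l 0 ord0 = 1 - \sum_i t 0 i by rewrite mxE unlift_none.
have lS i : l 0 (lift ord0 i) = t 0 i by rewrite mxE liftK.
exists l; split.
- by move=> i; case: (unliftP ord0 i) => [i'|] ->; rewrite ?lS ?l0// subr_ge0.
- rewrite big_ord_recl l0.
  have -> : \sum_(i < k) l 0 (lift ord0 i) = \sum_i t 0 i by apply: eq_bigr => i _; exact: lS.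
  by rewrite subrK.
apply/rowP => j; rewrite !mxE big_ord_recl l0 mulrBl mul1r -addrA; congr (_ + _).
rewrite mulr_suml addrC -sumrN -big_split /=; apply: eq_bigr => i _.
by rewrite lS mxE; ring.
Qed.

(** The entries of the Gram matrix are at most h^2, so by the Leibniz formula its determinant is at
    most k! h^{2k}; the surface element is the square root of this. *)
Lemma L2_face_cst (e : 'M[R]_(k.+1, k.+1)) (phi : pt -> R) (c h : R) : 0 <= h ->
  (forall x, hull e x -> phi x = c) ->
  (forall x y, hull e x -> hull e y -> enorm (x - y) <= h) ->
  L2_face e phi <= Num.sqrt (Num.sqrt k`!%:R * fine (lebesgue_row k (@ref_simplex R k))) *
    Num.sqrt (h ^+ k) * `|c|.
Proof.
move=> h0 hphi hd; rewrite /L2_face /face_integral.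
rewrite (_ : \int[_]_(t in _) _ = \int[lebesgue_row k]_(t in @ref_simplex R k) (c ^+ 2)); last first.
  by apply: eq_Rintegral => t /set_mem ht; rewrite hphi//; exact: face_point.
rewrite Rintegral_cst; last exact: measurable_ref_simplex.
set S := fine _; have S0 : 0 <= S by exact: fine_ge0.
rewrite -[`|c|]sqrtr_sqr -!sqrtrM ?mulr_ge0 ?sqrtr_ge0 ?exprn_ge0//.
rewrite ler_wsqrtr// [leRHS](_ : _ = Num.sqrt k`!%:R * h ^+ k * (c ^+ 2 * S)); last by ring.
apply: ler_wpM2r; first by rewrite mulr_ge0 ?sqr_ge0.
apply: (@le_trans _ _ (Num.sqrt (k`!%:R * (h ^+ 2) ^+ k))).
  apply: ler_wsqrtr; apply: det_le => i m.
  rewrite (_ : (_ *m _) i m = dot (row i (edge_mx e)) (row m (edge_mx e))); last first.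
    by rewrite mxE; apply: eq_bigr => l _; rewrite !mxE.
  apply: (le_trans (norm_dot_le _ _)); rewrite expr2.
  have E l : enorm (row l (edge_mx e)) <= h.
    have -> : row l (edge_mx e) = row (lift ord0 l) e - row ord0 e.
      by apply/rowP => r; rewrite !mxE.
    by apply: hd; exact: hull_row.
  by apply: ler_pM; rewrite ?enorm_ge0.
by rewrite sqrtrM ?ler0n// -exprM mulnC exprM sqrtr_sqr ger0_norm// exprn_ge0.
Qed.

End jumps.

(** * Assembly of the element and face estimates into the indicator *)

Section indicators.
Context {R : realType} {k : nat}.
Local Notation d := k.+1.
Local Notation pt := 'rV[R]_k.+1.
Local Notation mu := (@lebesgue_row R k.+1).
Variables (Om : set pt) (hOm : polyhedral_domain Om) (P : pde_data R k) (hP : admissible Om P).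
Variables (u : pt -> pt) (p C : pt -> R) (hsol : problem_Va Om P u p C).
Variables (J : Type) (Th : J -> seq (simplex R k)) (sigma beta0 : R)
  (hTh : regular_family Om Th sigma beta0).
Let oOm : open Om. Proof. exact: domain_open hOm. Qed.
Let bOm : (mu Om < +oo)%E. Proof. exact: domain_lty hOm. Qed.
Let mOm : measurable Om. Proof. exact: measurable_row_open. Qed.

(** If no other element contains the face, [neighbour] returns a itself; both properties persist,
    and the jump is then zero. *)
Lemma neighbourP j a i : a \in Th j ->
  neighbour (Th j) a i \in Th j /\ hull (face a i) `<=` hull (neighbour (Th j) a i).
Proof.
move=> aT; rewrite /neighbour.
have fa : hull (face a i) `<=` hull a.
  apply: hull_rows => m; rewrite (_ : row m (face a i) = row (lift i m) a); first exact: hull_row.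
  by apply/rowP => l; rewrite !mxE.
case E : [seq b <- Th j | _] => [|b s] /=; first by split.
have : b \in b :: s by rewrite mem_head.
by rewrite -E mem_filter => /andP[/andP[_ /asboolP]].
Qed.

(** The jump is constant on the face. The weight h^{1/2} and the root of the area, of order
    h^{(d-1)/2}, combine into the factor h^{d/2} of [face_bound]. *)
Lemma face_indicator j (C' : pt -> R) q t a i :
  (forall a, a \in Th j -> forall x, hull a x -> C' x = dot (q a) x + t a) ->
  a \in Th j ->
  diam (hull (face a i)) `^ 2^-1 * L2_face (face a i) (fun x => alpha P * jump (Th j) a i C' x) <=
  Num.sqrt (Num.sqrt k`!%:R * fine (lebesgue_row k (@ref_simplex R k))) * alpha P *
  (enorm (q a - q (neighbour (Th j) a i)) * Num.sqrt (mesh_size (Th j) ^+ d)).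
Proof.
move=> hqt aT; set h := mesh_size (Th j); set b := neighbour (Th j) a i; have [bT fb] := neighbourP i aT.
have h0 : 0 < h by exact: mesh_gt0 hOm hTh j.
have al0 : 0 < alpha P by case: (hP) => -[].
have fa : hull (face a i) `<=` hull a.
  apply: hull_rows => m; rewrite (_ : row m (face a i) = row (lift i m) a); first exact: hull_row.
  by apply/rowP => l; rewrite !mxE.
pose n := unit_normal (face a i).
have dh x y : hull (face a i) x -> hull (face a i) y -> enorm (x - y) <= h.
  by move=> /fa ax /fa ay; exact: mesh_diam aT ax ay.
have hj x : hull (face a i) x -> alpha P * jump (Th j) a i C' x = alpha P * dot (q a - q b) n.
  move=> fx; rewrite /jump -/b dotBl.
  rewrite (normal_trace_affine _ (mesh_nondegenerate hTh aT) (hqt a aT) (fa x fx)).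
  by rewrite (normal_trace_affine _ (mesh_nondegenerate hTh bT) (hqt b bT) (fb x fx)).
have le1 := L2_face_cst (ltW h0) hj dh.
set K := Num.sqrt (_ * _) in le1 *; have K0 : 0 <= K by exact: sqrtr_ge0.
have le2 : `|alpha P * dot (q a - q b) n| <= alpha P * enorm (q a - q b).
  rewrite normrM gtr0_norm// ler_wpM2l ?(ltW al0)// (le_trans (norm_dot_le _ _))//.
  by rewrite ler_piMr ?enorm_ge0// unit_normal_le1.
have le3 : diam (hull (face a i)) `^ 2^-1 <= Num.sqrt h.
  rewrite -(powR12_sqrt (ltW h0)); apply: ge0_ler_powR; rewrite ?nnegrE ?(ltW h0)//.
    have r0 := hull_row (face a i) ord0; apply: ub_le_sup.
      by exists h => _ [[x y] [fx fy] <-]; exact: dh.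
    by exists (row ord0 (face a i), row ord0 (face a i)) => //=; rewrite subrr enorm0.
  exact: diam_le dh.
apply: (@le_trans _ _ (Num.sqrt h * (K * Num.sqrt (h ^+ k) * (alpha P * enorm (q a - q b))))).
  apply: ler_pM => //; [exact: powR_ge0|exact: sqrtr_ge0|].
  by apply: (le_trans le1); rewrite ler_wpM2l// mulr_ge0// sqrtr_ge0.
rewrite exprS sqrtrM ?(ltW h0)// le_eqVlt; apply/orP; left; apply/eqP; ring.
Qed.

Lemma eta_D1_bound (d3 : (k.+1 <= 3)%N) (H M : R) : 1 <= H -> 0 <= M -> exists2 c : R, 0 < c &
  forall j (u' : pt -> pt) (C' : pt -> R) gh a,
  let w := elem_patch (Th j) a in mesh_size (Th j) <= H ->
  spaceXh Om (Th j) u' -> spaceYh Om (Th j) C' ->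
  (forall a x, a \in Th j -> hull a x -> `|C' x| <= M) -> a \in Th j ->
  eta_D1 Om P (Th j) gh a u' C' <=
  c * (local_error Om u C w° u' C' +
    \sum_(b <- Th j | `[< hull b `<=` w >])
       diam (hull b) * Lp 2%:E (hull b)° (fun x => g P x - gh b)).
Proof.
move=> H1 M0.
have [Ke Ke0 hKe] := element_bound hOm hP hsol hTh d3 H1 M0.
have [Kf Kf0 hKf] := face_bound hOm hP hsol hTh d3 H1 M0.
have al0 : 0 < alpha P by case: (hP) => -[].
have b0 := beta0_gt0 hTh.
set KJ := Num.sqrt (Num.sqrt k`!%:R * fine (lebesgue_row k (@ref_simplex R k))) * alpha P.
have KJ0 : 0 <= KJ by rewrite mulr_ge0 ?sqrtr_ge0// ltW.
(* Uniform regularity replaces h by diam / beta0 in each oscillation term, and a face involves two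
   elements. *)
pose m := 1 + 2 / beta0; have m0 : 0 < m by rewrite ltr_wpDr// divr_ge0// ltW.
exists (Ke * m + 2^-1 * (k.+2%:R * (KJ * (Kf * m)))).
  rewrite ltr_wpDr ?mulr_gt0// mulr_ge0// mulr_ge0// mulr_ge0// mulr_ge0//; exact: ltW.
move=> j u' C' gh a w hH hu' hC' hM aT.
have h0 := mesh_gt0 hOm hTh j; set h := mesh_size (Th j) in h0 hH *.
have [q [t hqt]] := P1h_pieces hC'.1.
have hs b x : b \in Th j -> hull b x -> hull a x -> hull b `<=` w.
  by move=> bT bx ax z bz; exists b => //; split=> //; exists x.
have wc : w `<=` closure Om by move=> x [b [bT _] bx]; exact: (hull_sub_closure hTh bT bx).
have wO : w° `<=` Om.
  by apply: (open_sub_domain hOm); [exact: open_interior|move=> x /interior_subset/wc].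
have mw : measurable (w° : set pt) by apply: measurable_row_open; exact: open_interior.
set E := local_error _ _ _ _ _ _; set S := \sum_(b <- _ | _) _.
have E0 : 0 <= E by rewrite addr_ge0 ?LpV_ge0 ?H1norm_ge0.
have dg (b : simplex R k) : 0 <= diam (hull b).
  have r0 := hull_row b ord0; apply: le_trans (hull_diam r0 r0); exact: enorm_ge0.
have T0 b : 0 <= diam (hull b) * Lp 2%:E (hull b)° (fun x => g P x - gh b).
  by rewrite mulr_ge0 ?Lp_ge0.
have uT : uniq (Th j) by have [_ /(_ j)[[]]] := hTh.
have Sb b : b \in Th j -> hull b `<=` w ->
    h * Lp 2%:E (hull b)° (fun x => g P x - gh b) <= beta0^-1 * S.
  move=> bT bw; have [_ /(_ j)[_ /(_ b bT)[_ hb]]] := hTh.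
  apply: (@le_trans _ _ (beta0^-1 * (diam (hull b) * Lp 2%:E (hull b)° (fun x => g P x - gh b)))).
    by rewrite mulrA ler_wpM2r ?Lp_ge0// ler_pdivlMl.
  rewrite ler_wpM2l ?invr_ge0 ?(ltW b0)// /S big_mkcond (bigD1_seq b)//= asboolT// lerDl.
  by rewrite sumr_ge0// => c _; case: ifP.
have S0 : 0 <= S by rewrite sumr_ge0.
have xa := hull_row a ord0; have aw : hull a `<=` w by exact: (hs a _ aT xa xa).
have R1 : diam (hull a) * Lp 2%:E (hull a)° (element_residual Om P a gh u' C') <= Ke * m * (E + S).
  apply: (@le_trans _ _ (h * Lp 2%:E (hull a)° (element_residual Om P a gh u' C'))).
    by rewrite ler_wpM2r ?Lp_ge0//; exact: (diam_mesh aT).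
  apply: (le_trans (hKe j u' C' gh a w° hH hu' hC' hM aT mw (interiorS aw) wO)).
  rewrite -mulrA ler_wpM2l ?(ltW Ke0)// -/h -/E; have := Sb a aT aw.
  move: (h * _) => G; rewrite /m mulrDl mul1r mulrDr => hG.
  have : 0 <= beta0^-1 * S by rewrite mulr_ge0// invr_ge0 ltW.
  have : 0 <= 2 / beta0 * E by rewrite mulr_ge0// divr_ge0// ltW.
  rewrite -[2 / beta0 * S]mulrA; move: (2 / beta0 * E) (_^-1 * S) hG => e1 e2; lra.
have R2 i : enorm (q a - q (neighbour (Th j) a i)) * Num.sqrt (h ^+ d) <= Kf * m * (E + S).
  set b := neighbour (Th j) a i; have [bT fb] := neighbourP i aT; rewrite -/b in bT fb.
  have [<-|ab] := eqVneq a b.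
    rewrite subrr enorm0 mul0r; apply: mulr_ge0; last exact: addr_ge0.
    exact: (mulr_ge0 (ltW Kf0) (ltW m0)).
  have fr := hull_row (face a i) ord0.
  have fa : hull (face a i) `<=` hull a.
    apply: hull_rows => n; rewrite (_ : row n (face a i) = row (lift i n) a); first exact: hull_row.
    by apply/rowP => l; rewrite !mxE.
  have bw : hull b `<=` w by exact: (hs b _ bT (fb _ fr) (fa _ fr)).
  have abw : (hull a `|` hull b)° `<=` w° by apply: interiorS => x [/aw|/bw].
  apply: (le_trans (hKf j u' C' gh a b i w° q t hH hu' hC' hM hqt aT bT ab fb mw abw wO)).
  rewrite -mulrA ler_wpM2l ?(ltW Kf0)// -/h -/E; have := Sb a aT aw; have := Sb b bT bw.
  move: (h * _) (h * _) => Gb Ga; rewrite /m mulrDl mul1r mulrDr => hG hG'.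
  have : 0 <= 2 / beta0 * E by rewrite mulr_ge0// divr_ge0// ltW.
  rewrite -[2 / beta0 * S]mulrA; move: (2 / beta0 * E) (_^-1 * S) hG hG' => e1 e2; lra.
rewrite /eta_D1 mulrDl; apply: lerD; first exact: R1.
rewrite -mulrA ler_wpM2l// big_mkcond/=.
apply: (@le_trans _ _ (\sum_(i < k.+2) KJ * (Kf * m * (E + S)))); last first.
  by rewrite sumr_const card_ord -[_ *+ k.+2]mulr_natl !mulrA.
have X0 : 0 <= KJ * (Kf * m * (E + S)).
  exact: (mulr_ge0 KJ0 (mulr_ge0 (mulr_ge0 (ltW Kf0) (ltW m0)) (addr_ge0 E0 S0))).
apply: ler_sum => i _; case: ifP => // _.
apply: (le_trans (face_indicator i hqt aT)).
by rewrite -/KJ ler_wpM2l.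
Qed.

End indicators.

(** * The smallness assumptions in usable form *)

Section smallness.
Context {R : realType} {k : nat}.
Local Notation pt := 'rV[R]_k.+1.

(** The smallness of C is stated in extended reals, so it also carries the finiteness of both
    norms. *)
Lemma finite_of_le (S X : R) (A B : \bar R) : 0 < S -> (0 <= A)%E -> (0 <= B)%E ->
  (S%:E * A + B <= X%:E)%E -> [/\ (A < +oo)%E, (B < +oo)%E & S * fine A + fine B <= X].
Proof.
move=> S0 A0 B0 h.
have SA0 : (0 <= S%:E * A)%E by rewrite mule_ge0// lee_fin ltW.
have Boo : (B < +oo)%E.
  by apply: le_lt_trans (ltry X); apply: le_trans h; rewrite leeDr.
have SAoo : (S%:E * A < +oo)%E.
  by apply: le_lt_trans (ltry X); apply: le_trans h; rewrite leeDl.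
have Aoo : (A < +oo)%E.
  rewrite ltey; apply/eqP => Ae; move: SAoo.
  by rewrite Ae gt0_muley ?lte_fin// ltxx.
split=> //; rewrite -lee_fin EFinD EFinM !fineK ?ge0_fin_numE//.
Qed.

(** Since d/3 - d/2 + 1 = (6 - d)/6, raising the assumption on h to this power undoes its exponent
    6/(6 - d). *)
Lemma mesh_condition (d : nat) (cI c1 h W : R) : (d < 6)%N -> 0 < cI -> 0 < c1 -> 0 < h ->
  0 <= W -> h <= ((2 * cI * c1)^-1 * W) `^ (6 / (6 - d%:R)) ->
  cI * h `^ (d%:R / 3 - d%:R / 2) * (c1 * h) <= 2^-1 * W.
Proof.
move=> d6 cI0 c10 h0 W0 hh; set X := _ * W in hh.
have X0 : 0 <= X by rewrite mulr_ge0// invr_ge0 !mulr_ge0// ltW.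
have e0 : 0 < 6 - d%:R :> R by rewrite subr_gt0 ltr_nat.
have hX : h `^ ((6 - d%:R) / 6) <= X.
  apply: (@le_trans _ _ ((X `^ (6 / (6 - d%:R))) `^ ((6 - d%:R) / 6))).
    apply: ge0_ler_powR; rewrite ?nnegrE ?powR_ge0 ?(ltW h0)//.
    by rewrite divr_ge0// ltW.
  by rewrite -powRrM mulrA divfK ?gt_eqF// mulfV ?pnatr_eq0// powRr1.
have -> : cI * h `^ (d%:R / 3 - d%:R / 2) * (c1 * h) = cI * c1 * h `^ ((6 - d%:R) / 6).
  rewrite (_ : (6 - d%:R) / 6 = (d%:R / 3 - d%:R / 2) + 1 :> R); last by field.
  rewrite [in RHS]powRD; last by rewrite (gt_eqF h0) implybT.
  by rewrite (powRr1 (ltW h0)); ring.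
apply: (@le_trans _ _ (cI * c1 * X)); first by rewrite ler_wpM2l// mulr_ge0// ltW.
by rewrite /X le_eqVlt; apply/orP; left; apply/eqP; field; rewrite !gt_eqF.
Qed.

End smallness.

Theorem theorem4p10 (R : realType) (k : nat) (d23 : k.+1 = 2%N \/ k.+1 = 3%N)
  (Om : set 'rV[R]_k.+1) (hOm : polyhedral_domain Om)
  (P : pde_data R k) (hP : admissible Om P)
  (J : Type) (Th : J -> seq (simplex R k)) (sigma beta0 : R)
  (hTh : regular_family Om Th sigma beta0)
  (u : 'rV[R]_k.+1 -> 'rV[R]_k.+1) (p C : 'rV[R]_k.+1 -> R)
  (hsol : problem_Va Om P u p C) :
  (forall S2 S6 cI c1 : R,
    poincare_sobolev_constant Om 2 S2 ->
    poincare_sobolev_constant Om 6 S6 ->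
    inverse_constant Om Th cI ->
    apriori_constant Om P Th u p C c1 ->
    in_LpV 2%:E Om (f0 P) ->
    H2 Om C -> W1V 3%:E Om u -> H2 Om p ->
    (S6%:E * eLp 3%:E Om (fun x => enorm (wgrad Om C x)) + eLp +oo Om C <=
      (alpha P * mu P * Km P /
        (2 * Num.sqrt 2 * rho P * cf1 P * S2))%:E)%E ->
    exists2 c : R, 0 < c &
    forall (j : J) (uh : 'rV[R]_k.+1 -> 'rV[R]_k.+1) (ph Ch : 'rV[R]_k.+1 -> R)
      (gamma : R) (us : nat -> 'rV[R]_k.+1 -> 'rV[R]_k.+1)
      (ps Cs : nat -> 'rV[R]_k.+1 -> R) (gh : simplex R k -> R),
    let h := mesh_size (Th j) in
    problem_Vah Om P (Th j) uh ph Ch ->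
    0 < gamma ->
    iterates Om P (Th j) gamma us ps Cs ->
    LpV 2%:E Om (us 0%N) <= L1_bound Om P S2 ->
    Num.max (gamma_star Om P S2 cI h) (gamma_starstar Om P S2 cI h) < gamma ->
    h <= ((2 * cI * c1)^-1 *
           (W1seminorm 3%:E Om C + Lp +oo Om C / S6))
         `^ (6 / (6 - k.+1%:R)) ->
    exists i1 : nat, forall i, (i1 <= i)%N -> forall a, a \in Th j ->
      let w := elem_patch (Th j) a in
      eta_D1 Om P (Th j) gh a (us i.+1) (Cs i.+1) <=
      c * (LpV 2%:E w° (fun x => us i.+1 x - u x)
           + H1norm Om w° (fun x => C x - Cs i.+1 x)
           + \sum_(b <- Th j | `[< hull b `<=` w >])
               diam (hull b) * Lp 2%:E (hull b)° (fun x => g P x - gh b)))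
  /\
  (forall (j : J) (gamma : R) (us : nat -> 'rV[R]_k.+1 -> 'rV[R]_k.+1)
      (ps Cs : nat -> 'rV[R]_k.+1 -> R),
    0 < gamma ->
    iterates Om P (Th j) gamma us ps Cs ->
    forall i a, a \in Th j ->
      eta_L2 Om a (Cs i) (Cs i.+1) <=
      H1norm Om (hull a)° (fun x => C x - Cs i.+1 x)
      + H1norm Om (hull a)° (fun x => C x - Cs i x)).
Proof.
have d3 : (k.+1 <= 3)%N by case: d23 => ->.
have oOm := domain_open hOm; have bOm := domain_lty hOm.
have mOm : measurable Om by exact: measurable_row_open.
have hC : H10 Om C by exact: (concentration_H10 hsol).
split; last first.
  move=> j gamma us ps Cs _ [hu0 hC0 hI] i a aT.
  have hY n : spaceYh Om (Th j) (Cs n) by case: n => [|n]; [exact: hC0|have [[_ _ hn] _] := hI n; exact: hn].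
  have aO := interior_hull_sub hOm hTh aT.
  have ma : measurable ((hull a)° : set 'rV[R]_k.+1).
    by apply: measurable_row_open; exact: open_interior.
  have W n : W1 2%:E Om (fun x => C x - Cs n x).
    by have [] := H10B oOm bOm hC (hY n).2.
  (* The triangle inequality through the exact concentration. *)
  rewrite /eta_L2 (_ : (fun x => Cs i x - Cs i.+1 x) =
      fun x => (C x - Cs i.+1 x) - (C x - Cs i x)); last by apply/funext => x; ring.
  exact: H1normB.
move=> S2 S6 cI c1 hS2 hS6 hcI hap hf0 _ _ _ hlam.
have [S60 _] := hS6; have [cI0 _] := hcI; have [c10 hap'] := hap.
have [A3 Boo lam] := finite_of_le S60 (eLp_ge0 _ _ _) (eLp_ge0 _ _ _) hlam.
have [C2 gC2 wC] := H10_L2 hOm hC.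
have Coo : in_Lp +oo%E Om C by split=> //; case: C2.
have gC3 : in_LpV 3%:E Om (wgrad Om C) by split=> //; case: gC2.
have [H H1 hH] := mesh_bound hOm hTh.
have c110 : 0 <= c1 + 1 by rewrite addr_ge0// ltW.
have d6 : (k.+1 <= 6)%N by exact: leq_trans d3 _.
(* c1 + 1 is the constant of [iterates_converge]. M and then c are thus fixed before the mesh, gamma
   and the iterates are introduced. *)
have [M M0 hM] := concentration_sup hOm hsol hTh d6 hS6 c110 H1 Coo.
have [c c0 hc] := eta_D1_bound hOm hP hsol hTh d3 H1 M0.
exists c => // j uh ph Ch gamma us ps Cs gh h pbh gamma0 its _ hgamma hh.
have h0 : 0 < h by exact: (mesh_gt0 hOm hTh j).
have hC1 : W1seminorm 2%:E Om (fun x => C x - Ch x) <= c1 * h.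
  apply: le_trans (hap' _ _ _ _ pbh); rewrite -addrA lerDl addr_ge0 ?LpV_ge0//.
have W0 : 0 <= W1seminorm 3%:E Om C + Lp +oo%E Om C / S6.
  by rewrite addr_ge0 ?LpV_ge0// divr_ge0 ?Lp_ge0// ltW.
have hh' := mesh_condition (leq_ltn_trans d3 (isT : (3 < 6)%N)) cI0 c10 h0 W0 hh.
have hg : gamma_star Om P S2 cI h < gamma by move: hgamma; rewrite gt_max => /andP[].
have [i1 hi1] := iterates_converge hOm hP hTh hS2 hS6 hcI hC Coo gC3 hf0 lam pbh gamma0 its hg hC1 hh'.
exists i1 => i ii1 a aT; have [_ _ hI] := its; have [[hu' _ hC'] _] := hI i.
exact: (hc j _ _ gh a (hH j) hu' hC' (hM j _ (hH j) hC' (hi1 i ii1)) aT).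
Qed.
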